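(* Let $n\ge 2$, $T>0$, $a_{ij}^{\alpha\beta}\in L_\infty(0,T;L_{\infty\#})$, $\mathbf f\in L_2(0,T;\dot{\mathbf H}_\#^{-1})$ and $\mathbf u^0\in\dot{\mathbf H}_{\#\sigma}^{0}$. If $\mathbf u$ is a Serrin-type solution on $[0,T]$ of the anisotropic Navier-Stokes initial value problem with data $\mathbf f,\mathbf u^0$, then for any $[t_0,t]\subset[0,T]$ the energy equality $$\frac12\|\mathbf u(\cdot,t)\|_{\mathbf L_{2\#}}^2+\int_{t_0}^{t}a_{\mathbb T}(\tau;\mathbf u(\cdot,\tau),\mathbf u(\cdot,\tau))\,d\tau=\frac12\|\mathbf u(\cdot,t_0)\|_{\mathbf L_{2\#}}^2+\int_{t_0}^{t}\langle\mathbf f(\cdot,\tau),\mathbf u(\cdot,\tau)\rangle_{\mathbb T}\,d\tau$$ holds. In particular, for all $t\in[0,T]$, $$\frac12\|\mathbf u(\cdot,t)\|_{\mathbf L_{2\#}}^2+\int_{0}^{t}a_{\mathbb T}(\tau;\mathbf u(\cdot,\tau),\mathbf u(\cdot,\tau))\,d\tau=\frac12\|\mathbf u^0\|_{\mathbf L_{2\#}}^2+\int_{0}^{t}\langle\mathbf f(\cdot,\tau),\mathbf u(\cdot,\tau)\rangle_{\mathbb T}\,d\tau .$$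
   Context: Spaces. $\mathbb T$ is the $n$-dimensional torus (unit cube $[0,1)^n$ with periodicity); functions/distributions on $\mathbb T$ are identified with 1-periodic ones on $\mathbb R^n$ (subscript $\#$). $\hat g(\xi)=\int_{\mathbb T}e^{-2\pi i x\cdot\xi}g(x)\,dx$, $\xi\in\mathbb Z^n$ (extended to distributions). With $\varrho(\xi)=2\pi(1+|\xi|^2)^{1/2}$ and $s\in\mathbb R$, $H^s_\#$ is the space of periodic distributions with $\|g\|_{H^s_\#}^2=\sum_{\xi\in\mathbb Z^n}\varrho(\xi)^{2s}|\hat g(\xi)|^2<\infty$; $\dot H^s_\#=\{g\in H^s_\#:\hat g(0)=0\}$. Bold letters denote $n$-component vector versions; $\dot{\mathbf H}^s_{\#\sigma}=\{\mathbf w\in\dot{\mathbf H}^s_\#:\operatorname{div}\mathbf w=0\}$. $L_{q\#}$ is the periodic Lebesgue space and $\mathbf L_{2\#}=\mathbf H^0_\#$. The dual product is $\langle g,f\rangle_{\mathbb T}=\sum_\xi\hat g(\xi)\hat f(-\xi)$ (equal to $\int_{\mathbb T}gf$ for $L_2$ functions), summed over components for vectors/matrices. $\mathbb P_\sigma:\dot{\mathbf H}^s_\#\to\dot{\mathbf H}^s_{\#\sigma}$ is the Leray (orthogonal) projector. All functions are real-valued; $'$ is the distributional time derivative; repeated indices are summed from $1$ to $n$. Operator. The viscosity tensor $\mathbb A=\{a_{kj}^{\alpha\beta}(\mathbf x,t)\}$ is real, 1-periodic in $\mathbf x$, and satisfies the symmetry conditions $a_{kj}^{\alpha\beta}=a_{\alpha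 j}^{k\beta}=a_{k\beta}^{\alpha j}$. $E_{j\beta}(\mathbf u)=\frac12(\partial_ju_\beta+\partial_\beta u_j)$, $(\boldsymbol{\mathfrak L}\mathbf u)_k=\partial_\alpha(a_{kj}^{\alpha\beta}E_{j\beta}(\mathbf u))$, and $a_{\mathbb T}(t;\mathbf u,\mathbf v)=\langle a_{ij}^{\alpha\beta}(\cdot,t)E_{j\beta}(\mathbf u),E_{i\alpha}(\mathbf v)\rangle_{\mathbb T}$. Problem: $\mathbf u'-\boldsymbol{\mathfrak L}\mathbf u+\nabla p+(\mathbf u\cdot\nabla)\mathbf u=\mathbf f$, $\operatorname{div}\mathbf u=0$ in $\mathbb T\times(0,T)$, $\mathbf u(\cdot,0)=\mathbf u^0$. Weak solution on $[0,T]$ (for $\mathbf f\in L_2(0,T;\dot{\mathbf H}^{-1}_\#)$, $\mathbf u^0\in\dot{\mathbf H}^0_{\#\sigma}$): $\mathbf u\in L_\infty(0,T;\dot{\mathbf H}^0_{\#\sigma})\cap L_2(0,T;\dot{\mathbf H}^1_{\#\sigma})$ such that $\langle\mathbf u'(\cdot,t)+\mathbb P_\sigma[(\mathbf u(\cdot,t)\cdot\nabla)\mathbf u(\cdot,t)],\mathbf w\rangle_{\mathbb T}+a_{\mathbb T}(t;\mathbf u(\cdot,t),\mathbf w)=\langle\mathbf f(\cdot,t),\mathbf w\rangle_{\mathbb T}$ for a.e. $t\in(0,T)$ and all $\mathbf w\in\dot{\mathbf H}^1_{\#\sigma}$, and $\langle\mathbf u(\cdot,0),\mathbf w\rangle_{\mathbb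 T}=\langle\mathbf u^0,\mathbf w\rangle_{\mathbb T}$ for all $\mathbf w\in\dot{\mathbf H}^0_{\#\sigma}$. (Here $\mathbf u$ is identified with its $\dot{\mathbf H}^0_{\#\sigma}$-weakly continuous in time representative on $[0,T]$, which exists.) A Serrin-type solution is a weak solution that belongs to $L_2(0,T;\dot{\mathbf H}^{n/2}_{\#\sigma})$. *)

(* Defs.v *)
From HB Require Import structures.
From mathcomp Require Import all_boot all_order all_algebra.
From mathcomp Require Import all_classical all_reals all_analysis.
From mathcomp.real_closed Require Import complex.

Set Implicit Arguments.
Unset Strict Implicit.
Unset Printing Implicit Defensive.

Import Order.TTheory GRing.Theory Num.Theory.
Import numFieldNormedType.Exports.

Local Open Scope classical_set_scope.
Local Open Scope ring_scope.

Section unit_cube.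
Variable R : realType.
Let leb : {measure set (measurableTypeR R) -> \bar R} := @lebesgue_measure R.

Definition unit_leb : set (measurableTypeR R) -> \bar R :=
  mrestr leb (measurable_itv `[(0 : R), 1[).

HB.instance Definition _ := Measure.on unit_leb.

Let unit_lebT : unit_leb [set: measurableTypeR R] = 1%E.
Proof.
rewrite /unit_leb /mrestr setTI [LHS]lebesgue_measure_itv/=.
by rewrite lte_fin ltr01 sube0.
Qed.

HB.instance Definition _ := Measure_isProbability.Build _ _ _ unit_leb unit_lebT.

Definition tuple_cons n (p : measurableTypeR R * n.-tuple (measurableTypeR R)) :
  n.+1.-tuple (measurableTypeR R) := [tuple of p.1 :: p.2].

Let measurable_tuple_cons n : measurable_fun setT (@tuple_cons n).
Proof. by apply: measurable_cons; [exact: measurable_fst|exact: measurable_snd]. Qed.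

HB.instance Definition _ n := isMeasurableFun.Build _ _ _ _ (@tuple_cons n)
  (@measurable_tuple_cons n).

Fixpoint cube_leb n : probability (n.-tuple (measurableTypeR R)) R :=
  match n with
  | 0%N => \d_([tuple] : 0.-tuple (measurableTypeR R))
  | m.+1 => distribution (unit_leb \x cube_leb m)%E (@tuple_cons m)
  end.

End unit_cube.

Definition row_of (R : realType) n (x : n.-tuple (measurableTypeR R)) : 'rV[R]_n :=
  \row_i tnth x i.

(** Measurability and integrability with respect to the Lebesgue (completed)
    sigma-algebra: the functions below are only determined almost everywhere,
    whereas [measurable_fun] refers to the Borel sigma-algebra. *)
Definition ae_measurable d (X : measurableType d) (R : realType)
    (mu : {measure set X -> \bar R}) (A : set X) (f : X -> R) : Prop :=
  exists2 g : X -> R, measurable_fun A g & {ae mu, forall x, A x -> f x = g x}.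

Definition ae_integrable d (X : measurableType d) (R : realType)
    (mu : {measure set X -> \bar R}) (A : set X) (f : X -> R) : Prop :=
  exists2 g : X -> R, mu.-integrable A (EFin \o g) &
    {ae mu, forall x, A x -> f x = g x}.

(** Meaningful when [F] is absolutely summable. *)
Definition abs_sum (I : choiceType) (R : realType) (F : I -> R) : R :=
  fine (\esum_(i in [set: I]) (Num.max (F i) 0)%:E) -
  fine (\esum_(i in [set: I]) (Num.max (- F i) 0)%:E).

Section periodic.
Variables (R : realType) (n : nat).
Local Notation Rn := 'rV[R]_n.
Local Notation Zn := 'rV[int]_n.
Local Notation cube := (@cube_leb R n).

Definition periodic (h : Rn -> R) : Prop :=
  forall (x : Rn) (m : Zn), h (x + map_mx (intr : int -> R) m) = h x.

Definition on_cube (h : Rn -> R) (x : n.-tuple (measurableTypeR R)) : R :=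
  h (row_of x).

Definition L1per (h : Rn -> R) : Prop :=
  periodic h /\ ae_integrable cube setT (on_cube h).

Definition L2per (h : Rn -> R) : Prop :=
  [/\ periodic h, ae_measurable cube setT (on_cube h) &
      (\int[cube]_x ((on_cube h x) ^+ 2)%:E < +oo)%E].

Definition Linfper (h : Rn -> R) : Prop :=
  [/\ periodic h, ae_measurable cube setT (on_cube h) &
      exists M : R, {ae cube, forall x, `|on_cube h x| <= M}].

Definition partial (j : 'I_n) (h : Rn -> R) (x : Rn) : R := 'D_(delta_mx 0 j) h x.

Definition partials (s : seq 'I_n) (h : Rn -> R) : Rn -> R := foldr partial h s.

Definition test_fun (h : Rn -> R) : Prop :=
  periodic h /\ forall s : seq 'I_n, continuous (partials s h) /\
    forall (j : 'I_n) (x : Rn), derivable (partials s h) x (delta_mx 0 j).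

(** Real periodic distributions are encoded as functionals on all functions, of
    which only the values on [test_fun] are meaningful; hence [deq]. *)
Local Notation distr := ((Rn -> R) -> R).

Definition deq (g h : distr) : Prop := forall phi, test_fun phi -> g phi = h phi.

Definition is_distr (g : distr) : Prop :=
  (forall (c : R) (phi psi : Rn -> R), test_fun phi -> test_fun psi ->
     g (c *: phi + psi) = c * g phi + g psi) /\
  (exists (C : R) (N : nat), forall (phi : Rn -> R) (B : R), test_fun phi ->
     (forall (s : seq 'I_n) (x : Rn), (size s <= N)%N -> `|partials s phi x| <= B) ->
     `|g phi| <= C * B).

Definition distr_of (h : Rn -> R) : distr := fun phi =>
  \int[cube]_x (on_cube h x * on_cube phi x).

Definition dpartial (j : 'I_n) (g : distr) : distr := fun phi => - g (partial j phi).

Definition zdot (xi : Zn) (x : Rn) : R := \sum_i (xi 0 i)%:~R * x 0 i.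

(** [hat g xi] is g applied to exp(-2 i pi xi.x). *)
Definition hat (g : distr) (xi : Zn) : R[i] :=
  Complex (g (fun x => cos (2 * pi * zdot xi x)))
          (- g (fun x => sin (2 * pi * zdot xi x))).

Definition rho (xi : Zn) : R :=
  2 * pi * Num.sqrt (1 + \sum_i ((xi 0 i)%:~R) ^+ 2).

Definition hsqnorm (s : R) (g : distr) : \bar R :=
  \esum_(xi in [set: Zn])
    (rho xi `^ (2 * s) * Normc.normc (hat g xi) ^+ 2)%:E.

Definition Hs (s : R) (g : distr) : Prop := is_distr g /\ (hsqnorm s g < +oo)%E.

(** The terms at xi and -xi are conjugate, so that taking real parts does not
    change the sum. *)
Definition dual (g h : distr) : R :=
  abs_sum (fun xi : Zn => complex.Re (hat g xi * hat h (- xi))).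

(** The L_2 function (determined a.e.) representing a distribution of H^0 = L_2. *)
Definition l2fun (g : distr) : Rn -> R :=
  xget (fun=> 0) [set h | L2per h /\ deq g (distr_of h)].

Local Notation vdistr := ('I_n -> (Rn -> R) -> R).

Definition vhnorm (s : R) (g : vdistr) : \bar R :=
  ((\sum_(k < n) hsqnorm s (g k)) `^ 2^-1)%E.

Definition vHdot (s : R) (g : vdistr) : Prop :=
  forall k, Hs s (g k) /\ hat (g k) 0 = 0.

Definition div (g : vdistr) : distr := \sum_(j < n) dpartial j (g j).

Definition vHdot_sol (s : R) (g : vdistr) : Prop :=
  vHdot s g /\ deq (div g) 0.

Definition vdual (g h : vdistr) : R := \sum_(k < n) dual (g k) (h k).

Definition vhinner (s : R) (g h : vdistr) : R :=
  \sum_(k < n) abs_sum (fun xi : Zn =>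
    rho xi `^ (2 * s) * complex.Re (hat (g k) xi * (hat (h k) xi)^*%C)).

Definition is_leray (g h : vdistr) : Prop :=
  exists s : R, [/\ vHdot s g, vHdot_sol s h &
    forall w, vHdot_sol s w -> vhinner s (g - h) w = 0].

(** The orthogonal projection onto solenoidal fields is the same for all the
    exponents s such that [vHdot s g]. *)
Definition leray (g : vdistr) : vdistr := xget 0 [set h | is_leray g h].

Definition convect (u v : vdistr) : vdistr := fun k =>
  distr_of (fun x => \sum_(j < n) l2fun (u j) x * l2fun (dpartial j (v k)) x).

Definition strain (u : vdistr) (j b : 'I_n) : distr := fun phi =>
  2^-1 * (dpartial j (u b) phi + dpartial b (u j) phi).

(** The argument order of a viscosity tensor is [a k j alpha beta] for
    a_{kj}^{alpha beta}. *)
Local Notation tensor := ('I_n -> 'I_n -> 'I_n -> 'I_n -> Rn -> R).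

Definition aform (a : tensor) (u v : vdistr) : R :=
  \sum_(i < n) \sum_(al < n) \sum_(j < n) \sum_(b < n)
    dual (distr_of (fun x => a i j al b x * l2fun (strain u j b) x))
         (strain v i al).

Definition tensor_sym (a : tensor) : Prop := forall k j al b : 'I_n,
  {ae cube, forall x, on_cube (a k j al b) x = on_cube (a al j k b) x /\
                      on_cube (a k j al b) x = on_cube (a k b al j) x}.

End periodic.

Section bochner.
Variable R : realType.
Local Notation leb := (@lebesgue_measure R).

Definition ae_time (T : R) (P : R -> Prop) : Prop :=
  {ae leb, forall t, 0 < t < T -> P t}.

Section valued.
Variables (V : zmodType) (X : V -> Prop) (N : V -> \bar R).

Definition simple_valued (s : R -> V) : Prop :=
  [/\ finite_set (range s), forall t, X (s t) &
      forall v : V, measurable (s @^-1` [set v] : set (measurableTypeR R))].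

Definition bochner_measurable (T : R) (u : R -> V) : Prop :=
  ae_time T (fun t => X (u t)) /\
  exists s : nat -> R -> V, (forall k, simple_valued (s k)) /\
    ae_time T (fun t => N (s k t - u t) @[k --> \oo] --> 0%E).

Definition bochnerL2 (T : R) (u : R -> V) : Prop :=
  bochner_measurable T u /\
  (\int[leb]_(t in `]0%R, T[) (N (u t) ^+ 2) < +oo)%E.

Definition bochnerLinf (T : R) (u : R -> V) : Prop :=
  bochner_measurable T u /\
  exists M : R, ae_time T (fun t => (N (u t) <= M%:E)%E).

End valued.

(** L_infty is not separable: the usual (weak-star) measurability in t is used,
    i.e. L_infty(0,T;L_infty) is the dual of L_1(0,T;L_1). *)
Definition Linf_Linf n (T : R) (c : R -> 'rV[R]_n -> R) : Prop :=
  [/\ ae_time T (fun t => Linfper (c t)),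
      forall phi, L1per phi ->
        ae_measurable leb `]0, T[ (fun t => distr_of (c t) phi) &
      exists M : R, ae_time T (fun t =>
        {ae @cube_leb R n, forall x, `|on_cube (c t) x| <= M})].

Definition test_time (T : R) (chi : R -> R) : Prop :=
  (forall (m : nat) (t : R), derivable (derive1n m chi) t 1) /\
  exists a b : R, [/\ 0 < a, b < T & forall t, ~~ (a <= t <= b) -> chi t = 0].

(** [v] is the distributional time derivative of [u] on ]0,T[, both being
    functions of t valued in periodic distributions. *)
Definition time_derivative n (T : R) (u v : R -> 'I_n -> ('rV[R]_n -> R) -> R) :
    Prop :=
  ae_time T (fun t => forall k, is_distr (v t k)) /\
  forall (k : 'I_n) (psi : 'rV[R]_n -> R), test_fun psi ->
    (forall a b : R, 0 < a -> b < T ->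
       ae_integrable leb `[a, b] (fun t => v t k psi)) /\
    (forall chi, test_time T chi ->
       \int[leb]_(t in `]0, T[) (v t k psi * chi t) =
       - \int[leb]_(t in `]0, T[) (u t k psi * derive1 chi t)).

End bochner.

Section navier_stokes.
Variables (R : realType) (n : nat).
Local Notation vdistr := ('I_n -> ('rV[R]_n -> R) -> R).
Local Notation tensor := ('I_n -> 'I_n -> 'I_n -> 'I_n -> 'rV[R]_n -> R).

Definition weak_solution (T : R) (a : R -> tensor) (f : R -> vdistr)
    (u0 : vdistr) (u : R -> vdistr) : Prop :=
  [/\ bochnerLinf (@vHdot_sol R n 0) (@vhnorm R n 0) T u,
      bochnerL2 (@vHdot_sol R n 1) (@vhnorm R n 1) T u,
      (* u is the weakly continuous representative *)
      (forall t, 0 <= t <= T -> vHdot_sol 0 (u t)) /\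
      (forall w, vHdot_sol 0 w ->
         {within `[0, T], continuous (fun t => vdual (u t) w)}),
      exists2 u' : R -> vdistr, time_derivative T u u' &
        ae_time T (fun t => forall w, vHdot_sol 1 w ->
          vdual (u' t + leray (convect (u t) (u t))) w + aform (a t) (u t) w
          = vdual (f t) w) &
      forall w, vHdot_sol 0 w -> vdual (u 0) w = vdual u0 w].

Definition serrin_solution (T : R) (a : R -> tensor) (f : R -> vdistr)
    (u0 : vdistr) (u : R -> vdistr) : Prop :=
  weak_solution T a f u0 u /\
  bochnerL2 (@vHdot_sol R n (n%:R / 2)) (@vhnorm R n (n%:R / 2)) T u.

End navier_stokes.

(* Main.v *)
(** Let u_N be the truncation of u to the frequencies of the cube [-N, N]^n; it
    is a smooth solenoidal field, hence admissible in the weak formulation. Since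
    each Fourier coefficient c of u is continuous in time with weak derivative v
    the corresponding coefficient of u', one has (c^2)' = 2 v c, and summation
    gives 1/2 |u_N|^2 (t) - 1/2 |u_N|^2 (t0) = \int <u', u_N>, where
    <u', u_N> = <f, u_N> - a(u, u_N) - <(u . grad) u, u_N>.
    The convective term tends to 0 as N goes to infinity: splitting a product of
    trigonometric polynomials according to which factor has the larger
    frequency and applying Cauchy-Schwarz together with the count
    #{xi : |xi|_inf <= r} = (2 r + 1)^n yields
      |\int h q r| <= C |r|_0 (|h|_0 |q|_{n/2} + |h|_{n/2} |q|_0),
    so that T_N = \int (u . grad) u . u_N differs from the same expression with
    all three factors truncated, which vanishes by integration by parts, by a
    quantity tending to 0, while |T_N| <= C |u|_0 |u|_{n/2} |u|_1 is dominated by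
    an integrable function of time. The other terms are dominated by
    |f|_{-1}^2 + |u|_1^2, and dominated convergence concludes.

    All computations use the real coefficients g (cos 2 pi xi.x) and
    g (sin 2 pi xi.x) of a distribution g. *)
Require Import Defs.
From HB Require Import structures.
From mathcomp Require Import all_boot all_order all_algebra.
From mathcomp Require Import all_classical all_reals all_analysis.
From mathcomp.real_closed Require Import complex.
From mathcomp Require Import measurable_realfun ring lra zify.
Import Defs.

Set Implicit Arguments.
Unset Strict Implicit.
Unset Printing Implicit Defensive.

Import Order.TTheory GRing.Theory Num.Theory.
Import numFieldNormedType.Exports.

Local Open Scope classical_set_scope.
Local Open Scope ring_scope.

(** * Almost everywhere equality and square-integrable functions *)

(** The derivative [u'] is only a family of distributions, locally integrable in time when tested
    with a fixed smooth function, so there is no duality pairing of [u'] with [u] to start from. For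
    scalar coefficients the chain rule is elementary, and the weak formulation then supplies the
    integrability of the truncated rate up to the endpoints. The exponent [n / 2] is critical:
    H^{n/2} does not embed in L_infty. The convective bound survives because it takes one factor
    from each of H^0, H^{n/2} and H^1, the first bounded and the other two square integrable in
    time. Weak continuity and the initial condition involve solenoidal tests only, so single
    coefficients are recovered by testing with projected modes. The L_2 function of a distribution
    is pinned down by its action on test functions alone. Relating products and norms to
    coefficients thus requires completeness of the trigonometric system, which is obtained from
    uniqueness in one variable by induction on the dimension. Such functions are known only almost
    everywhere, hence the constant passage to measurable representatives. *)

Lemma aeS d (X : measurableType d) (R : realType)
    (mu : {measure set X -> \bar R}) (P Q : X -> Prop) :
  (forall x, P x -> Q x) -> {ae mu, forall x, P x} -> {ae mu, forall x, Q x}.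
Proof. by move=> PQ; apply: filterS. Qed.

Lemma aeS2 d (X : measurableType d) (R : realType)
    (mu : {measure set X -> \bar R}) (P P' Q : X -> Prop) :
  (forall x, P x -> P' x -> Q x) ->
  {ae mu, forall x, P x} -> {ae mu, forall x, P' x} -> {ae mu, forall x, Q x}.
Proof. by move=> PQ; apply: filterS2. Qed.

Section ae_integral.
Context d (X : measurableType d) (R : realType) (mu : {measure set X -> \bar R}).
Import HBNNSimple.
Local Open Scope ereal_scope.

(** Without measurability the integral of a nonnegative function is a supremum over the simple
    functions below it. Cutting such a simple function off on the exceptional null set preserves its
    integral and brings it below [g]. *)
Lemma ge0_ae_le_integralT (f g : X -> \bar R) :
  (forall x, 0 <= f x) -> (forall x, 0 <= g x) ->
  {ae mu, forall x, f x = g x} -> \int[mu]_x f x <= \int[mu]_x g x.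
Proof.
move=> f0 g0 [N [mN N0 sN]].
rewrite !ge0_integralTE//; apply: ge_ereal_sup => _ [h/= hf <-].
pose k : {nnsfun X >-> R} := proj_nnsfun h (measurableC mN).
have -> : sintegral mu h = sintegral mu k.
  rewrite -!integralT_nnsfun; apply: ge0_ae_eq_integral => //.
  - by apply/measurable_EFinP.
  - by apply/measurable_EFinP.
  - by move=> x _; rewrite lee_fin.
  - by move=> x _; rewrite lee_fin.
  exists N; split => // x /= /not_implyP[_ hk].
  apply: contrapT => nN; apply: hk.
  by rewrite /k /= /measurable_realfun.mindic indicE mem_set//= mulr1.
apply: ereal_sup_ubound; exists k => //= x.
rewrite /k /= /measurable_realfun.mindic indicE.
have [|nN] := boolP (x \in ~` N); last by rewrite mulr0.
rewrite inE /= => nN; rewrite mulr1 (le_trans (hf x))//.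
suff -> : f x = g x by [].
by apply: contrapT => fg; apply: nN; exact: sN.
Qed.

Lemma ge0_ae_eq_integralT (f g : X -> \bar R) :
  (forall x, 0 <= f x) -> (forall x, 0 <= g x) ->
  {ae mu, forall x, f x = g x} -> \int[mu]_x f x = \int[mu]_x g x.
Proof.
move=> f0 g0 fg; apply/eqP; rewrite eq_le !ge0_ae_le_integralT//.
by apply: filterS fg.
Qed.

(** No measurability is assumed: the integral of a non measurable function is
    a difference of lower integrals. *)
Lemma ae_eq_integral_nm (D : set X) (f g : X -> \bar R) :
  {ae mu, forall x, D x -> f x = g x} ->
  \int[mu]_(x in D) f x = \int[mu]_(x in D) g x.
Proof.
move=> fg; rewrite integral_mkcond [RHS]integral_mkcond.
have {fg} : {ae mu, forall x, (f \_ D) x = (g \_ D) x}.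
  apply: filterS fg => x fg; rewrite !patchE; case: ifPn => //.
  by rewrite inE => /fg.
move: (f \_ D) (g \_ D) => {D} {}f {}g fg.
rewrite integralE [RHS]integralE; congr (_ - _); apply: ge0_ae_eq_integralT => //;
  by apply: filterS fg => x fg; rewrite ?funeposE ?funenegE fg.
Qed.

End ae_integral.

Lemma ae_eq_Rintegral_nm d (X : measurableType d) (R : realType)
    (mu : {measure set X -> \bar R}) (D : set X) (f g : X -> R) :
  {ae mu, forall x, D x -> f x = g x} ->
  \int[mu]_(x in D) f x = \int[mu]_(x in D) g x.
Proof.
move=> fg; rewrite /Rintegral (ae_eq_integral_nm (g := EFin \o g))//.
by apply: filterS fg => x fg Dx /=; rewrite fg.
Qed.

Section square_integrable.
Context d (X : measurableType d) (R : realType) (P : probability X R).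

Definition sq_int (f : X -> R) :=
  measurable_fun setT f /\ (\int[P]_x (f x ^+ 2)%:E < +oo)%E.

Definition bnd_meas (f : X -> R) :=
  measurable_fun setT f /\ exists M : R, forall x, `|f x| <= M.

Local Notation intg f := (P.-integrable setT (EFin \o f)).

Lemma sq_int_sqr (f : X -> R) : sq_int f -> intg (fun x => f x ^+ 2).
Proof.
move=> [mf foo]; apply/integrableP; split.
  by apply/measurable_EFinP; exact: measurable_funX.
apply: le_lt_trans foo; rewrite le_eqVlt; apply/orP; left; apply/eqP.
by apply: eq_integral => x _ /=; rewrite ger0_norm// sqr_ge0.
Qed.

Lemma integrableP_fin (f : X -> R) : intg f -> measurable_fun setT f.
Proof. by move=> /measurable_int/measurable_EFinP. Qed.

Lemma integrable_dom (f g : X -> R) : measurable_fun setT f ->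
  (forall x, `|f x| <= g x) -> intg g -> intg f.
Proof.
move=> mf fg; apply: le_integrable => //; first exact/measurable_EFinP.
by move=> x _ /=; rewrite lee_fin (le_trans (fg x))// ler_norm.
Qed.

Lemma integrable_funD (f g : X -> R) : intg f -> intg g ->
  intg (fun x => f x + g x).
Proof. by move=> iF iG; exact: (integrableD measurableT iF iG). Qed.

Lemma integrable_funZ (k : R) (f : X -> R) : intg f -> intg (fun x => k * f x).
Proof. by move=> iF; exact: (integrableZl measurableT k iF). Qed.

Lemma integrable_funN (f : X -> R) : intg f -> intg (fun x => - f x).
Proof.
move=> /(integrable_funZ (-1)); apply: eq_integrable => // x _ /=.
by rewrite mulN1r.
Qed.

Lemma integrable_funB (f g : X -> R) : intg f -> intg g ->
  intg (fun x => f x - g x).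
Proof. by move=> iF /integrable_funN iG; exact: integrable_funD. Qed.

Lemma integrable_sum (I : Type) (s : seq I) (p : pred I) (F : I -> X -> R) :
  (forall i, p i -> intg (F i)) -> intg (fun x => \sum_(i <- s | p i) F i x).
Proof.
move=> iF; elim: s => [|i s IH].
  rewrite (_ : _ \o _ = cst 0%E); first exact: (@integrable0 _ _ _ P setT).
  by apply/funext => x /=; rewrite big_nil.
rewrite (_ : _ \o _ = EFin \o (fun x => (if p i then F i x else 0)
    + \sum_(j <- s | p j) F j x)); last first.
  by apply/funext => x /=; rewrite big_cons; case: ifP => //; rewrite add0r.
apply: integrable_funD => //; case: (boolP (p i)) => [/iF//|_].
exact: (@integrable0 _ _ _ P setT).
Qed.

Lemma Rintegral_sum (I : Type) (s : seq I) (p : pred I) (F : I -> X -> R) :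
  (forall i, p i -> intg (F i)) ->
  \int[P]_x (\sum_(i <- s | p i) F i x) = \sum_(i <- s | p i) \int[P]_x F i x.
Proof.
move=> iF; elim: s => [|i s IH].
  rewrite big_nil; under eq_Rintegral do rewrite big_nil.
  by rewrite Rintegral_cst// mul0r.
rewrite big_cons; under eq_Rintegral do rewrite big_cons.
case: ifPn => // pi; rewrite RintegralD//; [by rewrite IH|exact: iF|].
exact: integrable_sum.
Qed.

Lemma sq_int_mul (f g : X -> R) : sq_int f -> sq_int g ->
  intg (fun x => f x * g x).
Proof.
move=> f2 g2; apply: integrable_dom
    (integrable_funD (sq_int_sqr f2) (sq_int_sqr g2)).
  by case: f2 g2 => [mf _] [mg _]; exact: measurable_funM.
move=> x; rewrite normrM -(real_normK (num_real (f x)))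
  -(real_normK (num_real (g x))).
move: (normr_ge0 (f x)) (normr_ge0 (g x)); nra.
Qed.

Lemma Rintegral_sqr_ge0 (f : X -> R) : 0 <= \int[P]_x (f x ^+ 2).
Proof. by apply: Rintegral_ge0 => x _; exact: sqr_ge0. Qed.

Lemma Rintegral_sqrE (f : X -> R) : sq_int f ->
  (\int[P]_x (f x ^+ 2)%:E = (\int[P]_x (f x ^+ 2))%:E)%E.
Proof.
move=> [mf foo]; rewrite /Rintegral fineK// ge0_fin_numE//.
by apply: integral_ge0 => x _; rewrite lee_fin sqr_ge0.
Qed.

Lemma sq_int_integrable (f : X -> R) : intg (fun x => f x ^+ 2) ->
  measurable_fun setT f -> sq_int f.
Proof.
move=> /integrableP[_ i] mf; split => //; apply: le_lt_trans i.
rewrite le_eqVlt; apply/orP; left; apply/eqP.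
by apply: eq_integral => x _ /=; rewrite ger0_norm// sqr_ge0.
Qed.

Lemma sq_intD (f g : X -> R) : sq_int f -> sq_int g ->
  sq_int (fun x => f x + g x).
Proof.
move=> f2 g2; have [mf _] := f2; have [mg _] := g2.
apply: sq_int_integrable; last exact: measurable_funD.
have i := integrable_funD (integrable_funD (sq_int_sqr f2) (sq_int_sqr g2))
  (integrable_funZ 2 (sq_int_mul f2 g2)).
by apply: eq_integrable i => // x _ /=; congr EFin; ring.
Qed.

Lemma sq_intZ (k : R) (f : X -> R) : sq_int f -> sq_int (fun x => k * f x).
Proof.
move=> f2; have [mf _] := f2; apply: sq_int_integrable; last first.
  exact: measurable_funM.
have i := integrable_funZ (k ^+ 2) (sq_int_sqr f2).
by apply: eq_integrable i => // x _ /=; rewrite exprMn.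
Qed.

Lemma eq_sq_int (f g : X -> R) : f =1 g -> sq_int f -> sq_int g.
Proof. by move=> /funext ->. Qed.

Lemma sq_intB (f g : X -> R) : sq_int f -> sq_int g ->
  sq_int (fun x => f x - g x).
Proof.
move=> f2 /(sq_intZ (-1)) g2; apply: eq_sq_int (sq_intD f2 g2) => x.
by rewrite mulN1r.
Qed.

Lemma bnd_meas_integrable (f : X -> R) : bnd_meas f -> intg f.
Proof.
move=> [mf [M fM]]; apply: (@integrable_dom _ (cst M)) => //.
exact: finite_measure_integrable_cst.
Qed.

Lemma bnd_measM (f g : X -> R) : bnd_meas f -> bnd_meas g ->
  bnd_meas (fun x => f x * g x).
Proof.
move=> [mf [M fM]] [mg [N gN]]; split; first exact: measurable_funM.
by exists (M * N) => x; rewrite normrM ler_pM.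
Qed.

Lemma bnd_meas_sq_int (f : X -> R) : bnd_meas f -> sq_int f.
Proof.
move=> bf; apply: sq_int_integrable; last by case: bf.
by apply: bnd_meas_integrable; exact: bnd_measM.
Qed.

Lemma Rintegral_prob_cst (r : R) : \int[P]_x r = r.
Proof.
rewrite Rintegral_cst// -[RHS]mulr1; congr (_ * _).
transitivity (fine (1%:E : \bar R)) => //.
congr fine; exact: probability_setT.
Qed.

Lemma cst_sq_int (r : R) : sq_int (fun=> r).
Proof. by apply: bnd_meas_sq_int; split => //; exists `|r|. Qed.

Lemma sq_int_int (f : X -> R) : sq_int f -> intg f.
Proof.
move=> f2; have := sq_int_mul f2 (cst_sq_int 1).
by apply: eq_integrable => // x _ /=; rewrite mulr1.
Qed.

Lemma sq_intM_bnd (f g : X -> R) : sq_int f -> bnd_meas g ->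
  sq_int (fun x => f x * g x).
Proof.
move=> f2 [mg [M gM]]; have [mf _] := f2; apply: sq_int_integrable.
  apply: integrable_dom (integrable_funZ (M ^+ 2) (sq_int_sqr f2)).
    by apply: measurable_funX; exact: measurable_funM.
  move=> x; rewrite exprMn normrM !normrX mulrC ler_pM ?exprn_ge0//.
    by rewrite lerXn2r ?nnegrE// (le_trans _ (gM x)).
  by rewrite real_normK ?num_real.
exact: measurable_funM.
Qed.

Lemma integrableM_bnd (f g : X -> R) : intg f -> bnd_meas g ->
  intg (fun x => f x * g x).
Proof.
move=> iF [mg [M gM]]; have mf := integrableP_fin iF.
apply: integrable_dom (integrable_funZ M (integrable_norm iF)).
  exact: measurable_funM.
by move=> x; rewrite normrM mulrC ler_wpM2r.
Qed.

Lemma cauchy_schwarz_sq (f g : X -> R) : sq_int f -> sq_int g ->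
  (\int[P]_x (f x * g x)) ^+ 2 <=
  \int[P]_x (f x ^+ 2) * \int[P]_x (g x ^+ 2).
Proof.
move=> f2 g2; set a := \int[P]_x _; set b := \int[P]_x _; set c := \int[P]_x _.
have q (t s : R) : 0 <= s ^+ 2 * b + 2 * s * t * a + t ^+ 2 * c.
  have -> : s ^+ 2 * b + 2 * s * t * a + t ^+ 2 * c =
      \int[P]_x ((s * f x + t * g x) ^+ 2).
    rewrite /a /b /c -!RintegralZl//; try exact: sq_int_sqr.
    2: exact: sq_int_mul.
    rewrite -!RintegralD//; try apply: integrable_funD;
      try apply: integrable_funZ; try exact: sq_int_sqr; try exact: sq_int_mul.
    by apply: eq_Rintegral => x _; ring.
  exact: Rintegral_sqr_ge0.
have b0 : 0 <= b := Rintegral_sqr_ge0 f.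
have c0 : 0 <= c := Rintegral_sqr_ge0 g.
have [c00|cn0] := eqVneq c 0.
  (* With [c = 0] this choice gives [0 <= - (b + 2) * a ^+ 2], hence [a = 0]. *)
  have := q (- (b + 1)) a; rewrite c00 !mulr0 addr0 => h.
  have : 0 <= a ^+ 2 := sqr_ge0 a.
  nra.
have {}c0 : 0 < c by rewrite lt_def cn0.
(* This choice turns the quadratic form into [c * (b * c - a ^+ 2)]. *)
have := q (- a) c; move=> h.
have : 0 <= c * (b * c - a ^+ 2) by apply: le_trans h _; rewrite le_eqVlt; apply/orP; left; apply/eqP; ring.
by rewrite pmulr_rge0// subr_ge0.
Qed.

Lemma cauchy_schwarz (f g : X -> R) : sq_int f -> sq_int g ->
  `|\int[P]_x (f x * g x)| <=
  Num.sqrt (\int[P]_x (f x ^+ 2)) * Num.sqrt (\int[P]_x (g x ^+ 2)).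
Proof.
move=> f2 g2; rewrite -sqrtrM ?Rintegral_sqr_ge0// -sqrtr_sqr ler_wsqrtr//.
exact: cauchy_schwarz_sq.
Qed.

Lemma sq_int_norm (f : X -> R) : sq_int f -> sq_int (fun x => `|f x|).
Proof.
move=> f2; have [mf _] := f2; apply: sq_int_integrable.
  apply: eq_integrable (sq_int_sqr f2) => // x _ /=.
  by rewrite real_normK ?num_real.
exact: measurableT_comp.
Qed.

Lemma ae_le_Rintegral (f g : X -> R) : intg f -> intg g ->
  {ae P, forall x, f x <= g x} -> \int[P]_x f x <= \int[P]_x g x.
Proof.
move=> iF iG fg.
have -> : \int[P]_x g x = \int[P]_x (Num.max (f x) (g x)).
  by apply: ae_eq_Rintegral_nm; apply: aeS fg => x fg _; rewrite max_r.
apply: le_Rintegral => // [|x _]; last by rewrite le_max lexx.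
apply: integrable_dom (integrable_funD (integrable_norm iF) (integrable_norm iG)).
  by apply: measurable_maxr; exact: integrableP_fin.
move=> x /=; have [_|_] := leP (f x) (g x); first by rewrite lerDr.
by rewrite lerDl.
Qed.

(** The increments have summable L_2 norms, hence summable L_1 norms on a probability space, so
    their series converges absolutely almost everywhere. Fatou's lemma carries the rate over to the
    limit, and square integrability of the limit follows from the rate. *)
Lemma sq_int_complete (s : nat -> X -> R) : (forall k, sq_int (s k)) ->
  (forall k m, (k <= m)%N ->
     \int[P]_x ((s m x - s k x) ^+ 2) <= (2^-1 ^+ k) ^+ 2) ->
  exists g : X -> R, [/\ sq_int g,
    (forall k, \int[P]_x ((g x - s k x) ^+ 2) <= (2^-1 ^+ k) ^+ 2) &
    {ae P, forall x, s ^~ x @ \oo --> g x}].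
Proof.
move=> s2 sC; have ms k : measurable_fun setT (s k) by case: (s2 k).
pose D k x : R := `|s k.+1 x - s k x|.
have sB k m : sq_int (fun x => s k x - s m x) by exact: sq_intB.
have D2 k : sq_int (D k) by exact: sq_int_norm.
(* Cauchy-Schwarz against the constant 1 bounds the L_1 norm of an increment by its L_2 norm. *)
have DE k : (\int[P]_x (D k x)%:E <= (2^-1 ^+ k)%:E)%E.
  have iD := sq_int_int (D2 k).
  have -> : (\int[P]_x (D k x)%:E = (\int[P]_x (D k x))%:E)%E.
    by rewrite /Rintegral fineK//; exact: integrable_fin_num iD.
  rewrite lee_fin.
  have := cauchy_schwarz (D2 k) (cst_sq_int 1).
  rewrite Rintegral_prob_cst expr1n sqrtr1 mulr1.
  under eq_Rintegral do rewrite mulr1.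
  rewrite ger0_norm; last by apply: Rintegral_ge0 => x _; exact: normr_ge0.
  move=> /le_trans; apply.
  rewrite -[leRHS](@ger0_norm _ (2^-1 ^+ k)) ?exprn_ge0 ?invr_ge0// -sqrtr_sqr.
  apply: ler_wsqrtr; apply: le_trans (sC k k.+1 (leqnSn k)).
  by under eq_Rintegral do rewrite /D real_normK ?num_real//.
have mD k : measurable_fun setT (EFin \o D k).
  by apply/measurable_EFinP; case: (D2 k).
have D0 k x : setT x -> (0 <= (EFin \o D k) x)%E by move=> _; rewrite /= lee_fin normr_ge0.
have fin : (\int[P]_x (\sum_(k <oo) (D k x)%:E) < +oo)%E.
  rewrite (integral_nneseries _ measurableT mD)//.
  apply: (@le_lt_trans _ _ (\sum_(k <oo) (2^-1 ^+ k)%:E)%E).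
    by apply: lee_nneseries => [k _ _|k _]; [apply: integral_ge0; exact: D0|exact: DE].
  have -> : (\sum_(k <oo) (2^-1 ^+ k : R)%:E)%E = 2%:E.
    apply/cvg_lim => //.
    rewrite (_ : (fun n => _) = EFin \o series (geometric (1 : R) 2^-1)).
      apply: cvg_EFin; first exact: nearW.
      have := @cvg_geometric_series R 1 2^-1.
      rewrite (_ : 1 * (1 - 2^-1)^-1 = 2); last by field.
      apply; rewrite ger0_norm; lra.
    apply/funext => n; rewrite /series /= -sumEFin; apply: eq_bigr => i _.
    by rewrite mul1r.
  by rewrite ltry.
have msum : measurable_fun setT (fun x => \sum_(k <oo) (D k x)%:E)%E.
  apply: (@ge0_emeasurable_sum _ _ _ setT (fun k x => (D k x)%:E) xpredT).
    by move=> k x _ _; rewrite lee_fin normr_ge0.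
  by move=> k _; exact: mD.
have cvgae : {ae P, forall x, cvgn (s ^~ x)}.
  have : {ae P, forall x, setT x -> (\sum_(k <oo) (D k x)%:E)%E \is a fin_num}.
    apply: integrable_ae => //; apply/integrableP; split => //.
    apply: le_lt_trans fin; rewrite le_eqVlt; apply/orP; left; apply/eqP.
    apply: eq_integral => x _; rewrite gee0_abs//.
    by apply: nneseries_ge0 => k _ _; rewrite lee_fin normr_ge0.
  apply: filterS => x /(_ I) xfin.
  have : cvgn (series (fun k => s k.+1 x - s k x)).
    apply: normed_cvg.
    apply: nondecreasing_is_cvgn.
      by apply: nondecreasing_series => k _ _ /=; exact: normr_ge0.
    exists (fine (\sum_(k <oo) (D k x)%:E)%E) => _ [n _ <-].
    rewrite -lee_fin fineK//.
    rewrite (_ : ([normed series (fun k => s k.+1 x - s k x)] n)%:E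
      = (\sum_(0 <= k < n) (D k x)%:E)%E); last first.
      by rewrite /series /= sumEFin.
    by apply: nneseries_lim_ge => k _; rewrite lee_fin normr_ge0.
  have -> : series (fun k => s k.+1 x - s k x) = (fun n => s n x - s 0%N x).
    by apply/funext => n; rewrite /series /= telescope_sumr.
  move=> /cvg_ex[l c]; apply/cvg_ex; exists (l + s 0%N x).
  rewrite (_ : s ^~ x = fun n => (s n x - s 0%N x) + s 0%N x); last first.
    by apply/funext => n; rewrite subrK.
  by apply: cvgD => //; exact: cvg_cst.
(* The upper limit is measurable everywhere and agrees with the limit wherever the latter exists. *)
pose g x := fine (limn_esup (fun k => (s k x)%:E)).
have mg : measurable_fun setT g.
  apply: measurableT_comp; first exact: fine_measurable.
  by apply: measurable_fun_limn_esup => k; exact/measurable_EFinP.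
have sg : {ae P, forall x, s ^~ x @ \oo --> g x}.
  apply: filterS cvgae => x /cvg_ex[l sl]; rewrite /g.
  have /cvg_limn_einf_sup[_ ->] : (fun k => (s k x)%:E) @ \oo --> l%:E.
    by apply: cvg_EFin => //; exact: nearW.
  exact: sl.
have key k : (\int[P]_x ((g x - s k x) ^+ 2)%:E <= ((2^-1 ^+ k) ^+ 2)%:E)%E.
  (* The shift by [k] makes the rate hypothesis available for every term of the sequence fed to
     Fatou's lemma. *)
  pose u m x := ((s (m + k)%N x - s k x) ^+ 2)%:E.
  have mu m : measurable_fun setT (u m).
    by apply/measurable_EFinP/measurable_funX/measurable_funB.
  have u0 m x : setT x -> (0 <= u m x)%E by rewrite lee_fin sqr_ge0.
  have uM m : (\int[P]_x u m x <= ((2^-1 ^+ k) ^+ 2)%:E)%E.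
    by rewrite Rintegral_sqrE// lee_fin sC// leq_addl.
  have -> : (\int[P]_x ((g x - s k x) ^+ 2)%:E =
      \int[P]_x limn_einf (u ^~ x))%E.
    apply: ge0_ae_eq_integralT.
    - by move=> x; rewrite lee_fin sqr_ge0.
    - move=> x; rewrite limn_einf_lim; apply: lime_ge.
        exact: is_cvg_einfs.
      apply: nearW => m; apply: le_ereal_inf_tmp => _ [j _ <-]; exact: u0.
    apply: filterS sg => x sg.
    have /cvg_limn_einf_sup[-> _]// : (u ^~ x) @ \oo -->
      ((g x - s k x) ^+ 2)%:E.
    apply: cvg_EFin; first exact: nearW.
    have sk : s (m + k)%N x - s k x @[m --> \oo] --> g x - s k x.
      apply: cvgB; last exact: cvg_cst.
      exact: cvg_comp (cvg_addnr k) sg.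
    exact: (cvgM sk sk).
  apply: le_trans (fatou P measurableT mu u0) _.
  rewrite limn_einf_lim; apply: lime_le; first exact: is_cvg_einfs.
  apply: nearW => m; apply: le_trans (uM m).
  by apply: ereal_inf_lbound; exists m => /=.
exists g; split => // [|k].
  have : sq_int (fun x => (g x - s 0%N x) + s 0%N x).
    apply: sq_intD => //; split; first exact: measurable_funB.
    by apply: le_lt_trans (key 0%N) _; rewrite ltry.
  by apply: eq_sq_int => x; rewrite subrK.
rewrite -lee_fin -Rintegral_sqrE//; split; first exact: measurable_funB.
by apply: le_lt_trans (key k) _; rewrite ltry.
Qed.

End square_integrable.

(** * Lebesgue measure on the unit cube *)

Section cube_integration.
Variable R : realType.
Local Notation leb := (@lebesgue_measure R).
Local Notation unitm := (@unit_leb R).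
Local Notation mR := (measurableTypeR R).
Local Notation cube := (@cube_leb R).

Lemma ae_unit_leb : {ae unitm, forall x, 0 <= x < 1}.
Proof.
exists (~` `[(0:R), 1[%classic); split.
- exact: measurableC.
- by rewrite /= /unit_leb /mrestr setICl measure0.
- by move=> x /=; rewrite in_itv.
Qed.

Lemma integral_unit_leb (f : R -> \bar R) :
  (\int[unitm]_x f x = \int[leb]_(x in `[0%R, 1%R[) f x)%E.
Proof.
transitivity (\int[unitm]_(x in `[0%R, 1%R[) f x)%E.
  rewrite [RHS]integral_mkcond; apply: ae_eq_integral_nm.
  apply: aeS ae_unit_leb => x x01 _; rewrite patchE ifT// inE /=.
  by rewrite in_itv.
apply: eq_measure_integral => A mA sA.
by rewrite /= /unit_leb /mrestr setIidl.
Qed.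

Lemma Rintegral_unit_leb (f : R -> R) :
  \int[unitm]_x f x = \int[leb]_(x in `[0%R, 1%R[) f x.
Proof. by rewrite /Rintegral integral_unit_leb. Qed.

Section step.
Variable n : nat.
Local Notation cons := (@tuple_cons R n).
Local Notation intg mu f := (mu.-integrable setT (EFin \o f)).

Lemma measurable_tuple_cons2 : measurable_fun setT cons.
Proof. by apply: measurable_cons; [exact: measurable_fst|exact: measurable_snd]. Qed.

Lemma ge0_integral_cubeS (f : n.+1.-tuple mR -> \bar R) :
  measurable_fun setT f -> (forall x, 0 <= f x)%E ->
  (\int[cube n.+1]_x f x =
   \int[cube n]_y \int[unitm]_x f (cons (x, y)))%E.
Proof.
move=> mf f0; rewrite [LHS]ge0_integral_distribution//.
rewrite (@fubini_tonelli2 _ _ _ _ _ unitm (cube n) (f \o cons))//.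
  exact: measurableT_comp mf measurable_tuple_cons2.
by move=> z; exact: f0.
Qed.

Lemma integrable_cubeS (f : n.+1.-tuple mR -> R) : intg (cube n.+1) f ->
  (unitm \x cube n)%E.-integrable setT (EFin \o (f \o cons)).
Proof.
move=> /integrableP[mf foo]; apply/integrableP; split.
  exact: measurableT_comp mf measurable_tuple_cons2.
apply: le_lt_trans foo; rewrite le_eqVlt; apply/orP; left; apply/eqP.
by rewrite [RHS]ge0_integral_distribution//; exact: measurableT_comp.
Qed.

Lemma cube_ae_integrable (f : n.+1.-tuple mR -> R) : intg (cube n.+1) f ->
  {ae cube n, forall y, intg unitm (fun x => f (cons (x, y)))}.
Proof. by move=> /integrable_cubeS /ae_integrable2. Qed.

Lemma cube_integrable2 (f : n.+1.-tuple mR -> R) : intg (cube n.+1) f ->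
  intg (cube n) (fun y => \int[unitm]_x f (cons (x, y))).
Proof.
move=> /integrable_cubeS iF; have aeI := ae_integrable2 iF.
have mF := measurable_int _ iF.
have iG : (cube n).-integrable setT
    (fun y => \int[unitm]_x (f (cons (x, y)))%:E)%E.
  have := (integrable21ltyP _ _ mF).1 iF => lt.
  apply/integrableP; split; first exact: measurable_fubini_G iF.
  apply: le_lt_trans lt; apply: ge0_le_integral => //.
  - apply: measurableT_comp => //; exact: measurable_fubini_G iF.
  - apply: (measurable_fun_fubini_tonelli_G (abse \o (EFin \o (f \o cons)))).
      exact: measurableT_comp.
    by move=> z; exact: abse_ge0.
  move=> y _; apply: le_abse_integral => //.
  exact: measurableT_comp mF (measurable_pair2 y).
apply/integrableP; split.
  apply/measurable_EFinP; apply: measurableT_comp; first exact: fine_measurable.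
  exact: measurable_int iG.
move/integrableP : iG => [_]; apply: le_lt_trans.
rewrite le_eqVlt; apply/orP; left; apply/eqP; apply: ae_eq_integral_nm.
apply: aeS aeI => y iy _ /=; rewrite /fubini_G /Rintegral.
by rewrite -[in RHS](@fineK _ (\int[unitm]_x _)%E)//; exact: integrable_fin_num.
Qed.

Lemma Rintegral_cubeS (f : n.+1.-tuple mR -> R) : intg (cube n.+1) f ->
  \int[cube n.+1]_x f x = \int[cube n]_y \int[unitm]_x f (cons (x, y)).
Proof.
move=> iF; have iF' := integrable_cubeS iF.
rewrite /Rintegral [X in fine X = _]integral_distribution//; last first.
  by case/integrableP : iF.
have -> : (\int[unitm \x cube n]_x ((EFin \o f) \o cons) x =
    \int[cube n]_y \int[unitm]_x (f (cons (x, y)))%:E)%E.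
  by rewrite -(integral21_prod_meas1 iF').
congr fine; apply: ae_eq_integral_nm.
apply: aeS (cube_ae_integrable iF) => y iy _ /=.
by rewrite fineK//; exact: integrable_fin_num iy.
Qed.

Lemma Rintegral_cubeS2 (f : n.+1.-tuple mR -> R) : intg (cube n.+1) f ->
  \int[cube n.+1]_x f x = \int[unitm]_x \int[cube n]_y f (cons (x, y)).
Proof.
move=> iF; have iF' := integrable_cubeS iF.
rewrite /Rintegral [X in fine X = _]integral_distribution//; last first.
  by case/integrableP : iF.
have -> : (\int[unitm \x cube n]_x ((EFin \o f) \o cons) x =
    \int[unitm]_x \int[cube n]_y (f (cons (x, y)))%:E)%E.
  by rewrite -(integral12_prod_meas1 iF').
congr fine; apply: ae_eq_integral_nm.
apply: aeS (ae_integrable1 iF') => y iy _ /=.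
by rewrite fineK//; exact: integrable_fin_num iy.
Qed.

End step.

(** Tonelli's theorem applied to the indicator of the complement, which is why [Q] has to be
    measurable. *)
Lemma ae_cubeS n (Q : n.+1.-tuple mR -> Prop) :
  measurable [set x | Q x] ->
  {ae cube n, forall y, {ae unitm, forall x, Q (@tuple_cons R n (x, y))}} ->
  {ae cube n.+1, forall x, Q x}.
Proof.
move=> mQ aeQ; exists (~` [set x | Q x]); split => //; first exact: measurableC.
rewrite -[LHS]/(cube n.+1 (~` [set x | Q x])).
have mCQ : measurable (~` [set x | Q x]) by exact: measurableC.
rewrite -[~` _]setIT -integral_indic// ge0_integral_cubeS; [|by apply/measurable_EFinP; exact: measurable_indic|by move=> x; rewrite lee_fin].
transitivity (\int[cube n]_y cst 0 y)%E; last exact: integral0.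
apply: ae_eq_integral_nm; apply: aeS aeQ => y aey _ /=.
transitivity (\int[unitm]_x cst 0 x)%E; last exact: integral0.
apply: ae_eq_integral_nm; apply: aeS aey => x Qx _ /=.
by rewrite indicE memNset//= => /(_ Qx).
Qed.

Lemma measurable_boxT n (J : 'I_n -> set mR) : (forall i, measurable (J i)) ->
  measurable [set x : n.-tuple mR | forall i, J i (tnth x i)].
Proof.
move=> mJ; rewrite (_ : [set x | _] =
    \bigcap_(i in [set: 'I_n]) ((fun x => tnth x i) @^-1` J i)).
  apply: fin_bigcap_measurable => // i _; rewrite -[X in measurable X]setTI.
  exact: (measurable_tnth i measurableT).
by apply/seteqP; split => [x /= Jx i _|x Jx i]; [exact: Jx|exact: Jx].
Qed.

Lemma ae_cube n : {ae cube n, forall x, forall i, 0 <= tnth x i < 1}.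
Proof.
elim: n => [|n IH]; first by apply: aeW => x -[].
apply: ae_cubeS.
  rewrite (_ : [set x | _] = [set x : n.+1.-tuple mR |
      forall i, `[(0:R), 1[%classic (tnth x i)]).
    by apply: (@measurable_boxT _ (fun=> `[(0:R), 1[%classic)) => i; exact: measurable_itv.
  by apply/seteqP; split => x /= xi i; have := xi i; rewrite in_itv.
apply: aeS IH => y yi; apply: aeS ae_unit_leb => x x01 i.
have [->//|i0] := eqVneq i ord0.
by case: (unliftP ord0 i) i0 => [j ->|->]//; rewrite tnthS.
Qed.

End cube_integration.

(** * Continuous functions of several variables and derivatives along lines *)

Section rows.
Variable R : realType.
Local Notation leb := (@lebesgue_measure R).
Local Notation unitm := (@unit_leb R).
Local Notation mR := (measurableTypeR R).
Local Notation cube := (@cube_leb R).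

Lemma row_ballP n (x y : 'rV[R]_n) (e : R) : 0 < e ->
  ball x e y <-> forall i, `|x 0 i - y 0 i| < e.
Proof.
move=> e0; split=> [[_ b] i|b]; first exact: b.
by split => // i j; rewrite (ord1 i); exact: b.
Qed.

Lemma row_continuousP n (h : 'rV[R]_n -> R) : continuous h <->
  forall (x : 'rV[R]_n) (e : R), 0 < e -> exists2 dl : R, 0 < dl &
    forall y : 'rV[R]_n, (forall i, `|x 0 i - y 0 i| < dl) -> `|h x - h y| < e.
Proof.
split=> [ch x e e0|H x].
  have /cvgrPdist_lt /(_ _ e0) /nbhs_ballP[dl /= dl0 hd] := ch x.
  by exists dl => // y xy; apply: hd; apply/row_ballP.
apply/(@cvgrPdist_lt _ _ _ (nbhs x) (nbhs_filter x)) => e e0.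
have [dl dl0 hd] := H x e e0.
apply/nbhs_ballP; exists dl => //= y /row_ballP xy; exact/hd/xy.
Qed.

(** The sigma-algebra on tuples only knows coordinates, so [h] is approximated by step functions:
    sampled at the grid point of mesh [1 / m.+1] below [x], it is constant on each of countably many
    boxes, and continuity gives pointwise convergence. *)
Lemma measurable_row n (h : 'rV[R]_n -> R) : continuous h ->
  measurable_fun setT (fun x : n.-tuple mR => h (row_of x)).
Proof.
move=> /row_continuousP ch.
pose q (m : nat) (x : R) : int := Num.floor (x * m.+1%:R).
pose rq (m : nat) (z : n.-tuple int) : 'rV[R]_n :=
  \row_i ((tnth z i)%:~R / m.+1%:R).
pose hm (m : nat) (x : n.-tuple mR) : R :=
  h (rq m [tuple q m (tnth x i) | i < n]).
apply: (@measurable_fun_cvg _ _ _ _ hm).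
  move=> m _ B mB; rewrite setTI.
  rewrite (_ : _ @^-1` _ = \bigcup_(z : n.-tuple int) (if `[< B (h (rq m z)) >]
      then [set x | forall i, (fun x : mR => `[< q m x = tnth z i >]) (tnth x i)]
      else set0)); last first.
    apply/seteqP; split => [x /= Bx|x [z _]].
      exists [tuple q m (tnth x i) | i < n] => //.
      by rewrite ifT; [move=> i /=; apply/asboolP; rewrite tnth_mktuple|apply/asboolP].
    case: ifPn => // /asboolP Bz /= xz; rewrite /hm.
    suff -> : [tuple q m (tnth x i) | i < n] = z by [].
    by apply: eq_from_tnth => i; rewrite tnth_mktuple; exact/asboolP/xz.
  apply: countable_bigcupT_measurable; first exact: countableP.
  move=> z; case: ifPn => // _.
  apply: (@measurable_boxT _ _ (fun i => [set x | `[< q m x = tnth z i >]])) => i.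
  rewrite (_ : [set _ | _] = `[(tnth z i)%:~R / m.+1%:R,
      (tnth z i + 1)%:~R / m.+1%:R[%classic); first exact: measurable_itv.
  apply/seteqP; split => x /=; rewrite in_itv /= ler_pdivrMr// ltr_pdivlMr//.
    by move=> /asboolP <-; rewrite floor_le_tmp floorD1_gt.
  by move=> xz; apply/asboolP; exact: floor_def.
move=> x _; apply/cvgrPdist_lt => e e0.
have [dl dl0 hd] := ch (row_of x) e e0.
near=> m; apply: hd => i; rewrite !mxE tnth_mktuple.
have m0 : (0 : R) < m.+1%:R by [].
rewrite -(@ltr_pM2r _ m.+1%:R)// -[X in `|_| * X](gtr0_norm m0) -normrM mulrBl.
rewrite divfK ?gt_eqF// ger0_norm; last by rewrite subr_ge0 floor_le_tmp.
apply: (@lt_trans _ _ 1).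
  by rewrite ltrBlDr addrC -[X in _ + X]mulr1z -intrD floorD1_gt.
rewrite -ltr_pdivrMl// mulr1.
near: m; exists (Num.truncn (dl^-1)).+1 => // m /= hm1.
apply: lt_trans (truncnS_gt _) _.
by rewrite ltr_nat ltnS.
Unshelve. all: by end_near. Qed.

Definition int_row n (m : 'rV[int]_n) : 'rV[R]_n := map_mx (intr : int -> R) m.

Lemma periodic_bounded n (h : 'rV[R]_n -> R) : periodic h -> continuous h ->
  exists M, forall x, `|h x| <= M.
Proof.
move=> ph ch.
pose A := [set v : 'rV[R]_n | forall i, `[(0:R), 1]%classic (v ord0 i)].
have cA : compact A by apply: (@rV_compact _ _ (fun=> `[(0:R), 1]%classic)) => i; exact: segment_compact.
have A0 : A !=set0.
  by exists 0 => i; rewrite mxE /= in_itv /= lexx ler01.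
have cf : {within A, continuous (fun x => `|h x|)}.
  apply: continuous_subspaceT => x; apply: (cvg_norm (ch x)).
have [c cA' hc] := EVT_max_rV A0 cA cf.
exists `|h c| => x.
(* Translating by minus the integer parts moves [x] into the compact cube. *)
pose m : 'rV[int]_n := \row_i - Num.floor (x 0 i).
rewrite -(ph x m); apply: hc; rewrite inE => i /=.
rewrite in_itv /= !mxE intrN subr_ge0 floor_le_tmp /=.
by rewrite lerBlDr addrC ltW// -[X in _ + X]mulr1z -intrD floorD1_gt.
Qed.

Definition row_cons n (a : R) (v : 'rV[R]_n) : 'rV[R]_n.+1 :=
  \row_i (if unlift ord0 i is Some j then v 0 j else a).

Lemma row_of_cons n (a : mR) (t : n.-tuple mR) :
  row_of (tuple_cons (a, t)) = row_cons a (row_of t).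
Proof.
apply/rowP => i; rewrite !mxE; case: unliftP => [j ->|->].
  by rewrite mxE tnthS.
by rewrite tnth0.
Qed.

Lemma row_cons_lift n (a : R) (v : 'rV[R]_n) (j : 'I_n) (c : R) :
  row_cons a (c *: delta_mx 0 j + v) =
  c *: delta_mx 0 (lift ord0 j) + row_cons a v.
Proof.
apply/rowP => i; rewrite !mxE; case: unliftP => [k ->|->].
  by rewrite !mxE (inj_eq lift_inj).
by rewrite (negbTE (neq_lift _ _)) mulr0 add0r.
Qed.

Lemma row_cons_0 n (a : R) (v : 'rV[R]_n) (c : R) :
  row_cons (c + a) v = c *: delta_mx 0 ord0 + row_cons a v.
Proof.
apply/rowP => i; rewrite !mxE; case: unliftP => [k ->|->].
  by rewrite eq_sym (negbTE (neq_lift _ _)) mulr0 add0r.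
by rewrite eqxx mulr1.
Qed.

Lemma row_cons_int n (a : R) (v : 'rV[R]_n) (k : int) (m : 'rV[int]_n) :
  row_cons (a + k%:~R) (v + int_row m) =
  row_cons a v + int_row (\row_i (if unlift ord0 i is Some j then m 0 j else k)).
Proof. by apply/rowP => i; rewrite !mxE; case: unliftP => [j _|_]; rewrite ?mxE. Qed.

Lemma derive_line (V W : normedModType R) (f : V -> W) (x v : V) :
  'D_v f x = 'D_1 (fun h : R => f (h *: v + x)) 0.
Proof.
rewrite /derive; set g1 := fun h => h^-1 *: _; set g2 := fun h => h^-1 *: _.
suff -> : g1 = g2 by [].
by rewrite funeqE /g1 /g2 => h /=; rewrite addr0 scale0r add0r [_%:A]mulr1.
Qed.

(** Both derivatives are computed from the common restriction to a line, so the two functions may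
    live on spaces of different dimensions, such as a function and one of its slices. *)
Lemma derive_line_eq (V V' W : normedModType R) (f : V -> W) (g : V' -> W)
    (x v : V) (y w : V') : (forall t : R, f (t *: v + x) = g (t *: w + y)) ->
  'D_v f x = 'D_w g y.
Proof.
move=> fg; rewrite derive_line [RHS]derive_line.
suff -> : (fun t => f (t *: v + x)) = (fun t => g (t *: w + y)) by [].
exact/funext.
Qed.

Lemma derivable_line_eq (V V' W : normedModType R) (f : V -> W) (g : V' -> W)
    (x v : V) (y w : V') : (forall t : R, f (t *: v + x) = g (t *: w + y)) ->
  derivable f x v -> derivable g y w.
Proof.
move=> fg /derivable1P df; apply/derivable1P.
suff <- : (fun t => f (t *: v + x)) = (fun t => g (t *: w + y)) by [].
exact/funext.
Qed.

Lemma is_derive_line (V W : normedModType R) (f : V -> W) (x v : V) (d : W) :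
  is_derive (0 : R) (1 : R) (fun h : R => f (h *: v + x)) d -> is_derive x v f d.
Proof.
move=> [dv <-]; apply: DeriveDef; first exact/derivable1P.
exact: derive_line.
Qed.

Lemma is_derive_lineP (V W : normedModType R) (f : V -> W) (x v : V) :
  forall t : R, derivable f (t *: v + x) v ->
  is_derive t (1 : R) (fun h : R => f (h *: v + x)) ('D_v f (t *: v + x)).
Proof.
move=> t /derivableP df; apply: is_derive_line.
rewrite (_ : (fun h : R => f ((h *: 1 + t) *: v + x)) =
  (fun h : R => f (h *: v + (t *: v + x)))); last first.
  by apply/funext => h; rewrite scalerDl addrA [_ *: 1]mulr1.
case: df => dv _; apply: DeriveDef; first by move/derivable1P: dv.
by rewrite -derive_line.
Qed.

Lemma continuous_itv01 (f : R -> R) : continuous f ->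
  {within `[(0:R), 1], continuous f}.
Proof. by move=> cf; apply: continuous_subspaceT. Qed.

Lemma Rintegral_unit_derive (F f : R -> R) : continuous f ->
  (forall t : R, is_derive t (1 : R) F (f t)) ->
  \int[unitm]_x f x = F 1 - F 0.
Proof.
move=> cf dF; rewrite Rintegral_unit_leb Rintegral_itv_bndo_bndc; last first.
  apply: integrableS (continuous_compact_integrable (@segment_compact R 0 1)
    (continuous_itv01 cf)) => //.
  by apply: subset_itvl; rewrite bnd_simp.
have cF : continuous F.
  by move=> t; apply: differentiable_continuous; apply/derivable1_diffP; case: (dF t).
rewrite /Rintegral (@continuous_FTC2 _ f F 0 1)//.
- exact: continuous_itv01.
- split.
  + by move=> t _; case: (dF t).
  + exact: cvg_at_right_filter (cF 0).
  + exact: cvg_at_left_filter (cF 1).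
- by move=> t _; rewrite derive1E; case: (dF t).
Qed.

End rows.

(** * Integrals of partial derivatives of periodic functions *)

Section cube_ibp.
Variable R : realType.
Local Notation unitm := (@unit_leb R).
Local Notation mR := (measurableTypeR R).
Local Notation cube := (@cube_leb R).

Lemma periodic_bnd_meas n (h : 'rV[R]_n -> R) : periodic h -> continuous h ->
  bnd_meas (fun x : n.-tuple mR => h (row_of x)).
Proof.
move=> ph ch; split; first exact: measurable_row.
by have [M hM] := periodic_bounded ph ch; exists M => x; exact: hM.
Qed.

Lemma periodic_partial n (h : 'rV[R]_n -> R) (j : 'I_n) : periodic h ->
  periodic (partial j h).
Proof.
move=> ph x m; rewrite /partial; apply: derive_line_eq => t.
by rewrite addrA ph.
Qed.

Lemma continuous_row_cons1 n (h : 'rV[R]_n.+1 -> R) (v : 'rV[R]_n) :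
  continuous h -> continuous (fun a : R => h (row_cons a v)).
Proof.
move=> /row_continuousP ch a; apply/cvgrPdist_lt => e e0.
have [dl dl0 hd] := ch (row_cons a v) e e0.
apply/nbhs_ballP; exists dl => //= b ab; apply: hd => i; rewrite !mxE.
by case: unliftP => // j _; rewrite subrr normr0.
Qed.

Lemma continuous_row_cons2 n (h : 'rV[R]_n.+1 -> R) (a : R) :
  continuous h -> continuous (fun v : 'rV[R]_n => h (row_cons a v)).
Proof.
move=> /row_continuousP ch; apply/row_continuousP => v e e0.
have [dl dl0 hd] := ch (row_cons a v) e e0.
exists dl => // w vw; apply: hd => i; rewrite !mxE.
by case: unliftP => // _; rewrite subrr normr0.
Qed.

(** Induction on the dimension. A derivative in a later coordinate is integrated slice by slice with
    the induction hypothesis; in the first coordinate the inner integral is a difference of values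
    at 1 and 0, which periodicity cancels. *)
Lemma integral_partial n (h : 'rV[R]_n -> R) (j : 'I_n) : periodic h ->
  continuous h -> continuous (partial j h) ->
  (forall x, derivable h x (delta_mx 0 j)) ->
  \int[cube n]_x partial j h (row_of x) = 0.
Proof.
elim: n h j => [|n IH] h j ph ch cdh dh; first by case: j cdh dh.
have iF : (cube n.+1).-integrable setT
    (EFin \o (fun x => partial j h (row_of x))).
  by apply/bnd_meas_integrable/periodic_bnd_meas => //; exact: periodic_partial.
case: (unliftP ord0 j) => [k jE|jE].
  rewrite Rintegral_cubeS2//.
  transitivity (\int[unitm]_x (cst 0 x : R)); last first.
    by rewrite Rintegral_prob_cst.
  apply: eq_Rintegral => x _ /=.
  pose hx (v : 'rV[R]_n) := h (row_cons x v).
  have dhx : partial k hx = fun v => partial j h (row_cons x v).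
    apply/funext => v.
    by rewrite /partial jE; apply: derive_line_eq => t; rewrite /hx row_cons_lift.
  under eq_Rintegral do rewrite row_of_cons.
  rewrite -(IH hx k).
  - by apply: eq_Rintegral => y _; rewrite dhx.
  - move=> v m; have := row_cons_int x v 0 m; rewrite mulr0z addr0 /hx => ->.
    exact: ph.
  - exact: continuous_row_cons2.
  - by rewrite dhx; exact: continuous_row_cons2.
  - move=> v; have := dh (row_cons x v); rewrite jE.
    by apply: derivable_line_eq => t; rewrite /hx row_cons_lift.
rewrite Rintegral_cubeS//.
transitivity (\int[cube n]_x (cst 0 x : R)); last by rewrite Rintegral_prob_cst.
apply: eq_Rintegral => y _ /=.
under eq_Rintegral do rewrite row_of_cons.
pose g (t : R) := h (row_cons t (row_of y)).
have dg (t : R) : is_derive t (1 : R) g (partial j h (row_cons t (row_of y))).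
  have := dh (row_cons t (row_of y)); rewrite /partial jE => df.
  have := @is_derive_lineP R _ _ h (row_cons 0 (row_of y)) (delta_mx 0 ord0) t.
  rewrite -row_cons_0 addr0 => /(_ df).
  rewrite (_ : (fun h0 => h (h0 *: _ + _)) = fun t => h (row_cons t (row_of y)))//.
  by apply/funext => s; rewrite -row_cons_0 addr0.
rewrite (Rintegral_unit_derive (@continuous_row_cons1 _ _ (row_of y) cdh) dg).
have := row_cons_int 0 (row_of y) 1 0; rewrite add0r mulr1z.
by rewrite /int_row map_mx0 addr0 /g => ->; rewrite ph subrr.
Qed.

End cube_ibp.

(** * Trigonometric test functions *)

Section trig.
Variables (R : realType) (n : nat).
Local Notation mR := (measurableTypeR R).
Local Notation cube := (@cube_leb R n).
Local Notation Rn := 'rV[R]_n.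
Local Notation Zn := 'rV[int]_n.

Definition cs (xi : Zn) (x : Rn) : R := cos (2 * pi * zdot xi x).
Definition sn (xi : Zn) (x : Rn) : R := sin (2 * pi * zdot xi x).

Lemma zdot_line (xi : Zn) (t : R) (j : 'I_n) (x : Rn) :
  zdot xi (t *: delta_mx 0 j + x) = t * (xi 0 j)%:~R + zdot xi x.
Proof.
rewrite /zdot; under eq_bigr do rewrite mxE mulrDr.
rewrite big_split /=; congr (_ + _).
rewrite (bigD1 j)//= big1 ?addr0 => [|i ij]; last first.
  by rewrite !mxE eqxx (negbTE ij) /= !mulr0.
by rewrite !mxE !eqxx mulr1 mulrC.
Qed.

Lemma zdotDl (xi eta : Zn) (x : Rn) : zdot (xi + eta) x = zdot xi x + zdot eta x.
Proof.
rewrite /zdot -big_split; apply: eq_bigr => i _.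
by rewrite mxE intrD mulrDl.
Qed.

Lemma zdotNl (xi : Zn) (x : Rn) : zdot (- xi) x = - zdot xi x.
Proof. by rewrite /zdot -sumrN; apply: eq_bigr => i _; rewrite mxE intrN mulNr. Qed.

Lemma zdot0l (x : Rn) : zdot (0 : Zn) x = 0.
Proof. by rewrite /zdot big1 // => i _; rewrite mxE mul0r. Qed.

Lemma csN (xi : Zn) : cs (- xi) = cs xi.
Proof. by apply/funext => x; rewrite /cs zdotNl mulrN cosN. Qed.

Lemma snN (xi : Zn) : sn (- xi) = (fun x => - sn xi x).
Proof. by apply/funext => x; rewrite /sn zdotNl mulrN sinN. Qed.

Lemma cs0 : cs 0 = cst 1.
Proof. by apply/funext => x; rewrite /cs zdot0l mulr0 cos0. Qed.

Lemma sn0 : sn 0 = cst 0.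
Proof. by apply/funext => x; rewrite /sn zdot0l mulr0 sin0. Qed.

Lemma cosD2pinat (x : R) (k : nat) : cos (x + 2 * pi * k%:R) = cos x.
Proof.
elim: k => [|k IH]; first by rewrite mulr0 addr0.
rewrite (_ : x + _ = (x + 2 * pi * k%:R) + pi *+ 2) ?cosD2pi//.
by rewrite -[k.+1%:R]natr1; ring.
Qed.

Lemma sinD2pinat (x : R) (k : nat) : sin (x + 2 * pi * k%:R) = sin x.
Proof.
elim: k => [|k IH]; first by rewrite mulr0 addr0.
rewrite (_ : x + _ = (x + 2 * pi * k%:R) + pi *+ 2) ?sinD2pi//.
by rewrite -[k.+1%:R]natr1; ring.
Qed.

Lemma cosD2piint (x : R) (k : int) : cos (x + 2 * pi * k%:~R) = cos x.
Proof.
case: k => [k|k]; first by rewrite cosD2pinat.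
by rewrite -[in RHS](subrK (2 * pi * k.+1%:R) x) cosD2pinat NegzE intrN mulrN.
Qed.

Lemma sinD2piint (x : R) (k : int) : sin (x + 2 * pi * k%:~R) = sin x.
Proof.
case: k => [k|k]; first by rewrite sinD2pinat.
by rewrite -[in RHS](subrK (2 * pi * k.+1%:R) x) sinD2pinat NegzE intrN mulrN.
Qed.

Lemma zdot_shift (xi m : Zn) (x : Rn) :
  zdot xi (x + map_mx (intr : int -> R) m) =
  zdot xi x + (\sum_i xi 0 i * m 0 i)%:~R.
Proof.
rewrite /zdot rmorph_sum -big_split; apply: eq_bigr => i _.
by rewrite !mxE mulrDr rmorphM.
Qed.

Lemma periodic_cs (xi : Zn) : periodic (cs xi).
Proof. by move=> x m; rewrite /cs zdot_shift mulrDr cosD2piint. Qed.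

Lemma periodic_sn (xi : Zn) : periodic (sn xi).
Proof. by move=> x m; rewrite /sn zdot_shift mulrDr sinD2piint. Qed.

Lemma continuous_coord (i : 'I_n) : continuous (fun x : Rn => x 0 i).
Proof.
apply/row_continuousP => x e e0; exists e => // y; exact.
Qed.

Lemma continuous_zdot (xi : Zn) : continuous (zdot xi : Rn -> R).
Proof.
have H (s : seq 'I_n) :
    continuous (fun x : Rn => \sum_(i <- s) (xi 0 i)%:~R * x 0 i).
  elim: s => [|i s IH] x.
    rewrite (_ : (fun x => _) = cst 0); first exact: cst_continuous.
    by apply/funext => y; rewrite big_nil.
  rewrite (_ : (fun x => _) = (fun x : Rn => (xi 0 i)%:~R * x 0 i +
    \sum_(i <- s) (xi 0 i)%:~R * x 0 i)).
    apply: (@continuousD _ _ _ (fun x : Rn => (xi 0 i)%:~R * x 0 i)).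
      apply: (@continuousM _ _ (cst (xi 0 i)%:~R)); first exact: cst_continuous.
      exact: continuous_coord.
    exact: IH.
  by apply/funext => y; rewrite big_cons.
exact: H.
Qed.

Lemma continuous_cs (xi : Zn) : continuous (cs xi).
Proof.
move=> x; apply: (@continuous_comp _ _ _ (fun x => 2 * pi * zdot xi x) cos).
  apply: (@continuousM _ _ (cst (2 * pi))); first exact: cst_continuous.
  exact: continuous_zdot.
exact: continuous_cos.
Qed.

Lemma continuous_sn (xi : Zn) : continuous (sn xi).
Proof.
move=> x; apply: (@continuous_comp _ _ _ (fun x => 2 * pi * zdot xi x) sin).
  apply: (@continuousM _ _ (cst (2 * pi))); first exact: cst_continuous.
  exact: continuous_zdot.
exact: continuous_sin.
Qed.

Definition freq (xi : Zn) (j : 'I_n) : R := 2 * pi * (xi 0 j)%:~R.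

Lemma is_derive_affine (a b t : R) :
  is_derive t (1 : R) (fun h : R => a * h + b) a.
Proof.
rewrite (_ : (fun h : R => _) = a *: (id : R -> R) + cst b)//.
by apply: is_derive_eq; rewrite addr0 [_ *: _]mulr1.
Qed.

Lemma is_derive_cs (xi : Zn) (j : 'I_n) (x : Rn) :
  is_derive x (delta_mx 0 j) (cs xi) (- freq xi j * sn xi x).
Proof.
apply: is_derive_line.
rewrite (_ : (fun h : R => _) =
  cos \o (fun h : R => freq xi j * h + 2 * pi * zdot xi x)); last first.
  by apply/funext => h; rewrite /cs zdot_line /= /freq; congr cos; ring.
have da := is_derive_affine (freq xi j) (2 * pi * zdot xi x) 0.
have := @is_derive1_comp R cos _ 0 _ _ (is_derive_cos _) da.
suff -> : - freq xi j * sn xi x =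
  - sin (freq xi j * 0 + 2 * pi * zdot xi x) * freq xi j by [].
by rewrite mulr0 add0r mulNr mulrC mulNr.
Qed.

Lemma is_derive_sn (xi : Zn) (j : 'I_n) (x : Rn) :
  is_derive x (delta_mx 0 j) (sn xi) (freq xi j * cs xi x).
Proof.
apply: is_derive_line.
rewrite (_ : (fun h : R => _) =
  sin \o (fun h : R => freq xi j * h + 2 * pi * zdot xi x)); last first.
  by apply/funext => h; rewrite /sn zdot_line /= /freq; congr sin; ring.
have da := is_derive_affine (freq xi j) (2 * pi * zdot xi x) 0.
have := @is_derive1_comp R sin _ 0 _ _ (is_derive_sin _) da.
suff -> : freq xi j * cs xi x =
  cos (freq xi j * 0 + 2 * pi * zdot xi x) * freq xi j by [].
by rewrite mulr0 add0r mulrC.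
Qed.

Lemma partial_cs (xi : Zn) (j : 'I_n) :
  partial j (cs xi) = (- freq xi j) *: sn xi.
Proof. by apply/funext => x; rewrite /partial; case: (is_derive_cs xi j x). Qed.

Lemma partial_sn (xi : Zn) (j : 'I_n) : partial j (sn xi) = freq xi j *: cs xi.
Proof. by apply/funext => x; rewrite /partial; case: (is_derive_sn xi j x). Qed.

Lemma partialD (j : 'I_n) (c : R) (f g : Rn -> R) :
  (forall x, derivable f x (delta_mx 0 j)) ->
  (forall x, derivable g x (delta_mx 0 j)) ->
  partial j (c *: f + g) = c *: partial j f + partial j g.
Proof.
move=> df dg; apply/funext => x; rewrite /partial.
by rewrite deriveD ?deriveZ//; exact: derivableZ.
Qed.

Lemma partialsD (s : seq 'I_n) (c : R) (f g : Rn -> R) :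
  test_fun f -> test_fun g ->
  partials s (c *: f + g) = c *: partials s f + partials s g.
Proof.
move=> tf tg; elim: s => [//|j s IH] /=; rewrite -/(partials s _) IH partialD//.
- by move=> x; have [_] := tf.2 s; exact.
- by move=> x; have [_] := tg.2 s; exact.
Qed.

Lemma test_funD (c : R) (f g : Rn -> R) :
  test_fun f -> test_fun g -> test_fun (c *: f + g).
Proof.
move=> tf tg; have [[pf sf] [pg sg]] := (tf, tg); split => [x m|s].
  by rewrite /= ![(_ + _) _]/(_ + _) /= ![(_ *: _) _]/(_ *: _) pf pg.
rewrite partialsD//; split => [x|j x].
  apply: (@continuousD _ _ _ (c *: partials s f)); last exact: (sg s).1.
  by apply: (@continuousZr); exact: (sf s).1.
by apply: derivableD; [apply: derivableZ; exact: (sf s).2|exact: (sg s).2].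
Qed.

Lemma test_fun_partial (j : 'I_n) (f : Rn -> R) :
  test_fun f -> test_fun (partial j f).
Proof.
move=> [pf sf]; split; first exact: periodic_partial.
by move=> s; have := sf (rcons s j); rewrite /partials foldr_rcons.
Qed.

Lemma partials_cst0 (s : seq 'I_n) :
  partials s (cst 0 : Rn -> R) = cst 0.
Proof.
elim: s => // j s /= ->; apply/funext => x; exact: derive_cst.
Qed.

Lemma test_fun0 : test_fun (0 : Rn -> R).
Proof.
split => // s; rewrite (partials_cst0 s : partials s 0 = cst 0); split => [x|j x].
  exact: cst_continuous.
exact: derivable_cst.
Qed.

Lemma test_funZ (c : R) (f : Rn -> R) : test_fun f -> test_fun (c *: f).
Proof. by move=> tf; rewrite -[_ *: _]addr0; apply: test_funD => //; exact: test_fun0. Qed.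

Lemma test_fun_add (f g : Rn -> R) : test_fun f -> test_fun g -> test_fun (f + g).
Proof. by move=> tf tg; rewrite -[f]scale1r; exact: test_funD. Qed.

(** Differentiation preserves the span of the cosine and the sine of a given frequency, so all
    iterated partials inherit the regularity of these two functions. *)
Lemma trig_partials (xi : Zn) (s : seq 'I_n) : exists a b : R,
  partials s (cs xi) = a *: cs xi + b *: sn xi /\
  exists a' b' : R, partials s (sn xi) = a' *: cs xi + b' *: sn xi.
Proof.
elim: s => [|j s [a [b [Ec [a' [b' Es]]]]]].
  exists 1, 0; rewrite scale1r scale0r addr0; split => //.
  by exists 0, 1; rewrite scale1r scale0r add0r.
have dc x : derivable (cs xi) x (delta_mx 0 j) by case: (is_derive_cs xi j x).
have ds x : derivable (sn xi) x (delta_mx 0 j) by case: (is_derive_sn xi j x).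
have D c d : partial j (c *: cs xi + d *: sn xi) =
    (d * freq xi j) *: cs xi + (- c * freq xi j) *: sn xi.
  rewrite partialD// => [|x]; last exact: derivableZ.
  rewrite partial_cs -[_ *: sn xi]addr0 partialD//.
  rewrite partial_sn (_ : partial j 0 = 0); last first.
    by apply/funext => x; exact: derive_cst.
  by rewrite addr0 addrC !scalerA mulrN mulNr.
exists (b * freq xi j), (- a * freq xi j); split.
  by rewrite /= -/(partials s _) Ec D.
exists (b' * freq xi j), (- a' * freq xi j).
by rewrite /= -/(partials s _) Es D.
Qed.

Lemma trig_lin_regular (xi : Zn) (a b : R) :
  continuous (a *: cs xi + b *: sn xi) /\
  forall (j : 'I_n) (x : Rn),
    derivable (a *: cs xi + b *: sn xi) x (delta_mx 0 j).
Proof.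
split=> [x|j x].
  apply: (@continuousD _ _ _ (a *: cs xi)).
    exact/continuousZr/continuous_cs.
  exact/continuousZr/continuous_sn.
apply: derivableD; apply: derivableZ.
  by case: (is_derive_cs xi j x).
by case: (is_derive_sn xi j x).
Qed.

Lemma test_fun_cs (xi : Zn) : test_fun (cs xi).
Proof.
split; first exact: periodic_cs.
move=> s; have [a [b [-> _]]] := trig_partials xi s; exact: trig_lin_regular.
Qed.

Lemma test_fun_sn (xi : Zn) : test_fun (sn xi).
Proof.
split; first exact: periodic_sn.
move=> s; have [_ [_ [_ [a [b ->]]]]] := trig_partials xi s.
exact: trig_lin_regular.
Qed.

Lemma test_fun_bnd_meas (f : Rn -> R) : test_fun f -> bnd_meas (on_cube f).
Proof. by move=> [pf sf]; apply: periodic_bnd_meas => //; exact: (sf [::]).1. Qed.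

Lemma test_fun_derivable (f : Rn -> R) (j : 'I_n) : test_fun f ->
  forall x, derivable f x (delta_mx 0 j).
Proof. by move=> [_ sf] x; have [_] := sf [::]; exact. Qed.

Lemma test_fun_continuous (f : Rn -> R) : test_fun f -> continuous f.
Proof. by move=> [_ sf]; exact: (sf [::]).1. Qed.

Lemma on_cube_cs_bnd (xi : Zn) : bnd_meas (on_cube (cs xi)).
Proof. exact/test_fun_bnd_meas/test_fun_cs. Qed.

Lemma on_cube_sn_bnd (xi : Zn) : bnd_meas (on_cube (sn xi)).
Proof. exact/test_fun_bnd_meas/test_fun_sn. Qed.

End trig.

(** * Partial sums over cubes of frequencies *)

Section finite_sums.
Variable R : realType.

Lemma ler_sum_sub (I : eqType) (s t : seq I) (F : I -> R) : uniq s ->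
  {subset s <= t} -> (forall i, 0 <= F i) ->
  \sum_(i <- s) F i <= \sum_(i <- t) F i.
Proof.
move=> + + F0; elim: s t => [|x s IH] t /=.
  by rewrite big_nil => _ _; exact: sumr_ge0.
move=> /andP[xs us] st; have xt : x \in t by apply: st; rewrite mem_head.
rewrite big_cons (big_rem x xt)/= lerD2l; apply: IH => // y ys.
have yx : y != x by apply: contraNneq xs => <-.
have : y \in t by apply: st; rewrite inE ys orbT.
by rewrite (perm_mem (perm_to_rem xt)) inE (negbTE yx).
Qed.

Lemma sum_cauchy_schwarz_sq (I : Type) (s : seq I) (a b : I -> R) :
  (\sum_(i <- s) a i * b i) ^+ 2 <=
  (\sum_(i <- s) a i ^+ 2) * (\sum_(i <- s) b i ^+ 2).
Proof.
set A := \sum_(i <- s) a i ^+ 2; set B := \sum_(i <- s) b i ^+ 2.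
set C := \sum_(i <- s) _.
have A0 : 0 <= A by apply: sumr_ge0 => i _; exact: sqr_ge0.
have q (t r : R) : 0 <= r ^+ 2 * A + 2 * r * t * C + t ^+ 2 * B.
  rewrite /A /B /C !mulr_sumr -!big_split /=; apply: sumr_ge0 => i _.
  by have := sqr_ge0 (r * a i + t * b i); nra.
have [c00|cn0] := eqVneq B 0.
  have := q (- (A + 1)) C; rewrite c00 !mulr0 addr0 => h.
  have : 0 <= C ^+ 2 := sqr_ge0 C.
  nra.
have c0 : 0 < B by rewrite lt_def cn0; apply: sumr_ge0 => i _; exact: sqr_ge0.
have h := q (- C) B.
have : 0 <= B * (A * B - C ^+ 2).
  by apply: le_trans h _; rewrite le_eqVlt; apply/orP; left; apply/eqP; ring.
by rewrite pmulr_rge0// subr_ge0.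
Qed.

Lemma sum_cauchy_schwarz (I : Type) (s : seq I) (a b : I -> R) :
  `|\sum_(i <- s) a i * b i| <=
  Num.sqrt (\sum_(i <- s) a i ^+ 2) * Num.sqrt (\sum_(i <- s) b i ^+ 2).
Proof.
rewrite -sqrtrM; last by apply: sumr_ge0 => i _; exact: sqr_ge0.
by rewrite -sqrtr_sqr ler_wsqrtr// sum_cauchy_schwarz_sq.
Qed.

End finite_sums.

(** * Cubes of integer frequencies *)

Section box.
Variable n : nat.
Local Notation Zn := 'rV[int]_n.

(** Cubes are preferred to balls because they are products of intervals: counting and sums of
    product weights factor over the coordinates. *)
Definition box (N : nat) : seq Zn :=
  [seq \row_i ((f i : nat)%:Z - N%:Z) | f : {ffun 'I_n -> 'I_N.*2.+1}].

Definition znorm (xi : Zn) : nat := \max_i `|xi 0%R i|%N.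

Lemma box_uniq N : uniq (box N).
Proof.
rewrite map_inj_uniq ?enum_uniq// => f g /rowP fg; apply/ffunP => i.
by have := fg i; rewrite !mxE => /addIr [] /val_inj.
Qed.

Lemma size_box N : size (box N) = (N.*2.+1 ^ n)%N.
Proof. by rewrite size_map -cardE card_ffun !card_ord. Qed.

Lemma mem_box N (xi : Zn) : (xi \in box N) = (znorm xi <= N)%N.
Proof.
apply/mapP/bigmax_leqP => [[f _ ->] i _|xiN].
  rewrite mxE; move: (ltn_ord (f i)).
  by move: (nat_of_ord (f i)) => k; rewrite -addnn ltnS => kN; lia.
have xb i : (absz (xi 0%R i + N%:Z)%R < N.*2.+1)%N.
  by have := xiN i isT; rewrite -addnn; lia.
exists [ffun i => Ordinal (xb i)]; first by rewrite mem_enum.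
apply/rowP => i; rewrite !mxE ffunE /=; have := xiN i isT; lia.
Qed.

Lemma znormN (xi : Zn) : znorm (- xi) = znorm xi.
Proof. by apply: eq_bigr => i _; rewrite mxE abszN. Qed.

Lemma znorm0 : znorm 0 = 0%N.
Proof. by apply: big1 => i _; rewrite mxE. Qed.

Lemma box0 N : (0 : Zn) \in box N.
Proof. by rewrite mem_box znorm0. Qed.

Lemma boxN N (xi : Zn) : (- xi \in box N) = (xi \in box N).
Proof. by rewrite !mem_box znormN. Qed.

Lemma box_sub N M : (N <= M)%N -> {subset box N <= box M}.
Proof. by move=> NM xi; rewrite !mem_box => /leq_trans; apply. Qed.

Lemma count_znorm N r :
  (count (fun xi => znorm xi <= r)%N (box N) <= r.*2.+1 ^ n)%N.
Proof.
rewrite -size_filter -size_box; apply: uniq_leq_size.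
  by rewrite filter_uniq ?box_uniq.
by move=> xi; rewrite mem_filter !mem_box => /andP[].
Qed.

Lemma sub_box (s : seq Zn) : exists N, {subset s <= box N}.
Proof.
elim: s => [|x s [N sN]]; first by exists 0%N.
exists (maxn N (znorm x)) => y; rewrite inE => /predU1P[->|ys].
  by rewrite mem_box leq_maxr.
by apply: box_sub (sN _ ys); rewrite leq_maxl.
Qed.

End box.

(** * Unordered sums as limits over growing cubes *)

Section box_sums.
Variables (R : realType) (n : nat).
Local Notation Zn := 'rV[int]_n.
Implicit Type F : Zn -> R.

Definition bsum (F : Zn -> R) (N : nat) : R := \sum_(xi <- box n N) F xi.

Lemma bsum_nd F : (forall xi, 0 <= F xi) -> nondecreasing_seq (bsum F).
Proof.
move=> F0 N M NM; apply: ler_sum_sub => //; first exact: box_uniq.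
exact: box_sub.
Qed.

(** Every finite set of frequencies lies in some cube, so cubes are cofinal among the finite sets
    that define an unordered sum. *)
Lemma esum_boxE F : (forall xi, 0 <= F xi) ->
  (\esum_(xi in [set: Zn]) (F xi)%:E)%E =
  ereal_sup (range (fun N => (bsum F N)%:E)).
Proof.
move=> F0; apply/eqP; rewrite eq_le; apply/andP; split.
  apply: ge_ereal_sup => _ [X [fX _] <-].
  rewrite fsbig_finite//= sumEFin.
  have [N sN] := sub_box (finmap.enum_fset (fset_set X)).
  apply: (@le_trans _ _ (bsum F N)%:E).
    rewrite lee_fin; apply: ler_sum_sub => //; exact: finmap.fset_uniq.
  by apply: ereal_sup_ubound; exists N.
apply: ge_ereal_sup => _ [N _ <-].
apply: esum_ge; exists [set` box n N] => //.
  by split => //; exact: finite_seq.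
by rewrite -fsbig_seq ?box_uniq// /bsum -sumEFin.
Qed.

Lemma bsum_le_esum F N : (forall xi, 0 <= F xi) ->
  ((bsum F N)%:E <= \esum_(xi in [set: Zn]) (F xi)%:E)%E.
Proof. by move=> F0; rewrite esum_boxE//; apply: ereal_sup_ubound; exists N. Qed.

Lemma esum_box_le F (M : \bar R) : (forall xi, 0 <= F xi) ->
  (forall N, ((bsum F N)%:E <= M)%E) ->
  (\esum_(xi in [set: Zn]) (F xi)%:E <= M)%E.
Proof. by move=> F0 FM; rewrite esum_boxE//; apply: ge_ereal_sup => _ [N _ <-]. Qed.

Lemma esum_cvgE F : (forall xi, 0 <= F xi) ->
  (fun N => (bsum F N)%:E) @ \oo --> (\esum_(xi in [set: Zn]) (F xi)%:E)%E.
Proof.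
move=> F0; rewrite esum_boxE//; apply: ereal_nondecreasing_cvgn => N M NM.
by rewrite lee_fin; exact: bsum_nd.
Qed.

Lemma esum_fineK F : (forall xi, 0 <= F xi) ->
  (\esum_(xi in [set: Zn]) (F xi)%:E < +oo)%E ->
  (\esum_(xi in [set: Zn]) (F xi)%:E)%E =
  (fine (\esum_(xi in [set: Zn]) (F xi)%:E))%:E.
Proof.
move=> F0 Foo; rewrite fineK// ge0_fin_numE//.
by apply: esum_ge0 => xi _; rewrite lee_fin.
Qed.

Lemma bsum_cvg F : (forall xi, 0 <= F xi) ->
  (\esum_(xi in [set: Zn]) (F xi)%:E < +oo)%E ->
  bsum F @ \oo --> fine (\esum_(xi in [set: Zn]) (F xi)%:E).
Proof.
move=> F0 Foo; have := esum_cvgE F0; rewrite (esum_fineK F0 Foo).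
by move=> /fine_cvg.
Qed.

Lemma bsum_le_fine F N : (forall xi, 0 <= F xi) ->
  (\esum_(xi in [set: Zn]) (F xi)%:E < +oo)%E ->
  bsum F N <= fine (\esum_(xi in [set: Zn]) (F xi)%:E).
Proof.
by move=> F0 Foo; rewrite -lee_fin -(esum_fineK F0 Foo); exact: bsum_le_esum.
Qed.

Definition zsummable F := exists M, forall N, bsum (fun xi => `|F xi|) N <= M.

Lemma abs_sum_cvg F : zsummable F -> bsum F @ \oo --> abs_sum F.
Proof.
move=> [M FM].
have H G : (forall xi, 0 <= G xi) -> (forall xi, G xi <= `|F xi|) ->
    bsum G @ \oo --> fine (\esum_(i in [set: Zn]) (G i)%:E)%E.
  move=> G0 GF; apply: bsum_cvg => //.
  apply: (@le_lt_trans _ _ M%:E); last exact: ltry.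
  apply: esum_box_le => // N; rewrite lee_fin; apply: le_trans (FM N).
  by apply: ler_sum => xi _; exact: GF.
have Hp := H (fun xi => Num.max (F xi) 0).
have Hm := H (fun xi => Num.max (- F xi) 0).
rewrite (_ : bsum F = (fun N => bsum (fun xi => Num.max (F xi) 0) N -
    bsum (fun xi => Num.max (- F xi) 0) N)).
  apply: cvgB; [apply: Hp|apply: Hm] => xi; rewrite ?le_max ?lexx ?orbT//.
    by rewrite ge_max ler_norm normr_ge0.
  by rewrite ge_max -normrN ler_norm normr_ge0.
apply/funext => N; rewrite /bsum -sumrB; apply: eq_bigr => xi _.
by have [h|h] := leP (F xi) 0; [rewrite max_l ?oppr_ge0// opprK add0r|
  rewrite max_r ?subr0// oppr_le0 ltW].
Qed.

Lemma abs_sum_box F N : (forall xi, xi \notin box n N -> F xi = 0) ->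
  abs_sum F = bsum F N.
Proof.
move=> F0.
have E (G : Zn -> R) M : (forall xi, xi \notin box n N -> G xi = 0) ->
    (N <= M)%N -> bsum G M = bsum G N.
  move=> G0 NM; rewrite /bsum (bigID (mem (box n N)))/= [X in _ + X]big1.
    rewrite addr0 -big_filter; apply: perm_big; apply: uniq_perm.
    - by rewrite filter_uniq ?box_uniq.
    - exact: box_uniq.
    move=> xi; rewrite mem_filter /=; apply: andb_idr => xN.
    exact: box_sub xN.
  by move=> xi; exact: G0.
have Fs : zsummable F.
  exists (bsum (fun xi => `|F xi|) N) => M.
  apply: le_trans (bsum_nd (F := fun xi => `|F xi|) _ (leq_maxr N M)) _.
    by move=> xi; exact: normr_ge0.
  rewrite (E _ (maxn N M)) ?leq_maxl// => xi /F0 ->; exact: normr0.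
have := abs_sum_cvg Fs.
have : bsum F @ \oo --> bsum F N.
  apply: cvg_near_cst; exists N => // M /= NM; exact: E.
move=> h1 h2; exact: (cvg_unique _ h2 h1).
Qed.

Lemma eq_bsum F G N : F =1 G -> bsum F N = bsum G N.
Proof. by move=> FG; apply: eq_bigr => xi _. Qed.

End box_sums.

(** * Trigonometric polynomials and Fourier coefficients *)

Section trig_poly.
Variables (R : realType) (n : nat).
Local Notation mR := (measurableTypeR R).
Local Notation cube := (@cube_leb R n).
Local Notation Rn := 'rV[R]_n.
Local Notation Zn := 'rV[int]_n.
Local Notation intg f := ((@cube_leb R n).-integrable setT (EFin \o f)).

Definition C1per (j : 'I_n) (h : Rn -> R) := [/\ periodic h, continuous h,
  continuous (partial j h) & forall x, derivable h x (delta_mx 0 j)].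

Lemma test_fun_C1per (j : 'I_n) (h : Rn -> R) : test_fun h -> C1per j h.
Proof.
move=> th; split; first by case: th.
- exact: test_fun_continuous.
- exact/test_fun_continuous/test_fun_partial.
- exact: test_fun_derivable.
Qed.

Lemma partialM (j : 'I_n) (f g : Rn -> R) : C1per j f -> C1per j g ->
  partial j (fun x => f x * g x) = fun x => f x * partial j g x + g x * partial j f x.
Proof.
move=> [_ _ _ df] [_ _ _ dg]; apply/funext => x; rewrite /partial.
exact: deriveM.
Qed.

Lemma C1perM (j : 'I_n) (f g : Rn -> R) : C1per j f -> C1per j g ->
  C1per j (fun x => f x * g x).
Proof.
move=> hf hg; have [pf cf cdf df] := hf; have [pg cg cdg dg] := hg; split.
- by move=> x m; rewrite pf pg.
- by move=> x; apply: continuousM; [exact: cf|exact: cg].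
- rewrite partialM// => x; apply: (@continuousD _ _ _ (fun x => f x * _)).
    by apply: continuousM; [exact: cf|exact: cdg].
  by apply: continuousM; [exact: cg|exact: cdf].
- by move=> x; exact: derivableM.
Qed.

Lemma C1per_integral (j : 'I_n) (h : Rn -> R) : C1per j h ->
  \int[cube]_x on_cube (partial j h) x = 0.
Proof. by move=> [ph ch cdh dh]; exact: integral_partial. Qed.

Lemma C1per_bnd (j : 'I_n) (h : Rn -> R) : C1per j h ->
  bnd_meas (on_cube h) /\ bnd_meas (on_cube (partial j h)).
Proof.
move=> [ph ch cdh dh]; split; apply: periodic_bnd_meas => //.
exact: periodic_partial.
Qed.

Lemma cube_ibp (j : 'I_n) (f g : Rn -> R) : C1per j f -> C1per j g ->
  \int[cube]_x (on_cube (partial j f) x * on_cube g x) =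
  - \int[cube]_x (on_cube f x * on_cube (partial j g) x).
Proof.
move=> hf hg; have [bf bdf] := C1per_bnd hf; have [bg bdg] := C1per_bnd hg.
have := C1per_integral (C1perM hf hg); rewrite partialM// /on_cube RintegralD//.
- move=> /eqP; rewrite addr_eq0 => /eqP ->; rewrite opprK.
  by apply: eq_Rintegral => x _; rewrite mulrC.
- by apply: bnd_meas_integrable; exact: (bnd_measM bf bdg).
- by apply: bnd_meas_integrable; exact: (bnd_measM bg bdf).
Qed.

(** For a nonzero frequency some component of [freq] is nonzero, and the cosine is then a multiple
    of a partial derivative of the sine. *)
Lemma integral_cs (xi : Zn) : \int[cube]_x on_cube (cs xi) x = (xi == 0)%:R.
Proof.
have [->|x0] := eqVneq xi 0.
  rewrite cs0; exact: Rintegral_prob_cst.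
have [j xj] : exists j, xi 0 j != 0.
  apply/existsP; rewrite -negb_forall; apply: contra x0 => /forallP H.
  by apply/eqP/rowP => i; rewrite mxE; exact/eqP/H.
have := C1per_integral (test_fun_C1per j (test_fun_sn R xi)).
rewrite partial_sn /on_cube => /eqP.
rewrite RintegralZl//; last exact/bnd_meas_integrable/on_cube_cs_bnd.
by rewrite mulf_eq0 /freq !mulf_eq0 pnatr_eq0 /= gt_eqF ?pi_gt0//= intr_eq0 (negbTE xj) /= => /eqP.
Qed.

Lemma integral_sn (xi : Zn) : \int[cube]_x on_cube (sn xi) x = 0.
Proof.
have [->|x0] := eqVneq xi 0.
  rewrite sn0; exact: Rintegral_prob_cst.
have [j xj] : exists j, xi 0 j != 0.
  apply/existsP; rewrite -negb_forall; apply: contra x0 => /forallP H.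
  by apply/eqP/rowP => i; rewrite mxE; exact/eqP/H.
have := C1per_integral (test_fun_C1per j (test_fun_cs R xi)).
rewrite partial_cs /on_cube => /eqP.
rewrite RintegralZl//; last exact/bnd_meas_integrable/on_cube_sn_bnd.
by rewrite mulf_eq0 oppr_eq0 /freq !mulf_eq0 pnatr_eq0 /= gt_eqF ?pi_gt0//= intr_eq0 (negbTE xj) /= => /eqP.
Qed.

(** The two indicators reflect that the cosine is even in the frequency. Both equal 1 when [xi] and
    [eta] vanish, where the integral is 1 instead of one half. *)
Lemma integral_cscs (xi eta : Zn) :
  \int[cube]_x (on_cube (cs xi) x * on_cube (cs eta) x) =
  2^-1 * ((xi == eta)%:R + (xi == - eta)%:R).
Proof.
transitivity (\int[cube]_x (2^-1 * on_cube (cs (xi - eta)) x +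
    2^-1 * on_cube (cs (xi + eta)) x)).
  apply: eq_Rintegral => x _; rewrite /on_cube /cs !zdotDl zdotNl !mulrDr mulrN.
  by rewrite cosB cosD; field.
rewrite RintegralD//; try exact/integrable_funZ/bnd_meas_integrable/on_cube_cs_bnd.
rewrite !RintegralZl//; try exact/bnd_meas_integrable/on_cube_cs_bnd.
by rewrite !integral_cs subr_eq0 addr_eq0 mulrDr.
Qed.

Lemma integral_snsn (xi eta : Zn) :
  \int[cube]_x (on_cube (sn xi) x * on_cube (sn eta) x) =
  2^-1 * ((xi == eta)%:R - (xi == - eta)%:R).
Proof.
transitivity (\int[cube]_x (2^-1 * on_cube (cs (xi - eta)) x -
    2^-1 * on_cube (cs (xi + eta)) x)).
  apply: eq_Rintegral => x _; rewrite /on_cube /cs /sn !zdotDl zdotNl !mulrDr mulrN.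
  by rewrite cosB cosD; field.
rewrite RintegralB//; try exact/integrable_funZ/bnd_meas_integrable/on_cube_cs_bnd.
rewrite !RintegralZl//; try exact/bnd_meas_integrable/on_cube_cs_bnd.
by rewrite !integral_cs subr_eq0 addr_eq0 mulrBr.
Qed.

Lemma integral_sncs (xi eta : Zn) :
  \int[cube]_x (on_cube (sn xi) x * on_cube (cs eta) x) = 0.
Proof.
transitivity (\int[cube]_x (2^-1 * on_cube (sn (xi + eta)) x +
    2^-1 * on_cube (sn (xi - eta)) x)).
  apply: eq_Rintegral => x _; rewrite /on_cube /cs /sn !zdotDl zdotNl !mulrDr mulrN.
  by rewrite sinB sinD; field.
rewrite RintegralD//; try exact/integrable_funZ/bnd_meas_integrable/on_cube_sn_bnd.
rewrite !RintegralZl//; try exact/bnd_meas_integrable/on_cube_sn_bnd.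
by rewrite !integral_sn !mulr0 addr0.
Qed.

Lemma integral_cssn (xi eta : Zn) :
  \int[cube]_x (on_cube (cs xi) x * on_cube (sn eta) x) = 0.
Proof. by under eq_Rintegral do rewrite mulrC; exact: integral_sncs. Qed.

(** The frequencies [xi] and [- xi] are both listed. For even [A] and odd [B] this redundancy makes
    the Fourier coefficients of the sum equal to [A] and [B] themselves, without a factor 2. *)
Definition tp (N : nat) (A B : Zn -> R) : Rn -> R :=
  fun x => \sum_(xi <- box n N) (A xi * cs xi x + B xi * sn xi x).

Lemma test_fun_sum (I : Type) (s : seq I) (F : I -> Rn -> R) :
  (forall i, test_fun (F i)) -> test_fun (fun x => \sum_(i <- s) F i x).
Proof.
move=> tF; elim: s => [|i s IH].
  rewrite (_ : (fun x => _) = 0); first exact: test_fun0.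
  by apply/funext => x; rewrite big_nil.
rewrite (_ : (fun x => _) = F i + (fun x => \sum_(j <- s) F j x)).
  exact: test_fun_add.
by apply/funext => x; rewrite big_cons.
Qed.

Lemma test_fun_trig (xi : Zn) (a b : R) :
  test_fun (fun x => a * cs xi x + b * sn xi x).
Proof.
have := test_funD a (test_fun_cs R xi) (test_funZ b (test_fun_sn R xi)); exact.
Qed.

Lemma test_fun_tp N A B : test_fun (tp N A B).
Proof. by apply: test_fun_sum => xi; exact: test_fun_trig. Qed.

Lemma partial_sum (j : 'I_n) (I : Type) (s : seq I) (F : I -> Rn -> R) :
  (forall i, test_fun (F i)) ->
  partial j (fun x => \sum_(i <- s) F i x) = fun x => \sum_(i <- s) partial j (F i) x.
Proof.
move=> tF; elim: s => [|i s IH].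
  rewrite (_ : (fun x => \sum_(i <- [::]) F i x) = cst 0); last first.
    by apply/funext => x; rewrite big_nil.
  by apply/funext => x; rewrite big_nil; exact: derive_cst.
rewrite (_ : (fun x => \sum_(i <- i :: s) F i x) =
  1 *: F i + (fun x => \sum_(j <- s) F j x)); last first.
  by apply/funext => x; rewrite big_cons scale1r.
rewrite partialD; last 2 first.
  exact: test_fun_derivable.
  by apply: test_fun_derivable; exact: test_fun_sum.
by rewrite IH scale1r; apply/funext => x; rewrite big_cons.
Qed.

Lemma partial_trig (j : 'I_n) (xi : Zn) (a b : R) :
  partial j (fun x => a * cs xi x + b * sn xi x) =
  fun x => (freq R xi j * b) * cs xi x + (- (freq R xi j * a)) * sn xi x.
Proof.
rewrite (_ : (fun x => a * cs xi x + _) = a *: cs xi + (b *: sn xi + 0)); last first.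
  by rewrite addr0.
rewrite partialD; last 2 first.
  exact/test_fun_derivable/test_fun_cs.
  exact/test_fun_derivable/test_funD/test_fun0/test_fun_sn.
rewrite partialD; last 2 first.
  exact/test_fun_derivable/test_fun_sn.
  exact/test_fun_derivable/test_fun0.
rewrite partial_cs partial_sn (_ : partial j 0 = 0); last first.
  by apply/funext => x; exact: derive_cst.
rewrite addr0; apply/funext => x.
rewrite -[LHS]/(a * (- freq R xi j * sn xi x) + b * (freq R xi j * cs xi x)).
ring.
Qed.

Lemma partial_tp (j : 'I_n) N A B : partial j (tp N A B) =
  tp N (fun xi => freq R xi j * B xi) (fun xi => - (freq R xi j * A xi)).
Proof.
rewrite partial_sum; last by move=> xi; exact: test_fun_trig.
by apply/funext => x; apply: eq_bigr => xi _; rewrite partial_trig.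
Qed.

Definition fc (H : n.-tuple mR -> R) (xi : Zn) : R :=
  \int[cube]_x (H x * on_cube (cs xi) x).
Definition fs (H : n.-tuple mR -> R) (xi : Zn) : R :=
  \int[cube]_x (H x * on_cube (sn xi) x).

Definition evenZ (A : Zn -> R) := forall xi, A (- xi) = A xi.
Definition oddZ (B : Zn -> R) := forall xi, B (- xi) = - B xi.

Lemma fc_even H : evenZ (fc H).
Proof. by move=> xi; rewrite /fc csN. Qed.

Lemma fs_odd H : intg H -> oddZ (fs H).
Proof.
move=> iH xi; rewrite /fs snN -mulN1r -RintegralZl//.
  by apply: eq_Rintegral => x _; rewrite /on_cube; ring.
exact/integrableM_bnd/on_cube_sn_bnd.
Qed.

Lemma integral_tp H N A B : intg H ->
  \int[cube]_x (H x * on_cube (tp N A B) x) =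
  bsum (fun xi => A xi * fc H xi + B xi * fs H xi) N.
Proof.
move=> iH.
have ic xi : intg (fun x => H x * on_cube (cs xi) x).
  exact/integrableM_bnd/on_cube_cs_bnd.
have isn xi : intg (fun x => H x * on_cube (sn xi) x).
  exact/integrableM_bnd/on_cube_sn_bnd.
transitivity (\int[cube]_x (\sum_(xi <- box n N) (A xi * (H x * on_cube (cs xi) x)
    + B xi * (H x * on_cube (sn xi) x)))).
  apply: eq_Rintegral => x _; rewrite /on_cube /tp mulr_sumr.
  by apply: eq_bigr => xi _; ring.
rewrite Rintegral_sum => [|xi _]; last exact/integrable_funD/integrable_funZ/isn/integrable_funZ/ic.
apply: eq_bigr => xi _; rewrite RintegralD//; try exact: integrable_funZ.
by rewrite !RintegralZl.
Qed.

Lemma tp_bnd N A B : bnd_meas (on_cube (tp N A B)).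
Proof. exact/test_fun_bnd_meas/test_fun_tp. Qed.

Lemma tp_sq_int N A B : sq_int (@cube_leb R n) (on_cube (tp N A B)).
Proof. exact/bnd_meas_sq_int/tp_bnd. Qed.

Lemma sum_delta (s : seq Zn) (F : Zn -> R) (eta : Zn) : uniq s ->
  \sum_(xi <- s) F xi * (xi == eta)%:R = if eta \in s then F eta else 0.
Proof.
elim: s => [|x s IH] /=; first by rewrite big_nil.
move=> /andP[xs us]; rewrite big_cons IH// inE.
have [->|ex] := eqVneq eta x; first by rewrite /= mulr1 (negbTE xs) addr0.
by rewrite mulr0 add0r.
Qed.

Lemma fc_tp N A B eta : evenZ A -> fc (on_cube (tp N A B)) eta =
  if eta \in box n N then A eta else 0.
Proof.
move=> eA; rewrite /fc; under eq_Rintegral do rewrite mulrC.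
rewrite integral_tp; last exact/bnd_meas_integrable/on_cube_cs_bnd.
rewrite (eq_bsum (G := fun xi => 2^-1 * (A xi * (xi == eta)%:R) +
    2^-1 * (A xi * (xi == - eta)%:R))); last first.
  move=> xi; rewrite /fc /fs integral_cscs integral_cssn mulr0 addr0.
  by rewrite [eta == xi]eq_sym [eta == - xi]eq_sym eqr_oppLR; ring.
rewrite /bsum big_split /= -!mulr_sumr !sum_delta ?box_uniq// boxN eA.
case: ifP => _; last by rewrite mulr0 addr0.
by field.
Qed.

Lemma fs_tp N A B eta : oddZ B -> fs (on_cube (tp N A B)) eta =
  if eta \in box n N then B eta else 0.
Proof.
move=> oB; rewrite /fs; under eq_Rintegral do rewrite mulrC.
rewrite integral_tp; last exact/bnd_meas_integrable/on_cube_sn_bnd.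
rewrite (eq_bsum (G := fun xi => 2^-1 * (B xi * (xi == eta)%:R) -
    2^-1 * (B xi * (xi == - eta)%:R))); last first.
  move=> xi; rewrite /fc /fs integral_snsn integral_sncs mulr0 add0r.
  by rewrite [eta == xi]eq_sym [eta == - xi]eq_sym eqr_oppLR; ring.
rewrite /bsum sumrB -!mulr_sumr !sum_delta ?box_uniq// boxN oB.
case: ifP => _; last by rewrite mulr0 subr0.
by field.
Qed.

Lemma integral_tp_sqr N A B : evenZ A -> oddZ B ->
  \int[cube]_x (on_cube (tp N A B) x ^+ 2) =
  bsum (fun xi => A xi ^+ 2 + B xi ^+ 2) N.
Proof.
move=> eA oB; under eq_Rintegral do rewrite expr2.
rewrite integral_tp; last exact/bnd_meas_integrable/tp_bnd.
rewrite /bsum !big_seq; apply: eq_bigr => xi xN.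
by rewrite fc_tp// fs_tp// xN !expr2.
Qed.

Definition pS (H : n.-tuple mR -> R) (N : nat) := tp N (fc H) (fs H).

(** Pythagoras: the partial sum is the orthogonal projection of [H] on the trigonometric polynomials
    of the cube. *)
Lemma integral_dist_pS H N : sq_int (@cube_leb R n) H ->
  \int[cube]_x ((H x - on_cube (pS H N) x) ^+ 2) =
  \int[cube]_x (H x ^+ 2) - bsum (fun xi => fc H xi ^+ 2 + fs H xi ^+ 2) N.
Proof.
move=> H2; have iH := sq_int_int H2.
have p2 := tp_sq_int N (fc H) (fs H).
transitivity (\int[cube]_x (H x ^+ 2 - 2 * (H x * on_cube (pS H N) x) +
    on_cube (pS H N) x ^+ 2)).
  by apply: eq_Rintegral => x _; ring.
have i1 := sq_int_sqr H2; have i3 := sq_int_sqr p2.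
have i2 := sq_int_mul H2 p2.
rewrite RintegralD//; last exact: (integrable_funB i1 (integrable_funZ 2 i2)).
rewrite RintegralB//; last exact: (integrable_funZ 2 i2).
rewrite RintegralZl// integral_tp// integral_tp_sqr//.
- rewrite (eq_bsum (F := fun xi => fc H xi * fc H xi + _)
    (G := fun xi => fc H xi ^+ 2 + fs H xi ^+ 2)); last by move=> xi; rewrite !expr2.
  ring.
- exact: fc_even.
- exact: fs_odd.
Qed.

Lemma bessel H N : sq_int (@cube_leb R n) H ->
  bsum (fun xi => fc H xi ^+ 2 + fs H xi ^+ 2) N <= \int[cube]_x (H x ^+ 2).
Proof.
move=> H2; rewrite -subr_ge0 -integral_dist_pS//; exact: Rintegral_sqr_ge0.
Qed.

End trig_poly.

(** * Uniqueness of Fourier coefficients *)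

Section fubini_real.
Context d1 d2 (T1 : measurableType d1) (T2 : measurableType d2) (R : realType).
Variable m1 : {finite_measure set T1 -> \bar R}.
Variable m2 : {finite_measure set T2 -> \bar R}.

Lemma Rintegral_Fubini (H : T1 * T2 -> R) :
  (m1 \x m2)%E.-integrable setT (EFin \o H) ->
  \int[m1]_x \int[m2]_y H (x, y) = \int[m2]_y \int[m1]_x H (x, y).
Proof.
move=> iH; rewrite /Rintegral.
have E1 : (\int[m1]_x (fine (\int[m2]_y (H (x, y))%:E))%:E =
    \int[m1]_x \int[m2]_y (EFin \o H) (x, y))%E.
  apply: ae_eq_integral_nm; apply: aeS (ae_integrable1 iH) => x ix _.
  by rewrite fineK//; exact: integrable_fin_num ix.
have E2 : (\int[m2]_y (fine (\int[m1]_x (H (x, y))%:E))%:E =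
    \int[m2]_y \int[m1]_x (EFin \o H) (x, y))%E.
  apply: ae_eq_integral_nm; apply: aeS (ae_integrable2 iH) => x ix _.
  by rewrite fineK//; exact: integrable_fin_num ix.
by rewrite E1 E2 (Fubini iH).
Qed.

Lemma integrable_prod_bnd (H : T1 * T2 -> R) (g : T2 -> R) :
  measurable_fun setT H -> m2.-integrable setT (EFin \o g) ->
  (forall z, `|H z| <= `|g z.2|) ->
  (m1 \x m2)%E.-integrable setT (EFin \o H).
Proof.
move=> mH ig Hg; apply/integrable12ltyP; first exact/measurable_EFinP.
have [mg goo] := integrableP _ _ _ ig.
apply: (@le_lt_trans _ _ (\int[m1]_x cst (\int[m2]_y `|(EFin \o g) y|) x)%E).
  apply: ge0_le_integral => //.
  - by move=> x _; exact: integral_ge0.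
  - apply: (measurable_fun_fubini_tonelli_F (abse \o (EFin \o H))).
      by apply: measurableT_comp => //; exact/measurable_EFinP.
    by move=> z; exact: abse_ge0.
  move=> x _; apply: ge0_le_integral => //.
  - apply: measurableT_comp => //; apply/measurable_EFinP.
    exact: measurableT_comp mH (measurable_pair1 x).
  - exact: measurableT_comp.
  - by move=> y _ /=; rewrite lee_fin; exact: Hg (x, y).
rewrite integral_cst//; apply: lte_mul_pinfty => //.
- by apply: integral_ge0 => y _; exact: abse_ge0.
- by rewrite ge0_fin_numE//; apply: integral_ge0 => y _; exact: abse_ge0.
- by rewrite -ge0_fin_numE//; exact: fin_num_measure.
Qed.

End fubini_real.

(** * Uniqueness of Fourier coefficients in one variable *)

Section unit_uniqueness.
Variable R : realType.
Local Notation leb := (@lebesgue_measure R).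
Local Notation unitm := (@unit_leb R).
Local Notation mR := (measurableTypeR R).
Local Notation intg f := (unitm.-integrable setT (EFin \o f)).

(** The phase [th] covers the sine and the cosine at once. *)
Definition cs1 (k : int) (th x : R) : R := cos (2 * pi * k%:~R * x - th).

Lemma continuous_cs1 k th : continuous (cs1 k th).
Proof.
move=> x; apply: (@continuous_comp _ _ _ (fun x => 2 * pi * k%:~R * x - th) cos).
  apply: continuousB; last exact: cst_continuous.
  by apply: continuousM; [exact: cst_continuous|].
exact: continuous_cos.
Qed.

Lemma cs1_le1 k th x : `|cs1 k th x| <= 1.
Proof. by rewrite ler_norml cos_geN1 cos_le1. Qed.

Lemma continuous_measurableT (f : R -> R) : continuous f ->
  measurable_fun (setT : set mR) f.
Proof. by move=> cf; apply: continuous_measurable_fun. Qed.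

Lemma cs1_bnd k th : bnd_meas (cs1 k th : mR -> R).
Proof.
split; first by apply: continuous_measurableT; exact: continuous_cs1.
by exists 1 => x; exact: cs1_le1.
Qed.

(** This is [cos (pi (x - x0)) ^ 2], whose powers concentrate at [x0]. *)
Definition peak (x0 x : R) : R := 2^-1 + 2^-1 * cs1 1 (2 * pi * x0) x.

Lemma continuous_peak x0 : continuous (peak x0).
Proof.
have -> : peak x0 = (cst 2^-1 : R -> R) + (fun x => 2^-1 * cs1 1 (2 * pi * x0) x).
  by [].
move=> x; apply: continuousD; first exact: cst_continuous.
apply: (@continuousM _ _ (cst 2^-1)); first exact: cst_continuous.
exact: continuous_cs1.
Qed.

Lemma peak_le1 x0 x : `|peak x0 x| <= 1.
Proof. by have := cs1_le1 1 (2 * pi * x0) x; rewrite /peak !ler_norml; lra. Qed.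

Lemma peak_bnd x0 m : bnd_meas ((fun x => peak x0 x ^+ m) : mR -> R).
Proof.
split.
  apply: measurable_funX; apply: continuous_measurableT; exact: continuous_peak.
by exists 1 => x; rewrite normrX exprn_ile1// peak_le1.
Qed.

Section orth.
Variable f : R -> R.
Hypothesis iF : intg f.

(** By the product formula for cosines, multiplication by [peak] shifts a frequency by one in either
    direction. The induction on [m] therefore runs over all frequencies and phases at once. *)
Lemma orth_peak m k th x0 :
  (forall k th, \int[unitm]_x (f x * cs1 k th x) = 0) ->
  \int[unitm]_x (f x * cs1 k th x * peak x0 x ^+ m) = 0.
Proof.
move=> f0.
have cos2 (a b : R) : cos (a + b) + cos (a - b) = 2 * (cos a * cos b).
  by rewrite cosD cosB; ring.
elim: m k th => [|m IH] k th.
  by under eq_Rintegral do rewrite expr0 mulr1; exact: f0.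
have i k' th' : intg (fun x => f x * cs1 k' th' x * peak x0 x ^+ m).
  by apply: integrableM_bnd (peak_bnd x0 m); apply: integrableM_bnd (cs1_bnd k' th').
transitivity (\int[unitm]_x (2^-1 * (f x * cs1 k th x * peak x0 x ^+ m) +
   (4^-1 * (f x * cs1 (k + 1) (th + 2 * pi * x0) x * peak x0 x ^+ m) +
    4^-1 * (f x * cs1 (k - 1) (th - 2 * pi * x0) x * peak x0 x ^+ m)))).
  apply: eq_Rintegral => x _; rewrite exprS.
  have E : cs1 (k + 1) (th + 2 * pi * x0) x + cs1 (k - 1) (th - 2 * pi * x0) x =
      2 * (cs1 k th x * cs1 1 (2 * pi * x0) x).
    rewrite /cs1 !intrD intrN.
    rewrite (_ : _ - (th + _) = (2 * pi * k%:~R * x - th) +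
      (2 * pi * 1%:~R * x - 2 * pi * x0)); last by ring.
    rewrite (_ : _ - (th - _) = (2 * pi * k%:~R * x - th) -
      (2 * pi * 1%:~R * x - 2 * pi * x0)); last by ring.
    exact: cos2.
  have hp : peak x0 x = 2^-1 + 2^-1 * cs1 1 (2 * pi * x0) x by [].
  move: hp E; move: (peak x0 x) (f x) => p y.
  move: (cs1 _ _ x) (cs1 _ _ x) (cs1 _ _ x) (cs1 _ _ x) => a b c1 c2 ->.
  move: (_ ^+ m) => q E.
  have {E} -> : c1 = 2 * (a * c2) - b by rewrite -E addrK.
  by field.
rewrite RintegralD//; try exact: integrable_funZ; last first.
  by apply: integrable_funD; exact: integrable_funZ.
rewrite RintegralD//; try exact: integrable_funZ.
by rewrite !RintegralZl// !IH !mulr0 !addr0.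
Qed.


Lemma ler_cos_2pi (x y : R) : 0 <= y -> y <= x -> x <= 2^-1 ->
  cos (2 * pi * x) <= cos (2 * pi * y).
Proof.
move=> y0 yx x2; rewrite leNgt ltr_cos; last 2 first.
- by rewrite in_itv /=; have := pi_gt0 R; nra.
- by rewrite in_itv /=; have := pi_gt0 R; nra.
by rewrite -leNgt ler_pM2l// mulr_gt0// pi_gt0.
Qed.

(** Distances count modulo 1, whence the upper bound [1 - dl]. The reflection of [y] to [1 - y]
    reduces the range beyond one half to monotonicity of the cosine. *)
Lemma peak_far (x0 dl x : R) : 0 <= dl -> dl <= `|x - x0| <= 1 - dl ->
  peak x0 x <= 2^-1 + 2^-1 * cos (2 * pi * dl).
Proof.
move=> dl0 /andP[h1 h2]; rewrite /peak lerD2l ler_wpM2l ?invr_ge0//.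
rewrite /cs1 (_ : _ - _ = 2 * pi * (x - x0)); last by ring.
have -> : cos (2 * pi * (x - x0)) = cos (2 * pi * `|x - x0|).
  have [h|h] := leP 0 (x - x0); first by rewrite ger0_norm.
  by rewrite ltr0_norm// mulrN cosN.
move: (`|x - x0|) h1 h2 => y h1 h2.
have [yh|yh] := leP y 2^-1; first exact: ler_cos_2pi.
have -> : cos (2 * pi * y) = cos (2 * pi * (1 - y)).
  have -> : 2 * pi * (1 - y) = - (2 * pi * y) + pi *+ 2 by ring.
  by rewrite cosD2pi cosN.
by apply: ler_cos_2pi; lra.
Qed.

Lemma peak_near (x0 dl x : R) : dl <= 2^-1 -> `|x - x0| <= dl ->
  2^-1 + 2^-1 * cos (2 * pi * dl) <= peak x0 x.
Proof.
move=> dl0 h1; rewrite /peak lerD2l ler_wpM2l ?invr_ge0//.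
rewrite /cs1 (_ : _ - _ = 2 * pi * (x - x0)); last by ring.
have -> : cos (2 * pi * (x - x0)) = cos (2 * pi * `|x - x0|).
  have [h|h] := leP 0 (x - x0); first by rewrite ger0_norm.
  by rewrite ltr0_norm// mulrN cosN.
move: (`|x - x0|) (normr_ge0 (x - x0)) h1 => y h0 h1.
exact: ler_cos_2pi.
Qed.

(** The primitive of [f] from 0, written with an indicator as kernel so that Fubini's theorem
    applies on the square. *)
Definition prim (x : R) : R := \int[unitm]_t (f t * (t <= x)%R%:R).

Lemma measurable_le_indic : measurable_fun setT (fun z : mR * mR => (z.2 <= z.1)%R%:R : R).
Proof.
rewrite (_ : (fun z => _) = \1_[set z : mR * mR | (z.2 : R) <= z.1]); last first.
  by apply/funext => z; rewrite indicE mem_setE.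
apply: measurable_indic; rewrite -[X in measurable X]setTI.
exact: (@measurable_fun_le _ _ _ setT snd fst).
Qed.

Lemma indic_le1 (b : bool) : `|b%:R : R| <= 1.
Proof. by case: b; rewrite ?normr1 ?normr0. Qed.

Lemma prim_prod_int (g : mR -> R) : bnd_meas g ->
  (unitm \x unitm)%E.-integrable setT
    (EFin \o (fun z : mR * mR => f z.2 * (z.2 <= z.1)%R%:R * g z.1)).
Proof.
move=> [mg [M gM]]; have mf := integrableP_fin iF.
apply: (@integrable_prod_bnd _ _ mR mR R unitm unitm _ (fun t => M * f t)).
- apply: measurable_funM; last exact: measurableT_comp mg measurable_fst.
  apply: measurable_funM; last exact: measurable_le_indic.
  exact: measurableT_comp mf measurable_snd.
- exact: integrable_funZ.
move=> z; rewrite !normrM mulrC.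
have M0 : 0 <= M by apply: le_trans (gM 0).
rewrite (ger0_norm M0); apply: ler_pM; rewrite ?mulr_ge0// ler_piMr//.
exact: indic_le1.
Qed.

Lemma prim_bnd : bnd_meas (prim : mR -> R).
Proof.
have b1 : bnd_meas ((fun=> 1) : mR -> R) by split => //; exists 1 => x; rewrite normr1.
have iH := prim_prod_int b1.
split.
  have := measurable_fubini_F iH => mF.
  rewrite (_ : prim = fine \o fubini_F unitm (EFin \o (fun z : mR * mR =>
      f z.2 * (z.2 <= z.1)%R%:R * 1))).
    exact: measurableT_comp mF.
  apply/funext => x /=; rewrite /prim /Rintegral /fubini_F; congr fine.
  by apply: eq_integral => t _ /=; rewrite mulr1.
exists (\int[unitm]_t `|f t|) => x.
have b : bnd_meas (fun t : mR => (t <= x)%R%:R : R).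
  split; last by exists 1 => t; exact: indic_le1.
  exact: measurableT_comp measurable_le_indic (measurable_pair1 x).
have i1 := integrableM_bnd iF b.
apply: le_trans (le_normr_Rintegral _ i1) _ => //.
apply: le_Rintegral => //; [exact: integrable_norm i1|exact: integrable_norm iF|].
by move=> t _; rewrite normrM ler_piMr// indic_le1.
Qed.


(** Integration by parts in the guise of Fubini's theorem: integrating the kernel in [x] first turns
    the coefficient of the primitive into a combination of coefficients of [f] at the frequencies 0
    and [k]. *)
Lemma prim_coeff k th :
  (forall k th, \int[unitm]_x (f x * cs1 k th x) = 0) -> k != 0 ->
  \int[unitm]_x (prim x * cs1 k th x) = 0.
Proof.
move=> f0 k0; have iH := prim_prod_int (cs1_bnd k th).
have b x : bnd_meas ((fun t => (t <= x)%R%:R) : mR -> R).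
  split; last by exists 1 => t; exact: indic_le1.
  exact: measurableT_comp measurable_le_indic (measurable_pair1 x).
have b' t : bnd_meas ((fun x => (t <= x)%R%:R) : mR -> R).
  split; last by exists 1 => x; exact: indic_le1.
  exact: measurableT_comp measurable_le_indic (measurable_pair2 t).
transitivity (\int[unitm]_x \int[unitm]_t (f t * (t <= x)%R%:R * cs1 k th x)).
  apply: eq_Rintegral => x _; rewrite RintegralZr//.
  exact: integrableM_bnd iF (b x).
rewrite (Rintegral_Fubini iH) /=.
have w0 : 2 * pi * k%:~R != 0 :> R.
  by rewrite !mulf_neq0 ?pnatr_eq0 ?intr_eq0// gt_eqF// pi_gt0.
set w : R := 2 * pi * k%:~R.
(* The inner integral over [t <= x <= 1] is elementary; the phase shift by [pi / 2] writes the
   resulting sine as a [cs1]. *)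
transitivity (\int[unitm]_t (- sin th / w * (f t * cs1 0 0 t) -
    w^-1 * (f t * cs1 k (th + pi / 2) t))).
  apply: ae_eq_Rintegral_nm; apply: aeS (ae_unit_leb R) => t /andP[t0 t1] _.
  transitivity (f t * \int[unitm]_x ((t <= x)%R%:R * cs1 k th x)).
    rewrite -RintegralZl//; last exact/bnd_meas_integrable/bnd_measM/cs1_bnd.
    by apply: eq_Rintegral => x _; rewrite mulrA.
  have -> : \int[unitm]_x ((t <= x)%R%:R * cs1 k th x) =
      \int[leb]_(x in `[t, 1]) cs1 k th x.
    rewrite Rintegral_unit_leb -Rintegral_itv_bndo_bndc; last first.
      apply: integrableS (continuous_compact_integrable (@segment_compact R t 1)
        (continuous_subspaceT (@continuous_cs1 k th))) => //.
      by apply: subset_itvl; rewrite bnd_simp.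
    rewrite Rintegral_mkcond [RHS]Rintegral_mkcond; apply: eq_Rintegral => x _.
    rewrite !patchE !mem_setE !in_itv /=.
    have [tx|tx] := leP t x; last by rewrite mul0r; case: ifP.
    by rewrite mul1r (le_trans t0 tx).
  have -> : \int[leb]_(x in `[t, 1]) cs1 k th x =
      w^-1 * sin (w * 1 - th) - w^-1 * sin (w * t - th).
    pose F x := w^-1 * sin (w * x - th).
    have dF x : is_derive x (1 : R) F (cs1 k th x).
      have da := is_derive_affine w (- th) x.
      have := @is_derive1_comp R sin _ x _ _ (is_derive_sin _) da.
      move=> /(is_deriveZ (w^-1)) ds.
      suff -> : cs1 k th x = w^-1 *: (cos (w * x + - th) * w) by exact: ds.
      by rewrite [_ *: _]mulrC mulfK.
    rewrite /Rintegral (@continuous_FTC2 _ (cs1 k th) F t 1)//.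
    - exact/continuous_subspaceT/continuous_cs1.
    - have cF : continuous F.
        move=> x; apply: differentiable_continuous; apply/derivable1_diffP.
        by case: (dF x).
      split.
      + by move=> x _; case: (dF x).
      + exact: cvg_at_right_filter (cF t).
      + exact: cvg_at_left_filter (cF 1).
    - by move=> x _; rewrite derive1E; case: (dF x).
  have -> : sin (w * 1 - th) = - sin th.
    by rewrite mulr1 addrC sinD2piint sinN.
  have -> : cs1 0 0 t = 1 by rewrite /cs1 mulr0z mulr0 mul0r subr0 cos0.
  have -> : cs1 k (th + pi / 2) t = sin (w * t - th).
    by rewrite /cs1 opprD addrA -/w cosBpihalf.
  ring.
have i k' th' : intg (fun t => f t * cs1 k' th' t).
  exact: integrableM_bnd iF (cs1_bnd k' th').
rewrite RintegralB//; try exact: integrable_funZ.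
by rewrite !RintegralZl// !f0 !mulr0 subr0.
Qed.


Lemma prim_leb x : 0 <= x <= 1 ->
  prim x = \int[leb]_(t in `[0, x]) (f \_ `[(0:R), 1[) t.
Proof.
move=> /andP[x0 x1]; rewrite /prim Rintegral_unit_leb.
rewrite Rintegral_mkcond [RHS]Rintegral_mkcond; apply: ae_eq_Rintegral_nm.
have ne1 : {ae leb, forall t : mR, t != 1}.
  exists [set 1]; split => //; first exact: lebesgue_measure_set1.
  by move=> t /= /negP; rewrite negbK => /eqP.
apply: aeS ne1 => t t1 _; rewrite !patchE !mem_setE !in_itv /=.
have [t0|t0] //= := leP 0 t; have [tx|tx] := leP t x.
  by rewrite lt_neqAle t1 (le_trans tx x1) /= mulr1.
by rewrite mulr0 if_same.
Qed.

Lemma f01_integrable : leb.-integrable setT (EFin \o (f \_ `[(0:R), 1[)).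
Proof.
rewrite -restrict_EFin; apply/integrable_restrict => //; rewrite setTI.
have [mf foo] := integrableP _ _ _ iF; apply/integrableP; split.
  exact: measurable_funTS.
by rewrite -integral_unit_leb.
Qed.

Lemma prim_continuous : {within `[(0:R), 1], continuous prim}.
Proof.
have := @parameterized_integral_continuous R 0 1 (f \_ `[(0:R), 1[) ler01.
have iS : leb.-integrable `[(0:R), 1] (EFin \o (f \_ `[(0:R), 1[)).
  exact: integrableS f01_integrable.
move=> /(_ iS); apply: subspace_eq_continuous => x /=.
by rewrite inE /= in_itv /= => x01; rewrite /from_subspace /= (prim_leb x01).
Qed.

End orth.

(** If [G x0] were positive, a neighbourhood of [x0] would dominate the integrals of [G] against
    high powers of [peak x0]: there the powers are at least [q ^+ m], while wherever [G] may be
    negative they are at most [p ^+ m] with [p < q]. Yet all these integrals vanish. *)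
Lemma continuous_uniqueness_le (G : R -> R) : {within `[(0:R), 1], continuous G} ->
  bnd_meas (G : mR -> R) ->
  (forall k th, \int[unitm]_x (G x * cs1 k th x) = 0) ->
  forall x0, 0 < x0 < 1 -> G x0 <= 0.
Proof.
move=> cG bG G0 x0 /andP[x00 x01]; rewrite leNgt; apply/negP => g0.
have [mG [M GM]] := bG.
have M0 : 0 <= M by apply: le_trans (GM x0).
have cGx : {for x0, continuous G}.
  apply: (within_continuous_continuous _ cG); rewrite ?in_itv /= ?x00//.
have [d d0 dG] : exists2 d, 0 < d & forall x, `|x0 - x| < d -> G x0 / 2 < G x.
  have /cvgrPdist_lt /(_ (G x0 / 2)) := cGx.
  rewrite divr_gt0// => /(_ isT) /nbhs_ballP[d /= d0 dG]; exists d => // x xd.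
  have := dG x xd; rewrite ltr_norml; lra.
(* Within [d / 2] of [x0] the function stays above half of [G x0]. The bounds by [x0] and [1 - x0]
   keep every point of the unit interval within [1 - dl] of [x0], as [peak_far] requires. *)
pose dl := Num.min (d / 2) (Num.min x0 (1 - x0)).
have dl0 : 0 < dl by rewrite /dl !lt_min; apply/and3P; split; lra.
have [dd dx0 dx1] : [/\ dl <= d / 2, dl <= x0 & dl <= 1 - x0].
  by rewrite /dl; split; rewrite !ge_min lexx ?orbT.
have pi0 := pi_gt0 R.
pose p := 2^-1 + 2^-1 * cos (2 * pi * dl).
pose q := 2^-1 + 2^-1 * cos (2 * pi * (dl / 2)).
have p0 : 0 <= p by have := cos_geN1 (2 * pi * dl); rewrite /p; lra.
have pq : p < q.
  rewrite /p /q ltrD2l ltr_pM2l ?invr_gt0// ltr_cos ?in_itv /=; nra.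
have q0 : 0 < q := le_lt_trans p0 pq.
pose J := `[x0 - dl / 2, x0 + dl / 2]%classic.
have mJ : measurable (J : set mR) by exact: measurable_itv.
have bJ : bnd_meas (\1_J : mR -> R).
  split; first exact: measurable_indic.
  by exists 1 => x; rewrite indicE; exact: indic_le1.
have IJ : \int[unitm]_x \1_J x = dl.
  rewrite /Rintegral integral_indic// setIT /= /unit_leb /mrestr.
  rewrite (_ : J `&` _ = J); last first.
    apply/setIidl => x; rewrite /J /= !in_itv /= => /andP[h1 h2].
    by apply/andP; split; lra.
  rewrite [X in fine X]lebesgue_measure_itv /= lte_fin ifT /=; last lra.
  lra.
have key m : G x0 / 2 * dl * q ^+ m <= M * p ^+ m.
  have iG : intg (fun x => G x * peak x0 x ^+ m).
    exact/bnd_meas_integrable/bnd_measM/peak_bnd.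
  have iL : intg (fun x => G x0 / 2 * q ^+ m * \1_J x).
    exact/integrable_funZ/bnd_meas_integrable.
  have iC : intg (fun x : mR => M * p ^+ m).
    exact/sq_int_int/cst_sq_int.
  have : \int[unitm]_x (G x0 / 2 * q ^+ m * \1_J x - M * p ^+ m) <=
      \int[unitm]_x (G x * peak x0 x ^+ m).
    apply: ae_le_Rintegral => //; first exact: integrable_funB.
    apply: aeS (ae_unit_leb R) => x /andP[xx0 xx1].
    have pm0 : 0 <= p ^+ m by exact: exprn_ge0.
    have Mpm0 : 0 <= M * p ^+ m by exact: mulr_ge0.
    rewrite indicE; have [xd|xd] := leP `|x - x0| dl; last first.
      rewrite memNset ?mulr0 ?sub0r => [|]; last first.
        rewrite /J /= in_itv /= => /andP[h1 h2].
        by move: xd; rewrite ltNge ler_norml => /negP; apply; apply/andP; split; lra.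
      have pk : `|peak x0 x| <= p.
        rewrite ger0_norm; last first.
          have := cos_geN1 (2 * pi * 1%:~R * x - 2 * pi * x0).
          rewrite /peak /cs1; lra.
        apply: peak_far; [exact: ltW|apply/andP; split; first exact: ltW].
        by rewrite ler_norml; apply/andP; split; lra.
      apply: le_trans (_ : - `|G x * peak x0 x ^+ m| <= _).
        rewrite lerN2 normrM normrX; apply: ler_pM => //.
        by rewrite lerXn2r ?nnegrE.
      by rewrite lerNl -normrN ler_norm.
    have Gx : G x0 / 2 < G x.
      apply: dG; rewrite distrC; apply: le_lt_trans xd _.
      by apply: le_lt_trans dd _; lra.
    have pk0 : 0 <= peak x0 x.
      have := cos_geN1 (2 * pi * 1%:~R * x - 2 * pi * x0).
      rewrite /peak /cs1; lra.
    have pkm0 : 0 <= peak x0 x ^+ m by exact: exprn_ge0.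
    have [xJ|xJ] := boolP (x \in J); last first.
      rewrite mulr0 sub0r (@le_trans _ _ 0) ?oppr_le0// mulr_ge0//.
      by apply: le_trans (ltW Gx); lra.
    rewrite mulr1 lerBlDr; apply: ler_wpDr => //.
    apply: ler_pM; [lra|by rewrite exprn_ge0// ltW|exact: ltW|].
    rewrite lerXn2r ?nnegrE// ?(ltW q0)//; apply: peak_near; first lra.
    move: xJ; rewrite inE /J /= in_itv /= => /andP[h1 h2].
    by rewrite ler_norml; apply/andP; split; lra.
  rewrite [leRHS](_ : _ = 0); last first.
    have := @orth_peak G (bnd_meas_integrable _ bG) m 0 0 x0 G0.
    by under eq_Rintegral do rewrite /cs1 mulr0z mulr0 mul0r subr0 cos0 mulr1.
  rewrite RintegralB// RintegralZl//; last exact: bnd_meas_integrable.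
  by rewrite IJ Rintegral_prob_cst subr_le0 mulrAC.
have lim0 : (p / q) ^+ m @[m --> \oo] --> (0 : R).
  apply: cvg_expr; rewrite ger0_norm; last by rewrite divr_ge0// ltW.
  by rewrite ltr_pdivrMr// mul1r.
(* Dividing by [M + 1] instead of [M] covers the case [M = 0]. *)
have c0 : 0 < G x0 / 2 * dl / (M + 1).
  by rewrite !divr_gt0 ?mulr_gt0 ?divr_gt0//; lra.
have /cvgrPdist_lt /(_ _ c0) [m _ /(_ m (leqnn m))] := lim0.
rewrite sub0r normrN ger0_norm; last by rewrite exprn_ge0// divr_ge0// ltW.
have qm : 0 < q ^+ m by exact: exprn_gt0.
rewrite expr_div_n ltr_pdivrMr// => h.
have := key m; rewrite leNgt => /negP; apply.
apply: (@le_lt_trans _ _ ((M + 1) * p ^+ m)).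
  by rewrite ler_wpM2r ?exprn_ge0//; lra.
have M1 : 0 < M + 1 by lra.
by rewrite -ltr_pdivlMl// [ltRHS]mulrC mulrAC.
Qed.

Lemma integral_cs1 k th : k != 0 -> \int[unitm]_x cs1 k th x = 0.
Proof.
move=> k0; set w : R := 2 * pi * k%:~R.
have w0 : w != 0.
  by rewrite !mulf_neq0 ?pnatr_eq0 ?intr_eq0// gt_eqF// pi_gt0.
pose F x := w^-1 * sin (w * x - th).
have dF x : is_derive x (1 : R) F (cs1 k th x).
  have da := is_derive_affine w (- th) x.
  have := @is_derive1_comp R sin _ x _ _ (is_derive_sin _) da.
  move=> /(is_deriveZ (w^-1)) ds.
  suff -> : cs1 k th x = w^-1 *: (cos (w * x + - th) * w) by exact: ds.
  by rewrite [_ *: _]mulrC mulfK.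
rewrite (Rintegral_unit_derive (@continuous_cs1 k th) dF) /F mulr1 mulr0.
by rewrite [w - th]addrC sinD2piint sub0r subrr.
Qed.

(** The primitive minus its mean is continuous and orthogonal to all modes, hence zero on the open
    interval. By Lebesgue differentiation [f] is almost everywhere the derivative of that constant
    primitive. *)
Lemma unit_uniqueness (f : R -> R) : intg f ->
  (forall k th, \int[unitm]_x (f x * cs1 k th x) = 0) ->
  {ae unitm, forall x, f x = 0}.
Proof.
move=> iF f0; have bF := prim_bnd iF; have iP := bnd_meas_integrable unitm bF.
pose c := \int[unitm]_x prim f x.
pose G x := prim f x - c.
have bG : bnd_meas (G : mR -> R).
  have [mp [M pM]] := bF; split; first exact: measurable_funB.
  by exists (M + `|c|) => x; rewrite (le_trans (ler_normB _ _))// lerD2r.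
have G0 k th : \int[unitm]_x (G x * cs1 k th x) = 0.
  have ic : intg (cs1 k th) by exact/bnd_meas_integrable/cs1_bnd.
  have ipc : intg (fun x => prim f x * cs1 k th x).
    exact/integrableM_bnd/cs1_bnd.
  transitivity (\int[unitm]_x (prim f x * cs1 k th x - c * cs1 k th x)).
    by apply: eq_Rintegral => x _; rewrite mulrBl.
  rewrite RintegralB//; last exact: integrable_funZ.
  rewrite RintegralZl//.
  have [k0|k0] := eqVneq k 0; last first.
    by rewrite (prim_coeff iF th f0 k0) integral_cs1// mulr0 subr0.
  have E x : cs1 k th x = cos th.
    by rewrite k0 /cs1 mulr0z mulr0 mul0r sub0r cosN.
  under eq_Rintegral do rewrite E.
  under [X in _ - _ * X]eq_Rintegral do rewrite E.
  by rewrite RintegralZr// Rintegral_prob_cst subrr.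
have cG : {within `[(0:R), 1], continuous G}.
  move=> x; apply: (@continuousB _ _ _ (prim f : subspace _ -> R)).
    exact: (prim_continuous iF).
  exact: cst_continuous.
have GE x : 0 < x < 1 -> prim f x = c.
  move=> x01; apply/eqP; rewrite -subr_eq0 eq_le; apply/andP; split.
    exact: (continuous_uniqueness_le cG bG G0 x01).
  rewrite -oppr_le0.
  apply: (@continuous_uniqueness_le (fun x => - G x) _ _ _ x x01).
  - by move=> y; apply: (@continuousN _ _ _ (G : subspace _ -> R)); exact: cG.
  - have [mp [M pM]] := bG; split; first exact: measurableT_comp.
    by exists M => y; rewrite normrN.
  - move=> k th; transitivity (\int[unitm]_x (-1 * (G x * cs1 k th x))).
      by apply: eq_Rintegral => y _; rewrite mulN1r mulNr.
    rewrite RintegralZl// ?G0 ?mulr0//.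
    exact/integrableM_bnd/cs1_bnd/bnd_meas_integrable.
have iz := f01_integrable iF.
have iy (y : R) : leb.-integrable `[0, y] (EFin \o (f \_ `[(0:R), 1[)).
  by apply: integrableS iz.
have := @FTC1 R (f \_ `[(0:R), 1[) (BLeft 0) iy.
have loc : locally_integrable [set: R] (f \_ `[(0:R), 1[).
  have := @integrable_locally R (f \_ `[(0:R), 1[) setT measurableT iz.
  by rewrite patch_setT.
move=> /(_ loc) /= [N [mN N0 sN]].
(* Besides the null set where differentiation fails, the endpoint 0 is discarded so that a
   neighbourhood of each remaining point lies in the open interval. *)
exists ((N `&` `[(0:R), 1[) `|` [set 0] `|` ~` `[(0:R), 1[); split.
- apply: measurableU; first by apply: measurableU => //; exact: measurableI.
  exact: measurableC.
- rewrite /= /unit_leb /mrestr setIUl setICl setU0.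
  apply/eqP; rewrite -measure_le0.
  apply: (@le_trans _ _ (leb (N `|` [set 0]))).
    rewrite le_measure ?inE//; last by move=> x [[[]|]]; [left|right].
      by apply: measurableI => //; apply: measurableU => //; exact: measurableI.
    exact: measurableU.
  rewrite measureU0//; first by rewrite [X in (X <= _)%E]N0.
  exact: lebesgue_measure_set1.
move=> x /= fx; apply: contrapT => /not_orP[/not_orP[NN x0]].
move=> /contrapT; rewrite /= in_itv /= => /andP[x00 x1].
have x0' : 0 < x by rewrite lt_def x00 andbT; apply/eqP.
apply: fx; have : ~ N x by move=> Nx; apply: NN; rewrite in_itv /= x00.
apply: contra_notP => fx; apply: sN => /= H.
have hx : (0%:E < x%:E)%E by rewrite lte_fin.
have [dF] := H hx; rewrite patchE mem_setE in_itv /= x00 x1 /= => F'E; apply: fx; rewrite -F'E derive1E.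
rewrite (@near_eq_derive _ _ _ _ (cst c)) ?derive_cst//.
have xin : x \in `]0, 1[ by rewrite in_itv /= x0'.
near=> y.
have : y \in `]0, 1[ by near: y; exact: near_in_itvoo.
rewrite in_itv /= => /andP[y0 y1].
by rewrite -[RHS](GE y) ?y0// (prim_leb _) ?(ltW y0) ?(ltW y1).
Unshelve. all: by end_near. Qed.

End unit_uniqueness.

(** * Riesz-Fischer and Parseval *)

Section cube_uniqueness.
Variable R : realType.
Local Notation unitm := (@unit_leb R).
Local Notation mR := (measurableTypeR R).
Local Notation cube := (@cube_leb R).

(** * Uniqueness of Fourier coefficients on the cube *)

Definition csp n (xi : 'rV[int]_n) (th : R) (x : 'rV[R]_n) : R :=
  cos (2 * pi * zdot xi x - th).

Lemma csp_lin n (xi : 'rV[int]_n) th x :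
  csp xi th x = cos th * cs xi x + sin th * sn xi x.
Proof. by rewrite /csp cosB /cs /sn; ring. Qed.

Lemma csp_bnd n (xi : 'rV[int]_n) th : bnd_meas (on_cube (csp xi th)).
Proof.
rewrite (_ : csp xi th = fun x => cos th * cs xi x + sin th * sn xi x).
  exact/test_fun_bnd_meas/test_fun_trig.
by apply/funext => x; rewrite csp_lin.
Qed.

Definition int_cons n (k : int) (eta : 'rV[int]_n) : 'rV[int]_n.+1 :=
  \row_i (if unlift ord0 i is Some j then eta 0 j else k).

Lemma zdot_cons n (k : int) (eta : 'rV[int]_n) (x : R) (y : 'rV[R]_n) :
  zdot (int_cons k eta) (row_cons x y) = k%:~R * x + zdot eta y.
Proof.
rewrite /zdot big_ord_recl !mxE unlift_none; congr (_ + _).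
by apply: eq_bigr => i _; rewrite !mxE liftK.
Qed.

Lemma cs1_phase k th (x : R) :
  cs1 k th x = cos th * cs1 k 0 x + sin th * cs1 k (pi / 2) x.
Proof. by rewrite /cs1 subr0 cosBpihalf cosB; ring. Qed.

(** Induction on the dimension. For each mode in the first variable, the partial coefficient is a
    function of the remaining variables whose own coefficients all vanish, so it is zero for almost
    every slice; uniqueness in one variable then applies on almost every slice. *)
Lemma cube_uniqueness_phase n (f : n.-tuple mR -> R) :
  (cube n).-integrable setT (EFin \o f) ->
  (forall xi th, \int[cube n]_x (f x * on_cube (csp xi th) x) = 0) ->
  {ae cube n, forall x, f x = 0}.
Proof.
elim: n f => [|n IH] f iF f0.
  apply: aeW => x; have := f0 0 0; rewrite /Rintegral integral_dirac//.
    rewrite diracT mul1e /= /on_cube /csp zdot0l mulr0 subr0 cos0 mulr1.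
    by rewrite (tuple0 x).
  apply/measurable_EFinP/measurable_funM; last by case: (csp_bnd (0 : 'rV_0) 0).
  exact: integrableP_fin iF.
have mf := integrableP_fin iF.
have ic k th : (cube n.+1).-integrable setT
    (EFin \o (fun z : n.+1.-tuple mR => f z * cs1 k th (thead z))).
  apply: integrableM_bnd iF _; split.
    apply: measurableT_comp; first by case: (cs1_bnd k th).
    exact: measurable_tnth.
  by exists 1 => x; exact: cs1_le1.
have slice k th : {ae cube n, forall y,
    \int[unitm]_x (f (tuple_cons (x, y)) * cs1 k th x) = 0}.
  have := IH (fun y => \int[unitm]_x (f (tuple_cons (x, y)) * cs1 k th x)).
  apply.
    have := cube_integrable2 (ic k th); congr (integrable _ _ _).
  move=> eta th'.
  have ibig : (cube n.+1).-integrable setT (EFin \o (fun z : n.+1.-tuple mR =>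
      f z * cs1 k th (thead z) * on_cube (csp eta th') [tuple of behead z])).
    apply: integrableM_bnd (ic k th) _; have [mc [M cM]] := csp_bnd eta th'.
    split; last by exists M => z; exact: cM.
    apply: measurableT_comp mc _; exact: measurable_behead.
  have consE x (y : n.-tuple mR) :
      [tuple of behead (tuple_cons (x, y))] = y by apply/val_inj.
  transitivity (\int[cube n]_y \int[unitm]_x (fun z : n.+1.-tuple mR =>
      f z * cs1 k th (thead z) * on_cube (csp eta th') [tuple of behead z])
      (tuple_cons (x, y))).
    apply: ae_eq_Rintegral_nm; apply: aeS (cube_ae_integrable (ic k th)) => y iy _.
    rewrite -RintegralZr//.
    by apply: eq_Rintegral => x _; rewrite consE.
  rewrite -(Rintegral_cubeS ibig).
  have i k' xi th'' : (cube n.+1).-integrable setT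
      (EFin \o (fun z => k' * (f z * on_cube (csp xi th'') z))).
    exact/integrable_funZ/integrableM_bnd/csp_bnd.
  (* A product of cosines in separate variables is a half sum of two modes of the whole space. *)
  transitivity (\int[cube n.+1]_z
      (2^-1 * (f z * on_cube (csp (int_cons k eta) (th + th')) z) +
       2^-1 * (f z * on_cube (csp (int_cons k (- eta)) (th - th')) z))).
    apply: eq_Rintegral => z _.
    have [x [y ->]] : exists x y, z = tuple_cons (x, y).
      exists (thead z), [tuple of behead z].
      by apply/val_inj => /=; rewrite [in LHS](tuple_eta z).
    have -> : thead (tuple_cons (x, y)) = x by rewrite /thead (tnth_nth 0).
    rewrite consE /on_cube row_of_cons /csp !zdot_cons zdotNl /cs1.
    move: (f _) (zdot _ _) => a b.
    have -> : 2 * pi * (k%:~R * x + b) - (th + th') =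
      (2 * pi * k%:~R * x - th) + (2 * pi * b - th') by ring.
    have -> : 2 * pi * (k%:~R * x - b) - (th - th') =
      (2 * pi * k%:~R * x - th) - (2 * pi * b - th') by ring.
    move: (2 * pi * _ * x - th) (2 * pi * b - th') => A B.
    by rewrite cosD cosB; field.
  rewrite RintegralD//; try exact: i.
  rewrite !RintegralZl//; try exact/integrableM_bnd/csp_bnd.
  by rewrite !f0 mulr0 addr0.
(* The null sets for all integers [k] are united along the enumeration of [int]. Phases form a
   continuum, but 0 and [pi / 2] generate all of them by [cs1_phase]. *)
have aeall : {ae cube n, forall y, forall i : nat,
    if (unpickle i : option int) is Some k then
      \int[unitm]_x (f (tuple_cons (x, y)) * cs1 k 0 x) = 0 /\
      \int[unitm]_x (f (tuple_cons (x, y)) * cs1 k (pi / 2) x) = 0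
    else True}.
  apply: ae_foralln => i; case: (unpickle i) => [k|]; last exact: aeW.
  by apply: aeS2 (slice k 0) (slice k (pi / 2)) => y; split.
apply: ae_cubeS.
  rewrite (_ : [set x | _] = f @^-1` [set 0])//.
  rewrite -[X in measurable X]setTI; apply: mf => //; exact: measurable_set1.
apply: aeS2 (cube_ae_integrable iF) aeall => y iy fy.
apply: (unit_uniqueness iy) => k th.
have := fy (pickle k); rewrite pickleK => -[f1 f2].
transitivity (\int[unitm]_x (cos th * (f (tuple_cons (x, y)) * cs1 k 0 x) +
    sin th * (f (tuple_cons (x, y)) * cs1 k (pi / 2) x))).
  by apply: eq_Rintegral => x _; rewrite (cs1_phase k th); ring.
have i th' : unitm.-integrable setT
    (EFin \o (fun x => f (tuple_cons (x, y)) * cs1 k th' x)).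
  exact: integrableM_bnd iy (cs1_bnd k th').
rewrite RintegralD//; try exact: integrable_funZ.
by rewrite !RintegralZl// f1 f2 !mulr0 addr0.
Qed.

Lemma cube_uniqueness n (f : n.-tuple mR -> R) :
  (cube n).-integrable setT (EFin \o f) ->
  (forall xi, fc f xi = 0) -> (forall xi, fs f xi = 0) ->
  {ae cube n, forall x, f x = 0}.
Proof.
move=> iF c0 s0; apply: (cube_uniqueness_phase iF) => xi th.
transitivity (\int[cube n]_x (cos th * (f x * on_cube (cs xi) x) +
    sin th * (f x * on_cube (sn xi) x))).
  by apply: eq_Rintegral => x _; rewrite /on_cube csp_lin; ring.
have ic := integrableM_bnd iF (on_cube_cs_bnd R xi).
have isn := integrableM_bnd iF (on_cube_sn_bnd R xi).
rewrite RintegralD//; try exact: integrable_funZ.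
rewrite !RintegralZl// -[X in _ * X + _]/(fc f xi) -[X in _ + _ * X]/(fs f xi).
by rewrite c0 s0 !mulr0 addr0.
Qed.

(** * Convergence of Fourier partial sums in L_2 *)

Section riesz_fischer.
Variable n : nat.
Local Notation Zn := 'rV[int]_n.
Local Notation mu := (cube n).

Lemma integral_tp_diff N M (A B : Zn -> R) : evenZ A -> oddZ B -> (N <= M)%N ->
  \int[mu]_x ((on_cube (tp M A B) x - on_cube (tp N A B) x) ^+ 2) =
  bsum (fun xi => A xi ^+ 2 + B xi ^+ 2) M -
  bsum (fun xi => A xi ^+ 2 + B xi ^+ 2) N.
Proof.
move=> eA oB NM; set s := on_cube (tp M A B); set r := on_cube (tp N A B).
have s2 : sq_int mu s by exact: tp_sq_int.
have r2 : sq_int mu r by exact: tp_sq_int.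
transitivity (\int[mu]_x (s x ^+ 2 - 2 * (s x * r x) + r x ^+ 2)).
  by apply: eq_Rintegral => x _; ring.
have i1 := sq_int_sqr s2; have i3 := sq_int_sqr r2; have i2 := sq_int_mul s2 r2.
rewrite RintegralD//; last exact: (integrable_funB i1 (integrable_funZ 2 i2)).
rewrite RintegralB//; last exact: (integrable_funZ 2 i2).
rewrite RintegralZl// !integral_tp_sqr//.
rewrite [\int[mu]_x (s x * r x)](integral_tp N A B (sq_int_int s2)).
have -> : bsum (fun xi => A xi * fc s xi + B xi * fs s xi) N =
    bsum (fun xi => A xi ^+ 2 + B xi ^+ 2) N.
  rewrite /bsum !big_seq; apply: eq_bigr => xi xN.
  by rewrite /s fc_tp// fs_tp// (box_sub NM xN) !expr2.
ring.
Qed.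

Lemma bsum_ge0 (F : Zn -> R) N : (forall xi, 0 <= F xi) -> 0 <= bsum F N.
Proof. by move=> F0; exact: sumr_ge0. Qed.

(** Squared distances between partial sums are differences of the bounded monotone sums [b], so a
    subsequence has a geometric rate and a limit [g]. By Pythagoras the distance from [g] decreases
    along the whole sequence, which therefore converges too. *)
Lemma riesz_fischer (A B : Zn -> R) (M : R) : evenZ A -> oddZ B ->
  (forall N, bsum (fun xi => A xi ^+ 2 + B xi ^+ 2) N <= M) ->
  exists g, [/\ sq_int mu g, fc g =1 A, fs g =1 B &
    \int[mu]_x ((g x - on_cube (tp N A B) x) ^+ 2) @[N --> \oo] --> (0 : R)].
Proof.
move=> eA oB bM; set b := bsum _ in bM.
have nb : nondecreasing_seq b.
  by apply: bsum_nd => xi; rewrite addr_ge0 ?sqr_ge0.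
have cb : cvgn b.
  by apply: nondecreasing_is_cvgn => //; exists M => _ [N _ <-].
have bl N : b N <= limn b by exact: nondecreasing_cvgn_le.
pose e k : R := (2^-1 ^+ k) ^+ 2.
have e0 k : 0 < e k by rewrite /e !exprn_gt0// invr_gt0.
(* The index is also taken at least [k], so that the cubes along the subsequence exhaust all
   frequencies. *)
have Nk k : {N | (k <= N)%N /\ limn b - b N <= e k}.
  apply: cid; have /cvgrPdist_le /(_ _ (e0 k)) [N0 _ H] := cb.
  exists (maxn N0 k); split; first exact: leq_maxr.
  by apply: le_trans (H _ (leq_maxl _ _)); exact: ler_norm.
pose nk k := sval (Nk k).
have nkk k : (k <= nk k)%N by rewrite /nk; case: (Nk k) => ? [].
have nkl k : limn b - b (nk k) <= e k by rewrite /nk; case: (Nk k) => ? [].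
have dist N N' : \int[mu]_x ((on_cube (tp N' A B) x - on_cube (tp N A B) x) ^+ 2)
    <= Num.max (limn b - b N) (limn b - b N').
  rewrite le_max; have [NN|/ltnW NN] := leqP N N'.
    by rewrite integral_tp_diff// lerD2r bl.
  under eq_Rintegral do rewrite -sqrrN opprB.
  by rewrite integral_tp_diff// lerD2r bl orbT.
have ekm k m : (k <= m)%N -> e m <= e k.
  move=> km; rewrite /e lerXn2r ?nnegrE ?exprn_ge0 ?invr_ge0//.
  by apply: ler_wiXn2l => //; rewrite ?invr_ge0// invf_le1// ler1n.
have [|k m km|g [g2 gs _]] := @sq_int_complete _ _ _ mu
    (fun k => on_cube (tp (nk k) A B)).
- by move=> k; exact: tp_sq_int.
- apply: le_trans (dist _ _) _; rewrite ge_max nkl /=.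
  exact: le_trans (nkl m) (ekm _ _ km).
(* Cauchy-Schwarz bounds the error on a coefficient by the L_2 error. As each coefficient of the
   polynomials is eventually constant, it must be the coefficient of [g]. *)
have small (h : n.-tuple mR -> R) k : bnd_meas h -> (forall x, `|h x| <= 1) ->
    (\int[mu]_x (g x * h x) - \int[mu]_x (on_cube (tp (nk k) A B) x * h x)) ^+ 2
    <= e k.
  move=> bh h1; have h2 := bnd_meas_sq_int mu bh.
  have t2 := tp_sq_int (nk k) A B.
  rewrite -RintegralB//; try exact: sq_int_mul.
  have -> : \int[mu]_x (g x * h x - on_cube (tp (nk k) A B) x * h x) =
      \int[mu]_x ((g x - on_cube (tp (nk k) A B) x) * h x).
    by apply: eq_Rintegral => x _; rewrite mulrBl.
  apply: le_trans (cauchy_schwarz_sq (sq_intB g2 t2) h2) _.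
  rewrite -[leRHS]mulr1; apply: ler_pM; rewrite ?Rintegral_sqr_ge0 ?gs//.
  rewrite -[leRHS](Rintegral_prob_cst mu); apply: le_Rintegral => //.
  - exact: sq_int_sqr.
  - exact/sq_int_int/cst_sq_int.
  by move=> x _; rewrite -real_normK ?num_real// exprn_ile1.
have elim : e k @[k --> \oo] --> (0 : R).
  have h : 2^-1 ^+ k @[k --> \oo] --> (0 : R).
    by apply: cvg_expr; rewrite ger0_norm ?invr_ge0// invf_lt1// ltr1n.
  by rewrite -[X in _ --> X](mulr0 (0 : R)); exact: (cvgM h h).
have esmall (c : R) m : 0 < c -> exists2 k, (m <= k)%N & e k < c.
  move=> c0; have /cvgrPdist_lt /(_ _ c0) [k0 _ H] := elim.
  exists (maxn m k0); first exact: leq_maxl.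
  have := H _ (leq_maxr m k0); rewrite sub0r normrN; apply: le_lt_trans.
  exact: ler_norm.
have elim0 (c : R) m : (forall k, (m <= k)%N -> c ^+ 2 <= e k) -> c = 0.
  move=> ce; apply/eqP; rewrite -sqrf_eq0 eq_le sqr_ge0 andbT leNgt.
  by apply/negP => /(esmall _ m)[k /ce]; rewrite leNgt => /negP.
have gA : fc g = A.
  apply/funext => xi; apply/eqP; rewrite -subr_eq0; apply/eqP.
  apply: (elim0 _ (znorm xi)) => k kx.
  have c1 x : `|on_cube (cs xi) x| <= 1 :> R.
    by rewrite ler_norml cos_geN1 cos_le1.
  have := small (on_cube (cs xi)) k (on_cube_cs_bnd R xi) c1.
  rewrite -/(fc g xi) -/(fc _ xi) fc_tp// mem_box.
  by rewrite (leq_trans kx (nkk k)).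
have gB : fs g = B.
  apply/funext => xi; apply/eqP; rewrite -subr_eq0; apply/eqP.
  apply: (elim0 _ (znorm xi)) => k kx.
  have c1 x : `|on_cube (sn xi) x| <= 1 :> R.
    by rewrite ler_norml sin_geN1 sin_le1.
  have := small (on_cube (sn xi)) k (on_cube_sn_bnd R xi) c1.
  rewrite -/(fs g xi) -/(fs _ xi) fs_tp// mem_box.
  by rewrite (leq_trans kx (nkk k)).
exists g; split => //; [by rewrite gA|by rewrite gB|].
have gN N : \int[mu]_x ((g x - on_cube (tp N A B) x) ^+ 2) =
    \int[mu]_x (g x ^+ 2) - b N.
  by have := integral_dist_pS N g2; rewrite /pS gA gB.
apply/cvgrPdist_lt => c c0; have [k _ kc] := esmall c 0%N c0.
exists (nk k) => // N /= kN; rewrite sub0r normrN ger0_norm ?Rintegral_sqr_ge0//.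
apply: le_lt_trans kc; apply: le_trans (gs k).
by rewrite !gN lerD2l lerN2 nb.
Qed.

(** Riesz-Fischer provides a function with the coefficients of [h] that is the L_2 limit of the
    partial sums; uniqueness of the coefficients identifies it with [h]. *)
Lemma parseval (h : n.-tuple mR -> R) : sq_int mu h ->
  \int[mu]_x ((h x - on_cube (pS h N) x) ^+ 2) @[N --> \oo] --> (0 : R).
Proof.
move=> h2; have ih := sq_int_int h2.
have [g [g2 gc gs gh]] := riesz_fischer (@fc_even R n h) (fs_odd ih)
  (fun N => bessel N h2).
have ig := sq_int_int g2.
have hg : {ae mu, forall x, h x - g x = 0}.
  apply: cube_uniqueness; first exact: integrable_funB.
  - move=> xi; rewrite -[RHS](subrr (fc h xi)) -{2}gc /fc -RintegralB//.
    + by apply: eq_Rintegral => x _; rewrite mulrBl.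
    + exact/integrableM_bnd/on_cube_cs_bnd.
    + exact/integrableM_bnd/on_cube_cs_bnd.
  - move=> xi; rewrite -[RHS](subrr (fs h xi)) -{2}gs /fs -RintegralB//.
    + by apply: eq_Rintegral => x _; rewrite mulrBl.
    + exact/integrableM_bnd/on_cube_sn_bnd.
    + exact/integrableM_bnd/on_cube_sn_bnd.
apply: cvg_trans gh; apply: near_eq_cvg; apply: nearW => N.
apply: ae_eq_Rintegral_nm; apply: aeS hg => x /eqP; rewrite subr_eq0 => /eqP -> _.
by [].
Qed.

Lemma parseval_sum (h : n.-tuple mR -> R) : sq_int mu h ->
  bsum (fun xi => fc h xi ^+ 2 + fs h xi ^+ 2) @ \oo --> \int[mu]_x (h x ^+ 2).
Proof.
move=> h2; apply/cvgrPdist_lt => e e0.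
have /cvgrPdist_lt /(_ _ e0) [N0 _ H] := parseval h2; exists N0 => // N NN.
by have := H N NN; rewrite integral_dist_pS// sub0r normrN.
Qed.

End riesz_fischer.
End cube_uniqueness.

(** * Fourier series of test functions and distributions *)

Section coefficient_decay.
Variables (R : realType) (n : nat).
Local Notation mR := (measurableTypeR R).
Local Notation cube := (@cube_leb R n).
Local Notation Rn := 'rV[R]_n.
Local Notation Zn := 'rV[int]_n.

Lemma test_fun_int (phi : Rn -> R) : test_fun phi ->
  cube.-integrable setT (EFin \o on_cube phi).
Proof. by move=> tp; exact/bnd_meas_integrable/test_fun_bnd_meas. Qed.

Lemma fc_partial (j : 'I_n) (phi : Rn -> R) xi : test_fun phi ->
  fc (on_cube (partial j phi)) xi = freq R xi j * fs (on_cube phi) xi.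
Proof.
move=> tp.
rewrite /fc (cube_ibp (test_fun_C1per j tp) (test_fun_C1per j (test_fun_cs R xi))).
rewrite partial_cs /fs -RintegralZl//; last first.
  exact/integrableM_bnd/on_cube_sn_bnd/test_fun_int.
rewrite -mulN1r -RintegralZl//; last first.
  apply: integrableM_bnd (test_fun_int tp) _.
  exact/test_fun_bnd_meas/test_funZ/test_fun_sn.
apply: eq_Rintegral => x _; rewrite /on_cube.
rewrite -[(_ *: sn xi) _]/(- freq R xi j * sn xi (row_of x)); ring.
Qed.

Lemma fs_partial (j : 'I_n) (phi : Rn -> R) xi : test_fun phi ->
  fs (on_cube (partial j phi)) xi = - (freq R xi j * fc (on_cube phi) xi).
Proof.
move=> tp.
rewrite /fs (cube_ibp (test_fun_C1per j tp) (test_fun_C1per j (test_fun_sn R xi))).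
rewrite partial_sn /fc -RintegralZl//; last first.
  exact/integrableM_bnd/on_cube_cs_bnd/test_fun_int.
congr (- _); apply: eq_Rintegral => x _; rewrite /on_cube.
rewrite -[(_ *: cs xi) _]/(freq R xi j * cs xi (row_of x)); ring.
Qed.

(** One minus the second derivative in direction [j]. Its symbol [1 + freq R xi j ^+ 2] never
    vanishes, and one application per coordinate yields a summable decay. *)
Definition subLap (j : 'I_n) (phi : Rn -> R) : Rn -> R :=
  (-1) *: partial j (partial j phi) + phi.

Lemma test_fun_subLap j phi : test_fun phi -> test_fun (subLap j phi).
Proof.
move=> tp.
exact: (test_funD (-1) (test_fun_partial j (test_fun_partial j tp)) tp).
Qed.

Lemma coef_lin (c : R) (phi psi : Rn -> R) (tau : Rn -> R) : test_fun phi ->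
  test_fun psi -> test_fun tau ->
  \int[cube]_x (on_cube (c *: phi + psi) x * on_cube tau x) =
  c * \int[cube]_x (on_cube phi x * on_cube tau x) +
  \int[cube]_x (on_cube psi x * on_cube tau x).
Proof.
move=> tp tq tt.
have ip := integrableM_bnd (test_fun_int tp) (test_fun_bnd_meas tt).
have iq := integrableM_bnd (test_fun_int tq) (test_fun_bnd_meas tt).
rewrite -RintegralZl// -RintegralD//; last exact: integrable_funZ.
apply: eq_Rintegral => x _; rewrite /on_cube.
rewrite -[(_ + _) (row_of x)]/(c * phi (row_of x) + psi (row_of x)); ring.
Qed.

Lemma fc_subLap j phi xi : test_fun phi ->
  fc (on_cube (subLap j phi)) xi = (1 + freq R xi j ^+ 2) * fc (on_cube phi) xi.
Proof.
move=> tp; have tdp := test_fun_partial j tp.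
have tddp := test_fun_partial j tdp.
have := coef_lin (-1) tddp tp (test_fun_cs R xi).
rewrite -/(fc (on_cube (subLap j phi)) xi) => ->.
have := fc_partial j xi tdp; rewrite /fc => ->.
have := fs_partial j xi tp; rewrite /fs /fc => ->.
ring.
Qed.

Lemma fs_subLap j phi xi : test_fun phi ->
  fs (on_cube (subLap j phi)) xi = (1 + freq R xi j ^+ 2) * fs (on_cube phi) xi.
Proof.
move=> tp; have tdp := test_fun_partial j tp.
have tddp := test_fun_partial j tdp.
have := coef_lin (-1) tddp tp (test_fun_sn R xi).
rewrite -/(fs (on_cube (subLap j phi)) xi) => ->.
have := fs_partial j xi tdp; rewrite /fs => ->.
have := fc_partial j xi tp; rewrite /fc /fs => ->.
ring.
Qed.

Lemma foldr_subLap (s : seq 'I_n) phi : test_fun phi ->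
  [/\ test_fun (foldr subLap phi s),
   (forall xi, fc (on_cube (foldr subLap phi s)) xi =
     (\prod_(j <- s) (1 + freq R xi j ^+ 2)) * fc (on_cube phi) xi) &
   (forall xi, fs (on_cube (foldr subLap phi s)) xi =
     (\prod_(j <- s) (1 + freq R xi j ^+ 2)) * fs (on_cube phi) xi)].
Proof.
move=> tp; elim: s => [|j s [ts cS sS]] /=.
  by split => // xi; rewrite big_nil mul1r.
split; first exact: test_fun_subLap.
- by move=> xi; rewrite fc_subLap// cS big_cons mulrA.
- by move=> xi; rewrite fs_subLap// sS big_cons mulrA.
Qed.

Lemma coef_le (H : n.-tuple mR -> R) (tau : Rn -> R) :
  cube.-integrable setT (EFin \o H) -> bnd_meas (on_cube tau) ->
  (forall x, `|tau x| <= 1) ->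
  `|\int[cube]_x (H x * on_cube tau x)| <= \int[cube]_x `|H x|.
Proof.
move=> iH bt t1; have i := integrableM_bnd iH bt.
apply: le_trans (le_normr_Rintegral _ i) _ => //.
apply: le_Rintegral => //; [exact: integrable_norm i|exact: integrable_norm|].
by move=> x _; rewrite normrM ler_piMr// t1.
Qed.

Lemma cs_le1 xi (x : Rn) : `|cs xi x| <= 1.
Proof. by rewrite ler_norml cos_geN1 cos_le1. Qed.

Lemma sn_le1 xi (x : Rn) : `|sn xi x| <= 1.
Proof. by rewrite ler_norml sin_geN1 sin_le1. Qed.

(** A product weight, so that its sum over a cube factors into one-dimensional sums. *)
Definition decay (xi : Zn) : R := \prod_(j < n) (1 + (xi 0 j)%:~R ^+ 2)^-1.

Lemma decay_gt0 xi : 0 < decay xi.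
Proof.
by apply: prodr_gt0 => j _; rewrite invr_gt0 ltr_pwDl// sqr_ge0.
Qed.

Lemma two_pi_ge1 : 1 <= 2 * pi :> R.
Proof. have := pi_ge2 R; lra. Qed.

(** Applying [subLap] once in every coordinate multiplies the coefficients by the product of the
    symbols, while the coefficients of the result are at most its L_1 norm. *)
Lemma coef_decay phi : test_fun phi -> exists C, forall xi,
  `|fc (on_cube phi) xi| <= C * decay xi /\ `|fs (on_cube phi) xi| <= C * decay xi.
Proof.
move=> tp; have [tL cL sL] := foldr_subLap (enum 'I_n) tp.
set L := foldr _ _ _ in tL cL sL.
exists (\int[cube]_x `|on_cube L x|) => xi.
pose W : R := \prod_(j < n) (1 + freq R xi j ^+ 2).
have Wd : 1 <= decay xi * W.
  rewrite /decay /W -big_split /=.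
  apply: (@le_trans _ _ (\prod_(j < n) 1)); first by rewrite big1_eq.
  apply: ler_prod => j _; rewrite ler01 /= mulrC ler_pdivlMr ?mul1r; last first.
    by rewrite ltr_pwDl// sqr_ge0.
  rewrite lerD2l /freq exprMn ler_peMl ?sqr_ge0// expr_ge1 ?two_pi_ge1//.
  by rewrite (le_trans ler01)// two_pi_ge1.
have W0 : 0 < W by apply: prodr_gt0 => j _; rewrite ltr_pwDl// sqr_ge0.
have aux c d : d = W * c -> `|d| <= \int[cube]_x `|on_cube L x| ->
    `|c| <= \int[cube]_x `|on_cube L x| * decay xi.
  move=> -> h; rewrite normrM (gtr0_norm W0) in h.
  apply: (@le_trans _ _ (W * `|c| * decay xi)); last first.
    by rewrite ler_wpM2r// ltW// decay_gt0.
  by rewrite mulrAC mulrC [W * _]mulrC ler_peMr.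
have iL := test_fun_int tL.
split; [apply: (aux _ (fc (on_cube L) xi))|apply: (aux _ (fs (on_cube L) xi))].
- by rewrite cL big_enum.
- exact: coef_le iL (on_cube_cs_bnd R xi) (cs_le1 xi).
- by rewrite sL big_enum.
- exact: coef_le iL (on_cube_sn_bnd R xi) (sn_le1 xi).
Qed.

(** Telescoping: [(1 + a ^+ 2)^-1 <= 2 / (a * (a + 1)) = 2 / a - 2 / (a + 1)] for [a >= 1]. *)
Lemma sum_inv_sq (N : nat) :
  \sum_(k < N) (1 + k.+1%:R ^+ 2)^-1 <= 2 - 2 / N.+1%:R :> R.
Proof.
elim: N => [|N IH]; first by rewrite big_ord0 divr1 subrr.
rewrite big_ord_recr /=; apply: le_trans (lerD IH (lexx _)) _.
rewrite -[N.+2%:R]natr1.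
have : (1 : R) <= N.+1%:R by rewrite ler1n.
move: (N.+1%:R : R) => a a1.
have a0 : 0 < a by lra.
have h : (1 + a ^+ 2)^-1 <= 2 / (a * (a + 1)).
  by rewrite -[leLHS]mul1r ler_pdivrMr ?ltr_pwDl ?sqr_ge0// mulrAC ler_pdivlMr ?mulr_gt0; nra.
have -> : 2 - 2 / (a + 1) = (2 - 2 / a) + 2 / (a * (a + 1)).
  by field; apply/andP; split; lra.
by rewrite lerD2l.
Qed.

(** The constant is [2 + 1 + 2], for the negative integers, zero and the positive integers. *)
Lemma sum_inv_sq_int (N : nat) :
  \sum_(i < N.*2.+1) (1 + ((i : nat)%:Z - N%:Z)%:~R ^+ 2)^-1 <= 5 :> R.
Proof.
pose G (k : int) : R := (1 + k%:~R ^+ 2)^-1.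
have -> : \sum_(i < N.*2.+1) (1 + ((i : nat)%:Z - N%:Z)%:~R ^+ 2)^-1 =
    \sum_(0 <= i < N.*2.+1) G (i%:Z - N%:Z) by rewrite big_mkord.
have NN : (N <= N.*2.+1)%N by rewrite -addnn; lia.
rewrite (big_cat_nat (leq0n N) NN) /= [X in _ + X]big_ltn; last by rewrite -addnn; lia.
have -> : \sum_(0 <= i < N) G (i%:Z - N%:Z) = \sum_(k < N) G (k.+1%:Z).
  rewrite big_nat_rev /= big_mkord; apply: eq_bigr => k _.
  rewrite /G (_ : _ - N%:Z = - k.+1%:Z); last by have := ltn_ord k; lia.
  by rewrite intrN sqrrN.
have -> : \sum_(N.+1 <= i < N.*2.+1) G (i%:Z - N%:Z) = \sum_(k < N) G (k.+1%:Z).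
  rewrite -{1}[N.+1]add0n big_addn (_ : N.*2.+1 - N.+1 = N)%N; last first.
    by rewrite -addnn; lia.
  rewrite big_mkord; apply: eq_bigr => k _; congr G; lia.
have h : \sum_(k < N) G (k.+1%:Z) <= 2.
  by apply: le_trans (sum_inv_sq N) _; rewrite gerBl divr_ge0.
have -> : G (N%:Z - N%:Z) = 1 by rewrite subrr /G expr0n addr0 invr1.
lra.
Qed.

Lemma bsum_decay N : bsum decay N <= 5 ^+ n.
Proof.
rewrite /bsum /box big_map big_enum /=.
rewrite (eq_bigr (fun f : {ffun 'I_n -> 'I_N.*2.+1} =>
    \prod_(j < n) (1 + ((f j : nat)%:Z - N%:Z)%:~R ^+ 2)^-1)); last first.
  by move=> f _; apply: eq_bigr => j _; rewrite mxE.
rewrite -(bigA_distr_bigA (fun (j : 'I_n) (i : 'I_N.*2.+1) =>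
  (1 + ((i : nat)%:Z - N%:Z)%:~R ^+ 2)^-1)) /=.
apply: (@le_trans _ _ (\prod_(j < n) 5)); last by rewrite prodr_const card_ord.
apply: ler_prod => j _; rewrite sum_inv_sq_int andbT.
by apply: sumr_ge0 => i _; rewrite invr_ge0 ltW// ltr_pwDl// sqr_ge0.
Qed.

End coefficient_decay.

(** * Uniform convergence of the Fourier series of test functions *)

Section fourier_uniform.
Variable R : realType.
Local Notation mR := (measurableTypeR R).
Local Notation unitm := (@unit_leb R).
Local Notation cube := (@cube_leb R).

Lemma cube_box_measure n (b : 'I_n -> R) (dl : R) : 0 < dl ->
  (forall i, 0 <= b i /\ b i + dl <= 1) ->
  cube n [set x | forall i, tnth x i \in `[b i, b i + dl[ ] = (dl ^+ n)%:E.
Proof.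
move=> dl0; elim: n b => [|n IH] b b01.
  rewrite expr0 (_ : [set x | _] = setT); first exact: probability_setT.
  by apply/seteqP; split => x //= _ [].
have mB m (c : 'I_m -> R) :
    measurable [set x : m.-tuple mR | forall i, tnth x i \in `[c i, c i + dl[ ].
  have := @measurable_boxT R m (fun i => `[c i, c i + dl[%classic).
  by apply => i; exact: measurable_itv.
pose b' (i : 'I_n) := b (lift ord0 i).
have mBb := mB _ b; have mBb' := mB _ b'.
rewrite -[X in cube n.+1 X]setIT -integral_indic// ge0_integral_cubeS; last 2 first.
- by apply/measurable_EFinP; exact: measurable_indic.
- by move=> x; rewrite lee_fin.
transitivity (\int[cube n]_y (dl%:E *
    (\1_[set x : n.-tuple mR | forall i, tnth x i \in `[b' i, b' i + dl[ ] y)%:E))%E.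
  apply: eq_integral => y _.
  transitivity (\int[unitm]_x ((\1_[set x : n.-tuple mR |
      forall i, tnth x i \in `[b' i, b' i + dl[ ] y)%:E *
      (\1_(`[b ord0, b ord0 + dl[%classic : set mR) x)%:E))%E.
    apply: eq_integral => x _; rewrite -EFinM; congr EFin.
    rewrite !indicE -natrM mulnb; congr (_%:R); congr nat_of_bool.
    apply/idP/andP => [|[]]; rewrite !inE /=.
      move=> H; split; last by have := H ord0; rewrite tnth0.
      by move=> i; have := H (lift ord0 i); rewrite tnthS.
    move=> Hy Hx i; case: (unliftP ord0 i) => [j ->|->]; last by rewrite tnth0.
    by rewrite tnthS; exact: Hy.
  rewrite ge0_integralZl; [|by []|by apply/measurable_EFinP; exact: measurable_indic|
    by move=> x _; rewrite lee_fin|by rewrite lee_fin].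
  rewrite muleC; congr (_ * _)%E; rewrite integral_indic// setIT /= /unit_leb /mrestr.
  have [b0 b1] := b01 ord0.
  rewrite (_ : _ `&` _ = `[b ord0, b ord0 + dl[%classic); last first.
    apply/setIidl => x; rewrite /= !in_itv /= => /andP[h1 h2].
    by rewrite (le_trans b0 h1) (lt_le_trans h2 b1).
  rewrite [LHS]lebesgue_measure_itv /= lte_fin ltrDl dl0 -EFinD.
  by rewrite addrAC subrr add0r.
rewrite ge0_integralZl; [|by []|by apply/measurable_EFinP; exact: measurable_indic|
  by move=> x _; rewrite lee_fin|by rewrite lee_fin ltW].
rewrite integral_indic// setIT exprS EFinM; congr (_ * _)%E.
by apply: IH => i; exact: b01.
Qed.

Section uniform.
Variable n : nat.
Local Notation Zn := 'rV[int]_n.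
Local Notation Rn := 'rV[R]_n.

Lemma decay_cvg : cvgn (bsum (@decay R n)).
Proof.
apply: nondecreasing_is_cvgn.
  by apply: bsum_nd => xi; rewrite ltW// decay_gt0.
by exists (5 ^+ n) => _ [N _ <-]; exact: bsum_decay.
Qed.

Definition decay_tail (N : nat) : R :=
  limn (bsum (@decay R n)) - bsum (@decay R n) N.

Lemma decay_tail_cvg0 : decay_tail @ \oo --> (0 : R).
Proof.
rewrite -(subrr (limn (bsum (@decay R n)))); apply: cvgB; first exact: cvg_cst.
exact: decay_cvg.
Qed.

Lemma tp_diff_le N M (A B : Zn -> R) (C : R) x : (N <= M)%N ->
  (forall xi, `|A xi| <= C * decay R xi /\ `|B xi| <= C * decay R xi) ->
  `|tp M A B x - tp N A B x| <= 2 * C * decay_tail N.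
Proof.
move=> NM AB; have C0 : 0 <= C.
  have [h _] := AB 0; have := le_trans (normr_ge0 _) h.
  by rewrite pmulr_lge0// decay_gt0.
have split_sum (F : Zn -> R) : \sum_(xi <- box n M) F xi =
    \sum_(xi <- box n N) F xi + \sum_(xi <- box n M | xi \notin box n N) F xi.
  rewrite (bigID (mem (box n N)))/=; congr (_ + _).
  rewrite -big_filter; apply: perm_big; apply: uniq_perm.
  - by rewrite filter_uniq ?box_uniq.
  - exact: box_uniq.
  by move=> xi; rewrite mem_filter /=; apply: andb_idr => /(box_sub NM).
rewrite /tp split_sum addrC addKr.
apply: le_trans (ler_norm_sum _ _ _) _.
apply: (@le_trans _ _ (\sum_(xi <- box n M | xi \notin box n N)
    2 * C * decay R xi)).
  apply: ler_sum => xi _; apply: le_trans (ler_normD _ _) _.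
  have [hA hB] := AB xi; rewrite !normrM.
  have := cs_le1 xi x; have := sn_le1 xi x.
  move: (normr_ge0 (cs xi x)) (normr_ge0 (sn xi x)) (normr_ge0 (A xi)) (normr_ge0 (B xi)).
  nra.
rewrite -mulr_sumr ler_wpM2l ?mulr_ge0//.
have := split_sum (@decay R n); rewrite -/(bsum _ _) => /eqP.
rewrite addrC -subr_eq => /eqP <-; rewrite lerD2r.
apply: nondecreasing_cvgn_le; last exact: decay_cvg.
by apply: bsum_nd => xi; rewrite ltW// decay_gt0.
Qed.

(** The partial sums are uniformly Cauchy with rate [decay_tail], and Parseval identifies their
    limit. If the bound failed at a point, it would fail by a fixed margin on a small box, and the
    L_2 distance to all later partial sums would stay away from 0. *)
Lemma pS_uniform (phi : Rn -> R) : test_fun phi -> exists2 C, 0 <= C &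
  forall N x, `|phi x - pS (on_cube phi) N x| <= C * decay_tail N.
Proof.
move=> tphi; have [C HC] := coef_decay tphi.
have C0 : 0 <= C.
  have [h _] := HC 0; have := le_trans (normr_ge0 _) h.
  by rewrite pmulr_lge0// decay_gt0.
exists (2 * C); first by rewrite mulr_ge0.
move=> N x; rewrite leNgt; apply/negP => lt.
have pp M : periodic (pS (on_cube phi) M) by case: (test_fun_tp M
  (fc (on_cube phi)) (fs (on_cube phi))).
have cp M : continuous (pS (on_cube phi) M) := test_fun_continuous (test_fun_tp M
  (fc (on_cube phi)) (fs (on_cube phi))).
(* Periodicity moves the bad point into the half-open cube, the only place that the integrals
   see. *)
pose m : 'rV[int]_n := \row_i - Num.floor (x 0 i).
pose z : Rn := x + map_mx (intr : int -> R) m.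
have zE i : z 0 i = x 0 i - (Num.floor (x 0 i))%:~R by rewrite !mxE intrN.
have z0 i : 0 <= z 0 i by rewrite zE subr_ge0 floor_le_tmp.
have z1 i : z 0 i < 1.
  by rewrite zE ltrBlDr addrC -[X in _ + X]mulr1z -intrD floorD1_gt.
have {lt} : 2 * C * decay_tail N < `|phi z - pS (on_cube phi) N z|.
  by rewrite /z (pp N) tphi.1.
set D := 2 * C * _ => lt.
(* Near [z] the difference exceeds [D + eta], and passing from [N] to a later [M] costs at most [D],
   so an error of at least [eta] remains for every [M]. *)
pose eta := (`|phi z - pS (on_cube phi) N z| - D) / 2.
have eta0 : 0 < eta by rewrite /eta; lra.
have cd : continuous (fun y => phi y - pS (on_cube phi) N y).
  move=> y; apply: continuousB; last exact: cp.
  exact: (test_fun_continuous tphi).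
have [d d0 Hd] := (row_continuousP _).1 cd z eta eta0.
(* The box extends only upwards from [z], where the half-open cube always leaves room. *)
have [dl [dl0 dld dl1]] : exists dl, [/\ 0 < dl, dl <= d & forall i, z 0 i + dl <= 1].
  exists (\big[Num.min/d]_i (1 - z 0 i)); split.
  - by apply: lt_bigmin => // i _; rewrite subr_gt0.
  - by apply: bigmin_le_id.
  - by move=> i; rewrite -lerBrDl; apply: bigmin_le_cond.
pose J := [set y : n.-tuple mR | forall i, tnth y i \in `[z 0 i, z 0 i + dl[ ].
have mJ : measurable J.
  have := @measurable_boxT R n (fun i => `[z 0 i, z 0 i + dl[%classic).
  by apply => i; exact: measurable_itv.
have low M : (N <= M)%N -> eta ^+ 2 * dl ^+ n <=
    \int[cube n]_y ((on_cube phi y - on_cube (pS (on_cube phi) M) y) ^+ 2).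
  move=> NM.
  have -> : dl ^+ n = \int[cube n]_y \1_J y.
    rewrite /Rintegral integral_indic// setIT.
    transitivity (fine ((dl ^+ n)%:E : \bar R)) => //.
    by congr fine; apply/esym/cube_box_measure.
  have bJ : bnd_meas (\1_J : n.-tuple mR -> R).
    split; first exact: measurable_indic.
    by exists 1 => y; rewrite indicE; exact: indic_le1.
  rewrite -RintegralZl//; last exact: bnd_meas_integrable.
  apply: le_Rintegral => //.
  - exact/integrable_funZ/bnd_meas_integrable.
  - apply: sq_int_sqr; apply: sq_intB; last exact: tp_sq_int.
    exact/bnd_meas_sq_int/test_fun_bnd_meas.
  move=> y _; rewrite indicE; have [|yJ] := boolP (y \in J); last first.
    by rewrite mulr0 sqr_ge0.
  rewrite inE /J /= mulr1 => yJ.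
  have yz : `|(phi z - pS (on_cube phi) N z) -
      (phi (row_of y) - pS (on_cube phi) N (row_of y))| < eta.
    apply: Hd => i; have -> : row_of y 0 i = tnth y i by rewrite mxE.
    rewrite distrC.
    have := yJ i; rewrite in_itv /= => /andP[h1 h2].
    rewrite ger0_norm ?subr_ge0//; lra.
  have MN := tp_diff_le (row_of y) NM HC.
  rewrite -(real_normK (num_real (on_cube phi y - _))).
  rewrite lerXn2r ?nnegrE ?(ltW eta0)//.
  pose a := phi z - pS (on_cube phi) N z; pose b := phi (row_of y).
  pose c := pS (on_cube phi) M (row_of y); pose e := pS (on_cube phi) N (row_of y).
  have h1 : D < `|a| := lt.
  have h2 : `|a - (b - e)| < (`|a| - D) / 2 := yz.
  have h3 : `|c - e| <= D := MN.
  suff : (`|a| - D) / 2 <= `|b - c| by [].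
  move: a b c e h1 h2 h3 => a b c e h1 h2 h3.
  have := ler_normD (b - c) (c - e); have := ler_normD (a - (b - e)) (b - e).
  rewrite subrK (_ : b - c + (c - e) = b - e); last by ring.
  lra.
have c0 : 0 < eta ^+ 2 * dl ^+ n by rewrite mulr_gt0// exprn_gt0.
have p2 := bnd_meas_sq_int (cube n) (test_fun_bnd_meas tphi).
have /cvgrPdist_lt /(_ _ c0) [M0 _ HM] := parseval p2.
have := HM (maxn N M0) (leq_maxr _ _).
rewrite sub0r normrN ger0_norm ?Rintegral_sqr_ge0// ltNge => /negP; apply.
by apply: low; exact: leq_maxl.
Qed.

End uniform.

(** * Periodic distributions are determined by their coefficients *)

Section distributions.
Variable n : nat.
Local Notation Zn := 'rV[int]_n.
Local Notation Rn := 'rV[R]_n.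
Local Notation distr := ((Rn -> R) -> R).

Lemma pS_partial (j : 'I_n) (phi : Rn -> R) N : test_fun phi ->
  partial j (pS (on_cube phi) N) = pS (on_cube (partial j phi)) N.
Proof.
move=> tphi; rewrite /pS partial_tp; apply/funext => x; apply: eq_bigr => xi _.
by rewrite fc_partial// fs_partial.
Qed.

Lemma partials_rcons (s : seq 'I_n) (j : 'I_n) (phi : Rn -> R) :
  partials (rcons s j) phi = partials s (partial j phi).
Proof. by rewrite /partials foldr_rcons. Qed.

Lemma test_fun_partials (s : seq 'I_n) (phi : Rn -> R) : test_fun phi ->
  test_fun (partials s phi).
Proof.
move=> tphi; elim: s => [|j s IH]; first exact: tphi.
exact: (test_fun_partial j IH).
Qed.

Lemma pS_partials (s : seq 'I_n) (phi : Rn -> R) N : test_fun phi ->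
  partials s (pS (on_cube phi) N) = pS (on_cube (partials s phi)) N.
Proof.
move=> tphi; elim: s => [//|j s IH].
rewrite -[LHS]/(partial j (partials s (pS (on_cube phi) N))) IH.
exact: (pS_partial j N (test_fun_partials s tphi)).
Qed.

Section linear.
Variable g : distr.
Hypothesis dg : is_distr g.

Lemma distr_lin (c : R) (phi psi : Rn -> R) : test_fun phi -> test_fun psi ->
  g (c *: phi + psi) = c * g phi + g psi.
Proof. by case: dg => lg _; exact: lg. Qed.

Lemma distr0 : g 0 = 0.
Proof.
have t0 := test_fun0 R n; have := distr_lin (-1) t0 t0.
by rewrite addr0 scaler0 mulN1r addNr.
Qed.

Lemma distrZ (c : R) (phi : Rn -> R) : test_fun phi -> g (c *: phi) = c * g phi.
Proof.
move=> tphi; have := distr_lin c tphi (test_fun0 R n).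
by rewrite distr0 !addr0.
Qed.

Lemma distr_sum (I : Type) (s : seq I) (F : I -> Rn -> R) :
  (forall i, test_fun (F i)) ->
  g (fun x => \sum_(i <- s) F i x) = \sum_(i <- s) g (F i).
Proof.
move=> tF; elim: s => [|i s IH].
  rewrite big_nil; transitivity (g 0); last exact: distr0.
  by congr g; apply/funext => x; rewrite big_nil.
rewrite big_cons -IH -[g (F i)]mul1r -(distr_lin 1 (tF i) (test_fun_sum s tF)).
by congr g; apply/funext => x; rewrite scale1r big_cons.
Qed.

Lemma distr_trig (xi : Zn) (a b : R) :
  g (fun x => a * cs xi x + b * sn xi x) = a * g (cs xi) + b * g (sn xi).
Proof.
have tc := test_fun_cs R xi; have tsn := test_fun_sn R xi.
rewrite -(distrZ b tsn) -(distr_lin a tc (test_funZ b tsn)).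
by congr g.
Qed.

Lemma distr_tp N (A B : Zn -> R) :
  g (tp N A B) = bsum (fun xi => A xi * g (cs xi) + B xi * g (sn xi)) N.
Proof.
rewrite /tp distr_sum => [|xi]; last exact: test_fun_trig.
by apply: eq_bigr => xi _; rewrite distr_trig.
Qed.

Lemma distr_snN (xi : Zn) : g (sn (- xi)) = - g (sn xi).
Proof.
rewrite snN -mulN1r -(distrZ _ (test_fun_sn R xi)); congr g.
by rewrite scaleN1r.
Qed.

Lemma pS_uniform_all (phi : Rn -> R) (k : nat) (e : R) : test_fun phi -> 0 < e ->
  exists N, forall M (s : seq 'I_n) x, (N <= M)%N -> (size s <= k)%N ->
    `|partials s ((-1) *: pS (on_cube phi) M + phi) x| <= e.
Proof.
move=> tphi e0.
have one (s : seq 'I_n) : exists N, forall M x, (N <= M)%N ->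
    `|partials s ((-1) *: pS (on_cube phi) M + phi) x| <= e.
  have ts := test_fun_partials s tphi.
  have [C C0 HC] := pS_uniform ts.
  have cv : C * decay_tail n N @[N --> \oo] --> (0 : R).
    rewrite -(mulr0 C); apply: cvgM; [exact: cvg_cst|exact: decay_tail_cvg0].
  have /cvgrPdist_le /(_ _ e0) [N _ HN] := cv.
  exists N => M x NM; rewrite (partialsD s (-1) (test_fun_tp M _ _) tphi).
  rewrite (pS_partials s M tphi) -[(_ + _) x]/(-1 * pS (on_cube (partials s phi)) M x +
    partials s phi x) mulN1r addrC.
  apply: le_trans (HC M x) _; apply: le_trans (HN M NM).
  by rewrite sub0r normrN ler_norm.
elim: k => [|k [N HN]].
  have [N HN] := one [::]; exists N => M s x NM.
  by rewrite leqn0 size_eq0 => /eqP ->; exact: HN.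
(* There are finitely many sequences of [k.+1] directions, so the maximum of their thresholds serves
   all of them. *)
have /all_sig[f Hf] : forall t : k.+1.-tuple 'I_n, {N | forall M x, (N <= M)%N ->
    `|partials t ((-1) *: pS (on_cube phi) M + phi) x| <= e}.
  by move=> t; apply: cid; exact: one.
exists (maxn N (\max_(t : k.+1.-tuple 'I_n) f t)) => M s x.
rewrite geq_max => /andP[NM fM]; rewrite leq_eqVlt => /predU1P[sk|]; last exact: HN.
pose t : k.+1.-tuple 'I_n := tcast sk (in_tuple s).
have := Hf t M x; rewrite val_tcast; apply.
by apply: leq_trans fM; exact: (leq_bigmax t).
Qed.

(** The Fourier sums of a test function converge together with all their
    derivatives, and [g] is continuous for that convergence. *)
Lemma distr_vanish : (forall xi, g (cs xi) = 0) -> (forall xi, g (sn xi) = 0) ->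
  forall phi, test_fun phi -> g phi = 0.
Proof.
move=> gc gs phi tphi; have [_ [C [k Hk]]] := dg.
have bound e : 0 < e -> `|g phi| <= C * e.
  move=> e0; have [N HN] := pS_uniform_all k tphi e0.
  have tS := test_fun_tp N (fc (on_cube phi)) (fs (on_cube phi)).
  have -> : g phi = g ((-1) *: pS (on_cube phi) N + phi).
    rewrite (distr_lin (-1) tS tphi) distr_tp /bsum big1 ?mulr0 ?add0r// => xi _.
    by rewrite gc gs !mulr0 addr0.
  apply: Hk; first exact: (test_funD (-1) tS tphi).
  by move=> s x sk; exact: HN.
apply/eqP; rewrite -normr_eq0 eq_le normr_ge0 andbT leNgt; apply/negP => g0.
have [C0|C0] := leP C 0.
  have := bound 1 ltr01; rewrite mulr1 => h; have := lt_le_trans g0 h.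
  by rewrite ltNge C0.
have := bound (`|g phi| / (2 * C)) (divr_gt0 g0 (mulr_gt0 (ltr0Sn R 1) C0)).
have -> : C * (`|g phi| / (2 * C)) = `|g phi| / 2 by field; rewrite gt_eqF.
lra.
Qed.

End linear.
End distributions.
End fourier_uniform.

(** * Square-integrable representatives *)

Section l2_representation.
Variables (R : realType) (n : nat).
Local Notation mR := (measurableTypeR R).
Local Notation cube := (@cube_leb R n).
Local Notation Zn := 'rV[int]_n.
Local Notation Rn := 'rV[R]_n.
Local Notation distr := ((Rn -> R) -> R).

Definition ecoef (g : distr) (xi : Zn) : R := g (cs xi) ^+ 2 + g (sn xi) ^+ 2.

Lemma ecoef_ge0 g xi : 0 <= ecoef g xi.
Proof. by rewrite addr_ge0 ?sqr_ge0. Qed.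

Lemma normc_hat g xi : Normc.normc (hat g xi) ^+ 2 = ecoef g xi.
Proof.
rewrite /hat /Normc.normc sqr_sqrtr; first by rewrite sqrrN.
by rewrite addr_ge0 ?sqr_ge0.
Qed.

Lemma hsqnormE s g : hsqnorm s g =
  (\esum_(xi in [set: Zn]) (rho R xi `^ (2 * s) * ecoef g xi)%:E)%E.
Proof. by apply: eq_esum => xi _; rewrite normc_hat. Qed.

Lemma hsqnorm0E g : hsqnorm 0 g = (\esum_(xi in [set: Zn]) (ecoef g xi)%:E)%E.
Proof. by rewrite hsqnormE; apply: eq_esum => xi _; rewrite mulr0 powRr0 mul1r. Qed.

Lemma csN_even (g : distr) : evenZ (fun xi => g (cs xi)).
Proof. by move=> xi; rewrite csN. Qed.

Lemma snN_odd (g : distr) : is_distr g -> oddZ (fun xi => g (sn xi)).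
Proof. by move=> dg xi; exact: distr_snN. Qed.

Lemma is_distr_lin (c : R) (g h : distr) : is_distr g -> is_distr h ->
  is_distr (fun phi => c * g phi + h phi).
Proof.
move=> [lg [C [N gC]]] [lh [D [M hD]]]; split.
  by move=> k phi psi tphi tpsi; rewrite (lg k _ _ tphi tpsi) (lh k _ _ tphi tpsi); ring.
exists (`|c| * C + D), (maxn N M) => phi B tphi HB.
apply: le_trans (ler_normD _ _) _; rewrite normrM mulrDl -mulrA.
apply: lerD; [apply: ler_wpM2l => //; apply: gC tphi _|apply: hD tphi _] => s x sN.
  by apply: HB; rewrite (leq_trans sN)// leq_maxl.
by apply: HB; rewrite (leq_trans sN)// leq_maxr.
Qed.

Lemma is_distr_distr_of (h : Rn -> R) (G : n.-tuple mR -> R) :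
  cube.-integrable setT (EFin \o G) -> {ae cube, forall x, on_cube h x = G x} ->
  is_distr (distr_of h) /\
  forall phi, test_fun phi -> distr_of h phi = \int[cube]_x (G x * on_cube phi x).
Proof.
move=> iG hG.
have E phi : distr_of h phi = \int[cube]_x (G x * on_cube phi x).
  by apply: ae_eq_Rintegral_nm; apply: aeS hG => x -> _.
split; last by move=> phi _; exact: E.
split.
  move=> c phi psi tphi tpsi; rewrite !E.
  have ip := integrableM_bnd iG (test_fun_bnd_meas tphi).
  have iq := integrableM_bnd iG (test_fun_bnd_meas tpsi).
  rewrite -RintegralZl// -RintegralD//; last exact: integrable_funZ.
  apply: eq_Rintegral => x _; rewrite /on_cube.
  rewrite -[(_ + _) (row_of x)]/(c * phi (row_of x) + psi (row_of x)); ring.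
exists (\int[cube]_x `|G x|), 0%N => phi B tphi HB; rewrite E.
have ip := integrableM_bnd iG (test_fun_bnd_meas tphi).
apply: le_trans (le_normr_Rintegral _ ip) _ => //.
rewrite -RintegralZr//; last exact: integrable_norm.
apply: le_Rintegral => //; first exact: integrable_norm ip.
  have := integrable_funZ B (integrable_norm iG).
  by apply: eq_integrable => // x _ /=; rewrite mulrC.
move=> x _; rewrite normrM ler_wpM2l//; exact: (HB [::] (row_of x) (leq0n _)).
Qed.

(** Composition with the fractional parts extends a function on the cube to a periodic one. *)
Definition frac_tuple (x : Rn) : n.-tuple mR :=
  [tuple x 0 i - (Num.floor (x 0 i))%:~R | i < n].

Lemma frac_tuple_periodic (G : n.-tuple mR -> R) :
  periodic (fun x => G (frac_tuple x)).
Proof.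
move=> x m; congr G; apply: eq_from_tnth => i; rewrite !tnth_mktuple !mxE.
rewrite floorDrz ?intr_int// intrKfloor intrD; ring.
Qed.

Lemma frac_tuple_ae (G : n.-tuple mR -> R) :
  {ae cube, forall x, on_cube (fun x => G (frac_tuple x)) x = G x}.
Proof.
apply: aeS (ae_cube R n) => x x01; rewrite /on_cube; congr G.
apply: eq_from_tnth => i; rewrite tnth_mktuple mxE.
have /andP[x0 x1] := x01 i.
by rewrite (@floor_def _ _ 0) ?subr0// add0r x0.
Qed.

Lemma L2per_rep (h : Rn -> R) : L2per h -> exists G : n.-tuple mR -> R,
  sq_int cube G /\ {ae cube, forall x, on_cube h x = G x}.
Proof.
move=> [_ [G mG hG] hoo]; exists G; split; last by apply: aeS hG => x /(_ I).
split => //; apply: le_lt_trans hoo; rewrite le_eqVlt; apply/orP; left; apply/eqP.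
by apply: ae_eq_integral_nm; apply: aeS hG => x /(_ I) -> _.
Qed.

(** Riesz-Fischer gives a function on the cube with the coefficients of [g]. Its periodic extension
    represents a distribution with these same coefficients, and [distr_vanish] applies to the
    difference. *)
Lemma L2per_exists (g : distr) : Hs 0 g -> exists h, L2per h /\ deq g (distr_of h).
Proof.
move=> [dg]; rewrite hsqnorm0E => goo.
have bM N : bsum (ecoef g) N <= fine (\esum_(xi in [set: Zn]) (ecoef g xi)%:E)%E.
  exact: bsum_le_fine (ecoef_ge0 g) goo.
have [G [G2 Gc Gs _]] := riesz_fischer (csN_even g) (snN_odd dg) bM.
pose h x := G (frac_tuple x).
have hG := frac_tuple_ae G.
have iG := sq_int_int G2.
have [dh hE] := is_distr_distr_of iG hG.
exists h; split.
  split; first exact: frac_tuple_periodic.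
    by exists G; [case: G2|apply: aeS hG].
  case: G2 => _; apply: le_lt_trans; rewrite le_eqVlt; apply/orP; left; apply/eqP.
  by apply: ae_eq_integral_nm; apply: aeS hG => x -> _.
move=> phi tphi; apply/eqP; rewrite -subr_eq0 addrC -mulN1r.
have dd : is_distr (fun phi => -1 * distr_of h phi + g phi) by exact: is_distr_lin.
apply/eqP; apply: (distr_vanish dd) tphi => xi.
  by rewrite (hE _ (test_fun_cs R xi)) -/(fc G xi) Gc mulN1r addNr.
by rewrite (hE _ (test_fun_sn R xi)) -/(fs G xi) Gs mulN1r addNr.
Qed.

(** All later use of the choice made by [l2fun] goes through this measurable representative on the
    cube. *)
Lemma l2fun_spec (g : distr) : Hs 0 g -> exists G : n.-tuple mR -> R,
  [/\ sq_int cube G, {ae cube, forall x, on_cube (l2fun g) x = G x},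
   (fc G =1 fun xi => g (cs xi)) & (fs G =1 fun xi => g (sn xi))].
Proof.
move=> /L2per_exists[h hP].
have [L2l gl] : [set h | L2per h /\ deq g (distr_of h)] (l2fun g) by exact: xgetI hP.
have [G [G2 lG]] := L2per_rep L2l; exists G; split => //.
  move=> xi; rewrite (gl _ (test_fun_cs R xi)).
  by have [_ ->//] := is_distr_distr_of (sq_int_int G2) lG; exact: test_fun_cs.
move=> xi; rewrite (gl _ (test_fun_sn R xi)).
by have [_ ->//] := is_distr_distr_of (sq_int_int G2) lG; exact: test_fun_sn.
Qed.

Lemma sq_int_ecoef (G : n.-tuple mR -> R) : sq_int cube G ->
  (\esum_(xi in [set: Zn]) (fc G xi ^+ 2 + fs G xi ^+ 2)%:E =
   (\int[cube]_x (G x ^+ 2))%:E)%E.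
Proof.
move=> G2.
have F0 xi : 0 <= fc G xi ^+ 2 + fs G xi ^+ 2 by rewrite addr_ge0 ?sqr_ge0.
have h1 := esum_cvgE F0.
have h2 : (fun N => (bsum (fun xi => fc G xi ^+ 2 + fs G xi ^+ 2) N)%:E) @ \oo -->
   (\int[cube]_x (G x ^+ 2))%:E.
  by apply: cvg_EFin; [exact: nearW|exact: parseval_sum].
exact: (cvg_unique _ h1 h2).
Qed.

(** The real part of [hat g xi * hat h (- xi)], once the parity of the coefficients of [h] has been
    used. *)
Definition dterm (g h : distr) (xi : Zn) : R :=
  g (cs xi) * h (cs xi) + g (sn xi) * h (sn xi).

Lemma dualE (g h : distr) : is_distr h -> dual g h = abs_sum (dterm g h).
Proof.
move=> dh; congr abs_sum; apply/funext => xi.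
rewrite /hat /= -/(cs xi) -/(sn xi) -/(cs (- xi)) -/(sn (- xi)) csN.
by rewrite (distr_snN dh) opprK /dterm mulNr opprK.
Qed.

End l2_representation.

(** * Derivatives, divergence and projection in Fourier coefficients *)

Section distribution_calculus.
Variables (R : realType) (n : nat).
Local Notation mR := (measurableTypeR R).
Local Notation cube := (@cube_leb R n).
Local Notation Zn := 'rV[int]_n.
Local Notation Rn := 'rV[R]_n.
Local Notation distr := ((Rn -> R) -> R).
Local Notation vdistr := ('I_n -> distr).

Lemma is_distr_dpartial (j : 'I_n) (g : distr) : is_distr g ->
  is_distr (dpartial j g).
Proof.
move=> [lg [C [N gC]]]; split.
  move=> c phi psi tphi tpsi; rewrite /dpartial partialD; last 2 first.
  - exact: test_fun_derivable tphi.
  - exact: test_fun_derivable tpsi.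
  rewrite (lg _ _ _ (test_fun_partial j tphi) (test_fun_partial j tpsi)); ring.
exists C, N.+1 => phi B tphi HB; rewrite normrN.
apply: gC (test_fun_partial j tphi) _ => s x sN.
by rewrite -partials_rcons; apply: HB; rewrite size_rcons.
Qed.

Lemma dpartial_cs (j : 'I_n) (g : distr) xi : is_distr g ->
  dpartial j g (cs xi) = freq R xi j * g (sn xi).
Proof.
move=> dg; rewrite /dpartial partial_cs (distrZ dg _ (test_fun_sn R xi)).
by rewrite mulNr opprK.
Qed.

Lemma dpartial_sn (j : 'I_n) (g : distr) xi : is_distr g ->
  dpartial j g (sn xi) = - (freq R xi j * g (cs xi)).
Proof. by move=> dg; rewrite /dpartial partial_sn (distrZ dg _ (test_fun_cs R xi)). Qed.

Lemma strain_lin (v : vdistr) (j b : 'I_n) : strain v j b =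
  fun phi => 2^-1 * dpartial j (v b) phi + (2^-1 * dpartial b (v j) phi + 0).
Proof. by apply/funext => phi; rewrite /strain addr0 mulrDr. Qed.

Lemma is_distr0 : is_distr ((fun=> 0) : distr).
Proof.
split; first by move=> *; rewrite mulr0 addr0.
by exists 0, 0%N => *; rewrite normr0 mul0r.
Qed.

Lemma is_distr_strain (v : vdistr) (j b : 'I_n) : (forall k, is_distr (v k)) ->
  is_distr (strain v j b).
Proof.
move=> dv; rewrite strain_lin.
apply: is_distr_lin; first exact: is_distr_dpartial.
apply: is_distr_lin; [exact: is_distr_dpartial|exact: is_distr0].
Qed.

Lemma strain_cs (v : vdistr) (j b : 'I_n) xi : (forall k, is_distr (v k)) ->
  strain v j b (cs xi) =
  2^-1 * (freq R xi j * v b (sn xi) + freq R xi b * v j (sn xi)).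
Proof. by move=> dv; rewrite /strain !dpartial_cs. Qed.

Lemma strain_sn (v : vdistr) (j b : 'I_n) xi : (forall k, is_distr (v k)) ->
  strain v j b (sn xi) =
  - (2^-1 * (freq R xi j * v b (cs xi) + freq R xi b * v j (cs xi))).
Proof. by move=> dv; rewrite /strain !dpartial_sn// -opprD mulrN. Qed.

Lemma divE (v : vdistr) phi : div v phi = - \sum_j v j (partial j phi).
Proof.
rewrite /div -sumrN; elim/big_rec2: _ => // j x y _ <-; exact: erefl.
Qed.

Lemma is_distr_div (v : vdistr) : (forall k, is_distr (v k)) -> is_distr (div v).
Proof.
move=> dv; rewrite /div; elim/big_rec: _ => [|j x _ dx]; first exact: is_distr0.
rewrite (_ : _ + x = fun phi => 1 * dpartial j (v j) phi + x phi).
  by apply: is_distr_lin => //; exact: is_distr_dpartial.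
by apply/funext => phi; rewrite mul1r.
Qed.

Lemma div_coef (v : vdistr) xi : (forall k, is_distr (v k)) ->
  div v (cs xi) = \sum_j freq R xi j * v j (sn xi) /\
  div v (sn xi) = - \sum_j freq R xi j * v j (cs xi).
Proof.
move=> dv; rewrite !divE; split.
  rewrite -sumrN; apply: eq_bigr => j _; exact: dpartial_cs.
congr (- _); apply: eq_bigr => j _.
by rewrite partial_sn (distrZ (dv j) _ (test_fun_cs R xi)).
Qed.

Lemma sol_coef (v : vdistr) xi : (forall k, is_distr (v k)) -> deq (div v) 0 ->
  \sum_j freq R xi j * v j (sn xi) = 0 /\ \sum_j freq R xi j * v j (cs xi) = 0.
Proof.
move=> dv d0; have [hc hs] := div_coef xi dv.
have := d0 _ (test_fun_cs R xi); rewrite hc => ->; split => //.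
by have := d0 _ (test_fun_sn R xi); rewrite hs => /eqP; rewrite oppr_eq0 => /eqP.
Qed.

Definition tpf N (A B : 'I_n -> Zn -> R) : vdistr :=
  fun k => distr_of (tp N (A k) (B k)).

Lemma distr_of_bnd (h : Rn -> R) : bnd_meas (on_cube h) -> is_distr (distr_of h).
Proof.
move=> bh.
have hh : {ae cube, forall x, on_cube h x = on_cube h x} by exact: aeW.
by have [] := is_distr_distr_of (bnd_meas_integrable _ bh) hh.
Qed.

Lemma tpf_distr N A B k : is_distr (tpf N A B k).
Proof. exact/distr_of_bnd/tp_bnd. Qed.

Lemma tpf_cs N A B k xi : evenZ (A k) ->
  tpf N A B k (cs xi) = if xi \in box n N then A k xi else 0.
Proof. by move=> eA; exact: (fc_tp _ _ _ eA). Qed.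

Lemma tpf_sn N A B k xi : oddZ (B k) ->
  tpf N A B k (sn xi) = if xi \in box n N then B k xi else 0.
Proof. by move=> oB; exact: (fs_tp _ _ _ oB). Qed.

Lemma esum_box_supp (F : Zn -> R) N : (forall xi, 0 <= F xi) ->
  (forall xi, xi \notin box n N -> F xi = 0) ->
  (\esum_(xi in [set: Zn]) (F xi)%:E <= (bsum F N)%:E)%E.
Proof.
move=> F0 Fs; apply: esum_box_le => // M; rewrite lee_fin.
apply: le_trans (bsum_nd F0 (leq_maxr N M)) _.
rewrite /bsum (bigID (mem (box n N)))/= [X in _ + X]big1 => [|xi]; last exact: Fs.
rewrite addr0 -big_filter; apply: ler_sum_sub => //.
  by rewrite filter_uniq ?box_uniq.
by move=> xi; rewrite mem_filter => /andP[].
Qed.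

Lemma tpf_sol s N A B : (forall k, evenZ (A k)) -> (forall k, oddZ (B k)) ->
  (forall k, A k 0 = 0) ->
  (forall xi, \sum_k freq R xi k * A k xi = 0) ->
  (forall xi, \sum_k freq R xi k * B k xi = 0) ->
  vHdot_sol s (tpf N A B).
Proof.
move=> eA oB A0 fA fB; have dt := tpf_distr N A B; split.
  move=> k; split.
    split => //; rewrite hsqnormE.
    apply: (@le_lt_trans _ _ _ _ _ (esum_box_supp (N := N) _ _)); last exact: ltry.
      by move=> xi; rewrite mulr_ge0 ?powR_ge0 ?ecoef_ge0.
    move=> xi xN; rewrite /ecoef tpf_cs// tpf_sn// (negbTE xN).
    by rewrite expr0n addr0 mulr0.
  rewrite /hat -/(cs 0) -/(sn 0) tpf_cs// tpf_sn// box0 A0.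
  (* Oddness forces the sine coefficient at frequency 0 to vanish. *)
  have : B k 0 = - B k 0 by rewrite -{1}[0]oppr0 oB.
  by move=> /eqP; rewrite -addr_eq0 -mulr2n mulrn_eq0 /= => /eqP ->; rewrite oppr0.
move=> phi tphi; apply: (distr_vanish (is_distr_div dt)) tphi => xi.
  have [-> _] := div_coef xi dt.
  under eq_bigr do rewrite tpf_sn//.
  by case: (xi \in box n N); [exact: fB|rewrite big1 // => j _; rewrite mulr0].
have [_ ->] := div_coef xi dt.
under eq_bigr do rewrite tpf_cs//.
case: (xi \in box n N); first by rewrite fA oppr0.
by rewrite big1 ?oppr0// => j _; rewrite mulr0.
Qed.

Lemma vHdot_distr s (v : vdistr) : vHdot s v -> forall k, is_distr (v k).
Proof. by move=> Hv k; have [[]] := Hv k. Qed.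

Lemma vHdot_coef0 s (v : vdistr) k : vHdot s v -> v k (cs 0) = 0.
Proof. by move=> /(_ k)[_] /eqP; rewrite eq_complex /= => /andP[/eqP]. Qed.

Lemma vdual_tpf (g : vdistr) N A B : (forall k, evenZ (A k)) ->
  (forall k, oddZ (B k)) ->
  vdual g (tpf N A B) =
  \sum_k bsum (fun xi => A k xi * g k (cs xi) + B k xi * g k (sn xi)) N.
Proof.
move=> eA oB; apply: eq_bigr => k _; rewrite dualE; last exact: tpf_distr.
rewrite (@abs_sum_box _ _ _ N) => [|xi xN].
  rewrite /bsum !big_seq; apply: eq_bigr => xi xN.
  by rewrite /dterm tpf_cs// tpf_sn// xN mulrC [X in _ + X]mulrC.
by rewrite /dterm tpf_cs// tpf_sn// (negbTE xN) !mulr0 addr0.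
Qed.

(** Testing with the truncated field multiplied by [rho ^ (- 2 s)] extracts the
    coefficients of the projection without constructing it. The second
    alternative is the case where there is no projection and [leray g] is the
    junk value [0]. *)
Lemma leray_dual (g : vdistr) A B : (forall k, evenZ (A k)) ->
  (forall k, oddZ (B k)) -> (forall k, A k 0 = 0) ->
  (forall xi, \sum_k freq R xi k * A k xi = 0) ->
  (forall xi, \sum_k freq R xi k * B k xi = 0) ->
  (forall N, vdual (leray g) (tpf N A B) = vdual g (tpf N A B)) \/
  (forall M, vdual (leray g) (tpf M A B) = 0).
Proof.
move=> eA oB A0 fA fB.
have [[h gh]|nh] := pselect (exists h, is_leray g h); last first.
  right=> M; rewrite (_ : leray g = 0).
    rewrite vdual_tpf// big1// => k _; rewrite /bsum big1// => xi _.
    by rewrite -[X in A k xi * X + _]/(0 : R) -[X in _ + B k xi * X]/(0 : R) !mulr0 addr0.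
  by apply: xgetPN => h gh; apply: nh; exists h.
left=> N; have {h gh} : is_leray g (leray g) by apply: (xgetI 0 gh).
move: (leray g) => h [s [Hg Hh orth]].
have rN xi : rho R (- xi) = rho R xi.
  by rewrite /rho; congr (_ * Num.sqrt (_ + _)); apply: eq_bigr => i _; rewrite mxE intrN sqrrN.
have r0 xi : 0 < rho R xi.
  rewrite /rho !mulr_gt0 ?pi_gt0// sqrtr_gt0 ltr_pwDl// sumr_ge0// => i _.
  exact: sqr_ge0.
pose A' k xi := (rho R xi `^ (2 * s))^-1 * A k xi.
pose B' k xi := (rho R xi `^ (2 * s))^-1 * B k xi.
have eA' k : evenZ (A' k) by move=> xi; rewrite /A' rN eA.
have oB' k : oddZ (B' k) by move=> xi; rewrite /B' rN oB mulrN.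
have w' : vHdot_sol s (tpf N A' B').
  apply: tpf_sol => //.
  - by move=> k; rewrite /A' A0 mulr0.
  - move=> xi; transitivity ((rho R xi `^ (2 * s))^-1 * \sum_k freq R xi k * A k xi).
      by rewrite mulr_sumr; apply: eq_bigr => k _; rewrite /A'; ring.
    by rewrite fA mulr0.
  - move=> xi; transitivity ((rho R xi `^ (2 * s))^-1 * \sum_k freq R xi k * B k xi).
      by rewrite mulr_sumr; apply: eq_bigr => k _; rewrite /B'; ring.
    by rewrite fB mulr0.
have := orth _ w'; rewrite /vhinner.
rewrite (eq_bigr (fun k => bsum (fun xi => A k xi * (g k (cs xi) - h k (cs xi)) +
    B k xi * (g k (sn xi) - h k (sn xi))) N)); last first.
  move=> k _; rewrite (@abs_sum_box _ _ _ N) => [|xi xN].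
    rewrite /bsum !big_seq; apply: eq_bigr => xi xN.
    rewrite /hat /= -/(cs xi) -/(sn xi) tpf_cs// tpf_sn// xN /A' /B'.
    rewrite -[(g - h) k (cs xi)]/(g k (cs xi) - h k (cs xi)).
    rewrite -[(g - h) k (sn xi)]/(g k (sn xi) - h k (sn xi)).
    have p0 : rho R xi `^ (2 * s) != 0 by rewrite gt_eqF// powR_gt0.
    by move: (_ `^ _) p0 => p p0; field.
  rewrite /hat /= -/(cs xi) -/(sn xi) tpf_cs// tpf_sn// (negbTE xN).
  by rewrite !(oppr0, mulr0, subr0).
rewrite !vdual_tpf// => H; apply/eqP; rewrite -subr_eq0 -oppr_eq0 opprB.
apply/eqP; rewrite -[RHS]H -sumrB; apply: eq_bigr => k _.
rewrite /bsum -sumrB; apply: eq_bigr => xi _; ring.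
Qed.

End distribution_calculus.

(** * The trilinear estimate *)

Section trilinear.
Variables (R : realType) (n : nat).
Local Notation mR := (measurableTypeR R).
Local Notation cube := (@cube_leb R n).
Local Notation Zn := 'rV[int]_n.
Local Notation Rn := 'rV[R]_n.
Local Notation intg f := (cube.-integrable setT (EFin \o f)).

(** The number of frequencies no larger than [xi], dominated by the weight of the squared H^{n/2}
    norm. *)
Definition zweight (xi : Zn) : R := ((znorm xi).*2.+1 ^ n)%N%:R.

Lemma zweight_ge0 xi : 0 <= zweight xi.
Proof. exact: ler0n. Qed.

Lemma integral_bnd_mul (b g r : n.-tuple mR -> R) (be : R) : bnd_meas b ->
  (forall x, `|b x| <= be) -> sq_int cube g -> sq_int cube r ->
  `|\int[cube]_x (b x * g x * r x)| <=
  be * Num.sqrt (\int[cube]_x (g x ^+ 2)) * Num.sqrt (\int[cube]_x (r x ^+ 2)).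
Proof.
move=> bb bbe g2 r2.
have be0 : 0 <= be by apply: le_trans (bbe point); exact: normr_ge0.
have bg2 : sq_int cube (fun x => b x * g x).
  by apply: eq_sq_int (sq_intM_bnd g2 bb) => x; rewrite mulrC.
apply: le_trans (cauchy_schwarz bg2 r2) _; rewrite ler_wpM2r ?sqrtr_ge0//.
rewrite -[X in X * _]ger0_norm// -sqrtr_sqr -sqrtrM ?sqr_ge0// ler_wsqrtr//.
rewrite -RintegralZl//; last exact: sq_int_sqr.
apply: le_Rintegral => //; first exact: sq_int_sqr.
  exact/integrable_funZ/sq_int_sqr.
move=> x _; rewrite exprMn ler_wpM2r ?sqr_ge0// -[X in X <= _]real_normK ?num_real//.
by rewrite ler_sqr ?nnegrE.
Qed.

(** Here [n / 2] enters: there are at most [zweight eta] frequencies [xi] no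
    larger than [eta]. *)
Lemma low_high_sum (A B c : Zn -> R) M N : (forall xi, 0 <= c xi) ->
  \sum_(xi <- box n M) (`|A xi| + `|B xi|) *
    Num.sqrt (bsum (fun eta => (znorm xi <= znorm eta)%N%:R * c eta) N) <=
  Num.sqrt (2 * bsum (fun xi => A xi ^+ 2 + B xi ^+ 2) M) *
  Num.sqrt (bsum (fun eta => zweight eta * c eta) N).
Proof.
move=> c0; apply: le_trans (ler_norm _) _.
apply: le_trans (sum_cauchy_schwarz _ _ _) _.
apply: ler_pM; rewrite ?sqrtr_ge0//; apply: ler_wsqrtr.
  rewrite /bsum mulr_sumr; apply: ler_sum => xi _.
  rewrite -[A xi ^+ 2]real_normK ?num_real// -[B xi ^+ 2]real_normK ?num_real//.
  have := sqr_ge0 (`|A xi| - `|B xi|); nra.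
rewrite (eq_bigr (fun xi => bsum (fun eta => (znorm xi <= znorm eta)%N%:R * c eta) N));
  last first.
  by move=> xi _; rewrite sqr_sqrtr// bsum_ge0// => eta; rewrite mulr_ge0.
rewrite /bsum exchange_big /=; apply: ler_sum => eta _.
rewrite -mulr_suml ler_wpM2r// -natr_sum ler_nat.
apply: leq_trans (count_znorm n M (znorm eta)).
by rewrite -sum1_count [leqRHS]big_mkcond /= leq_sum// => xi _; case: (_ <= _)%N.
Qed.

(** The terms of the product of the two polynomials are grouped according to
    which factor has the larger frequency. *)
Lemma trilinear_tp (A B C D : Zn -> R) M N (r : n.-tuple mR -> R) :
  evenZ A -> oddZ B -> evenZ C -> oddZ D -> sq_int cube r ->
  `|\int[cube]_x (on_cube (tp M A B) x * on_cube (tp N C D) x * r x)| <=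
  (Num.sqrt (2 * bsum (fun xi => A xi ^+ 2 + B xi ^+ 2) M) *
   Num.sqrt (bsum (fun xi => zweight xi * (C xi ^+ 2 + D xi ^+ 2)) N) +
   Num.sqrt (2 * bsum (fun xi => C xi ^+ 2 + D xi ^+ 2) N) *
   Num.sqrt (bsum (fun xi => zweight xi * (A xi ^+ 2 + B xi ^+ 2)) M)) *
  Num.sqrt (\int[cube]_x (r x ^+ 2)).
Proof.
move=> eA oB eC oD r2.
pose hi (E : Zn -> R) (z : nat) eta := (z <= znorm eta)%N%:R * E eta.
have ehi E z : evenZ E -> evenZ (hi E z) by move=> eE xi; rewrite /hi znormN eE.
have ohi E z : oddZ E -> oddZ (hi E z) by move=> oE xi; rewrite /hi znormN oE mulrN.
pose t (E F : Zn -> R) xi (x : n.-tuple mR) :=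
  E xi * on_cube (cs xi) x + F xi * on_cube (sn xi) x.
have tb E F xi : bnd_meas (t E F xi).
  exact: (test_fun_bnd_meas (test_fun_trig xi (E xi) (F xi))).
have tle E F xi x : `|t E F xi x| <= `|E xi| + `|F xi|.
  apply: le_trans (ler_normD _ _) _; rewrite !normrM; apply: lerD.
    by rewrite ler_piMr// cs_le1.
  by rewrite ler_piMr// sn_le1.
(* Pairs of frequencies of equal size belong to the first sum, whence the successor in the
   second. *)
have split x : on_cube (tp M A B) x * on_cube (tp N C D) x * r x =
    \sum_(xi <- box n M)
       t A B xi x * on_cube (tp N (hi C (znorm xi)) (hi D (znorm xi))) x * r x +
    \sum_(eta <- box n N)
       t C D eta x * on_cube (tp M (hi A (znorm eta).+1) (hi B (znorm eta).+1)) x * r x.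
  rewrite -!mulr_suml -mulrDl; congr (_ * _).
  rewrite [X in _ = _ + X](eq_bigr (fun eta => \sum_(xi <- box n M)
      (znorm eta < znorm xi)%N%:R * (t A B xi x * t C D eta x))); last first.
    move=> eta _; rewrite /on_cube /tp mulr_sumr; apply: eq_bigr => xi _.
    by rewrite /hi /t /on_cube; ring.
  rewrite exchange_big /= -big_split /= /on_cube {1}/tp mulr_suml.
  apply: eq_bigr => xi _; rewrite -[A xi * _ + _]/(t A B xi x) /tp !mulr_sumr -big_split.
  apply: eq_bigr => eta _ /=; rewrite /hi -[C eta * _ + _]/(t C D eta x).
  rewrite (_ : _ * C eta * _ + _ = (znorm xi <= znorm eta)%N%:R * t C D eta x); last first.
    by rewrite /t /on_cube; ring.
  by case: leqP => _ /=; ring.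
have iF E F xi g : sq_int cube g -> intg (fun x => t E F xi x * g x * r x).
  move=> g2; apply: sq_int_mul => //.
  by apply: eq_sq_int (sq_intM_bnd g2 (tb E F xi)) => x; rewrite mulrC.
under eq_Rintegral do rewrite split.
(* The threshold [z xi] stands for [znorm xi] in one half and for its successor in the other; only
   [znorm xi <= z xi] matters. *)
have half K L (E F G H : Zn -> R) (z : Zn -> nat) : evenZ G -> oddZ H ->
    (forall xi, znorm xi <= z xi)%N ->
  `|\int[cube]_x \sum_(xi <- box n K)
       t E F xi x * on_cube (tp L (hi G (z xi)) (hi H (z xi))) x * r x| <=
  Num.sqrt (2 * bsum (fun xi => E xi ^+ 2 + F xi ^+ 2) K) *
  Num.sqrt (bsum (fun xi => zweight xi * (G xi ^+ 2 + H xi ^+ 2)) L) *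
  Num.sqrt (\int[cube]_x (r x ^+ 2)).
  move=> eG oH zz; rewrite Rintegral_sum; last first.
    by move=> xi _; apply: iF; exact: tp_sq_int.
  apply: le_trans (ler_norm_sum _ _ _) _.
  apply: (@le_trans _ _ (\sum_(xi <- box n K) (`|E xi| + `|F xi|) *
    Num.sqrt (bsum (fun eta => (znorm xi <= znorm eta)%N%:R *
      (G eta ^+ 2 + H eta ^+ 2)) L) * Num.sqrt (\int[cube]_x (r x ^+ 2)))).
    apply: ler_sum => xi _.
    apply: le_trans (integral_bnd_mul (tb E F xi) (tle E F xi) (tp_sq_int _ _ _) r2) _.
    rewrite ler_wpM2r ?sqrtr_ge0// ler_wpM2l ?addr_ge0// ler_wsqrtr//.
    rewrite integral_tp_sqr; [|exact: ehi|exact: ohi].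
    apply: ler_sum => eta _; rewrite /hi !exprMn -mulrDr ler_wpM2r ?addr_ge0 ?sqr_ge0//.
    have := zz xi; case: (leqP (z xi) (znorm eta)) => [zx xz|_ _].
      by rewrite (leq_trans xz zx) expr1n.
    by rewrite expr0n ler0n.
  rewrite -mulr_suml ler_wpM2r ?sqrtr_ge0// low_high_sum// => xi.
  by rewrite addr_ge0 ?sqr_ge0.
rewrite RintegralD//; last 2 first.
- by apply: integrable_sum => xi _; apply: iF; exact: tp_sq_int.
- by apply: integrable_sum => xi _; apply: iF; exact: tp_sq_int.
apply: le_trans (ler_normD _ _) _; rewrite mulrDl; apply: lerD; first exact: half.
by apply: (half N M C D A B (fun eta => (znorm eta).+1)).
Qed.

End trilinear.

(** * The convective term tested with truncations *)

Section trilinear_limit.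
Variables (R : realType) (n : nat).
Local Notation mR := (measurableTypeR R).
Local Notation cube := (@cube_leb R n).
Local Notation Zn := 'rV[int]_n.
Local Notation Rn := 'rV[R]_n.
Local Notation intg f := (cube.-integrable setT (EFin \o f)).
Local Notation l2 f := (Num.sqrt (\int[cube]_x (f x ^+ 2))).
Local Notation zw := (@zweight R n).

Lemma cvg_sqrt0 (s : nat -> R) : s @ \oo --> (0 : R) ->
  (fun k => Num.sqrt (s k)) @ \oo --> (0 : R).
Proof.
by move=> s0; rewrite -[X in _ --> X]sqrtr0; apply: continuous_cvg => //; exact: sqrt_continuous.
Qed.

Lemma le_cvgn (s : nat -> R) (x y : R) : (forall N, x <= s N) -> s @ \oo --> y ->
  x <= y.
Proof.
move=> xs sy; rewrite -(cvg_lim _ sy)//; apply: limr_ge; first by apply/cvg_ex; exists y.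
by apply: nearW => N; exact: xs.
Qed.

Lemma cvgn_sum (I : Type) (s : seq I) (F : I -> nat -> R) (l : I -> R) :
  (forall i, F i @ \oo --> l i) ->
  (fun N => \sum_(i <- s) F i N) @ \oo --> \sum_(i <- s) l i.
Proof.
move=> Fl; elim: s => [|i s IH].
  by rewrite big_nil; under eq_fun do rewrite big_nil; exact: cvg_cst.
by rewrite big_cons; under eq_fun do rewrite big_cons; exact: cvgD.
Qed.

Lemma cvg0_le (a b : nat -> R) : (forall N, `|a N| <= b N) -> b @ \oo --> (0 : R) ->
  a @ \oo --> (0 : R).
Proof.
move=> ab b0; apply: (@squeeze_cvgr _ _ _ _ (fun N => - b N) b).
- by apply: nearW => N; rewrite -ler_norml.
- by rewrite -oppr0; exact: cvgN.
- exact: b0.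
Qed.

(** [G] is replaced by its partial sums, to which [trilinear_tp] applies with bounds independent of
    [M]. The error vanishes by Parseval, since the polynomial factor is bounded and keeps [q * r]
    square integrable. *)
Lemma trilinear (G r : n.-tuple mR -> R) (C D : Zn -> R) N L : sq_int cube G ->
  sq_int cube r -> evenZ C -> oddZ D ->
  (forall M, bsum (fun xi => zw xi * (fc G xi ^+ 2 + fs G xi ^+ 2)) M <= L) ->
  `|\int[cube]_x (G x * on_cube (tp N C D) x * r x)| <=
  (Num.sqrt (2 * \int[cube]_x (G x ^+ 2)) *
   Num.sqrt (bsum (fun xi => zw xi * (C xi ^+ 2 + D xi ^+ 2)) N) +
   Num.sqrt (2 * bsum (fun xi => C xi ^+ 2 + D xi ^+ 2) N) * Num.sqrt L) * l2 r.
Proof.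
move=> G2 r2 eC oD GL; set K := _ * l2 r.
have iG := sq_int_int G2.
pose q := on_cube (tp N C D).
have qr2 : sq_int cube (fun x => q x * r x).
  by apply: eq_sq_int (sq_intM_bnd r2 (tp_bnd N C D)) => x; rewrite mulrC.
have step M : `|\int[cube]_x (G x * q x * r x)| <=
    K + l2 (fun x => G x - on_cube (pS G M) x) * l2 (fun x => q x * r x).
  have p2 : sq_int cube (on_cube (pS G M)) by exact: tp_sq_int.
  have -> : \int[cube]_x (G x * q x * r x) =
     \int[cube]_x (on_cube (pS G M) x * q x * r x) +
     \int[cube]_x ((G x - on_cube (pS G M) x) * (q x * r x)).
    rewrite -RintegralD//; last 2 first.
    - by apply: eq_integrable (sq_int_mul p2 qr2) => // x _ /=; rewrite mulrA.
    - exact: sq_int_mul (sq_intB G2 p2) qr2.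
    by apply: eq_Rintegral => x _; ring.
  apply: le_trans (ler_normD _ _) _; apply: lerD; last first.
    exact: cauchy_schwarz (sq_intB G2 p2) qr2.
  apply: le_trans (trilinear_tp _ _ (@fc_even R n G) (fs_odd iG) eC oD r2) _.
  rewrite ler_wpM2r ?sqrtr_ge0//; apply: lerD.
    by rewrite ler_wpM2r ?sqrtr_ge0// ler_wsqrtr// ler_wpM2l// bessel.
  by rewrite ler_wpM2l ?sqrtr_ge0// ler_wsqrtr.
apply: (le_cvgn step).
rewrite -[X in _ --> X]addr0; apply: cvgD; first exact: cvg_cst.
rewrite -[X in _ --> X](mul0r (l2 (fun x => q x * r x))); apply: cvgMl.
by apply: cvg_sqrt0; exact: parseval.
Qed.

(** [A] and [B] are the coefficients of a solenoidal field with components [U k], and [D j k] is the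
    derivative of the component [k] in direction [j]; the last two hypotheses express the vanishing
    divergence. *)
Variables (A B : 'I_n -> Zn -> R) (U : 'I_n -> n.-tuple mR -> R)
  (D : 'I_n -> 'I_n -> n.-tuple mR -> R).
Hypotheses (eA : forall k, evenZ (A k)) (oB : forall k, oddZ (B k))
  (U2 : forall k, sq_int cube (U k)) (Uc : forall k, fc (U k) =1 A k)
  (Us : forall k, fs (U k) =1 B k)
  (D2 : forall j k, sq_int cube (D j k))
  (Dc : forall j k xi, fc (D j k) xi = freq R xi j * B k xi)
  (Ds : forall j k xi, fs (D j k) xi = - (freq R xi j * A k xi))
  (fA : forall xi, \sum_k freq R xi k * A k xi = 0)
  (fB : forall xi, \sum_k freq R xi k * B k xi = 0).

Let W k N := tp N (A k) (B k).

(** The convective term of the field tested with its own truncation [W]. *)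
Definition tri N : R := \sum_k \sum_j
  \int[cube]_x (U j x * on_cube (W k N) x * D j k x).

Let e k xi := A k xi ^+ 2 + B k xi ^+ 2.
Let e0 k xi : 0 <= e k xi. Proof. by rewrite addr_ge0 ?sqr_ge0. Qed.
Let we0 k xi : 0 <= zw xi * e k xi.
Proof. by rewrite mulr_ge0 ?zweight_ge0. Qed.

Let eU k xi : fc (U k) xi ^+ 2 + fs (U k) xi ^+ 2 = e k xi.
Proof. by rewrite Uc Us. Qed.

Lemma tri_bound (m0 m1 L : R) N : (forall k, \int[cube]_x (U k x ^+ 2) <= m0) ->
  (forall j k, \int[cube]_x (D j k x ^+ 2) <= m1) ->
  (forall k M, bsum (fun xi => zw xi * e k xi) M <= L) ->
  `|tri N| <= (n * n)%:R * Num.sqrt (2 * m0) * (L + m1).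
Proof.
move=> Um Dm eL.
have p0 (x : R) : 0 <= Num.sqrt x by exact: sqrtr_ge0.
have one j k : `|\int[cube]_x (U j x * on_cube (W k N) x * D j k x)| <=
    Num.sqrt (2 * m0) * (L + m1).
  have GL M : bsum (fun xi => zw xi * (fc (U j) xi ^+ 2 + fs (U j) xi ^+ 2)) M <= L.
    by rewrite (eq_bsum (G := fun xi => zw xi * e j xi)) // => xi; rewrite eU.
  apply: le_trans (trilinear N (U2 j) (D2 j k) (eA k) (oB k) GL) _.
  apply: (@le_trans _ _ ((Num.sqrt (2 * m0) * Num.sqrt L + Num.sqrt (2 * m0) * Num.sqrt L)
      * Num.sqrt m1)).
    apply: ler_pM; rewrite ?addr_ge0 ?mulr_ge0//; last exact: ler_wsqrtr.
    apply: lerD.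
      by apply: ler_pM => //; apply: ler_wsqrtr; [rewrite ler_wpM2l|exact: eL].
    rewrite ler_wpM2r// ler_wsqrtr// ler_wpM2l//.
    rewrite (eq_bsum (G := fun xi => fc (U k) xi ^+ 2 + fs (U k) xi ^+ 2)).
      exact: le_trans (bessel _ (U2 k)) (Um k).
    by move=> xi; rewrite eU.
  have L0 : 0 <= L by apply: le_trans (eL j 0%N); apply: bsum_ge0.
  have m10 : 0 <= m1 by apply: le_trans (Dm j k); exact: Rintegral_sqr_ge0.
  (* With [L] and [m1] written as squares, the two equal terms are absorbed by
     [2 * x * y <= x ^+ 2 + y ^+ 2]. *)
  rewrite -[X in _ * (X + _)](sqr_sqrtr L0) -[X in _ * (_ + X)](sqr_sqrtr m10).
  have := sqr_ge0 (Num.sqrt L - Num.sqrt m1); have := p0 (2 * m0); nra.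
apply: le_trans (ler_norm_sum _ _ _) _.
apply: (@le_trans _ _ (\sum_(k < n) \sum_(j < n) Num.sqrt (2 * m0) * (L + m1))).
  apply: ler_sum => k _; apply: le_trans (ler_norm_sum _ _ _) _.
  by apply: ler_sum => j _; exact: one.
by rewrite !sumr_const card_ord -mulrnA -[leLHS]mulr_natl mulrA.
Qed.

Let dW j k N : partial j (W k N) = pS (D j k) N.
Proof.
rewrite partial_tp /pS /tp; apply/funext => x; apply: eq_bigr => xi _.
by rewrite Dc Ds.
Qed.

(** [W_j W_k] times the derivative of [W_k] in direction [j] is half of [W_j] times that of
    [W_k ^+ 2]. Integrating by parts and summing over [j] leaves the divergence of the truncated
    field, which vanishes frequency by frequency. *)
Lemma tri_cancel N : \sum_k \sum_j
  \int[cube]_x (on_cube (W j N) x * on_cube (W k N) x * on_cube (pS (D j k) N) x) = 0.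
Proof.
have C1 j k : C1per j (W k N) := test_fun_C1per j (test_fun_tp N (A k) (B k)).
have bW k : bnd_meas (on_cube (W k N)) by exact: tp_bnd.
have bdW j k : bnd_meas (on_cube (partial j (W k N))) by rewrite dW; exact: tp_bnd.
apply: big1 => k _.
have step j : \int[cube]_x (on_cube (W j N) x * on_cube (W k N) x *
    on_cube (pS (D j k) N) x) =
   - 2^-1 * \int[cube]_x (on_cube (W k N) x ^+ 2 * on_cube (partial j (W j N)) x).
  have := cube_ibp (C1perM (C1 j k) (C1 j k)) (C1 j j).
  rewrite partialM// dW.
  rewrite (_ : \int[cube]_x _ = 2 * \int[cube]_x (on_cube (W j N) x * on_cube (W k N) x *
    on_cube (pS (D j k) N) x)); last first.
    rewrite -RintegralZl//; last first.
      apply: bnd_meas_integrable; apply: bnd_measM; first exact: bnd_measM.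
      exact: tp_bnd.
    by apply: eq_Rintegral => x _; rewrite /on_cube; ring.
  rewrite (_ : \int[cube]_x (on_cube (fun x => _ * _) x * _) =
    \int[cube]_x (on_cube (W k N) x ^+ 2 * on_cube (partial j (W j N)) x)) => [|//].
  by move=> H; move: (\int[cube]_x _) (\int[cube]_x _) H => x y; lra.
rewrite (eq_bigr _ (fun j _ => step j)) -mulr_sumr -Rintegral_sum; last first.
  by move=> j _; apply: bnd_meas_integrable; apply: bnd_measM => //; exact: bnd_measM.
rewrite (_ : \int[cube]_x _ = 0) ?mulr0//.
under eq_Rintegral do rewrite -mulr_sumr.
rewrite (_ : (fun x => _) = cst 0) ?Rintegral_cst ?mul0r//.
apply/funext => x; rewrite (_ : \sum_j _ = 0) ?mulr0//.
rewrite /on_cube; under eq_bigr do rewrite partial_tp /tp.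
rewrite exchange_big/= big1// => xi _.
by rewrite big_split/= -!mulr_suml fB sumrN fA oppr0 !mul0r addr0.
Qed.

Hypothesis Afin : forall k, (\esum_(xi in [set: Zn]) (zw xi * e k xi)%:E < +oo)%E.

Let L k := fine (\esum_(xi in [set: Zn]) (zw xi * e k xi)%:E).

Let eL k M : bsum (fun xi => zw xi * e k xi) M <= L k.
Proof. by apply: bsum_le_fine => // xi; exact: we0. Qed.

Let tail_cvg0 k : (fun N => L k - bsum (fun xi => zw xi * e k xi) N) @ \oo --> (0 : R).
Proof.
rewrite -(subrr (L k)); apply: cvgB; first exact: cvg_cst.
by apply: bsum_cvg => // xi; exact: we0.
Qed.

Let W2 k N : sq_int cube (on_cube (W k N)). Proof. exact: tp_sq_int. Qed.

Let WpS k N : W k N = pS (U k) N.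
Proof. by apply/funext => x; apply: eq_bigr => xi _; rewrite Uc Us. Qed.

Let tail k N xi : fc (fun x => U k x - on_cube (W k N) x) xi ^+ 2 +
  fs (fun x => U k x - on_cube (W k N) x) xi ^+ 2 =
  if xi \in box n N then 0 else e k xi.
Proof.
have iU := sq_int_int (U2 k); have iW := sq_int_int (W2 k N).
have -> : fc (fun x => U k x - on_cube (W k N) x) xi =
    fc (U k) xi - fc (on_cube (W k N)) xi.
  rewrite /fc -RintegralB//; last 2 first.
  - exact/integrableM_bnd/on_cube_cs_bnd.
  - exact/integrableM_bnd/on_cube_cs_bnd.
  by apply: eq_Rintegral => x _; rewrite mulrBl.
have -> : fs (fun x => U k x - on_cube (W k N) x) xi =
    fs (U k) xi - fs (on_cube (W k N)) xi.
  rewrite /fs -RintegralB//; last 2 first.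
  - exact/integrableM_bnd/on_cube_sn_bnd.
  - exact/integrableM_bnd/on_cube_sn_bnd.
  by apply: eq_Rintegral => x _; rewrite mulrBl.
rewrite fc_tp// fs_tp// Uc Us; case: (xi \in box n N); rewrite ?subr0//.
by rewrite !subrr expr0n addr0.
Qed.

(** Erasing a cube from the coefficients leaves the tail of a convergent series, uniformly in the
    cutoff [M]. *)
Let tail_le k N M :
  bsum (fun xi => zw xi * (fc (fun x => U k x - on_cube (W k N) x) xi ^+ 2 +
    fs (fun x => U k x - on_cube (W k N) x) xi ^+ 2)) M <=
  L k - bsum (fun xi => zw xi * e k xi) N.
Proof.
rewrite lerBrDr; apply: le_trans (eL k (maxn M N)).
pose t xi := if xi \in box n N then 0 else zw xi * e k xi.
have t0 xi : 0 <= t xi by rewrite /t; case: ifP.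
rewrite (eq_bsum (G := t)); last first.
  by move=> xi; rewrite tail /t; case: ifP; rewrite ?mulr0.
apply: le_trans (lerD (bsum_nd t0 (leq_maxl M N)) (lexx _)) _.
pose t' xi := if xi \in box n N then zw xi * e k xi else 0.
have t'0 xi : 0 <= t' xi by rewrite /t'; case: ifP.
rewrite (_ : bsum (fun xi => zw xi * e k xi) N = bsum t' N); last first.
  by rewrite /bsum !big_seq; apply: eq_bigr => xi xN; rewrite /t' xN.
apply: le_trans (lerD (lexx _) (bsum_nd t'0 (leq_maxr M N))) _.
rewrite /bsum -big_split/=; apply: ler_sum => xi _.
by rewrite /t /t'; case: ifP => _; rewrite ?add0r ?addr0.
Qed.

(** Subtracting the vanishing fully truncated expression, the difference splits into one term with
    [U j - W j N] and one with the error of the partial sum of [D j k]; the middle factor is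
    truncated already. Every product in [bd] contains a factor that tends to 0, by Parseval or as
    the tail of the weighted series. *)
Lemma tri_cvg0 : tri @ \oo --> (0 : R).
Proof.
pose d1 j N := \int[cube]_x ((U j x - on_cube (W j N) x) ^+ 2).
pose d2 j k N := \int[cube]_x ((D j k x - on_cube (pS (D j k) N) x) ^+ 2).
pose d3 j N := L j - bsum (fun xi => zw xi * e j xi) N.
pose m k := \int[cube]_x (U k x ^+ 2).
pose bd j k N := (Num.sqrt (2 * d1 j N) * Num.sqrt (L k) +
  Num.sqrt (2 * m k) * Num.sqrt (d3 j N)) * l2 (D j k) +
  (Num.sqrt (2 * m j) * Num.sqrt (L k) + Num.sqrt (2 * m k) * Num.sqrt (L j)) *
  Num.sqrt (d2 j k N).
have em k N : bsum (e k) N <= m k.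
  rewrite -(eq_bsum (F := fun xi => fc (U k) xi ^+ 2 + fs (U k) xi ^+ 2)).
    exact: bessel.
  by move=> xi; rewrite eU.
have p0 (x : R) : 0 <= Num.sqrt x by exact: sqrtr_ge0.
have one j k N : `|\int[cube]_x (U j x * on_cube (W k N) x * D j k x) -
   \int[cube]_x (on_cube (W j N) x * on_cube (W k N) x * on_cube (pS (D j k) N) x)| <=
   bd j k N.
  have bW i : bnd_meas (on_cube (W i N)) by exact: tp_bnd.
  have P2 : sq_int cube (on_cube (pS (D j k) N)) by exact: tp_sq_int.
  have V2 : sq_int cube (fun x => U j x - on_cube (W j N) x) by exact: sq_intB.
  have E2 : sq_int cube (fun x => D j k x - on_cube (pS (D j k) N) x) by exact: sq_intB.
  rewrite -RintegralB//; last 2 first.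
  - exact: sq_int_mul (sq_intM_bnd (U2 j) (bW k)) (D2 j k).
  - exact: sq_int_mul (sq_intM_bnd (W2 j N) (bW k)) P2.
  rewrite (_ : \int[cube]_x _ =
    \int[cube]_x ((U j x - on_cube (W j N) x) * on_cube (W k N) x * D j k x) +
    \int[cube]_x (on_cube (W j N) x * on_cube (W k N) x *
       (D j k x - on_cube (pS (D j k) N) x))); last first.
    rewrite -RintegralD//; last 2 first.
    - exact: sq_int_mul (sq_intM_bnd V2 (bW k)) (D2 j k).
    - exact: sq_int_mul (sq_intM_bnd (W2 j N) (bW k)) E2.
    by apply: eq_Rintegral => x _; ring.
  apply: le_trans (ler_normD _ _) _; apply: lerD.
    apply: le_trans (trilinear N V2 (D2 j k) (eA k) (oB k) (tail_le j N)) _.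
    rewrite ler_wpM2r//; apply: lerD.
      by rewrite ler_wpM2l// ler_wsqrtr//; exact: eL.
    by rewrite ler_wpM2r// ler_wsqrtr// ler_wpM2l//; exact: em.
  apply: le_trans (trilinear_tp N N (eA j) (oB j) (eA k) (oB k) E2) _.
  rewrite ler_wpM2r//; apply: lerD.
    apply: ler_pM => //; apply: ler_wsqrtr; last exact: eL.
    by rewrite ler_wpM2l//; exact: em.
  apply: ler_pM => //; apply: ler_wsqrtr; last exact: eL.
  by rewrite ler_wpM2l//; exact: em.
have d1_0 j : d1 j @ \oo --> (0 : R).
  have := parseval (U2 j); rewrite /d1.
  by rewrite (_ : (fun N => \int[cube]_x ((U j x - on_cube (W j N) x) ^+ 2)) =
    fun N => \int[cube]_x ((U j x - on_cube (pS (U j) N) x) ^+ 2))//;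
  apply/funext => N; rewrite WpS.
have bd0 j k : bd j k @ \oo --> (0 : R).
  rewrite (_ : 0 = (0 * Num.sqrt (L k) + Num.sqrt (2 * m k) * 0) * l2 (D j k) +
   (Num.sqrt (2 * m j) * Num.sqrt (L k) + Num.sqrt (2 * m k) * Num.sqrt (L j)) * 0 :> R);
    last by rewrite !(mul0r, mulr0, addr0).
  apply: cvgD.
    apply: cvgMl; apply: cvgD.
      apply: cvgMl; apply: cvg_sqrt0; rewrite -[X in _ --> X](mulr0 2).
      by apply: cvgMr; exact: d1_0.
    by apply: cvgMr; apply: cvg_sqrt0; exact: tail_cvg0.
  by apply: cvgMr; apply: cvg_sqrt0; exact: parseval.
apply: (cvg0_le (b := fun N => \sum_k \sum_j bd j k N)).
  move=> N; rewrite -[tri N]subr0 -[X in _ - X](tri_cancel N) /tri -sumrB /=.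
  apply: le_trans (ler_norm_sum _ _ _) _; apply: ler_sum => k _.
  rewrite -sumrB; apply: le_trans (ler_norm_sum _ _ _) _; apply: ler_sum => j _.
  exact: one.
rewrite [X in _ --> X](_ : _ = \sum_(k < n) \sum_(j < n) 0).
  apply: (cvgn_sum (F := fun k N => \sum_j bd j k N)
    (l := fun=> \sum_(j < n) 0)) => k.
  exact: (cvgn_sum (F := fun j N => bd j k N) (l := fun=> 0)).
by rewrite big1// => k _; rewrite big1.
Qed.

End trilinear_limit.

(** * The weak formulation at a fixed time *)

Section sobolev_bounds.
Variables (R : realType) (n : nat).
Local Notation mR := (measurableTypeR R).
Local Notation cube := (@cube_leb R n).
Local Notation Zn := 'rV[int]_n.
Local Notation Rn := 'rV[R]_n.
Local Notation distr := ((Rn -> R) -> R).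
Local Notation vdistr := ('I_n -> distr).

Let sq0 (xi : Zn) : 0 <= \sum_i ((xi 0 i)%:~R ^+ 2 : R).
Proof. by rewrite sumr_ge0// => i _; exact: sqr_ge0. Qed.

Lemma rho_sqr (xi : Zn) : rho R xi ^+ 2 = (2 * pi) ^+ 2 * (1 + \sum_i (xi 0 i)%:~R ^+ 2).
Proof. by rewrite /rho exprMn sqr_sqrtr// addr_ge0. Qed.

Lemma rho_ge1 (xi : Zn) : 1 <= rho R xi.
Proof.
rewrite -[leLHS]mulr1; apply: ler_pM => //; first exact: two_pi_ge1.
by rewrite -[leLHS]sqrtr1 ler_wsqrtr// lerDl.
Qed.

Lemma rho_gt0 (xi : Zn) : 0 < rho R xi.
Proof. exact: lt_le_trans (rho_ge1 xi). Qed.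

Lemma freq_rho (xi : Zn) j : freq R xi j ^+ 2 <= rho R xi ^+ 2.
Proof.
rewrite rho_sqr /freq exprMn ler_wpM2l ?sqr_ge0// (bigD1 j)//=.
have : 0 <= \sum_(i | i != j) ((xi 0 i)%:~R ^+ 2 : R).
  by rewrite sumr_ge0// => i _; exact: sqr_ge0.
lra.
Qed.

Lemma zweight_rho (xi : Zn) : zweight R xi <= rho R xi ^+ n.
Proof.
rewrite /zweight natrX; apply: lerXn2r; rewrite ?nnegrE ?ler0n ?(ltW (rho_gt0 xi))//.
set z := znorm xi.
have zy : z%:R <= Num.sqrt (\sum_i (xi 0 i)%:~R ^+ 2) :> R.
  rewrite /z /znorm; elim/big_ind: _ => [|a b ha hb|i _]; first exact: sqrtr_ge0.
    by rewrite /maxn; case: ifP.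
  rewrite natr_absz intr_norm -sqrtr_sqr ler_wsqrtr// (bigD1 i)//= lerDl.
  by rewrite sumr_ge0// => k _; exact: sqr_ge0.
set S := \sum_i _ in zy; have S0 : 0 <= S by exact: sq0.
have y0 := sqrtr_ge0 S; have p2 := pi_ge2 R.
have q0 : 0 <= Num.sqrt (1 + S) by exact: sqrtr_ge0.
have q2 : Num.sqrt (1 + S) ^+ 2 = 1 + S by rewrite sqr_sqrtr// addr_ge0.
have yy : Num.sqrt S ^+ 2 = S by rewrite sqr_sqrtr.
rewrite -/S -addn1 natrD -mul2n natrM.
(* The constant 4 comes from [pi >= 2] and leaves ample room, since
   [(2 * y + 1) ^+ 2 <= 16 * (1 + y ^+ 2)]. *)
apply: (@le_trans _ _ (4 * Num.sqrt (1 + S))); last first.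
  by rewrite /rho -/S ler_wpM2r//; lra.
apply: (@le_trans _ _ (2 * Num.sqrt S + 1)); first by lra.
rewrite -(@ler_pXn2r _ 2) ?nnegrE ?addr_ge0 ?mulr_ge0//.
rewrite exprMn q2; move: y0 yy; set y := Num.sqrt S => y0 yy.
by have := sqr_ge0 (2 * y - 1); nra.
Qed.

Lemma rho_powR_n (xi : Zn) : rho R xi `^ (2 * (n%:R / 2)) = rho R xi ^+ n.
Proof. by rewrite mulrCA divff// mulr1 powR_mulrn// ltW// rho_gt0. Qed.

Lemma rho_powR1 (xi : Zn) : rho R xi `^ (2 * 1) = rho R xi ^+ 2.
Proof. by rewrite mulr1 powR_mulrn// ltW// rho_gt0. Qed.

Lemma rho_powRN1 (xi : Zn) : rho R xi `^ (2 * -1) = (rho R xi ^+ 2)^-1.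
Proof. by rewrite mulrN powRN rho_powR1. Qed.

Lemma hterm_ge0 s (g : distr) xi : 0 <= rho R xi `^ (2 * s) * ecoef g xi.
Proof. by rewrite mulr_ge0 ?powR_ge0 ?ecoef_ge0. Qed.

Lemma hsqnorm_ge0 s (g : distr) : (0 <= hsqnorm s g)%E.
Proof.
by rewrite hsqnormE; apply: esum_ge0 => xi _; rewrite lee_fin hterm_ge0.
Qed.

Lemma hsqnorm_bsum s (g : distr) N : Hs s g ->
  bsum (fun xi => rho R xi `^ (2 * s) * ecoef g xi) N <= fine (hsqnorm s g).
Proof.
move=> [_]; rewrite hsqnormE => goo; apply: bsum_le_fine => // xi.
exact: hterm_ge0.
Qed.

Lemma Hs_dom s s' (g g' : distr) : is_distr g' ->
  (forall xi, rho R xi `^ (2 * s') * ecoef g' xi <=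
     rho R xi `^ (2 * s) * ecoef g xi) -> Hs s g ->
  Hs s' g' /\ fine (hsqnorm s' g') <= fine (hsqnorm s g).
Proof.
move=> dg' le [dg goo].
have le' : (hsqnorm s' g' <= hsqnorm s g)%E.
  by rewrite !hsqnormE; apply: le_esum => xi _; rewrite lee_fin.
have g'oo : (hsqnorm s' g' < +oo)%E by exact: le_lt_trans goo.
split; first by split.
by apply: fine_le => //; rewrite ge0_fin_numE ?hsqnorm_ge0.
Qed.

Lemma Hs_mono s s' (g : distr) : s' <= s -> Hs s g ->
  Hs s' g /\ fine (hsqnorm s' g) <= fine (hsqnorm s g).
Proof.
move=> ss Hg; apply: Hs_dom (Hg); first by case: Hg.
move=> xi; rewrite ler_wpM2r ?ecoef_ge0//.
by apply: ler_powR; [exact: rho_ge1|rewrite ler_pM2l].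
Qed.

Lemma ecoef_dpartial j (g : distr) xi : is_distr g ->
  ecoef (dpartial j g) xi = freq R xi j ^+ 2 * ecoef g xi.
Proof. by move=> dg; rewrite /ecoef dpartial_cs// dpartial_sn//; ring. Qed.

Lemma Hs_dpartial j (g : distr) : Hs 1 g ->
  Hs 0 (dpartial j g) /\ fine (hsqnorm 0 (dpartial j g)) <= fine (hsqnorm 1 g).
Proof.
move=> Hg; have [dg _] := Hg; apply: Hs_dom (Hg); first exact: is_distr_dpartial.
move=> xi; rewrite mulr0 powRr0 mul1r rho_powR1 ecoef_dpartial//.
by rewrite ler_wpM2r ?ecoef_ge0// freq_rho.
Qed.

(** Young's inequality term by term with weight [w]. The weight [rho ^+ 2] yields the pairing of
    H^{-1} with H^1, the constant weight that of L_2 with itself. *)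
Lemma dual_bound (w : Zn -> R) (g h : distr) (X Y : R) : is_distr h ->
  (forall xi, 0 < w xi) ->
  (forall N, bsum (fun xi => (w xi)^-1 * ecoef g xi) N <= X) ->
  (forall N, bsum (fun xi => w xi * ecoef h xi) N <= Y) ->
  bsum (dterm g h) @ \oo --> dual g h /\
  forall N, `|bsum (dterm g h) N| <= 2^-1 * (X + Y).
Proof.
move=> dh w0 gX hY.
have ab (a c v : R) : 0 < v -> `|a * c| <= 2^-1 * (v^-1 * a ^+ 2 + v * c ^+ 2).
  move=> v0; have i0 : 0 < v^-1 by rewrite invr_gt0.
  have h1 : 0 <= v^-1 * (`|a| - v * `|c|) ^+ 2 by rewrite mulr_ge0 ?sqr_ge0 ?ltW.
  rewrite normrM -[a ^+ 2]real_normK ?num_real// -[c ^+ 2]real_normK ?num_real//.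
  rewrite (_ : _ * (_ - _) ^+ 2 = v^-1 * `|a| ^+ 2 - 2 * (`|a| * `|c|) + v * `|c| ^+ 2)
    in h1; last by field; rewrite gt_eqF.
  by lra.
have bd N : bsum (fun xi => `|dterm g h xi|) N <= 2^-1 * (X + Y).
  apply: (@le_trans _ _ (2^-1 * (bsum (fun xi => (w xi)^-1 * ecoef g xi) N +
      bsum (fun xi => w xi * ecoef h xi) N))).
    rewrite /bsum -big_split mulr_sumr; apply: ler_sum => xi _ /=.
    apply: le_trans (ler_normD _ _) _.
    have := ab (g (cs xi)) (h (cs xi)) _ (w0 xi).
    have := ab (g (sn xi)) (h (sn xi)) _ (w0 xi); rewrite /ecoef; lra.
  by rewrite ler_wpM2l ?invr_ge0// lerD.
split; last by move=> N; apply: le_trans (bd N); exact: ler_norm_sum.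
by rewrite dualE//; apply: abs_sum_cvg; exists (2^-1 * (X + Y)).
Qed.

End sobolev_bounds.

(** * Truncated fields and the convective term at a fixed time *)

Section fixed_time.
Variables (R : realType) (n : nat).
Local Notation mR := (measurableTypeR R).
Local Notation cube := (@cube_leb R n).
Local Notation Zn := 'rV[int]_n.
Local Notation Rn := 'rV[R]_n.
Local Notation distr := ((Rn -> R) -> R).
Local Notation vdistr := ('I_n -> distr).
Local Notation tensor := ('I_n -> 'I_n -> 'I_n -> 'I_n -> Rn -> R).

Definition trunc N (v : vdistr) : vdistr :=
  tpf N (fun k xi => v k (cs xi)) (fun k xi => v k (sn xi)).

(** The square of [vhnorm] as a real number, meaningful when every component has finite norm. *)
Definition vhsq s (v : vdistr) : R := \sum_k fine (hsqnorm s (v k)).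

Lemma fine_hsqnorm_ge0 s (g : distr) : 0 <= fine (hsqnorm s g).
Proof. by rewrite fine_ge0// hsqnorm_ge0. Qed.

Lemma hsqnorm_vhsq s (v : vdistr) k : fine (hsqnorm s (v k)) <= vhsq s v.
Proof.
rewrite /vhsq (bigD1 k)//= lerDl sumr_ge0// => i _; exact: fine_hsqnorm_ge0.
Qed.

Lemma vhsq_ge0 s (v : vdistr) : 0 <= vhsq s v.
Proof. by rewrite sumr_ge0// => k _; exact: fine_hsqnorm_ge0. Qed.

(** Only finitely many frequencies are left, so any exponent [s'] is allowed; the divergence
    condition survives because it decouples over frequencies. *)
Lemma trunc_sol s s' N (v : vdistr) : vHdot_sol s v -> vHdot_sol s' (trunc N v).
Proof.
move=> [Hv dv]; have dd := vHdot_distr Hv.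
apply: tpf_sol.
- by move=> k; exact: csN_even.
- by move=> k; exact: snN_odd.
- by move=> k; exact: (vHdot_coef0 k Hv).
- by move=> xi; have [_] := sol_coef xi dd dv.
- by move=> xi; have [] := sol_coef xi dd dv.
Qed.

Lemma vdual_trunc (g v : vdistr) N : (forall k, is_distr (v k)) ->
  vdual g (trunc N v) = \sum_k bsum (dterm (g k) (v k)) N.
Proof.
move=> dv; rewrite vdual_tpf.
- by apply: eq_bigr => k _; apply: eq_bsum => xi; rewrite /dterm; ring.
- by move=> k; exact: csN_even.
- by move=> k; exact: snN_odd.
Qed.

Lemma integral_l2fun (g : distr) : Hs 0 g -> exists G : n.-tuple mR -> R,
  [/\ sq_int cube G, {ae cube, forall x, on_cube (l2fun g) x = G x},
   (fc G =1 fun xi => g (cs xi)), (fs G =1 fun xi => g (sn xi)) &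
   \int[cube]_x (G x ^+ 2) = fine (hsqnorm 0 g)].
Proof.
move=> Hg; have [G [G2 gG Gc Gs]] := l2fun_spec Hg; exists G; split => //.
rewrite hsqnorm0E -[LHS]/(fine (\int[cube]_x (G x ^+ 2))%:E) -sq_int_ecoef//.
by congr fine; apply: eq_esum => xi _; rewrite Gc Gs.
Qed.

(** The products in the convective term are merely integrable, but the truncation has finitely many
    frequencies, so the pairing is a genuine integral against trigonometric polynomials and equals
    [tri]. *)
Lemma convect_trunc (v : vdistr) : vHdot_sol 1 v -> vHdot_sol (n%:R / 2) v ->
  (fun N => vdual (convect v v) (trunc N v)) @ \oo --> (0 : R) /\
  forall N m0, vhsq 0 v <= m0 ->
    `|vdual (convect v v) (trunc N v)| <=
    (n * n)%:R * Num.sqrt (2 * m0) * (vhsq (n%:R / 2) v + vhsq 1 v).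
Proof.
move=> [Hv dv] [Hvn _]; have dd := vHdot_distr Hv.
have H1 k : Hs 1 (v k) by have [] := Hv k.
have H0 k : Hs 0 (v k) by have [] := Hs_mono (ler01 : 0 <= 1 :> R) (H1 k).
have Hn k : Hs (n%:R / 2) (v k) by have [] := Hvn k.
have /choice[U hU] k := integral_l2fun (H0 k).
have /choice[D' hD'] (p : 'I_n * 'I_n) := integral_l2fun (Hs_dpartial p.1 (H1 p.2)).1.
pose D j k := D' (j, k).
have hD j k := hD' (j, k); rewrite /= in hD.
pose A k xi := v k (cs xi); pose B k xi := v k (sn xi).
have eA k : evenZ (A k) by exact: csN_even.
have oB k : oddZ (B k) by exact: snN_odd.
have U2 k : sq_int cube (U k) by have [] := hU k.
have Uc k : fc (U k) =1 A k by have [] := hU k.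
have Us k : fs (U k) =1 B k by have [] := hU k.
have D2 j k : sq_int cube (D j k) by have [] := hD j k.
have Dc j k xi : fc (D j k) xi = freq R xi j * B k xi.
  by have [_ _ -> _ _] := hD j k; rewrite dpartial_cs.
have Ds j k xi : fs (D j k) xi = - (freq R xi j * A k xi).
  by have [_ _ _ -> _] := hD j k; rewrite dpartial_sn.
have fA xi : \sum_k freq R xi k * A k xi = 0 by have [] := sol_coef xi dd dv.
have fB xi : \sum_k freq R xi k * B k xi = 0 by have [] := sol_coef xi dd dv.
have zle k xi : zweight R xi * (A k xi ^+ 2 + B k xi ^+ 2) <=
    rho R xi `^ (2 * (n%:R / 2)) * ecoef (v k) xi.
  by rewrite rho_powR_n ler_wpM2r ?ecoef_ge0// zweight_rho.
have Afin k : (\esum_(xi in [set: Zn]) (zweight R xi * (A k xi ^+ 2 + B k xi ^+ 2))%:E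
    < +oo)%E.
  have [_] := Hn k; rewrite hsqnormE; apply: le_lt_trans; apply: le_esum => xi _.
  by rewrite lee_fin.
have E N : vdual (convect v v) (trunc N v) = tri A B U D N.
  rewrite vdual_trunc//; apply: eq_bigr => k _.
  have iUD j : cube.-integrable setT (EFin \o (fun x => U j x * D j k x)).
    exact: sq_int_mul.
  have iH : cube.-integrable setT (EFin \o (fun x => \sum_j U j x * D j k x)).
    exact: integrable_sum.
  transitivity (\int[cube]_x ((\sum_j U j x * D j k x) * on_cube (tp N (A k) (B k)) x)).
    rewrite integral_tp//; apply: eq_bsum => xi.
    have cE (phi : Rn -> R) : convect v v k phi =
        \int[cube]_x ((\sum_j U j x * D j k x) * on_cube phi x).
      apply: ae_eq_Rintegral_nm.
      have : \forall x \ae cube, forall j : 'I_n,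
          on_cube (l2fun (v j)) x = U j x /\
          on_cube (l2fun (dpartial j (v k))) x = D j k x.
        apply: filter_forall => j.
        have [_ h1 _ _ _] := hU j; have [_ h2 _ _ _] := hD j k.
        by apply: aeS2 h1 h2 => x.
      apply: aeS => x h _; congr (_ * _); rewrite /on_cube.
      by apply: eq_bigr => j _; have [<- <-] := h j.
    by rewrite /dterm !cE -/(fc _ xi) -/(fs _ xi) /A /B; ring.
  rewrite -Rintegral_sum; last first.
    move=> j _; apply: sq_int_mul => //.
    exact: sq_intM_bnd (tp_bnd _ _ _).
  by apply: eq_Rintegral => x _; rewrite mulr_suml; apply: eq_bigr => j _; ring.
under eq_fun do rewrite E.
split; first exact: (tri_cvg0 eA oB U2 Uc Us D2 Dc Ds fA fB Afin).
move=> N m0 vm; rewrite E; apply: (tri_bound eA oB U2 Uc Us D2).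
- move=> k; have [_ _ _ _ ->] := hU k.
  exact: le_trans (hsqnorm_vhsq 0 v k) vm.
- move=> j k; have [_ _ _ _ ->] := hD j k.
  exact: le_trans (Hs_dpartial j (H1 k)).2 (hsqnorm_vhsq 1 v k).
- move=> k M; apply: le_trans (hsqnorm_vhsq (n%:R / 2) v k).
  by apply: le_trans (hsqnorm_bsum M (Hn k)); apply: ler_sum.
Qed.

End fixed_time.

(** * The viscous form and the weak formulation tested with truncations *)

Section fixed_time_form.
Variables (R : realType) (n : nat).
Local Notation mR := (measurableTypeR R).
Local Notation cube := (@cube_leb R n).
Local Notation Zn := 'rV[int]_n.
Local Notation Rn := 'rV[R]_n.
Local Notation distr := ((Rn -> R) -> R).
Local Notation vdistr := ('I_n -> distr).
Local Notation tensor := ('I_n -> 'I_n -> 'I_n -> 'I_n -> Rn -> R).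

Lemma ecoef_strain (v : vdistr) j b xi : (forall k, is_distr (v k)) ->
  ecoef (strain v j b) xi <= 2^-1 * (rho R xi ^+ 2 * (ecoef (v b) xi + ecoef (v j) xi)).
Proof.
move=> dv; rewrite /ecoef strain_cs// strain_sn// sqrrN ![(2^-1 * _) ^+ 2]exprMn.
have q (x y : R) : (freq R xi j * x + freq R xi b * y) ^+ 2 <=
    2 * (rho R xi ^+ 2 * (x ^+ 2 + y ^+ 2)).
  apply: (@le_trans _ _ (2 * (freq R xi j ^+ 2 * x ^+ 2 + freq R xi b ^+ 2 * y ^+ 2))).
    by have := sqr_ge0 (freq R xi j * x - freq R xi b * y); lra.
  by rewrite ler_pM2l// mulrDr lerD// ler_wpM2r ?sqr_ge0// freq_rho.
apply: le_trans (lerD (ler_wpM2l (sqr_ge0 2^-1) (q _ _))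
  (ler_wpM2l (sqr_ge0 2^-1) (q _ _))) _.
by rewrite le_eqVlt; apply/orP; left; apply/eqP; field.
Qed.

Lemma Hs_strain (v : vdistr) j b : vHdot 1 v -> Hs 0 (strain v j b) /\
  (forall N, bsum (ecoef (strain v j b)) N <= vhsq 1 v) /\
  fine (hsqnorm 0 (strain v j b)) <= vhsq 1 v.
Proof.
move=> Hv; have dv := vHdot_distr Hv.
have bd N : bsum (ecoef (strain v j b)) N <= vhsq 1 v.
  apply: (@le_trans _ _ (2^-1 * (bsum (fun xi => rho R xi `^ (2 * 1) * ecoef (v b) xi) N +
      bsum (fun xi => rho R xi `^ (2 * 1) * ecoef (v j) xi) N))).
    rewrite /bsum -big_split mulr_sumr; apply: ler_sum => xi _ /=.
    by rewrite rho_powR1 -mulrDr ecoef_strain.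
  have := hsqnorm_bsum N (Hv b).1; have := hsqnorm_bsum N (Hv j).1.
  have := hsqnorm_vhsq 1 v b; have := hsqnorm_vhsq 1 v j; lra.
have le : (hsqnorm 0 (strain v j b) <= (vhsq 1 v)%:E)%E.
  rewrite hsqnorm0E.
  by apply: esum_box_le => [xi|N]; [exact: ecoef_ge0|rewrite lee_fin].
have lt : (hsqnorm 0 (strain v j b) < +oo)%E by exact: le_lt_trans le (ltry _).
split; first by split => //; exact: is_distr_strain.
by split => //; rewrite -lee_fin fineK// ge0_fin_numE ?hsqnorm_ge0.
Qed.

(** Clamping a measurable representative between [- M] and [M] makes the bound hold at every
    point. *)
Lemma ae_bnd_meas (c : Rn -> R) (M : R) : 0 <= M ->
  ae_measurable cube setT (on_cube c) -> {ae cube, forall x, `|on_cube c x| <= M} ->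
  exists g : n.-tuple mR -> R, [/\ bnd_meas g, (forall x, `|g x| <= M) &
    {ae cube, forall x, on_cube c x = g x}].
Proof.
move=> M0 [g mg cg] cM.
have gM x : `|Num.max (- M) (Num.min M (g x))| <= M.
  by rewrite ler_norml le_max lexx/= ge_max ge_min lexx/= andbT; lra.
exists (fun x => Num.max (- M) (Num.min M (g x))); split => //.
  split; last by exists M.
  by apply: measurable_maxr => //; exact: measurable_minr.
apply: aeS2 cg cM => x /(_ I) ->; rewrite ler_norml => /andP[h1 h2].
by rewrite min_r// max_r.
Qed.

(** Truncation commutes with the strain, so the pairing with the truncated strain is a partial sum
    of the dual series. In the bound, [M ^+ 2] comes from Bessel's inequality for the product with
    the coefficient and 1 from the tested strain. *)
Lemma tensor_term (c : Rn -> R) (M : R) (v : vdistr) j b i al : 0 <= M ->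
  ae_measurable cube setT (on_cube c) -> {ae cube, forall x, `|on_cube c x| <= M} ->
  vHdot_sol 1 v ->
  let g := distr_of (fun x => c x * l2fun (strain v j b) x) in
  (fun N => dual g (strain (trunc N v) i al)) @ \oo --> dual g (strain v i al) /\
  forall N, `|dual g (strain (trunc N v) i al)| <= 2^-1 * ((M ^+ 2 + 1) * vhsq 1 v).
Proof.
move=> M0 mc cM [Hv _] g; have dv := vHdot_distr Hv.
have [C [bC CM cC]] := ae_bnd_meas M0 mc cM.
have [H0 [_ Sb]] := Hs_strain j b Hv; have [_ [Sb' _]] := Hs_strain i al Hv.
have [S [S2 gS Sc Ss Sn]] := integral_l2fun H0.
have G2 := sq_intM_bnd S2 bC; set G := (fun x => S x * C x) in G2.
have gE phi : g phi = \int[cube]_x (G x * on_cube phi x).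
  apply: ae_eq_Rintegral_nm; apply: aeS2 gS cC => x; rewrite /G /on_cube => <- <- _.
  by congr (_ * _); rewrite mulrC.
have eg xi : ecoef g xi = fc G xi ^+ 2 + fs G xi ^+ 2 by rewrite /ecoef !gE.
have gb N : bsum (fun xi => 1^-1 * ecoef g xi) N <= M ^+ 2 * vhsq 1 v.
  rewrite (eq_bsum (G := fun xi => fc G xi ^+ 2 + fs G xi ^+ 2)); last first.
    by move=> xi; rewrite invr1 mul1r eg.
  apply: le_trans (bessel N G2) _.
  apply: (@le_trans _ _ (\int[cube]_x (M ^+ 2 * S x ^+ 2))).
    apply: le_Rintegral => //; first exact: sq_int_sqr.
      exact/integrable_funZ/sq_int_sqr.
    move=> x _; rewrite /G exprMn mulrC ler_wpM2r ?sqr_ge0//.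
    by rewrite -[leLHS]real_normK ?num_real// ler_sqr ?nnegrE.
  rewrite RintegralZl//; last exact: sq_int_sqr.
  by rewrite ler_wpM2l ?sqr_ge0// Sn.
have dst : is_distr (strain v i al) by exact: is_distr_strain.
have hb N : bsum (fun xi => 1 * ecoef (strain v i al) xi) N <= vhsq 1 v.
  by rewrite (eq_bsum (G := ecoef (strain v i al))) // => xi; rewrite mul1r.
have [cvg bd] := dual_bound dst (fun=> ltr01) gb hb.
have E N : dual g (strain (trunc N v) i al) = bsum (dterm g (strain v i al)) N.
  have dt := @tpf_distr R n N (fun k xi => v k (cs xi)) (fun k xi => v k (sn xi)).
  have ev k : evenZ (fun xi => v k (cs xi)) by exact: csN_even.
  have ov k : oddZ (fun xi => v k (sn xi)) by exact: snN_odd.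
  rewrite dualE; last exact: is_distr_strain.
  rewrite (@abs_sum_box _ _ _ N) => [|xi xN].
    rewrite /bsum !big_seq; apply: eq_bigr => xi xN.
    by rewrite /dterm !strain_cs// !strain_sn// /trunc !tpf_cs// !tpf_sn// xN.
  rewrite /dterm strain_cs// strain_sn// /trunc !tpf_cs// !tpf_sn// (negbTE xN).
  by rewrite !(mulr0, addr0, oppr0).
split; first by under eq_fun do rewrite E.
by move=> N; rewrite E; apply: le_trans (bd N) _; rewrite mulrDl mul1r.
Qed.

Lemma aform_trunc (a : tensor) (M : R) (v : vdistr) : 0 <= M ->
  (forall k j al b, ae_measurable cube setT (on_cube (a k j al b))) ->
  (forall k j al b, {ae cube, forall x, `|on_cube (a k j al b) x| <= M}) ->
  vHdot_sol 1 v ->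
  (fun N => aform a v (trunc N v)) @ \oo --> aform a v v /\
  forall N, `|aform a v (trunc N v)| <=
    (n ^ 4)%:R * (2^-1 * ((M ^+ 2 + 1) * vhsq 1 v)).
Proof.
move=> M0 ma aM Hv.
have T i al j b := tensor_term j b i al M0 (ma i j al b) (aM i j al b) Hv.
split.
  apply: (cvgn_sum (F := fun i N => _)) => i; apply: (cvgn_sum (F := fun al N => _)) => al.
  apply: (cvgn_sum (F := fun j N => _)) => j; apply: (cvgn_sum (F := fun b N => _)) => b.
  by have [] := T i al j b.
move=> N; set K := 2^-1 * _.
apply: (@le_trans _ _ (\sum_(i < n) \sum_(al < n) \sum_(j < n) \sum_(b < n) K)).
  apply: le_trans (ler_norm_sum _ _ _) _; apply: ler_sum => i _.
  apply: le_trans (ler_norm_sum _ _ _) _; apply: ler_sum => al _.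
  apply: le_trans (ler_norm_sum _ _ _) _; apply: ler_sum => j _.
  apply: le_trans (ler_norm_sum _ _ _) _; apply: ler_sum => b _.
  exact: (T i al j b).2.
by rewrite !sumr_const card_ord -!mulrnA mulr_natl !expnS expn0 muln1 !mulnA.
Qed.

(** The energy identity for the truncations is the weak formulation tested with
    them; the convective term disappears in the limit. *)
Lemma weak_trunc (a : tensor) (M m0 : R) (v v' f : vdistr) : 0 <= M ->
  (forall k j al b, ae_measurable cube setT (on_cube (a k j al b))) ->
  (forall k j al b, {ae cube, forall x, `|on_cube (a k j al b) x| <= M}) ->
  vHdot_sol 1 v -> vHdot_sol (n%:R / 2) v -> vHdot (-1) f -> vhsq 0 v <= m0 ->
  (forall w, vHdot_sol 1 w ->
     vdual (v' + leray (convect v v)) w + aform a v w = vdual f w) ->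
  [/\ (fun N => vdual f (trunc N v)) @ \oo --> vdual f v,
      (forall N, `|vdual f (trunc N v)| <= 2^-1 * (vhsq (-1) f + vhsq 1 v)),
      (fun N => vdual v' (trunc N v)) @ \oo --> vdual f v - aform a v v &
      forall N, `|vdual v' (trunc N v)| <= 2^-1 * (vhsq (-1) f + vhsq 1 v) +
        (n ^ 4)%:R * (2^-1 * ((M ^+ 2 + 1) * vhsq 1 v)) +
        (n * n)%:R * Num.sqrt (2 * m0) * (vhsq (n%:R / 2) v + vhsq 1 v)].
Proof.
move=> M0 ma aM Hv Hvn Hf vm weak; have [Hv1 dv] := Hv; have dd := vHdot_distr Hv1.
have F k : bsum (dterm (f k) (v k)) @ \oo --> dual (f k) (v k) /\ forall N,
    `|bsum (dterm (f k) (v k)) N| <=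
    2^-1 * (fine (hsqnorm (-1) (f k)) + fine (hsqnorm 1 (v k))).
  apply: (dual_bound (w := fun xi => rho R xi ^+ 2)) => //.
  - by move=> xi; rewrite exprn_gt0// rho_gt0.
  - move=> N; apply: le_trans (hsqnorm_bsum N (Hf k).1).
    by apply: ler_sum => xi _; rewrite rho_powRN1.
  - move=> N; apply: le_trans (hsqnorm_bsum N (Hv1 k).1).
    by apply: ler_sum => xi _; rewrite rho_powR1.
have fcv : (fun N => vdual f (trunc N v)) @ \oo --> vdual f v.
  under eq_fun do rewrite vdual_trunc//.
  by apply: (cvgn_sum (F := fun k N => _)) => k; have [] := F k.
have fb N : `|vdual f (trunc N v)| <= 2^-1 * (vhsq (-1) f + vhsq 1 v).
  rewrite vdual_trunc// /vhsq -big_split mulr_sumr.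
  apply: le_trans (ler_norm_sum _ _ _) _; apply: ler_sum => k _.
  by have [_] := F k; apply.
have [ac ab] := aform_trunc M0 ma aM Hv.
have [cc cb] := convect_trunc Hv Hvn.
(* When the projection exists, a solenoidal truncation does not distinguish it from the convective
   term itself; otherwise the pairing is 0. Both cases obey the same limit and the same bound. *)
have [lc lb] : (fun N => vdual (leray (convect v v)) (trunc N v)) @ \oo --> (0 : R) /\
    forall N, `|vdual (leray (convect v v)) (trunc N v)| <=
    (n * n)%:R * Num.sqrt (2 * m0) * (vhsq (n%:R / 2) v + vhsq 1 v).
  have [|||||E|E] := @leray_dual R n (convect v v) (fun k xi => v k (cs xi))
      (fun k xi => v k (sn xi)).
  - by move=> k; exact: csN_even.
  - by move=> k; exact: snN_odd.
  - by move=> k; exact: (vHdot_coef0 k Hv1).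
  - by move=> xi; have [_] := sol_coef xi dd dv.
  - by move=> xi; have [] := sol_coef xi dd dv.
  - under eq_fun do rewrite E.
    by split => // N; rewrite E; exact: cb.
  - under eq_fun do rewrite E.
    split; first exact: cvg_cst.
    move=> N; rewrite E normr0; apply: mulr_ge0; last by rewrite addr_ge0 ?vhsq_ge0.
    by apply: mulr_ge0; [exact: ler0n|exact: sqrtr_ge0].
have E N : vdual v' (trunc N v) = vdual f (trunc N v) - aform a v (trunc N v) -
    vdual (leray (convect v v)) (trunc N v).
  have := weak _ (trunc_sol 1 N Hv); rewrite (_ : vdual (v' + _) _ =
     vdual v' (trunc N v) + vdual (leray (convect v v)) (trunc N v)); first lra.
  rewrite !vdual_trunc// -big_split; apply: eq_bigr => k _ /=.
  rewrite /bsum -big_split; apply: eq_bigr => xi _ /=; rewrite /dterm.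
  rewrite -[(v' + _) k (cs xi)]/(v' k (cs xi) + leray (convect v v) k (cs xi)).
  by rewrite -[(v' + _) k (sn xi)]/(v' k (sn xi) + leray (convect v v) k (sn xi)); ring.
split; [exact: fcv|exact: fb| |].
  under eq_fun do rewrite E.
  by rewrite -[vdual f v - _]subr0; apply: cvgB; [exact: cvgB|exact: lc].
move=> N; rewrite E; apply: le_trans (ler_normB _ _) _; apply: lerD => //.
by apply: le_trans (ler_normB _ _) _; apply: lerD.
Qed.

End fixed_time_form.

(** * Smooth steps and weak derivatives in time *)

Section smooth_step.
Variable R : realType.
Implicit Types (f g : R -> R) (x : R).

(** Recursion through the derivative suits inductions for products and inverses. Level 0 already
    asks for one derivative, so level [m] provides [m.+1] of them. *)
Fixpoint smooth_upto (m : nat) f : Prop :=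
  (forall x, derivable f x 1) /\ if m is p.+1 then smooth_upto p (derive1 f) else True.

Lemma smooth_upto_derivable m f : smooth_upto m f -> forall x, derivable f x 1.
Proof. by case: m => [|m] []. Qed.

Lemma smooth_uptoW m f : smooth_upto m.+1 f -> smooth_upto m f.
Proof.
elim: m f => [|m IH] f; first by move=> [df _].
by move=> [df sf]; split => //; exact: IH.
Qed.

Lemma smooth_upto_derive1n m f : smooth_upto m f ->
  forall x, derivable (derive1n m f) x 1.
Proof.
elim: m f => [|m IH] f; first by move=> [df _] x; exact: df.
by move=> [_ sf] x; rewrite derive1Sn; exact: IH.
Qed.

Lemma is_derive_smooth f g m : (forall x, is_derive x 1 f (g x)) ->
  (if m is p.+1 then smooth_upto p g else True) -> smooth_upto m f.
Proof.
move=> df sg; have fg : derive1 f = g.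
  by apply/funext => x; rewrite derive1E; case: (df x).
by case: m sg => [|m] sg; split => //; try (by move=> x; case: (df x)); rewrite fg.
Qed.

Lemma smooth_is_derive m f : smooth_upto m f -> forall x, is_derive x 1 f (derive1 f x).
Proof.
move=> /smooth_upto_derivable df x; rewrite derive1E.
by split => //; exact: df.
Qed.

Lemma smooth_cst m (k : R) : smooth_upto m (fun=> k).
Proof.
elim: m k => [|m IH] k.
  by split => // x; exact: derivable_cst.
have D x : is_derive x 1 (fun=> k) 0 by exact: is_derive_cst.
exact: (is_derive_smooth (m := m.+1) D (IH 0)).
Qed.

Lemma smoothD m f g : smooth_upto m f -> smooth_upto m g ->
  smooth_upto m (fun x => f x + g x).
Proof.
elim: m f g => [|m IH] f g sf sg;
  have df := smooth_is_derive sf; have dg := smooth_is_derive sg;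
  have D x : is_derive x 1 (fun x => f x + g x) (derive1 f x + derive1 g x)
    by exact: is_deriveD.
- exact: (is_derive_smooth D).
- by apply: (is_derive_smooth D); case: sf sg => [_ sf] [_ sg]; exact: IH.
Qed.

Lemma smoothM m f g : smooth_upto m f -> smooth_upto m g ->
  smooth_upto m (fun x => f x * g x).
Proof.
elim: m f g => [|m IH] f g sf sg;
  have df := smooth_is_derive sf; have dg := smooth_is_derive sg;
  have D x : is_derive x 1 (fun x => f x * g x) (f x * derive1 g x + g x * derive1 f x)
    by exact: is_deriveM.
- exact: (is_derive_smooth D).
- have sfW := smooth_uptoW sf; have sgW := smooth_uptoW sg.
  apply: (is_derive_smooth D); case: sf sg => [_ sf] [_ sg]; apply: smoothD; exact: IH.
Qed.

Lemma smoothZ m (k : R) f : smooth_upto m f -> smooth_upto m (fun x => k * f x).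
Proof. by apply: smoothM; exact: smooth_cst. Qed.

(** The derivative of the inverse is a product that contains the inverse again, but at one order
    less. *)
Lemma smoothV m f : (forall x, f x != 0) -> smooth_upto m f ->
  smooth_upto m (fun x => (f x)^-1).
Proof.
move=> f0.
have D p x : smooth_upto p f -> is_derive x 1 (fun x => (f x)^-1)
    ((-1) * ((f x)^-1 * (f x)^-1 * derive1 f x)).
  move=> sf; have df := smooth_is_derive sf x.
  rewrite (_ : _ * _ = (- (f x) ^- 2) *: derive1 f x).
    exact: (is_deriveV (f0 x) df).
  by rewrite -exprVn mulN1r -mulNr.
elim: m => [|m IH] sf; apply: (is_derive_smooth (fun x => D _ x sf)) => //.
have sW := IH (smooth_uptoW sf); case: sf => _ sf.
by apply: smoothZ; apply: smoothM => //; exact: smoothM.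
Qed.

Lemma smooth_affine m f (k l : R) : smooth_upto m f ->
  smooth_upto m (fun x => f (k * x + l)).
Proof.
have D p g x : smooth_upto p g ->
    is_derive x 1 (fun x => g (k * x + l)) (k * derive1 g (k * x + l)).
  move=> sg; rewrite mulrC.
  exact: (@is_derive1_comp R g (fun x => k * x + l) x _ _
    (smooth_is_derive sg (k * x + l)) (is_derive_affine k l x)).
elim: m f => [|m IH] f sf; apply: (is_derive_smooth (fun x => D _ _ x sf)) => //.
by apply: smoothZ; apply: IH; case: sf.
Qed.

(** The extra parameter [k] makes the family closed under differentiation up to linear
    combinations. *)
Definition flat_exp (k : nat) (x : R) : R :=
  if 0 < x then x^-1 ^+ k * expR (- x^-1) else 0.

(** With [y = x^-1] and [k >= 1], [expR y = expR (y / k) ^+ k >= (y / k) ^+ k]. *)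
Lemma flat_exp_le k x : 0 <= flat_exp k x <= k%:R ^+ k.
Proof.
rewrite /flat_exp; case: ifPn => [x0|_]; last by rewrite lexx exprn_ge0.
have y0 : 0 < x^-1 by rewrite invr_gt0.
set y := x^-1 in y0 *; rewrite mulr_ge0 ?exprn_ge0 ?expR_ge0 ?(ltW y0)//=.
rewrite expRN ler_pdivrMr ?expR_gt0//.
case: k => [|k]; first by rewrite !expr0 mul1r -expR0 ler_expR ltW.
rewrite (_ : expR y = expR (y / k.+1%:R) ^+ k.+1); last first.
  by rewrite -expRM_natl mulrC divfK.
rewrite -exprMn; apply: lerXn2r; rewrite ?nnegrE ?(ltW y0) ?mulr_ge0 ?expR_ge0//.
rewrite mulrC -ler_pdivrMr//; apply: le_trans (expR_ge1Dx _).
by rewrite lerDr.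
Qed.

Lemma flat_expS k x : flat_exp k x = x * flat_exp k.+1 x.
Proof.
rewrite /flat_exp; case: ifPn => [x0|_]; last by rewrite mulr0.
by rewrite exprS !mulrA divff ?mul1r// gt_eqF.
Qed.

(** To the right of 0 this is the product rule. At 0 the difference quotient equals
    [h * flat_exp k.+2 h], and [flat_exp k.+2] is bounded. *)
Lemma is_derive_flat_exp k x :
  is_derive x 1 (flat_exp k) (flat_exp k.+2 x - k%:R * flat_exp k.+1 x).
Proof.
have [x0|x0|->] := ltgtP x 0.
- have -> : flat_exp k.+2 x - k%:R * flat_exp k.+1 x = 0.
    by rewrite /flat_exp ltNge (ltW x0)/= mulr0 subrr.
  have E : \forall y \near x, cst 0 y = flat_exp k y.
    near=> y; rewrite /flat_exp ifN// -leNgt ltW//; near: y.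
    exact: lt_nbhsl.
  exact: near_eq_is_derive E (is_derive_cst _ _ _).
- have -> : flat_exp k.+2 x - k%:R * flat_exp k.+1 x =
      x^-1 ^+ k.+2 * expR (- x^-1) - k%:R * (x^-1 ^+ k.+1 * expR (- x^-1)).
    by rewrite /flat_exp x0.
  have E : \forall y \near x, y^-1 ^+ k * expR (- y^-1) = flat_exp k y.
    near=> y; rewrite /flat_exp ifT//; near: y; exact: lt_nbhsr.
  apply: (near_eq_is_derive E); clear E.
  have x00 : x != 0 by rewrite gt_eqF.
  have dV : is_derive x (1 : R) (fun y : R => y^-1) (- x^-1 ^+ 2).
    apply: is_derive_eq; first by apply: is_deriveV; first exact: x00.
    by rewrite [_ *: _]mulr1 exprVn.
  elim: k => [|k IH].
    rewrite (_ : (fun y => _) = expR \o (fun y : R => - y^-1)); last first.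
      by apply/funext => y /=; rewrite expr0 mul1r.
    rewrite mul0r subr0 (_ : x^-1 ^+ 2 * _ = expR (- x^-1) * - (- x^-1 ^+ 2)); last by ring.
    apply: is_derive1_comp; exact: is_deriveN.
  rewrite (_ : (fun y => _) = (fun y : R => y^-1) * (fun y => y^-1 ^+ k * expR (- y^-1)));
    last by apply/funext => y; rewrite exprS -mulrA.
  have dM := is_deriveM dV IH; move: dM; rewrite /GRing.scale /=.
  by congr (is_derive _ _ _ _); rewrite -[k.+1%:R]natr1 !exprS; ring.
- have -> : flat_exp k.+2 0 - k%:R * flat_exp k.+1 0 = 0.
    by rewrite /flat_exp ltxx mulr0 subrr.
  have lim : h^-1 *: (flat_exp k (h *: 1 + 0) - flat_exp k 0) @[h --> 0^'] --> (0 : R).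
    apply/cvgrPdist_lt => e e0.
    pose K : R := k.+2%:R ^+ k.+2; have K0 : 0 <= K by rewrite exprn_ge0.
    near=> h; have h0 : h != 0 by near: h; exact: nbhs_dnbhs_neq.
    rewrite /flat_exp ltxx subr0 sub0r normrN -/(flat_exp k _) addr0.
    rewrite [h *: 1]mulr1 [_ *: _](_ : _ = h * flat_exp k.+2 h).
      rewrite normrM; apply: (@le_lt_trans _ _ (`|h| * K)).
        have /andP[f0 fK] := flat_exp_le k.+2 h.
        by rewrite ler_wpM2l// ger0_norm.
      apply: (@le_lt_trans _ _ (`|h| * (K + 1))); first by rewrite ler_wpM2l ?lerDl.
      rewrite -ltr_pdivlMr; last by rewrite ltr_wpDl.
      near: h; apply: dnbhs0_lt; by rewrite divr_gt0// ltr_wpDl.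
    by rewrite -[LHS]/(h^-1 * _) flat_expS flat_expS !mulrA mulVf// mul1r.
  split; first by apply/cvg_ex; exists 0; exact: lim.
  exact: cvg_lim lim.
Unshelve. all: by end_near. Qed.

Lemma smooth_flat_exp m k : smooth_upto m (flat_exp k).
Proof.
elim: m k => [|m IH] k; apply: (is_derive_smooth (is_derive_flat_exp k)) => //.
rewrite (_ : (fun x => _) = fun x => flat_exp k.+2 x + (- k%:R) * flat_exp k.+1 x).
  by apply: smoothD => //; exact: smoothZ.
by apply/funext => x; rewrite mulNr.
Qed.

End smooth_step.

(** * A smooth step and its derivative as an averaging kernel *)

Section step_kernel.
Variable R : realType.
Local Notation leb := (@lebesgue_measure R).
Implicit Types (x : R).

(** The classical smooth transition from 0 to 1 on the unit interval; the denominator is positive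
    because one of [x] and [1 - x] is. *)
Definition sstep (x : R) : R :=
  flat_exp 0 x / (flat_exp 0 x + flat_exp 0 (-1 * x + 1)).

Lemma flat_exp_gt0 k x : 0 < x -> 0 < flat_exp k x.
Proof. by move=> x0; rewrite /flat_exp x0 mulr_gt0 ?expR_gt0// exprn_gt0 ?invr_gt0. Qed.

Lemma flat_exp_ge0 k x : 0 <= flat_exp k x.
Proof. by have /andP[] := flat_exp_le k x. Qed.

Lemma flat_exp0 k x : x <= 0 -> flat_exp k x = 0.
Proof. by move=> x0; rewrite /flat_exp ltNge x0. Qed.

Lemma sstep_den x : 0 < flat_exp 0 x + flat_exp 0 (-1 * x + 1).
Proof.
have [x0|x0] := ltP 0 x; first by rewrite ltr_pwDl ?flat_exp_gt0 ?flat_exp_ge0.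
by rewrite ltr_wpDl ?flat_exp_gt0 ?flat_exp_ge0//; lra.
Qed.

Lemma sstep01 x : 0 <= sstep x <= 1.
Proof.
apply/andP; split; first by rewrite divr_ge0 ?flat_exp_ge0// ltW// sstep_den.
by rewrite ler_pdivrMr ?sstep_den// mul1r lerDl flat_exp_ge0.
Qed.

Lemma sstep_le0 x : x <= 0 -> sstep x = 0.
Proof. by move=> x0; rewrite /sstep flat_exp0// mul0r. Qed.

Lemma sstep_ge1 x : 1 <= x -> sstep x = 1.
Proof.
move=> x1; have h : flat_exp 0 (-1 * x + 1) = 0 by apply: flat_exp0; lra.
by rewrite /sstep h addr0 divff// gt_eqF// flat_exp_gt0//; lra.
Qed.

Lemma smooth_sstep m : smooth_upto m sstep.
Proof.
apply: smoothM; first exact: smooth_flat_exp.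
apply: smoothV; first by move=> x; rewrite gt_eqF// sstep_den.
by apply: smoothD; [exact: smooth_flat_exp|apply: smooth_affine; exact: smooth_flat_exp].
Qed.

(** In the quotient rule the numerator is a sum of products of flat exponentials, all nonnegative.
    This makes [ukern] a nonnegative averaging kernel. *)
Lemma derive1_sstep_ge0 x : 0 <= derive1 sstep x.
Proof.
pose h := flat_exp (R := R) 0; pose g x := h (-1 * x + 1); pose h' := flat_exp (R := R) 2.
have dh (y : R) : is_derive y 1 h (h' y).
  by have := is_derive_flat_exp 0 y; rewrite mul0r subr0.
have dg (y : R) : is_derive y 1 g (- h' (-1 * y + 1)).
  have := @is_derive1_comp R h (fun x => -1 * x + 1) y _ _ (dh _) (is_derive_affine _ _ _).
  by rewrite mulrN1.
have den : h x + g x != 0 by rewrite gt_eqF// sstep_den.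
have dd : is_derive x 1 (fun x => h x + g x) (h' x - h' (-1 * x + 1)).
  exact: is_deriveD.
have dS := is_deriveM (dh x) (@is_deriveV R (fun x => h x + g x) x _ 1 den dd).
have -> : derive1 sstep x = h x * (- (h x + g x) ^- 2 * (h' x - h' (-1 * x + 1))) +
    (h x + g x)^-1 * h' x.
  by rewrite derive1E; case: dS.
have -> : h x * (- (h x + g x) ^- 2 * (h' x - h' (-1 * x + 1))) +
    (h x + g x)^-1 * h' x =
  (h x + g x) ^- 2 * (h x * h' (-1 * x + 1) + g x * h' x) by field.
rewrite mulr_ge0 ?invr_ge0 ?sqr_ge0// addr_ge0// mulr_ge0//; exact: flat_exp_ge0.
Qed.

(** Rises from 0 to 1 on [[s, s + e]]; the affine form is the one that [smooth_affine] accepts. *)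
Definition ustep (s e x : R) : R := sstep (e^-1 * x + - (e^-1 * s)).

Lemma ustepE s e x : ustep s e x = sstep ((x - s) / e).
Proof. by rewrite /ustep mulrC [e^-1 * s]mulrC -mulrBl. Qed.

Lemma smooth_ustep m s e : smooth_upto m (ustep s e).
Proof. exact/smooth_affine/smooth_sstep. Qed.

Lemma ustep01 s e x : 0 <= ustep s e x <= 1. Proof. exact: sstep01. Qed.

Lemma ustep_le s e x : 0 < e -> x <= s -> ustep s e x = 0.
Proof. by move=> e0 xs; rewrite ustepE sstep_le0// pmulr_lle0 ?invr_gt0//; lra. Qed.

Lemma ustep_ge s e x : 0 < e -> s + e <= x -> ustep s e x = 1.
Proof. by move=> e0 xs; rewrite ustepE sstep_ge1// ler_pdivlMr//; lra. Qed.

Definition ukern s e : R -> R := derive1 (ustep s e).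

Lemma is_derive_ustep s e x : is_derive x 1 (ustep s e) (ukern s e x).
Proof. exact: smooth_is_derive (smooth_ustep 0 s e) x. Qed.

Lemma ukern_ge0 s e x : 0 < e -> 0 <= ukern s e x.
Proof.
move=> e0; have D := @is_derive1_comp R sstep (fun x => e^-1 * x + - (e^-1 * s)) x _ _
   (smooth_is_derive (smooth_sstep 0) _) (is_derive_affine _ _ _).
rewrite /ukern derive1E (_ : 'D_1 _ x = derive1 sstep (e^-1 * x + - (e^-1 * s)) * e^-1).
  by rewrite mulr_ge0 ?derive1_sstep_ge0// invr_ge0 ltW.
by case: D.
Qed.

Lemma continuous_ukern s e : continuous (ukern s e).
Proof.
move=> x; have sf : smooth_upto 0 (ukern s e) := (smooth_ustep 1 s e).2.
apply: differentiable_continuous; apply/derivable1_diffP.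
exact: smooth_upto_derivable sf x.
Qed.

Lemma ukern_out s e x : 0 < e -> ~~ (s <= x <= s + e) -> ukern s e x = 0.
Proof.
move=> e0; rewrite negb_and -!ltNge => /orP[xs|xs].
  have E : \forall y \near x, cst 0 y = ustep s e y.
    near=> y; rewrite ustep_le// ltW//; near: y; exact: lt_nbhsl.
  have D0 : is_derive x (1 : R) (cst (0 : R)) 0 by exact: is_derive_cst.
  by rewrite /ukern derive1E; case: (near_eq_is_derive E D0).
have E : \forall y \near x, cst 1 y = ustep s e y.
  near=> y; rewrite ustep_ge// ltW//; near: y; exact: lt_nbhsr.
have D0 : is_derive x (1 : R) (cst (1 : R)) 0 by exact: is_derive_cst.
by rewrite /ukern derive1E; case: (near_eq_is_derive E D0).
Unshelve. all: by end_near. Qed.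

Lemma integral_ukern s e : 0 < e -> \int[leb]_(x in `[s, s + e]) ukern s e x = 1.
Proof.
move=> e0; have cu : continuous (ustep s e).
  move=> x; apply: differentiable_continuous; apply/derivable1_diffP.
  exact: smooth_upto_derivable (smooth_ustep 0 s e) x.
rewrite /Rintegral (@continuous_FTC2 _ (ukern s e) (ustep s e) s (s + e))//.
- by rewrite (ustep_ge e0 (lexx _)) (ustep_le e0 (lexx s)) /= subr0.
- by rewrite ltrDl.
- exact/continuous_subspaceT/continuous_ukern.
- split.
  + by move=> x _; case: (is_derive_ustep s e x).
  + exact: cvg_at_right_filter (cu s).
  + exact: cvg_at_left_filter (cu (s + e)).
Qed.

Lemma Rintegral_supp (D E : set R) (f : R -> R) : E `<=` D ->
  (forall x, D x -> ~ E x -> f x = 0) ->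
  \int[leb]_(x in D) f x = \int[leb]_(x in E) f x.
Proof.
move=> ED f0; rewrite /Rintegral integral_mkcond [in RHS]integral_mkcond.
congr (fine (integral _ _ _)); apply/funext => x; rewrite !patchE.
case: (boolP (x \in D)) => [/set_mem Dx|/negP xD]; last first.
  by rewrite ifN//; apply/negP => /set_mem /ED Dx; apply: xD; exact: mem_set.
case: (boolP (x \in E)) => [//|/negP xE].
by rewrite f0// => Ex; apply: xE; exact: mem_set.
Qed.

Lemma continuous_itv_integrable (a b : R) (f : R -> R) :
  {within `[a, b], continuous f} -> leb.-integrable `[a, b] (EFin \o f).
Proof. by move=> cf; apply: continuous_compact_integrable => //; exact: segment_compact. Qed.

Lemma within_continuousM (A : set R) (f g : R -> R) :
  {within A, continuous f} -> {within A, continuous g} ->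
  {within A, continuous (fun x => f x * g x)}.
Proof. by move=> cf cg x; apply: continuousM; [exact: cf|exact: cg]. Qed.

(** The kernel is nonnegative with mass one on [[s, s + e]], so the error is a weighted average of
    [c x - c s] over that interval. *)
Lemma ukern_average (T s e eta : R) (c : R -> R) : 0 < e -> 0 < s -> s + e < T ->
  {within `[0, T], continuous c} ->
  (forall x, s <= x <= s + e -> `|c x - c s| <= eta) ->
  `|\int[leb]_(x in `]0, T[) (c x * ukern s e x) - c s| <= eta.
Proof.
move=> e0 s0 sT cc H.
have sub : `[s, s + e] `<=` `]0, T[.
  by move=> x /=; rewrite !in_itv /= => /andP[h1 h2]; apply/andP; split; lra.
have sub' : `[s, s + e] `<=` `[0, T].
  by apply: subset_trans sub _; exact: subset_itv_oo_cc.
have cK : {within `[s, s + e], continuous (ukern s e)}.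
  exact/continuous_subspaceT/continuous_ukern.
have cs : {within `[s, s + e], continuous c}.
  exact: continuous_subspaceW sub' cc.
have iK := continuous_itv_integrable cK.
have icK : leb.-integrable `[s, s + e] (EFin \o (fun x => c x * ukern s e x)).
  exact: continuous_itv_integrable (within_continuousM cs cK).
rewrite (Rintegral_supp (E := `[s, s + e]))//; last first.
  move=> x _ /= xE; rewrite ukern_out ?mulr0//.
  by apply/negP => xe; apply: xE; rewrite in_itv.
have -> : c s = \int[leb]_(x in `[s, s + e]) (c s * ukern s e x).
  by rewrite RintegralZl// integral_ukern// mulr1.
rewrite -RintegralB//; last first.
  by apply: eq_integrable (integrableZl _ (c s) iK) => // x _ /=; rewrite EFinM.
have iB : leb.-integrable `[s, s + e] (EFin \o (fun x => (c x - c s) * ukern s e x)).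
  have cB : {within `[s, s + e], continuous (fun x => c x - c s)}.
    by move=> x; apply: continuousB; [exact: cs|exact: cst_continuous].
  exact: continuous_itv_integrable (within_continuousM cB cK).
under eq_Rintegral do rewrite -mulrBl.
apply: le_trans (le_normr_Rintegral _ iB) _ => //.
have -> : eta = \int[leb]_(x in `[s, s + e]) (eta * ukern s e x).
  by rewrite RintegralZl// integral_ukern// mulr1.
apply: le_Rintegral => //.
- exact: integrable_norm.
- by apply: eq_integrable (integrableZl _ eta iK) => // x _ /=; rewrite EFinM.
- move=> x /=; rewrite in_itv /= => xe.
  by rewrite normrM [`|ukern s e x|]ger0_norm ?ukern_ge0// ler_wpM2r ?ukern_ge0// H.
Qed.

End step_kernel.

(** * From a weak derivative to a primitive on the open interval *)

Section du_bois_reymond.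
Variable R : realType.
Local Notation leb := (@lebesgue_measure R).

Lemma itv_continuous_at (T : R) (c : R -> R) s : {within `[0, T], continuous c} ->
  0 < s < T -> {for s, continuous c}.
Proof.
move=> cc /andP[s0 sT]; have T0 : 0 < T by exact: lt_trans sT.
have [ci _ _] := (continuous_within_itvP c T0).1 cc.
by apply: ci; rewrite in_itv /= s0 sT.
Qed.

Lemma right_modulus (c : R -> R) s eta : {for s, continuous c} -> 0 < eta ->
  exists2 r : R, 0 < r & forall e, 0 < e < r ->
    forall x, s <= x <= s + e -> `|c x - c s| <= eta.
Proof.
move=> cs eta0; have /cvgrPdist_lt/(_ _ eta0)/nbhs_ballP[r /= r0 H] := cs.
exists r => // e /andP[e0 er] x /andP[sx xe].
rewrite distrC ltW//; apply: H; rewrite /ball /= ltr_norml; lra.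
Qed.

Lemma right_small_integral (g : R -> R) a b eta : a < b -> 0 < eta ->
  leb.-integrable `[a, b] (EFin \o g) ->
  exists2 r : R, 0 < r & forall e, 0 < e < r ->
    \int[leb]_(x in `[a, a + e]) `|g x| <= eta.
Proof.
move=> ab eta0 ig.
have /nbhs_ballP[r /= r0 H] := parameterized_integral_near_left ab eta0 (integrable_norm ig).
exists r => // e /andP[e0 er]; apply/ltW/(le_lt_trans (ler_norm _)).
apply: (H (a + e)); last by rewrite lerDl ltW.
by rewrite /ball /= ltr_norml; lra.
Qed.

(** A smoothed indicator of [[s, t]] whose two edges are both spread to the right over a length [e];
    it is supported in [[s, t + e]]. *)
Definition plateau (s t e x : R) : R := ustep s e x + (-1) * ustep t e x.

Lemma test_plateau (T s t e : R) : 0 < e -> 0 < s -> s <= t -> t + e < T ->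
  test_time T (plateau s t e).
Proof.
move=> e0 s0 st tT; split.
  move=> m x; apply: smooth_upto_derive1n.
  apply: smoothD; [|apply: smoothZ]; exact: smooth_ustep.
exists s, (t + e); split => //.
move=> x; rewrite negb_and -!ltNge => /orP[h|h]; rewrite /plateau.
  by rewrite !ustep_le//; lra.
by rewrite !ustep_ge//; lra.
Qed.

Lemma derive1_plateau s t e x :
  derive1 (plateau s t e) x = ukern s e x - ukern t e x.
Proof.
have D : is_derive x 1 (plateau s t e) (ukern s e x + (-1) * ukern t e x).
  apply: is_deriveD; first exact: is_derive_ustep.
  exact: (is_deriveZ (-1) (is_derive_ustep t e x)).
by rewrite derive1E mulN1r in D *; case: D.
Qed.

Lemma plateau_indic (s t e x : R) : 0 < e -> s + e <= t -> s <= x ->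
  `|plateau s t e x - \1_(`[s, t] : set R) x| <=
  \1_(`[s, s + e] : set R) x + \1_(`[t, t + e] : set R) x.
Proof.
move=> e0 st sx; rewrite !indicE /plateau !mem_setE !in_itv /= !sx /=.
have /andP[a0 a1] := ustep01 s e x; have /andP[b0 b1] := ustep01 t e x.
have [xs|xs] := leP x (s + e).
  have -> : (x <= t) by lra.
  rewrite (_ : ustep t e x = 0); last by rewrite ustep_le//; lra.
  have : 0 <= (t <= x <= t + e)%R%:R :> R by exact: ler0n.
  rewrite mulr0 addr0 ler_norml -[true%:R]/(1 : R).
  by move: (_%:R) => z z0; apply/andP; split; lra.
rewrite (ustep_ge e0 (ltW xs)).
have [xt|xt] := leP x t.
  rewrite (ustep_le e0 xt) mulr0 addr0 subrr normr0 add0r; exact: ler0n.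
rewrite (ltW xt) /= add0r.
have [xe|xe] := leP x (t + e).
  by rewrite -[true%:R]/(1 : R) -[false%:R]/(0 : R) ler_norml; apply/andP; split; lra.
by rewrite (ustep_ge e0 (ltW xe)) mulr1 -[false%:R]/(0 : R) subr0 subrr normr0.
Qed.

Lemma integrable_mul_bnd (D : set (measurableTypeR R)) (g h : measurableTypeR R -> R) (K : R) : measurable D ->
  leb.-integrable D (EFin \o g) -> measurable_fun D h ->
  (forall x, D x -> `|h x| <= K) -> leb.-integrable D (EFin \o (fun x => g x * h x)).
Proof.
move=> mD ig mh hK.
have iK : leb.-integrable D (EFin \o (fun x => K * `|g x|)).
  by apply: eq_integrable (integrableZl _ K (integrable_norm ig)) => // x _ /=; rewrite EFinM.
apply: le_integrable iK => //.
  apply/measurable_EFinP; apply: measurable_funM.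
    by case/integrableP: ig => /measurable_EFinP.
  exact: mh.
move=> x Dx /=; rewrite lee_fin normrM mulrC; apply: le_trans (ler_norm _).
by rewrite ler_wpM2r// hK.
Qed.

Lemma set_integrableD (D : set (measurableTypeR R)) (f g : R -> R) : measurable D ->
  leb.-integrable D (EFin \o f) -> leb.-integrable D (EFin \o g) ->
  leb.-integrable D (EFin \o (fun x => f x + g x)).
Proof. by move=> mD fi gi; exact: (integrableD mD fi gi). Qed.

Lemma set_integrableB (D : set (measurableTypeR R)) (f g : R -> R) : measurable D ->
  leb.-integrable D (EFin \o f) -> leb.-integrable D (EFin \o g) ->
  leb.-integrable D (EFin \o (fun x => f x - g x)).
Proof. by move=> mD fi gi; exact: (integrableB mD fi gi). Qed.

Lemma Rintegral_indic (D E : set R) (f : R -> R) : E `<=` D ->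
  \int[leb]_(x in D) (f x * \1_E x) = \int[leb]_(x in E) f x.
Proof.
move=> ED; rewrite (Rintegral_supp ED) => [|x _ xE]; last first.
  by rewrite indicE memNset ?mulr0.
by apply: eq_Rintegral => x xE; rewrite indicE xE mulr1.
Qed.

(** Test with a smoothed indicator function of [[s, t]]. *)
Lemma du_bois_reymond (T : R) (c v : R -> R) : {within `[0, T], continuous c} ->
  (forall a b, 0 < a -> b < T -> ae_integrable leb `[a, b] v) ->
  (forall chi, test_time T chi -> \int[leb]_(t in `]0, T[) (v t * chi t) =
     - \int[leb]_(t in `]0, T[) (c t * derive1 chi t)) ->
  forall s t, 0 < s -> s < t -> t < T -> c t - c s = \int[leb]_(x in `[s, t]) v x.
Proof.
move=> cc iv dv s t s0 st tT.
(* A right end fixed before [e]: it contains the supports of all the plateaus used, and [v] is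
   integrable up to it. *)
pose b := (t + T) / 2; have tb : t < b by rewrite /b; lra.
have bT : b < T by rewrite /b; lra.
have [g ig vg] := iv s b s0 bT.
have sub : `[s, t] `<=` (`[s, b] : set R) by apply: subset_itvl; rewrite bnd_simp ltW.
have -> : \int[leb]_(x in `[s, t]) v x = \int[leb]_(x in `[s, t]) g x.
  by apply: ae_eq_Rintegral_nm; apply: aeS vg => x h /sub; exact: h.
apply/eqP; rewrite -subr_eq0 -normr_le0; apply/ler_addgt0Pl => eta4 eta40.
(* Four errors occur: two averages of [c] and the two edges of the plateau. *)
pose eta := eta4 / 4; have eta0 : 0 < eta by rewrite divr_gt0.
have igt : leb.-integrable `[t, b] (EFin \o g).
  by apply: integrableS ig => //; apply: subset_itvr; rewrite bnd_simp ltW.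
have [r1 r10 H1] := right_modulus (itv_continuous_at cc (introT andP (conj s0 (lt_trans st tT)))) eta0.
have [r2 r20 H2] := right_modulus (itv_continuous_at cc (introT andP (conj (lt_trans s0 st) tT))) eta0.
have [r3 r30 H3] := right_small_integral (lt_trans st tb) eta0 ig.
have [r4 r40 H4] := right_small_integral tb eta0 igt.
have [e [e0 [est [etb [e1 [e2 [e3 e4]]]]]]] : exists e : R, 0 < e /\ s + e <= t /\
    t + e <= b /\ e < r1 /\ e < r2 /\ e < r3 /\ e < r4.
  near (0 : R)^'+ => e; exists e.
  have h1 : e < t - s by near: e; apply: nbhs_right_lt; lra.
  have h2 : e < b - t by near: e; apply: nbhs_right_lt; lra.
  do 3 (split; first by [near: e; exact: nbhs_right_gt|lra]).
  do 3 (split; first by near: e; exact: nbhs_right_lt).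
  by near: e; exact: nbhs_right_lt.
have avs : `|\int[leb]_(x in `]0, T[) (c x * ukern s e x) - c s| <= eta.
  by apply: ukern_average => //; [lra|apply: H1; rewrite e0].
have avt : `|\int[leb]_(x in `]0, T[) (c x * ukern t e x) - c t| <= eta.
  by apply: ukern_average => //; [lra|lra|apply: H2; rewrite e0].
have ick z : leb.-integrable `]0, T[ (EFin \o (fun x => c x * ukern z e x)).
  have i0T : leb.-integrable `[0, T] (EFin \o (fun x => c x * ukern z e x)).
    apply: continuous_itv_integrable; apply: within_continuousM => //.
    exact/continuous_subspaceT/continuous_ukern.
  by apply: integrableS i0T => //; exact: subset_itv_oo_cc.
have := dv _ (test_plateau e0 s0 (ltW st) (le_lt_trans etb bT)).
rewrite [X in _ = - X](_ : _ = \int[leb]_(x in `]0, T[) (c x * ukern s e x) -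
    \int[leb]_(x in `]0, T[) (c x * ukern t e x)); last first.
  rewrite -RintegralB//; apply: eq_Rintegral => x _.
  by rewrite derive1_plateau mulrBr.
rewrite (Rintegral_supp (E := `[s, b])); last 2 first.
- by move=> x /=; rewrite !in_itv /= => /andP[h1 h2]; apply/andP; split; lra.
- move=> x _ xE; rewrite /plateau; have [xs|xs] := leP x s.
    by rewrite !ustep_le ?mulr0 ?addr0 ?mulr0//; lra.
  have xb : b < x.
    by rewrite ltNge; apply/negP => xb; apply: xE; rewrite /= in_itv /= (ltW xs).
  by rewrite !ustep_ge ?mulr1 ?subrr ?mulr0//; lra.
rewrite (_ : \int[leb]_(x in `[s, b]) (v x * _) =
    \int[leb]_(x in `[s, b]) (g x * plateau s t e x)); last first.
  by apply: ae_eq_Rintegral_nm; apply: aeS vg => x h xb; rewrite h.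
have mp : measurable_fun setT (plateau s t e : measurableTypeR R -> R).
  apply: continuous_measurable_fun => x; apply: differentiable_continuous.
  apply/derivable1_diffP; have [+ _] := test_plateau e0 s0 (ltW st) (le_lt_trans etb bT).
  by move=> /(_ 0%N x).
have pb x : `|plateau s t e x| <= 2.
  have := ustep01 s e x; have := ustep01 t e x; rewrite /plateau ler_norml; lra.
have igp := integrable_mul_bnd (measurable_itv _) ig (measurable_funTS mp) (fun x _ => pb x).
have mi (A : set (measurableTypeR R)) : measurable A ->
    measurable_fun setT (\1_A : measurableTypeR R -> R).
  by move=> mA; exact: measurable_indic.
have ib (A : set R) (x : R) : `|\1_A x : R| <= 1.
  by rewrite indicE ger0_norm ?ler0n// lern1; case: (_ \in _).
have igi (A : set (measurableTypeR R)) : measurable A ->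
    leb.-integrable `[s, b] (EFin \o (fun x => g x * \1_A x)).
  by move=> mA; exact: integrable_mul_bnd (measurable_funTS (mi A mA)) (fun x _ => ib A x).
have iagi (A : set (measurableTypeR R)) : measurable A ->
    leb.-integrable `[s, b] (EFin \o (fun x => `|g x| * \1_A x)).
  move=> mA; exact: integrable_mul_bnd (integrable_norm ig) (measurable_funTS (mi A mA))
    (fun x _ => ib A x).
have close : `|\int[leb]_(x in `[s, b]) (g x * plateau s t e x) -
    \int[leb]_(x in `[s, t]) g x| <= eta + eta.
  rewrite -(Rintegral_indic g sub) -RintegralB//; last exact: igi.
  under eq_Rintegral do rewrite -mulrBr.
  have iB : leb.-integrable `[s, b]
      (EFin \o (fun x => g x * (plateau s t e x - \1_(`[s, t] : set R) x))).
    have := set_integrableB (measurable_itv _) igp (igi _ (measurable_itv `[s, t])).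
    by apply: eq_integrable => // x _ /=; rewrite mulrBr.
  apply: le_trans (le_normr_Rintegral _ iB) _ => //.
  apply: (@le_trans _ _ (\int[leb]_(x in `[s, b]) (`|g x| * \1_(`[s, s + e] : set R) x +
      `|g x| * \1_(`[t, t + e] : set R) x))).
    apply: le_Rintegral => //; first exact: integrable_norm.
      exact: set_integrableD (measurable_itv _) (iagi _ (measurable_itv `[s, s + e]))
        (iagi _ (measurable_itv `[t, t + e])).
    move=> x /=; rewrite in_itv /= => /andP[sx _].
    by rewrite normrM -mulrDr ler_wpM2l// plateau_indic.
  rewrite RintegralD//; [|exact: iagi|exact: iagi].
  rewrite !Rintegral_indic; last 2 first.
  - by move=> x /=; rewrite !in_itv /= => /andP[h1 h2]; apply/andP; split; lra.
  - by move=> x /=; rewrite !in_itv /= => /andP[h1 h2]; apply/andP; split; lra.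
  by apply: lerD; [apply: H3; rewrite e0|apply: H4; rewrite e0].
move: close avs avt; rewrite /eta.
move: (\int[leb]_(x in `[s, b]) _) (\int[leb]_(x in `[s, t]) _)
  (\int[leb]_(x in `]0, T[) (c x * ukern s e x))
  (\int[leb]_(x in `]0, T[) (c x * ukern t e x)) => A B C D.
by rewrite !ler_norml addr0 => *; lra.
Unshelve. all: by end_near. Qed.

End du_bois_reymond.

(** * The square of a primitive and the passage to the closed interval *)

Section primitive_square.
Variable R : realType.
Local Notation leb := (@lebesgue_measure R).

(** Supremum argument on the points where [F] is at least [F s]. Comparing points on either side of
    a common [z] is enough: the inequality first reaches the supremum and then crosses it, unless
    the supremum is [t]. *)
Lemma local_nondecreasing (F : R -> R) (s t : R) : s <= t ->
  (forall z, s <= z <= t -> exists2 r, 0 < r & forall x y, s <= x -> x <= z ->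
     z <= y -> y <= t -> z - r < x -> y < z + r -> F x <= F y) ->
  F s <= F t.
Proof.
move=> st H; pose E := [set y | s <= y <= t /\ F s <= F y].
have Es : E s by rewrite /E /= lexx st.
have ubE : ubound E t by move=> y [/andP[]].
have supE : has_sup E by split; [exists s|exists t].
have sz : s <= sup E by apply: ub_le_sup => //; exists t.
have zt : sup E <= t by apply: ge_sup => //; exists s.
have [r r0 Hr] := H (sup E) (introT andP (conj sz zt)).
have [y0 [/andP[sy0 y0t] Fy0] zy0] := sup_adherent r0 supE.
have y0z : y0 <= sup E by apply: ub_le_sup => //; [exists t|split => //; apply/andP].
have Fz : F s <= F (sup E).
  by apply: le_trans Fy0 _; apply: Hr => //; rewrite ltrDl.
have [zt'|zt'] := ltP (sup E) t; last first.
  by rewrite (_ : t = sup E)//; apply/eqP; rewrite eq_le zt' zt.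
pose y := Num.min t (sup E + r / 2).
have zy : sup E < y by rewrite lt_min zt' ltrDl divr_gt0.
have yt : y <= t by rewrite ge_min lexx.
have Ey : E y.
  split; first by rewrite yt andbT; apply: le_trans sz (ltW zy).
  apply: le_trans Fz _; apply: Hr => //; [exact: ltW|by rewrite ltrBlDr ltrDl|].
  by rewrite gt_min; apply/orP; right; rewrite ltrD2l; lra.
have : y <= sup E by apply: ub_le_sup => //; exists t.
by rewrite leNgt zy.
Qed.

Lemma Rintegral_itv_add (h : R -> R) (s x y : R) : s <= x -> x <= y ->
  leb.-integrable `[s, y] (EFin \o h) ->
  \int[leb]_(z in `[s, y]) h z = \int[leb]_(z in `[s, x]) h z + \int[leb]_(z in `[x, y]) h z.
Proof.
move=> sx xy ih.
have := @Rintegral_itvB R h (BLeft s) (BRight y) x ih.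
rewrite !bnd_simp => /(_ sx xy) H.
rewrite -[LHS](subrK (\int[leb]_(z in `[s, x]) h z)) H addrC; congr (_ + _).
rewrite Rintegral_itv_obnd_cbnd//.
by apply: integrableS ih => //; apply: subset_itv; rewrite bnd_simp.
Qed.

Lemma integrable_continuous_mul (s t : R) (c g : R -> R) :
  {within `[s, t], continuous c} -> leb.-integrable `[s, t] (EFin \o g) ->
  leb.-integrable `[s, t] (EFin \o (fun x => g x * c x)).
Proof.
move=> cc ig.
have mc : measurable_fun `[s, t] (c : measurableTypeR R -> R).
  exact: subspace_continuous_measurable_fun.
have /compact_bounded[M [_ HM]] := continuous_compact cc (@segment_compact _ s t).
apply: (integrable_mul_bnd (K := M + 1)) => // x xst.
by apply: HM; [rewrite ltrDl|exists x].
Qed.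

(** On a short interval [[x, y]] the defect
    [c y ^ 2 - c x ^ 2 - 2 \int c v = \int v (c x + c y - 2 c)] is small compared
    with [\int |v|]. *)
Lemma primitive_square (T : R) (c v : R -> R) : {within `[0, T], continuous c} ->
  (forall a b, 0 < a -> b < T -> ae_integrable leb `[a, b] v) ->
  (forall s t, 0 < s -> s < t -> t < T -> c t - c s = \int[leb]_(x in `[s, t]) v x) ->
  forall s t, 0 < s -> s < t -> t < T ->
    c t ^+ 2 - c s ^+ 2 = 2 * \int[leb]_(x in `[s, t]) (c x * v x).
Proof.
move=> cc iv cv s t s0 st tT; have [g ig vg] := iv s t s0 tT.
have sub x y : s <= x -> y <= t -> `[x, y] `<=` (`[s, t] : set R).
  by move=> sx yt; apply: subset_itv; rewrite bnd_simp.
have cst : {within `[s, t], continuous c}.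
  by apply: continuous_subspaceW cc; apply: subset_itv; rewrite bnd_simp ltW.
have -> : \int[leb]_(x in `[s, t]) (c x * v x) = \int[leb]_(x in `[s, t]) (c x * g x).
  by apply: ae_eq_Rintegral_nm; apply: aeS vg => x h xst; rewrite h.
have igc : leb.-integrable `[s, t] (EFin \o (fun x => c x * g x)).
  apply: eq_integrable (integrable_continuous_mul cst ig) => // x _ /=.
  by rewrite mulrC.
have iag := integrable_norm ig.
pose A y := \int[leb]_(x in `[s, y]) `|g x|.
pose Phi y := c y ^+ 2 - 2 * \int[leb]_(x in `[s, y]) (c x * g x).
have S0 (h : R -> R) : \int[leb]_(x in `[s, s]) h x = 0 by rewrite set_itv1 Rintegral_set1.
(* Monotonicity of [e * A - k * Phi] for both signs of [k] bounds the variation of [Phi] by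
   [e * A t] for every [e]. *)
have key (k : R) : `|k| = 1 -> forall e, 0 < e -> k * (Phi t - Phi s) <= e * A t.
  move=> k1 e e0.
  suff : e * A s - k * Phi s <= e * A t - k * Phi t by rewrite {1}/A S0; lra.
  apply: (local_nondecreasing (F := fun y => e * A y - k * Phi y)); first exact: ltW.
  move=> z /andP[sz zt].
  have zT : 0 < z < T by apply/andP; split; lra.
  (* The factor [c x + c y - 2 * c w] is made of four differences with [c z], each below [e / 4]. *)
  have e4 : 0 < e / 4 by rewrite divr_gt0.
  have /cvgrPdist_lt/(_ _ e4)/nbhs_ballP[r /= r0 Hr] := itv_continuous_at cc zT.
  exists r => // x y sx xz zy yt zx yz.
  have near_z w : x <= w <= y -> `|c z - c w| < e / 4.
    by move=> /andP[xw wy]; apply: Hr; rewrite /ball /= ltr_norml; apply/andP; split; lra.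
  have xy : x <= y by lra.
  have iS (h : R -> R) u w : s <= u -> w <= t -> leb.-integrable `[s, t] (EFin \o h) ->
      leb.-integrable `[u, w] (EFin \o h).
    by move=> su wt; apply: integrableS => //; exact: sub.
  have addA : A y = A x + \int[leb]_(x in `[x, y]) `|g x|.
    by apply: Rintegral_itv_add => //; exact: iS.
  have addc : \int[leb]_(x in `[s, y]) (c x * g x) =
      \int[leb]_(x in `[s, x]) (c x * g x) + \int[leb]_(x in `[x, y]) (c x * g x).
    by apply: Rintegral_itv_add => //; exact: iS.
  have gxy : c y - c x = \int[leb]_(x in `[x, y]) g x.
    have [xy'|] := ltP x y; last first.
      move=> yx; have -> : y = x by apply/eqP; rewrite eq_le yx xy.
      by rewrite subrr set_itv1 Rintegral_set1.
    rewrite cv//; [|lra|lra].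
    by apply: ae_eq_Rintegral_nm; apply: aeS vg => w h /(sub _ _ sx yt); exact: h.
  have igxy := iS g x y sx yt ig.
  have icgxy := iS _ x y sx yt igc.
  have diff : Phi y - Phi x = \int[leb]_(w in `[x, y]) (g w * (c x + c y - 2 * c w)).
    have -> : Phi y - Phi x = (c x + c y) * (\int[leb]_(x in `[x, y]) g x) -
        2 * \int[leb]_(w in `[x, y]) (c w * g w).
      by rewrite -gxy /Phi addc; ring.
    rewrite -RintegralZl// -RintegralZl// -RintegralB//; last 2 first.
    - by apply: eq_integrable (integrableZl _ (c x + c y) igxy) => // w _ /=; rewrite EFinM.
    - by apply: eq_integrable (integrableZl _ 2 icgxy) => // w _ /=; rewrite EFinM.
    by apply: eq_Rintegral => w _; ring.
  have bd : `|Phi y - Phi x| <= e * \int[leb]_(x in `[x, y]) `|g x|.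
    rewrite diff.
    have iD : leb.-integrable `[x, y] (EFin \o (fun w => g w * (c x + c y - 2 * c w))).
      have i1 : leb.-integrable `[x, y] (EFin \o (fun w => (c x + c y) * g w)).
        by apply: eq_integrable (integrableZl _ (c x + c y) igxy) => // w _ /=; rewrite EFinM.
      have i2 : leb.-integrable `[x, y] (EFin \o (fun w => 2 * (c w * g w))).
        by apply: eq_integrable (integrableZl _ 2 icgxy) => // w _ /=; rewrite EFinM.
      apply: eq_integrable (set_integrableB (measurable_itv _) i1 i2) => // w _ /=.
      by congr EFin; ring.
    apply: le_trans (le_normr_Rintegral _ iD) _ => //.
    have iag' := integrable_norm igxy.
    rewrite -RintegralZl//; apply: le_Rintegral => //.
    - exact: integrable_norm.
    - by apply: eq_integrable (integrableZl _ e iag') => // w _ /=; rewrite EFinM.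
    move=> w /=; rewrite in_itv /= => wxy; rewrite normrM mulrC ler_wpM2r//.
    have := near_z w wxy; have := near_z x; have := near_z y.
    rewrite !lexx xy => /(_ isT) + /(_ isT).
    by rewrite ler_norml !ltr_norml => *; apply/andP; split; lra.
  rewrite addA; have : k * (Phi y - Phi x) <= `|Phi y - Phi x|.
    by rewrite -[leRHS]mul1r -k1 -normrM ler_norm.
  by move: bd; lra.
have Pst : Phi t - Phi s = 0.
  apply/eqP; rewrite -normr_le0; apply/ler_addgt0Pl => e e0; rewrite addr0.
  have At0 : 0 <= A t by apply: Rintegral_ge0 => x _; exact: normr_ge0.
  pose d := e / (A t + 1).
  have d0 : 0 < d by rewrite divr_gt0// ltr_wpDl.
  have dA : d * A t <= e.
    by rewrite /d mulrAC ler_pdivrMr ?ltr_wpDl// ler_wpM2l ?lerDl// ltW.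
  have := key 1 (normr1 _) d d0; have := key (-1) (normrN1 _) d d0.
  by rewrite ler_norml => *; apply/andP; split; lra.
move: Pst; rewrite /Phi S0; lra.
Qed.

Lemma continuous_itv_const (T : R) (phi : R -> R) : 0 < T ->
  {within `[0, T], continuous phi} ->
  (forall s t, 0 < s -> s < t -> t < T -> phi s = phi t) ->
  forall s, 0 <= s <= T -> phi s = phi (T / 2).
Proof.
move=> T0 cphi H s /andP[s0 sT]; pose m := T / 2.
have [m0 mT] : 0 < m /\ m < T by rewrite /m; split; lra.
have E z : 0 < z < T -> phi z = phi m.
  move=> /andP[z0 zT]; have [zm|mz|->//] := ltgtP z m; first exact: H.
  by rewrite (H m z).
have [_ c0 cT] := (continuous_within_itvP phi T0).1 cphi.
have [s00|sn0] := eqVneq s 0.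
  rewrite s00; apply: (cvg_unique _ c0) => //; apply: cvg_near_cst.
  near=> x; apply: E; apply/andP; split; near: x; first exact: nbhs_right_gt.
  exact: nbhs_right_lt.
have [sT'|snT] := eqVneq s T.
  rewrite sT'; apply: (cvg_unique _ cT) => //; apply: cvg_near_cst.
  near=> x; apply: E; apply/andP; split; near: x; last exact: nbhs_left_lt.
  exact: nbhs_left_gt.
by apply: E; rewrite !lt_neqAle s0 sT eq_sym sn0 snT.
Unshelve. all: by end_near. Qed.

(** The identity inside the interval makes [phi] minus the primitive of [psi] constant there. This
    difference is continuous on the closed interval, so it is constant up to the endpoints, which
    test functions in time do not see. *)
Lemma primitive_closed (T : R) (phi psi : R -> R) : 0 < T ->
  {within `[0, T], continuous phi} -> leb.-integrable `[0, T] (EFin \o psi) ->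
  (forall s t, 0 < s -> s < t -> t < T ->
     phi t - phi s = \int[leb]_(x in `[s, t]) psi x) ->
  forall s t, 0 <= s -> s <= t -> t <= T ->
    phi t - phi s = \int[leb]_(x in `[s, t]) psi x.
Proof.
move=> T0 cphi ipsi H.
pose P x := \int[leb]_(z in `[0, x]) psi z.
have cP : {within `[0, T], continuous P}.
  exact: parameterized_integral_continuous (ltW T0) ipsi.
have iS x : x <= T -> leb.-integrable `[0, x] (EFin \o psi).
  by move=> xT; apply: integrableS ipsi => //; apply: subset_itvl; rewrite bnd_simp.
have add s t : 0 <= s -> s <= t -> t <= T ->
    P t = P s + \int[leb]_(x in `[s, t]) psi x.
  by move=> s0 st tT; apply: Rintegral_itv_add => //; exact: iS.
have cD : {within `[0, T], continuous (fun x => phi x - P x)}.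
  by move=> x; apply: continuousB; [exact: cphi|exact: cP].
have C : forall s, 0 <= s <= T -> phi s - P s = phi (T / 2) - P (T / 2).
  apply: (continuous_itv_const T0 cD) => s t s0 st tT.
  have := H s t s0 st tT; rewrite (add s t (ltW s0) (ltW st) (ltW tT)); lra.
move=> s t s0 st tT.
have := C s (introT andP (conj s0 (le_trans st tT))).
have := C t (introT andP (conj (le_trans s0 st) tT)).
have := add s t s0 st tT; lra.
Qed.

End primitive_square.

(** * Measurability and domination in time *)

Section ae_toolkit.
Context d (X : measurableType d) (R : realType).
Variables (mu : {measure set X -> \bar R}) (D : set X).
Hypothesis mD : measurable D.
Implicit Types f g : X -> R.

(** The upper limit of measurable representatives is measurable and represents [f] outside countably
    many null sets. *)
Lemma ae_measurable_cvg (g_ : nat -> X -> R) f :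
  (forall m, ae_measurable mu D (g_ m)) ->
  {ae mu, forall x, D x -> g_ ^~ x @ \oo --> f x} -> ae_measurable mu D f.
Proof.
move=> mg gf.
have /choice[G HG] m : exists h : X -> R, measurable_fun D h /\
    {ae mu, forall x, D x -> g_ m x = h x} by have [h] := mg m; exists h.
exists (fun x => fine (limn_esup (fun m => (G m x)%:E))).
  apply: measurableT_comp => //; apply: measurable_fun_limn_esup => m.
  by apply/measurable_EFinP; have [] := HG m.
have gG : {ae mu, forall x m, D x -> g_ m x = G m x}.
  by apply/ae_foralln => m; have [] := HG m.
apply: aeS2 gG gf => x gGx gfx Dx.
have cG : (fun m => (G m x)%:E) @ \oo --> (f x)%:E.
  apply: cvg_EFin; first exact: nearW.
  rewrite (_ : fine \o _ = g_ ^~ x); first exact: gfx.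
  by apply/funext => m /=; rewrite gGx.
by rewrite is_cvg_limn_esupE ?(cvg_lim _ cG)//; apply/cvg_ex; exists (f x)%:E.
Qed.

Lemma eq_ae_measurable f g : {ae mu, forall x, D x -> f x = g x} ->
  ae_measurable mu D f -> ae_measurable mu D g.
Proof.
move=> fg [h mh fh]; exists h => //.
by apply: aeS2 fg fh => x fgx fhx Dx; rewrite -fgx// fhx.
Qed.

Lemma eq_ae_integrable f g : {ae mu, forall x, D x -> f x = g x} ->
  ae_integrable mu D f -> ae_integrable mu D g.
Proof.
move=> fg [h mh fh]; exists h => //.
by apply: aeS2 fg fh => x fgx fhx Dx; rewrite -fgx// fhx.
Qed.

Lemma ae_measurableD f g : ae_measurable mu D f -> ae_measurable mu D g ->
  ae_measurable mu D (fun x => f x + g x).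
Proof.
move=> [f' mf ff] [g' mg gg]; exists (fun x => f' x + g' x).
  exact: measurable_funD.
by apply: aeS2 ff gg => x ffx ggx Dx; rewrite ffx// ggx.
Qed.

Lemma ae_measurableM f g : ae_measurable mu D f -> ae_measurable mu D g ->
  ae_measurable mu D (fun x => f x * g x).
Proof.
move=> [f' mf ff] [g' mg gg]; exists (fun x => f' x * g' x).
  exact: measurable_funM.
by apply: aeS2 ff gg => x ffx ggx Dx; rewrite ffx// ggx.
Qed.

Lemma ae_measurable_cst (k : R) : ae_measurable mu D (fun=> k).
Proof. by exists (fun=> k) => //; apply: aeW. Qed.

Lemma ae_measurable_sum (I : Type) (s : seq I) (F : I -> X -> R) :
  (forall i, ae_measurable mu D (F i)) ->
  ae_measurable mu D (fun x => \sum_(i <- s) F i x).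
Proof.
move=> mF; elim: s => [|i s IH].
  by under eq_fun do rewrite big_nil; exact: ae_measurable_cst.
by under eq_fun do rewrite big_cons; exact: ae_measurableD.
Qed.

Lemma ae_integrable_measurable f : ae_integrable mu D f -> ae_measurable mu D f.
Proof. by move=> [g /integrableP[/measurable_EFinP mg _] fg]; exists g. Qed.

Lemma ae_integrableD f g : ae_integrable mu D f -> ae_integrable mu D g ->
  ae_integrable mu D (fun x => f x + g x) /\
  \int[mu]_(x in D) (f x + g x) = \int[mu]_(x in D) f x + \int[mu]_(x in D) g x.
Proof.
move=> [f' mf ff] [g' mg gg].
have E : {ae mu, forall x, D x -> f x + g x = f' x + g' x}.
  by apply: aeS2 ff gg => x ffx ggx Dx; rewrite ffx// ggx.
split; first by exists (fun x => f' x + g' x) => //; exact: (integrableD mD mf mg).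
rewrite (ae_eq_Rintegral_nm E) (ae_eq_Rintegral_nm ff) (ae_eq_Rintegral_nm gg).
exact: RintegralD.
Qed.

Lemma ae_integrableZ (k : R) f : ae_integrable mu D f ->
  ae_integrable mu D (fun x => k * f x) /\
  \int[mu]_(x in D) (k * f x) = k * \int[mu]_(x in D) f x.
Proof.
move=> [f' mf ff].
have E : {ae mu, forall x, D x -> k * f x = k * f' x}.
  by apply: aeS ff => x ffx Dx; rewrite ffx.
split.
  exists (fun x => k * f' x) => //.
  by apply: eq_integrable (integrableZl mD k mf) => // x _ /=; rewrite EFinM.
by rewrite (ae_eq_Rintegral_nm E) (ae_eq_Rintegral_nm ff) RintegralZl.
Qed.

Lemma ae_integrable_sum (I : Type) (s : seq I) (F : I -> X -> R) :
  (forall i, ae_integrable mu D (F i)) ->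
  ae_integrable mu D (fun x => \sum_(i <- s) F i x) /\
  \int[mu]_(x in D) (\sum_(i <- s) F i x) = \sum_(i <- s) \int[mu]_(x in D) F i x.
Proof.
move=> iF; elim: s => [|i s [IH IHe]].
  have E : (fun x => \sum_(i <- [::]) F i x) = cst 0.
    by apply/funext => x; rewrite big_nil.
  rewrite E big_nil; split; last by rewrite /Rintegral integral0.
  by exists (cst 0); [exact: integrable0|exact: aeW].
have [h1 h2] := ae_integrableD (iF i) IH.
have E : (fun x => \sum_(j <- i :: s) F j x) = fun x => F i x + \sum_(j <- s) F j x.
  by apply/funext => x; rewrite big_cons.
by rewrite E big_cons -IHe; split.
Qed.

Lemma ae_integrable_dom f g : ae_measurable mu D f -> ae_integrable mu D g ->
  {ae mu, forall x, D x -> `|f x| <= g x} -> ae_integrable mu D f.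
Proof.
move=> [f' mf ff] [g' ig gg] fg.
have [mg _] := integrableP _ _ _ ig.
have mg' : measurable_fun D g' by exact/measurable_EFinP.
(* Clamping the representative of [f] makes it dominated by the absolute value of [g'] at every
   point. *)
pose h x := Num.max (- g' x) (Num.min (g' x) (f' x)).
exists h.
  apply: le_integrable (integrable_norm ig) => //.
    apply/measurable_EFinP; apply: measurable_maxr; first exact: measurable_funN.
    exact: measurable_minr.
  move=> x Dx /=; rewrite lee_fin /h normr_id.
  have a1 : - g' x <= `|g' x| by rewrite -normrN ler_norm.
  have a2 : g' x <= `|g' x| by exact: ler_norm.
  have a3 : - `|g' x| <= g' x by rewrite lerNl.
  rewrite ler_norml le_max ge_max ge_min a1 a2 /= andbT.
  by apply/orP; left; rewrite lerN2.
apply: aeS2 (aeS2 (fun x p q => conj p q) ff gg) fg => x [ffx ggx] fgx Dx.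
have := fgx Dx; rewrite ffx// ggx// ler_norml => /andP[h1 h2].
by rewrite /h min_r// max_r.
Qed.

Lemma ae_integrable_ge0 f : ae_measurable mu D f -> (forall x, 0 <= f x) ->
  (\int[mu]_(x in D) (f x)%:E < +oo)%E -> ae_integrable mu D f.
Proof.
move=> [f' mf ff] f0 foo; exists f' => //.
apply/integrableP; split; first exact/measurable_EFinP.
apply: le_lt_trans foo; rewrite le_eqVlt; apply/orP; left; apply/eqP.
apply: ae_eq_integral_nm; apply: aeS ff => x ffx Dx /=.
by rewrite -ffx// ger0_norm.
Qed.

(** The classical theorem is applied to measurable representatives; a single null set serves all
    indices. *)
Lemma ae_dominated_cvg (f_ : nat -> X -> R) f g (E : set X) :
  measurable E -> E `<=` D ->
  (forall m, ae_measurable mu D (f_ m)) -> ae_integrable mu D g ->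
  {ae mu, forall x, D x -> f_ ^~ x @ \oo --> f x} ->
  {ae mu, forall x, D x -> forall m, `|f_ m x| <= g x} ->
  \int[mu]_(x in E) f_ m x @[m --> \oo] --> \int[mu]_(x in E) f x.
Proof.
move=> mE ED mf ig ff fg.
have /choice[F_ HF_] m : exists h : X -> R, measurable_fun D h /\
    {ae mu, forall x, D x -> f_ m x = h x} by have [h] := mf m; exists h.
have fF : {ae mu, forall x m, D x -> f_ m x = F_ m x}.
  by apply/ae_foralln => m; have [] := HF_ m.
have [F mF fFl] := ae_measurable_cvg mf ff.
have [G iG gG] := ig.
have mF_ m : measurable_fun E (EFin \o F_ m).
  by apply/measurable_EFinP; exact: measurable_funS mD ED (HF_ m).1.
have mFE : measurable_fun E (EFin \o F).
  by apply/measurable_EFinP; exact: measurable_funS mD ED mF.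
have cF : {ae mu, forall x, E x -> (fun m => (F_ m x)%:E) @ \oo --> (F x)%:E}.
  apply: aeS2 (aeS2 (fun x p q => conj p q) ff fF) fFl => x [h1 h2] h3 Ex.
  have Dx := ED _ Ex; apply: cvg_EFin; first exact: nearW.
  rewrite /= -h3// (_ : fine \o _ = f_ ^~ x); first exact: h1.
  by apply/funext => m /=; rewrite h2.
have bF : {ae mu, forall x m, E x -> (`|(F_ m x)%:E| <= (G x)%:E)%E}.
  apply: aeS2 (aeS2 (fun x p q => conj p q) fg fF) gG => x [h1 h2] h3 m Ex.
  by have Dx := ED _ Ex; rewrite /= lee_fin -h3// -h2// h1.
have iGE : mu.-integrable E (EFin \o G) by exact: integrableS mD mE ED iG.
have [iF _ H] := dominated_convergence mE mF_ mFE cF iGE bF.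
have fin : (\int[mu]_(x in E) (F x)%:E)%E \is a fin_num by exact: integrable_fin_num iF.
have lim : fine (\int[mu]_(x in E) (F_ m x)%:E) @[m --> \oo] -->
    \int[mu]_(x in E) F x.
  by apply: fine_cvg; rewrite /Rintegral fineK.
have -> : \int[mu]_(x in E) f x = \int[mu]_(x in E) F x.
  by apply: ae_eq_Rintegral_nm; apply: aeS fFl => x h /ED; exact: h.
rewrite (_ : (fun m => _) = fun m => fine (\int[mu]_(x in E) (F_ m x)%:E)) //.
apply/funext => m; rewrite -[RHS]/(\int[mu]_(x in E) F_ m x).
by apply: ae_eq_Rintegral_nm; apply: aeS fF => x h /ED; exact: h.
Qed.

End ae_toolkit.

(** * Recovering single coefficients from solenoidal tests *)

Section coefficient_extraction.
Variables (R : realType) (n : nat).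
Local Notation Zn := 'rV[int]_n.
Local Notation Rn := 'rV[R]_n.
Local Notation distr := ((Rn -> R) -> R).
Local Notation vdistr := ('I_n -> distr).

Lemma coef_sn0 (v : vdistr) k : is_distr (v k) -> v k (sn 0) = 0.
Proof.
move=> dv; have := snN_odd dv 0; rewrite oppr0 => /eqP.
by rewrite -addr_eq0 -mulr2n mulrn_eq0 /= => /eqP.
Qed.

(** The column [k0] of the symbol of the Leray projector at [xi0]. *)
Let P (k0 : 'I_n) (xi0 : Zn) (k : 'I_n) : R :=
  (k == k0)%:R - (xi0 0 k)%:~R * (xi0 0 k0)%:~R / \sum_i (xi0 0 i)%:~R ^+ 2.

Let den (xi0 : Zn) : xi0 != 0 -> \sum_i (xi0 0 i)%:~R ^+ 2 != 0 :> R.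
Proof.
move=> x0; have [i xi] : exists i, xi0 0 i != 0.
  apply/existsP; rewrite -negb_forall; apply: contra x0 => /forallP H.
  by apply/eqP/rowP => i; rewrite mxE; exact/eqP.
rewrite gt_eqF// (bigD1 i)//= ltr_pwDl//.
  by rewrite lt_def sqr_ge0 sqrf_eq0 intr_eq0 xi.
by rewrite sumr_ge0// => j _; exact: sqr_ge0.
Qed.

Let P_sol k0 xi0 : xi0 != 0 -> \sum_k freq R xi0 k * P k0 xi0 k = 0.
Proof.
move=> x0; have d0 := den x0; set q := \sum_i _ in d0.
rewrite (eq_bigr (fun k => 2 * pi * ((xi0 0 k)%:~R * (k == k0)%:R) -
    2 * pi * ((xi0 0 k0)%:~R / q) * (xi0 0 k)%:~R ^+ 2)); last first.
  by move=> k _; rewrite /freq /P -/q; ring.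
rewrite sumrB -!mulr_sumr -/q (bigD1 k0)//= eqxx big1 => [|k /negbTE ->]; last first.
  by rewrite mulr0.
by rewrite mulr1 addr0 -[X in _ - X]mulrA divfK// subrr.
Qed.

Let P_proj k0 xi0 (c : 'I_n -> R) : xi0 != 0 -> \sum_k freq R xi0 k * c k = 0 ->
  \sum_k P k0 xi0 k * c k = c k0.
Proof.
move=> x0 fc0; set q := \sum_i (xi0 0 i)%:~R ^+ 2 : R.
have s0 : \sum_k (xi0 0 k)%:~R * c k = 0 :> R.
  have : 2 * pi * \sum_k (xi0 0 k)%:~R * c k = 0 :> R.
    by rewrite mulr_sumr -[RHS]fc0; apply: eq_bigr => k _; rewrite /freq mulrA.
  by move=> /eqP; rewrite mulf_eq0 gt_eqF ?mulr_gt0 ?pi_gt0//= => /eqP.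
rewrite (eq_bigr (fun k => (k == k0)%:R * c k -
    ((xi0 0 k0)%:~R / q) * ((xi0 0 k)%:~R * c k))); last first.
  by move=> k _; rewrite /P -/q; ring.
rewrite sumrB -mulr_sumr s0 mulr0 subr0 (bigD1 k0)//= eqxx mul1r big1 ?addr0//.
by move=> k /negbTE ->; rewrite mul0r.
Qed.

(** A single mode in one component is not solenoidal, but its Leray projection is, and the
    projection is symmetric and fixes [v]. Hence the pairing of [v] with the projected mode is the
    wanted coefficient. *)
Lemma coef_test s (k0 : 'I_n) (xi0 : Zn) : exists wc ws : vdistr,
  [/\ vHdot_sol s wc, vHdot_sol s ws & forall s' v, vHdot_sol s' v ->
    v k0 (cs xi0) = vdual v wc /\ v k0 (sn xi0) = vdual v ws].
Proof.
have [->|x0] := eqVneq xi0 0.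
  (* At frequency 0 both coefficients of a mean-free field vanish, so the zero test field does. *)
  have z : vHdot_sol s (tpf 0 (fun _ : 'I_n => (fun=> 0) : Zn -> R) (fun=> fun=> 0)).
    apply: tpf_sol => //.
    - by move=> k xi; rewrite oppr0.
    - by move=> xi; rewrite big1// => k _; rewrite mulr0.
    - by move=> xi; rewrite big1// => k _; rewrite mulr0.
  exists (tpf 0 (fun=> fun=> 0) (fun=> fun=> 0)), (tpf 0 (fun=> fun=> 0) (fun=> fun=> 0)).
  split => // s' v [Hv _]; rewrite (vHdot_coef0 k0 Hv) coef_sn0; last first.
    exact: vHdot_distr Hv k0.
  rewrite vdual_tpf; [|by []|by move=> k xi; rewrite oppr0].
  by rewrite big1// => k _; rewrite /bsum big1// => xi _; rewrite !mul0r addr0.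
(* The mode is made even, and its companion odd, over [xi0] and [- xi0]; the factor one half
   compensates for their equal contributions. *)
pose A k (eta : Zn) := 2^-1 * P k0 xi0 k * ((eta == xi0)%:R + (eta == - xi0)%:R).
pose B k (eta : Zn) := 2^-1 * P k0 xi0 k * ((eta == xi0)%:R - (eta == - xi0)%:R).
pose z : 'I_n -> Zn -> R := fun=> fun=> 0.
have ez k : evenZ (z k) by [].
have oz k : oddZ (z k) by move=> xi; rewrite /z oppr0.
have eA k : evenZ (A k).
  by move=> xi; rewrite /A eqr_oppLR eqr_opp addrC.
have oB k : oddZ (B k).
  by move=> xi; rewrite /B eqr_oppLR eqr_opp -mulrN opprB.
have fz xi : \sum_k freq R xi k * z k xi = 0 by rewrite big1// => k _; rewrite mulr0.
have fP eta : (eta == xi0) || (eta == - xi0) ->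
    \sum_k freq R eta k * P k0 xi0 k = 0.
  move=> /orP[] /eqP ->; first exact: P_sol.
  rewrite (eq_bigr (fun k => - (freq R xi0 k * P k0 xi0 k))).
    by rewrite sumrN P_sol ?oppr0.
  by move=> k _; rewrite /freq mxE intrN; ring.
have fAB (e : R) (C : 'I_n -> Zn -> R) : (forall k eta, C k eta =
     2^-1 * P k0 xi0 k * ((eta == xi0)%:R + e * (eta == - xi0)%:R)) ->
    forall eta, \sum_k freq R eta k * C k eta = 0.
  move=> CE eta; rewrite (eq_bigr (fun k => 2^-1 * ((eta == xi0)%:R + e * (eta == - xi0)%:R) *
      (freq R eta k * P k0 xi0 k))); last by move=> k _; rewrite CE; ring.
  rewrite -mulr_sumr; have [h|] := boolP ((eta == xi0) || (eta == - xi0)).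
    by rewrite fP// mulr0.
  by rewrite negb_or => /andP[/negbTE -> /negbTE ->]; rewrite mulr0 addr0 mulr0 mul0r.
have xN : xi0 \in box n (znorm xi0) by rewrite mem_box.
have xN' : - xi0 \in box n (znorm xi0) by rewrite mem_box znormN.
have n00 : ((0 : Zn) == xi0) = false by rewrite eq_sym (negbTE x0).
have n01 : ((0 : Zn) == - xi0) = false by rewrite eq_sym oppr_eq0 (negbTE x0).
exists (tpf (znorm xi0) A z), (tpf (znorm xi0) z B); split.
- apply: tpf_sol => //; first by move=> k; rewrite /A n00 n01 addr0 mulr0.
  by apply: (fAB 1) => k eta; rewrite mul1r.
- apply: tpf_sol => //.
  by apply: (fAB (-1)) => k eta; rewrite mulN1r.
move=> s' v [Hv dv]; have dd := vHdot_distr Hv.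
have [hs hc] := sol_coef xi0 dd dv.
rewrite !vdual_tpf//; split.
  rewrite -[LHS](P_proj k0 x0 hc); apply: eq_bigr => k _.
  transitivity (\sum_(xi <- box n (znorm xi0)) 2^-1 * P k0 xi0 k * v k (cs xi) * (xi == xi0)%:R +
    \sum_(xi <- box n (znorm xi0)) 2^-1 * P k0 xi0 k * v k (cs xi) * (xi == - xi0)%:R).
    by rewrite !sum_delta ?box_uniq// xN xN' csN; field.
  by rewrite -big_split; apply: eq_bigr => xi _; rewrite /A /z /=; ring.
rewrite -[LHS](P_proj k0 x0 hs); apply: eq_bigr => k _.
transitivity (\sum_(xi <- box n (znorm xi0)) 2^-1 * P k0 xi0 k * v k (sn xi) * (xi == xi0)%:R -
    \sum_(xi <- box n (znorm xi0)) 2^-1 * P k0 xi0 k * v k (sn xi) * (xi == - xi0)%:R).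
  by rewrite !sum_delta ?box_uniq// xN xN' (distr_snN (dd k)); field.
by rewrite -sumrB; apply: eq_bigr => xi _; rewrite /B /z /=; ring.
Qed.

End coefficient_extraction.

(** * Bochner measurability read on coefficients *)

Section bochner_coefficients.
Variables (R : realType) (n : nat) (T : R).
Local Notation leb := (@lebesgue_measure R).
Local Notation mR := (measurableTypeR R).
Local Notation Zn := 'rV[int]_n.
Local Notation Rn := 'rV[R]_n.
Local Notation vdistr := ('I_n -> (Rn -> R) -> R).
Local Notation I0T := ([set` `]0%R, T[] : set mR).

Lemma sum_hsqnorm_ge0 s (g : vdistr) : (0 <= \sum_k hsqnorm s (g k))%E.
Proof. by apply: sume_ge0 => k _; exact: hsqnorm_ge0. Qed.

Lemma vhnorm_sqr s (g : vdistr) : (vhnorm s g ^+ 2 = \sum_k hsqnorm s (g k))%E.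
Proof.
rewrite /vhnorm expe2; have := sum_hsqnorm_ge0 s g.
move: (\sum_k _)%E => [r|_|//]; last by rewrite poweRyr ?invr_neq0// mulyy.
rewrite lee_fin => r0; rewrite poweR_EFin -EFinM powR12_sqrt//.
by rewrite -expr2 sqr_sqrtr.
Qed.

Lemma vhsqE s (g : vdistr) : (forall k, (hsqnorm s (g k) < +oo)%E) ->
  (\sum_k hsqnorm s (g k))%E = (vhsq s g)%:E.
Proof.
move=> goo; rewrite /vhsq -sumEFin; apply: eq_bigr => k _.
by rewrite fineK// ge0_fin_numE ?hsqnorm_ge0.
Qed.

Lemma fine_vhnorm_sqr s (g : vdistr) : (forall k, (hsqnorm s (g k) < +oo)%E) ->
  fine (vhnorm s g) ^+ 2 = vhsq s g.
Proof.
move=> goo; have sE := vhsqE goo; rewrite /vhnorm sE poweR_EFin /=.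
by rewrite powR12_sqrt ?vhsq_ge0// sqr_sqrtr// vhsq_ge0.
Qed.

Lemma measurable_simple_valued (V : zmodType) (X : V -> Prop) (s : R -> V) (g : V -> R) :
  simple_valued X s -> measurable_fun [set: mR] (g \o s : mR -> R).
Proof.
move=> [fs _ ms] _ Y mY; rewrite setTI.
rewrite (_ : _ @^-1` Y = \bigcup_(v in range s `&` [set v | Y (g v)]) (s @^-1` [set v])).
  by apply: fin_bigcup_measurable => [|v _]; [exact: finite_setIl|exact: ms].
apply/seteqP; split => [t Yt|t [v [_ Yv] /= sv]]; last by rewrite /= sv.
by exists (s t) => //; split => //; exists t.
Qed.

Lemma hterm_le_hsqnorm s (g : (Rn -> R) -> R) (xi : Zn) :
  ((rho R xi `^ (2 * s) * ecoef g xi)%:E <= hsqnorm s g)%E.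
Proof.
rewrite hsqnormE.
apply: le_trans (bsum_le_esum (znorm xi) (fun xi => hterm_ge0 s g xi)).
rewrite lee_fin -[leLHS](big_seq1 +%R _ (fun xi => rho R xi `^ (2 * s) * ecoef g xi)).
apply: ler_sum_sub => // [x|x]; last exact: hterm_ge0.
by rewrite inE => /eqP ->; rewrite mem_box.
Qed.

(** Each coefficient is at most the norm divided by a positive power weight. This turns Bochner
    limits of simple functions into limits of scalar functions. *)
Lemma vhnorm_cvg0_coef s (g_ : nat -> vdistr) (g : vdistr) k (xi : Zn) :
  vhnorm s (g_ m - g) @[m --> \oo] --> 0%E ->
  g_ m k (cs xi) @[m --> \oo] --> g k (cs xi) /\
  g_ m k (sn xi) @[m --> \oo] --> g k (sn xi).
Proof.
move=> /fine_cvgP[fin0 g0]; pose p := rho R xi `^ s.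
have p0 : 0 < p by rewrite powR_gt0 ?rho_gt0.
have p2 : rho R xi `^ (2 * s) = p ^+ 2.
  by rewrite /p -powR_mulrn ?powR_ge0// -powRrM mulrC.
have key e : 0 < e -> \forall m \near \oo, ecoef ((g_ m - g) k) xi < e ^+ 2.
  move=> e0; have pe0 : 0 < p * e by rewrite mulr_gt0.
  have /cvgrPdist_lt/(_ _ pe0) lt := g0.
  near=> m; have fin : vhnorm s (g_ m - g) \is a fin_num by near: m.
  have : `|0 - (fine \o (fun m => vhnorm s (g_ m - g))) m| < p * e by near: m.
  rewrite sub0r normrN /= => h.
  have : ((p ^+ 2 * ecoef ((g_ m - g) k) xi)%:E <= vhnorm s (g_ m - g)%R ^+ 2)%E.
    rewrite vhnorm_sqr -p2; apply: le_trans (hterm_le_hsqnorm s ((g_ m - g) k) xi) _.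
    by rewrite (bigD1 k)//= leeDl// sume_ge0// => i _; exact: hsqnorm_ge0.
  rewrite -(fineK fin) expe2 -EFinM lee_fin -expr2 => h2.
  rewrite -(ltr_pM2l (exprn_gt0 2 p0)) -exprMn; apply: le_lt_trans h2 _.
  by rewrite -[ltLHS]real_normK ?num_real// ltr_sqr ?nnegrE// ltW.
have one (d : nat -> R) : (forall m, d m ^+ 2 <= ecoef ((g_ m - g) k) xi) ->
    forall e, 0 < e -> \forall m \near \oo, `|d m| < e.
  move=> dle e e0; have := key e e0; apply: filterS => m h.
  rewrite -ltr_sqr ?nnegrE ?(ltW e0)// real_normK ?num_real//.
  exact: le_lt_trans (dle m) h.
split; apply/cvgrPdist_lt => e e0.
  have := one (fun m => g_ m k (cs xi) - g k (cs xi)) _ e e0.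
  by rewrite (_ : (\forall m \near \oo, _) = (\forall m \near \oo,
    `|g k (cs xi) - g_ m k (cs xi)| < e)); [apply => m; rewrite lerDl sqr_ge0|
    congr (nbhs _ _); apply/funext => m; rewrite distrC].
have := one (fun m => g_ m k (sn xi) - g k (sn xi)) _ e e0.
by rewrite (_ : (\forall m \near \oo, _) = (\forall m \near \oo,
  `|g k (sn xi) - g_ m k (sn xi)| < e)); [apply => m; rewrite lerDr sqr_ge0|
  congr (nbhs _ _); apply/funext => m; rewrite distrC].
Unshelve. all: by end_near. Qed.

Lemma bochner_coef s (X : vdistr -> Prop) (f : R -> vdistr) (k : 'I_n) (xi : Zn) :
  bochner_measurable X (@vhnorm R n s) T f ->
  ae_measurable leb I0T (fun t => f t k (cs xi)) /\
  ae_measurable leb I0T (fun t => f t k (sn xi)).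
Proof.
move=> [_ [s_ [ss sf]]].
have m1 (phi : Rn -> R) m : ae_measurable leb I0T (fun t => s_ m t k phi).
  exists (fun t => s_ m t k phi); last exact: aeW.
  apply: measurable_funTS.
  exact: (measurable_simple_valued (fun v : vdistr => v k phi) (ss m)).
split.
  apply: (ae_measurable_cvg (m1 (cs xi))); apply: aeS sf => t h.
  by rewrite /= in_itv /= => /h /(vhnorm_cvg0_coef k xi) [].
apply: (ae_measurable_cvg (m1 (sn xi))); apply: aeS sf => t h.
by rewrite /= in_itv /= => /h /(vhnorm_cvg0_coef k xi) [].
Qed.

(** Measurability of the squared norm in time comes from the coefficients, as a limit of finite
    weighted sums of their squares. *)
Lemma vhsq_ae_integrable s (v : R -> vdistr) : ae_time T (fun t => vHdot s (v t)) ->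
  (forall k xi, ae_measurable leb I0T (fun t => v t k (cs xi))) ->
  (forall k xi, ae_measurable leb I0T (fun t => v t k (sn xi))) ->
  (\int[leb]_(t in I0T) (vhnorm s (v t) ^+ 2) < +oo)%E ->
  ae_integrable leb I0T (fun t => vhsq s (v t)).
Proof.
move=> Hv mc ms voo.
have meas N : ae_measurable leb I0T (fun t => \sum_k
    bsum (fun xi => rho R xi `^ (2 * s) * ecoef (v t k) xi) N).
  apply: ae_measurable_sum => k; apply: ae_measurable_sum => xi.
  apply: ae_measurableM; first exact: ae_measurable_cst.
  by apply: ae_measurableD; apply: ae_measurableM.
have lim : {ae leb, forall t, I0T t -> (fun N => \sum_k
    bsum (fun xi => rho R xi `^ (2 * s) * ecoef (v t k) xi) N) @ \oo --> vhsq s (v t)}.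
  apply: aeS Hv => t h; rewrite /= in_itv /= => /h Ht.
  apply: (cvgn_sum (F := fun k N => _)) => k.
  rewrite hsqnormE; apply: bsum_cvg => [xi|]; first exact: hterm_ge0.
  by rewrite -hsqnormE; have [[]] := Ht k.
apply: (ae_integrable_ge0 (ae_measurable_cvg meas lim)) => [t|]; first exact: vhsq_ge0.
apply: le_lt_trans voo; rewrite le_eqVlt; apply/orP; left; apply/eqP.
apply: ae_eq_integral_nm; apply: aeS Hv => t h It; have Ht : vHdot s (v t) by move: It; rewrite /= in_itv => /h.
by rewrite vhnorm_sqr vhsqE// => k; have [[]] := Ht k.
Qed.

(** Tested with a fixed function, [u'] is only integrable on compact subintervals; its measurability
    is carried over to the open interval by exhaustion. *)
Lemma ae_measurable_glue (F : R -> R) : 0 < T ->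
  (forall a b, 0 < a -> b < T -> ae_measurable leb `[a, b] F) ->
  ae_measurable leb I0T F.
Proof.
move=> T0 H; pose D m : set mR := `[T / m.+1%:R, T - T / m.+2%:R]%classic.
have m0 (m : nat) : 0 < T / m.+1%:R by rewrite divr_gt0.
apply: (ae_measurable_cvg (g_ := fun m => F \_ (D m))).
  move=> m; have [|G mG FG] := H (T / m.+1%:R) (T - T / m.+2%:R) (m0 m).
    by rewrite ltrBlDr ltrDl.
  exists (G \_ (D m)).
    apply: measurable_funTS; apply/(measurable_restrictT _ _).1 => //.
    exact: measurable_itv.
  apply: aeS FG => t h _; rewrite !patchE; case: ifPn => // /set_mem; exact: h.
apply: aeW => t; rewrite /= in_itv /= => /andP[t0 tT].
apply: cvg_near_cst; near=> m; rewrite patchE ifT//; apply: mem_set.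
have h1 : T / t < m%:R by near: m; exact: nbhs_infty_gtr.
have h2 : T / (T - t) < m%:R by near: m; exact: nbhs_infty_gtr.
have mS : m%:R <= m.+1%:R :> R by rewrite ler_nat.
have mS2 : m%:R <= m.+2%:R :> R by rewrite ler_nat ltnW.
have tT' : 0 < T - t by rewrite subr_gt0.
rewrite /D /= in_itv /=; apply/andP; split.
  by rewrite ler_pdivrMr// mulrC -ler_pdivrMr//; lra.
by rewrite lerBrDl -lerBrDr ler_pdivrMr// mulrC -ler_pdivrMr//; lra.
Unshelve. all: by end_near. Qed.

End bochner_coefficients.

(** * Endpoints of the time interval and scalar functions of time *)

Section time_helpers.
Variables (R : realType) (T : R).
Local Notation leb := (@lebesgue_measure R).
Local Notation mR := (measurableTypeR R).
Local Notation I0T := ([set` `]0%R, T[] : set mR).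
Local Notation J0T := ([set` `[0%R, T]] : set mR).

Lemma norm_cvgn_le (s : nat -> R) (x y : R) : s @ \oo --> x ->
  (forall N, `|s N| <= y) -> `|x| <= y.
Proof.
move=> sx sy; have nx : (fun N => `|s N|) @ \oo --> `|x| by exact: cvg_norm.
rewrite -(cvg_lim _ nx)//; apply: limr_le; first by apply/cvg_ex; exists `|x|.
exact: nearW.
Qed.

Lemma ae_neq (r : R) : {ae leb, forall t : mR, t <> r}.
Proof.
exists [set r]; split; [exact: measurable_set1|exact: lebesgue_measure_set1|].
by move=> t /= /contrapT ->.
Qed.

Lemma ae_time_closed (P : R -> Prop) : ae_time T P ->
  {ae leb, forall t, J0T t -> P t}.
Proof.
move=> H; apply: aeS2 (aeS2 (fun x p q => conj p q) (ae_neq 0) (ae_neq T)) H.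
move=> t [t0 tT] h; rewrite /= in_itv /= => /andP[h0 hT]; apply: h.
by rewrite !lt_neqAle h0 hT !andbT; apply/andP; split; apply/eqP => // /esym.
Qed.

Lemma ae_integrable_closed (h : R -> R) : ae_integrable leb I0T h ->
  ae_integrable leb J0T h.
Proof.
move=> [g ig hg]; exists (g \_ I0T).
  have : leb.-integrable setT ((EFin \o g) \_ I0T).
    by apply/(integrable_mkcond _ _).1 => //; exact: measurable_itv.
  rewrite restrict_EFin; apply: integrableS => //; exact: measurable_itv.
have : ae_time T (fun t => h t = (g \_ I0T) t).
  apply: aeS hg => t H tI; rewrite patchE mem_set ?H//= in_itv //.
exact: ae_time_closed.
Qed.

Lemma ae_integrable_sub (D E : set mR) (h : R -> R) : measurable D -> measurable E ->
  E `<=` D -> ae_integrable leb D h -> ae_integrable leb E h.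
Proof.
move=> mD mE ED [g ig hg]; exists g; first exact: integrableS ig.
by apply: aeS hg => t H /ED; exact: H.
Qed.

Lemma within_continuousD (A : set R) (f g : R -> R) :
  {within A, continuous f} -> {within A, continuous g} ->
  {within A, continuous (fun x => f x + g x)}.
Proof. by move=> cf cg x; apply: continuousD; [exact: cf|exact: cg]. Qed.

Lemma within_continuous_sum (A : set R) (I : Type) (s : seq I) (F : I -> R -> R) :
  (forall i, {within A, continuous (F i)}) ->
  {within A, continuous (fun t => \sum_(i <- s) F i t)}.
Proof.
move=> cF; elim: s => [|i s IH].
  rewrite (_ : (fun t => _) = cst 0); first by move=> x; exact: cst_continuous.
  by apply/funext => t; rewrite big_nil.
rewrite (_ : (fun t => _) = fun t => F i t + \sum_(j <- s) F j t); last first.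
  by apply/funext => t; rewrite big_cons.
exact: within_continuousD.
Qed.

Lemma within_continuous_measurable (c : R -> R) : {within `[0, T], continuous c} ->
  measurable_fun J0T (c : mR -> R).
Proof. by move=> cc; apply: subspace_continuous_measurable_fun => //; exact: measurable_itv. Qed.

(** [c] is absolutely continuous with derivative [v], so [c ^ 2] has derivative
    [2 v c]. *)
Lemma weak_derivative_square (c v : R -> R) : {within `[0, T], continuous c} ->
  (forall a b, 0 < a -> b < T -> ae_integrable leb `[a, b] v) ->
  (forall chi, test_time T chi -> \int[leb]_(t in `]0, T[) (v t * chi t) =
     - \int[leb]_(t in `]0, T[) (c t * derive1 chi t)) ->
  forall s t, 0 < s -> s < t -> t < T ->
    ae_integrable leb `[s, t] (fun x => v x * c x) /\
    \int[leb]_(x in `[s, t]) (v x * c x) = 2^-1 * (c t ^+ 2 - c s ^+ 2).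
Proof.
move=> cc iv dv s t s0 st tT; split.
  have [g ig vg] := iv s t s0 tT; exists (fun x => g x * c x).
    apply: integrable_continuous_mul ig; apply: continuous_subspaceW cc.
    by apply: subset_itv; rewrite bnd_simp ltW.
  by apply: aeS vg => x h xst; rewrite h.
have P := du_bois_reymond cc iv dv.
rewrite (primitive_square cc iv P s0 st tT) mulKf//.
by apply: eq_Rintegral => x _; rewrite mulrC.
Qed.

End time_helpers.

(** * The energy equality *)

Section solution_facts.
Variables (R : realType) (n : nat) (T : R) (u : R -> 'I_n -> ('rV[R]_n -> R) -> R).
Local Notation leb := (@lebesgue_measure R).
Local Notation mR := (measurableTypeR R).
Local Notation I0T := ([set` `]0%R, T[] : set mR).
Local Notation J0T := ([set` `[0%R, T]] : set mR).
Hypotheses (T0 : 0 < T) (uH : forall t, 0 <= t <= T -> vHdot_sol 0 (u t))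
  (ucont : forall w, vHdot_sol 0 w ->
     {within `[0, T], continuous (fun t => vdual (u t) w)}).

(** Weak continuity speaks of pairings with solenoidal fields, and [coef_test] writes a single
    coefficient as such a pairing. *)
Lemma coef_continuous k xi : {within `[0, T], continuous (fun t => u t k (cs xi))} /\
  {within `[0, T], continuous (fun t => u t k (sn xi))}.
Proof.
have [wc [ws [Hc Hs E]]] := coef_test (R := R) 0 k xi.
split.
  apply: (subspace_eq_continuous _ (ucont Hc)) => t /set_mem; rewrite /= in_itv /= => tT.
  by have [] := E _ _ (uH tT).
apply: (subspace_eq_continuous _ (ucont Hs)) => t /set_mem; rewrite /= in_itv /= => tT.
by have [] := E _ _ (uH tT).
Qed.

Lemma coef_ae_measurable (D : set mR) k xi : measurable D -> D `<=` J0T ->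
  ae_measurable leb D (fun t => u t k (cs xi)) /\
  ae_measurable leb D (fun t => u t k (sn xi)).
Proof.
move=> mD DJ; have [cc cS] := coef_continuous k xi.
have mJ : measurable J0T by exact: measurable_itv.
split.
  exists (fun t => u t k (cs xi)); last exact: aeW.
  exact: measurable_funS mJ DJ (within_continuous_measurable cc).
exists (fun t => u t k (sn xi)); last exact: aeW.
exact: measurable_funS mJ DJ (within_continuous_measurable cS).
Qed.

Let uD t : 0 <= t <= T -> forall k, is_distr (u t k).
Proof. by move=> /uH[/vHdot_distr]. Qed.

Definition trunc_energy N t : R := 2^-1 * \sum_k bsum (ecoef (u t k)) N.

Lemma trunc_energy_continuous N : {within `[0, T], continuous (trunc_energy N)}.
Proof.
apply: within_continuousM; first by move=> x; exact: cst_continuous.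
apply: within_continuous_sum => k; apply: within_continuous_sum => xi.
have [cc cS] := coef_continuous k xi.
exact: within_continuousD (within_continuousM cc cc) (within_continuousM cS cS).
Qed.

Variable u' : R -> 'I_n -> ('rV[R]_n -> R) -> R.
Hypothesis ut : time_derivative T u u'.

Let F N t := vdual (u' t) (trunc N (u t)).

Let FE N t : 0 <= t <= T -> F N t = \sum_k bsum (dterm (u' t k) (u t k)) N.
Proof. by move=> tT; rewrite /F vdual_trunc//; exact: uD. Qed.

Lemma trunc_rate_measurable N : ae_measurable leb I0T (F N).
Proof.
apply: ae_measurable_glue => // a b a0 bT.
have sub : `[a, b]%classic `<=` J0T.
  by apply: subset_itv; rewrite bnd_simp ltW.
have E : {ae leb, forall t : mR, `[a, b]%classic t ->
    \sum_k \sum_(xi <- box n N) dterm (u' t k) (u t k) xi = F N t}.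
  by apply: aeW => t /sub /=; rewrite in_itv /= => tT; rewrite FE.
apply: (eq_ae_measurable E); apply: ae_measurable_sum => k; apply: ae_measurable_sum => xi.
have [mc ms] := coef_ae_measurable k xi (measurable_itv `[a, b]) sub.
have ic := (ut.2 k _ (test_fun_cs R xi)).1 a b a0 bT.
have is_ := (ut.2 k _ (test_fun_sn R xi)).1 a b a0 bT.
apply: ae_measurableD; apply: ae_measurableM => //; exact: ae_integrable_measurable.
Qed.

Lemma trunc_energy_rate N s t : 0 < s -> s < t -> t < T ->
  trunc_energy N t - trunc_energy N s = \int[leb]_(x in `[s, t]) F N x.
Proof.
move=> s0 st tT; have mst : measurable (`[s, t]%classic : set mR) by exact: measurable_itv.
have G k xi : ae_integrable leb `[s, t] (fun x => dterm (u' x k) (u x k) xi) /\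
    \int[leb]_(x in `[s, t]) dterm (u' x k) (u x k) xi =
    2^-1 * (ecoef (u t k) xi - ecoef (u s k) xi).
  have [cc cS] := coef_continuous k xi.
  have [ic dc] := ut.2 k _ (test_fun_cs R xi).
  have [is_ ds] := ut.2 k _ (test_fun_sn R xi).
  have [i1 e1] := weak_derivative_square cc ic dc s0 st tT.
  have [i2 e2] := weak_derivative_square cS is_ ds s0 st tT.
  have [i3 e3] := ae_integrableD mst i1 i2.
  split; first exact: i3.
  rewrite -[LHS]/(\int[leb]_(x in `[s, t]) (u' x k (cs xi) * u x k (cs xi) +
    u' x k (sn xi) * u x k (sn xi))) e3 e1 e2 /ecoef; ring.
have E : {ae leb, forall x : mR, `[s, t]%classic x ->
    F N x = \sum_k \sum_(xi <- box n N) dterm (u' x k) (u x k) xi}.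
  apply: aeW => x /=; rewrite in_itv /= => /andP[sx xt]; rewrite FE//.
  by apply/andP; split; lra.
rewrite (ae_eq_Rintegral_nm E) (ae_integrable_sum mst _ _).2; last first.
  by move=> k; apply: (ae_integrable_sum mst _ _).1 => xi; exact: (G k xi).1.
rewrite /trunc_energy -mulrBr -sumrB mulr_sumr; apply: eq_bigr => k _.
rewrite (ae_integrable_sum mst _ (fun xi => (G k xi).1)).2 /bsum -sumrB mulr_sumr.
by apply: eq_bigr => xi _; rewrite (G k xi).2.
Qed.

(** Integrability of the rate up to the endpoints is a hypothesis here, because [time_derivative]
    only gives it on compact subintervals; the weak formulation provides it later. *)
Lemma trunc_energy_closed N s t : ae_integrable leb J0T (F N) ->
  0 <= s -> s <= t -> t <= T ->
  trunc_energy N t - trunc_energy N s = \int[leb]_(x in `[s, t]) F N x.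
Proof.
move=> [g ig Fg] s0 st tT.
have E x y : 0 <= x -> y <= T ->
    \int[leb]_(z in `[x, y]) F N z = \int[leb]_(z in `[x, y]) g z.
  move=> x0 yT; apply: ae_eq_Rintegral_nm; apply: aeS Fg => z h zxy; apply: h.
  by apply: subset_itv zxy; rewrite bnd_simp.
have H x y : 0 < x -> x < y -> y < T ->
    trunc_energy N y - trunc_energy N x = \int[leb]_(z in `[x, y]) g z.
  by move=> x0 xy yT; rewrite trunc_energy_rate// E// ltW.
rewrite E//; exact: (primitive_closed T0 (@trunc_energy_continuous N) ig H s0 st tT).
Qed.

Lemma trunc_energy_cvg t : 0 <= t <= T ->
  trunc_energy N t @[N --> \oo] --> 2^-1 * fine (vhnorm 0 (u t)) ^+ 2.
Proof.
move=> tT; have [Hv _] := uH tT; rewrite fine_vhnorm_sqr => [|k]; last first.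
  by have [[]] := Hv k.
apply: cvgMr; apply: (cvgn_sum (F := fun k N => _)) => k.
rewrite hsqnorm0E; apply: bsum_cvg => [xi|]; first exact: ecoef_ge0.
by rewrite -hsqnorm0E; have [[]] := Hv k.
Qed.

End solution_facts.

Theorem theorem3p5 (R : realType) (n : nat) (T : R)
    (a : R -> 'I_n -> 'I_n -> 'I_n -> 'I_n -> 'rV[R]_n -> R)
    (f : R -> 'I_n -> ('rV[R]_n -> R) -> R)
    (u0 : 'I_n -> ('rV[R]_n -> R) -> R)
    (u : R -> 'I_n -> ('rV[R]_n -> R) -> R) :
  (2 <= n)%N -> 0 < T ->
  (forall k j al b : 'I_n, Linf_Linf T (fun t => a t k j al b)) ->
  ae_time T (fun t => tensor_sym (a t)) ->
  bochnerL2 (@vHdot R n (-1)) (@vhnorm R n (-1)) T f ->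
  vHdot_sol 0 u0 ->
  serrin_solution T a f u0 u ->
  ae_integrable (@lebesgue_measure R) `[0, T]
    (fun tau => aform (a tau) (u tau) (u tau)) /\
  ae_integrable (@lebesgue_measure R) `[0, T] (fun tau => vdual (f tau) (u tau)) /\
  (forall t0 t : R, 0 <= t0 -> t0 <= t -> t <= T ->
     2^-1 * fine (vhnorm 0 (u t)) ^+ 2
       + \int[@lebesgue_measure R]_(tau in `[t0, t]) aform (a tau) (u tau) (u tau)
     = 2^-1 * fine (vhnorm 0 (u t0)) ^+ 2
       + \int[@lebesgue_measure R]_(tau in `[t0, t]) vdual (f tau) (u tau)) /\
  (forall t : R, 0 <= t <= T ->
     2^-1 * fine (vhnorm 0 (u t)) ^+ 2
       + \int[@lebesgue_measure R]_(tau in `[0, t]) aform (a tau) (u tau) (u tau)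
     = 2^-1 * fine (vhnorm 0 u0) ^+ 2
       + \int[@lebesgue_measure R]_(tau in `[0, t]) vdual (f tau) (u tau)).
Proof.
move=> _ T0 La _ [fmeas fL2] Hu0 [[[_ [M0 uM]] [umeas uL2] [uH ucont] [u' ut weak] init] [unmeas unL2]].
pose I0T : set (measurableTypeR R) := [set` `]0%R, T[].
pose J0T : set (measurableTypeR R) := [set` `[0%R, T]].
have mI : measurable I0T by exact: measurable_itv.
have mJ : measurable J0T by exact: measurable_itv.
have IJ : I0T `<=` J0T by exact: subset_itv_oo_cc.
have uc k xi := coef_ae_measurable uH ucont k xi mI IJ.
have fco k xi := bochner_coef k xi fmeas.
pose s := n%:R / 2 : R.
have H1 : ae_time T (fun t => vHdot 1 (u t)) by apply: aeS umeas.1 => t h /h[].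
have Hs : ae_time T (fun t => vHdot s (u t)) by apply: aeS unmeas.1 => t h /h[].
have i1 := vhsq_ae_integrable H1 (fun k xi => (uc k xi).1) (fun k xi => (uc k xi).2) uL2.
have is_ := vhsq_ae_integrable Hs (fun k xi => (uc k xi).1) (fun k xi => (uc k xi).2) unL2.
have if_ := vhsq_ae_integrable fmeas.1 (fun k xi => (fco k xi).1)
  (fun k xi => (fco k xi).2) fL2.
(* There are finitely many index quadruples, so the sum of their bounds serves all tensor
   entries. *)
have [M [M_ge0 aM]] : exists M : R, 0 <= M /\ ae_time T (fun t => forall k j al b,
    {ae @cube_leb R n, forall x, `|on_cube (a t k j al b) x| <= M}).
  have /choice[Ma HMa] (p : ('I_n * 'I_n) * ('I_n * 'I_n)) : exists M, ae_time T (fun t =>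
      {ae @cube_leb R n, forall x, `|on_cube (a t p.1.1 p.1.2 p.2.1 p.2.2) x| <= M}).
    by have [_ _] := La p.1.1 p.1.2 p.2.1 p.2.2.
  exists (\sum_p `|Ma p|); split; first by rewrite sumr_ge0.
  have : \forall t \ae @lebesgue_measure R, forall p : ('I_n * 'I_n) * ('I_n * 'I_n),
     0 < t < T ->
     {ae @cube_leb R n, forall x, `|on_cube (a t p.1.1 p.1.2 p.2.1 p.2.2) x| <= Ma p}.
    by apply: filter_forall => p; exact: HMa.
  apply: aeS => t h tT k j al b; apply: aeS (h ((k, j), (al, b)) tT) => x /= hx.
  apply: le_trans hx _; apply: le_trans (ler_norm _) _.
  by rewrite (bigD1 ((k, j), (al, b)))//= lerDl sumr_ge0.
have am : ae_time T (fun t => forall k j al b,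
    ae_measurable (@cube_leb R n) setT (on_cube (a t k j al b))).
  have : \forall t \ae @lebesgue_measure R, forall p : ('I_n * 'I_n) * ('I_n * 'I_n),
     0 < t < T -> Linfper (a t p.1.1 p.1.2 p.2.1 p.2.2).
    by apply: filter_forall => p; have [] := La p.1.1 p.1.2 p.2.1 p.2.2.
  by apply: aeS => t h tT k j al b; have [] := h ((k, j), (al, b)) tT.
pose m0 := `|M0| ^+ 2.
have um0 : ae_time T (fun t => vhsq 0 (u t) <= m0).
  apply: aeS uM => t h tT; have tT' : 0 <= t <= T by case/andP: tT => *; rewrite !ltW.
  have [Hv _] := uH t tT'; rewrite -fine_vhnorm_sqr => [|k]; last by have [[]] := Hv k.
  have v0 : (0 <= vhnorm 0 (u t))%E by exact: poweR_ge0.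
  have vM := h tT; have vfin : vhnorm 0 (u t) \is a fin_num.
    by rewrite ge0_fin_numE// (le_lt_trans vM)// ltry.
  rewrite /m0 ler_sqr ?nnegrE ?fine_ge0//; apply: le_trans (ler_norm _).
  by rewrite -lee_fin fineK.
pose F N t := vdual (u' t) (trunc N (u t)).
pose V N t := vdual (f t) (trunc N (u t)).
pose Finf t := vdual (f t) (u t) - aform (a t) (u t) (u t).
(* [b1] and [b2] are the bounds of [weak_trunc]; they do not depend on [N] and will dominate in
   time. *)
pose b1 t : R := 2^-1 * (vhsq (-1) (f t) + vhsq 1 (u t)).
pose b2 t : R := b1 t + (n ^ 4)%:R * (2^-1 * ((M ^+ 2 + 1) * vhsq 1 (u t))) +
  (n * n)%:R * Num.sqrt (2 * m0) * (vhsq s (u t) + vhsq 1 (u t)).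
have all : ae_time T (fun t => [/\ V ^~ t @ \oo --> vdual (f t) (u t),
    (forall N, `|V N t| <= b1 t), F ^~ t @ \oo --> Finf t &
    (forall N, `|F N t| <= b2 t)]).
  have P1 := aeS2 (fun t p q => conj p q) umeas.1 unmeas.1.
  have P2 := aeS2 (fun t p q => conj p q) aM am.
  have P3 := aeS2 (fun t p q => conj p q) um0 weak.
  have P4 := aeS2 (fun t p q => conj p q) P1 P2.
  have P5 := aeS2 (fun t p q => conj p q) P3 fmeas.1.
  (* The weak formulation holds for all [w] outside one null set of times, so the test field may be
     the truncation of [u t], which depends on [t]. *)
  apply: aeS2 P4 P5 => t [[h1 h2] [h3 h4]] [[h5 h6] h7] tT.
  exact: (weak_trunc M_ge0 (h4 tT) (h3 tT) (h1 tT) (h2 tT) (h7 tT) (h5 tT) (h6 tT)).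
have ib1 : ae_integrable (@lebesgue_measure R) I0T b1.
  exact: (ae_integrableZ mI 2^-1 (ae_integrableD mI if_ i1).1).1.
have ib2 : ae_integrable (@lebesgue_measure R) I0T b2.
  apply: (ae_integrableD mI _ _).1.
    apply: (ae_integrableD mI ib1 _).1.
    have := (ae_integrableZ mI ((n ^ 4)%:R * (2^-1 * (M ^+ 2 + 1))) i1).1.
    by apply: eq_ae_integrable; apply: aeW => t _; rewrite !mulrA.
  exact: (ae_integrableZ mI _ (ae_integrableD mI is_ i1).1).1.
have It t : I0T t -> 0 < t < T by rewrite /I0T /= in_itv.
have mV N : ae_measurable (@lebesgue_measure R) I0T (V N).
  have E : {ae @lebesgue_measure R, forall t, I0T t ->
      \sum_k \sum_(xi <- box n N) dterm (f t k) (u t k) xi = V N t}.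
    apply: aeW => t /IJ; rewrite /J0T /= in_itv /= => tT.
    by rewrite /V vdual_trunc// => k; have [/vHdot_distr] := uH t tT.
  apply: (eq_ae_measurable E); apply: ae_measurable_sum => k; apply: ae_measurable_sum => xi.
  have [f1 f2] := fco k xi; have [u1 u2] := uc k xi.
  by apply: ae_measurableD; exact: ae_measurableM.
have mF N : ae_measurable (@lebesgue_measure R) I0T (F N).
  exact: (trunc_rate_measurable T0 uH ucont ut).
have iF N : ae_integrable (@lebesgue_measure R) I0T (F N).
  apply: (ae_integrable_dom mI (mF N) ib2).
  by apply: aeS all => t h /It/h[_ _ _]; exact.
have iV : ae_integrable (@lebesgue_measure R) I0T (fun t => vdual (f t) (u t)).
  have L : {ae @lebesgue_measure R, forall t, I0T t -> V ^~ t @ \oo --> vdual (f t) (u t)}.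
    by apply: aeS all => t h /It/h[].
  apply: (ae_integrable_dom mI (ae_measurable_cvg mV L) ib1).
  by apply: aeS all => t h /It/h[h1 h2 _ _]; exact: norm_cvgn_le h1 h2.
have LF : {ae @lebesgue_measure R, forall t, I0T t -> F ^~ t @ \oo --> Finf t}.
  by apply: aeS all => t h /It/h[].
have iFi : ae_integrable (@lebesgue_measure R) I0T Finf.
  apply: (ae_integrable_dom mI (ae_measurable_cvg mF LF) ib2).
  by apply: aeS all => t h /It/h[_ _ h1 h2]; exact: norm_cvgn_le h1 h2.
have jV := ae_integrable_closed iV; have jFi := ae_integrable_closed iFi.
have jb2 := ae_integrable_closed ib2.
have jF N := ae_integrable_closed (iF N).
(* The form is recovered as the force term minus the limit [Finf] of the truncated rates, so its
   integrability in time follows from theirs. *)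
have E : {ae @lebesgue_measure R, forall t, J0T t ->
    vdual (f t) (u t) + -1 * Finf t = aform (a t) (u t) (u t)}.
  by apply: aeW => t _; rewrite /Finf; ring.
have jA : ae_integrable (@lebesgue_measure R) J0T (fun t => aform (a t) (u t) (u t)).
  apply: (eq_ae_integrable E).
  exact: (ae_integrableD mJ jV (ae_integrableZ mJ (-1) jFi).1).1.
have main t0 t : 0 <= t0 -> t0 <= t -> t <= T ->
    2^-1 * fine (vhnorm 0 (u t)) ^+ 2
      + \int[@lebesgue_measure R]_(tau in `[t0, t]) aform (a tau) (u tau) (u tau)
    = 2^-1 * fine (vhnorm 0 (u t0)) ^+ 2
      + \int[@lebesgue_measure R]_(tau in `[t0, t]) vdual (f tau) (u tau).
  move=> t00 t0t tT; pose D : set (measurableTypeR R) := [set` `[t0, t]].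
  have mD : measurable D by exact: measurable_itv.
  have DJ : D `<=` J0T by apply: subset_itv; rewrite bnd_simp.
  have dV := ae_integrable_sub mJ mD DJ jV; have dFi := ae_integrable_sub mJ mD DJ jFi.
  have [_ eA] := ae_integrableD mD dV (ae_integrableZ mD (-1) dFi).1.
  rewrite (ae_integrableZ mD (-1) dFi).2 in eA.
  have eA' : \int[@lebesgue_measure R]_(tau in D) aform (a tau) (u tau) (u tau) =
      \int[@lebesgue_measure R]_(tau in D) (vdual (f tau) (u tau) + -1 * Finf tau).
    by apply: ae_eq_Rintegral_nm; apply: aeS E => x h /DJ/h ->.
  rewrite -/D eA' eA.
  have JL : {ae @lebesgue_measure R, forall x, J0T x -> F ^~ x @ \oo --> Finf x}.
    by apply: (ae_time_closed (P := fun x => F ^~ x @ \oo --> Finf x)); apply: aeS all => x h /h[].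
  have JB : {ae @lebesgue_measure R, forall x, J0T x -> forall N, `|F N x| <= b2 x}.
    by apply: (ae_time_closed (P := fun x => forall N, `|F N x| <= b2 x)); apply: aeS all => x h /h[].
  have lim := ae_dominated_cvg mJ mD DJ (fun N => ae_integrable_measurable (jF N)) jb2 JL JB.
  have limE : trunc_energy u N t - trunc_energy u N t0 @[N --> \oo] -->
      2^-1 * fine (vhnorm 0 (u t)) ^+ 2 - 2^-1 * fine (vhnorm 0 (u t0)) ^+ 2.
    apply: cvgB; apply: (trunc_energy_cvg uH).
      by rewrite tT (le_trans t00 t0t).
    by rewrite t00 (le_trans t0t tT).
  (* Both sides of this truncated balance converge, and the limits must agree. *)
  have EN : (fun N => trunc_energy u N t - trunc_energy u N t0) =
      fun N => \int[@lebesgue_measure R]_(x in D) F N x.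
    by apply/funext => N; exact: (trunc_energy_closed T0 uH ucont ut (jF N)).
  rewrite EN in limE; have := cvg_unique _ limE lim => /(_ (@Rhausdorff R)).
  set x := \int[_]_(x in D) Finf x; set y := \int[_]_(x in D) vdual _ _ => /(_ _) H.
  by move: H; move: x y => x y; lra.
split; first exact: jA.
split; first exact: jV.
split; first exact: main.
(* It remains to identify the norms of [u 0] and [u0]: each coefficient of either is a pairing with
   a solenoidal field, and the initial condition equates these pairings. *)
move=> t /andP[t0 tT]; rewrite main//; congr (_ * _ ^+ 2 + _).
congr (fine _); rewrite /vhnorm; congr poweR; apply: eq_bigr => k _.
rewrite !hsqnorm0E; apply: eq_esum => xi _.
have [wc [ws [Hc Hss C]]] := coef_test (R := R) 0 k xi.
have T00 : 0 <= (0 : R) <= T by rewrite lexx ltW.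
by have [c1 c2] := C _ _ (uH 0 T00); have [c3 c4] := C _ _ Hu0;
  rewrite /ecoef c1 c2 c3 c4 !init.
Qed.
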